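(* Let $m(x_0,x_1)=m(x_0,x_1;\alpha_0)$ with $\alpha_0\in\mathcal A\subseteq\mathbb A$, where $\mathbb A$ is a Banach space and the (possibly infinite-dimensional) parameter space $\mathcal A$ is equipped with a norm $\|\cdot\|_{\mathcal A}$. Suppose the following hold. (A1) $\mathbb M$ is bounded on $L^2$; there exist positive functions $\phi,\phi^*\in L^2$ and a scalar $\rho>0$ with $\mathbb M\phi=\rho\phi$ and $\mathbb M^*\phi^*=\rho\phi^*$; $\phi$ and $\phi^*$ are the unique (up to scale) positive solutions in $L^2$ of these two problems; $\rho$ is a simple and isolated eigenvalue of $\mathbb M$ and is the largest eigenvalue of $\mathbb M$; and, when $\phi,\phi^*$ are scaled so that $\mathbb E[\phi(X_t)\phi^*(X_t)]=1$, $\lim_{\tau\to\infty}\rho^{-\tau}\mathbb M_\tau\psi(x)=\mathbb E[\psi(X_t)\phi^*(X_t)]\,\phi(x)$ for all $\psi\in L^2$. (A2) $\|\Pi_k\mathbb M-\mathbb M\|=o(1)$. (A3) $\|\widehat{\mathbf G}^o-\mathbf I\|=o_p(1)$ and $\|\widehat{\mathbf M}^o-\mathbf M^o\|=o_p(1)$. (A4) (a) $\|\Pi_k\phi-\phi\|=o(n^{-1/2})$ and $\|\Pi_k\phi^*-\phi^*\|=o(n^{-1/2})$; (b) $\|\widehat{\mathbf G}^o-\mathbf I\|=o_p(n^{-1/4})$ and $\|\widehat{\mathbf M}^o-\mathbf M^o\|=o_p(n^{-1/4})$; (c) $\mathbb E[(\phi^*(X_t)m(X_t,X_{t+1})\phi(X_{t+1}))^2]<\infty$.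 Normalize $\phi,\phi^*$ so that $\|\phi\|=1$, $\langle\phi,\phi^*\rangle=1$; let $\psi_{\rho,t}=\phi^*(X_t)m(X_t,X_{t+1})\phi(X_{t+1})-\rho\,\phi^*(X_t)\phi(X_t)$, $\ell(\alpha)=\mathbb E[\phi^*(X_t)\phi(X_{t+1})m(X_t,X_{t+1};\alpha)]$, and $\mathcal G=\{g_\alpha:\alpha\in\mathcal A\}$ with $g_\alpha(x_t,x_{t+1})=\phi^*(x_t)\phi(x_{t+1})(m(x_t,x_{t+1};\alpha)-m(x_t,x_{t+1};\alpha_0))$. (A5) (a) $\mathcal G$ is Donsker (with covariance function $\mathbb K$); (b) $\ell$ is pathwise differentiable at $\alpha_0$ and $|\ell(\alpha)-\ell(\alpha_0)-\dot\ell_{\alpha_0}[\alpha-\alpha_0]|=O(\|\alpha-\alpha_0\|_{\mathcal A}^2)$; (c) $\sqrt n\,\dot\ell_{\alpha_0}[\hat\alpha-\alpha_0]=\frac1{\sqrt n}\sum_{t=0}^{n-1}\psi_{\ell,t}+o_p(1)$ for some $\mathbb R$-valued random process $\{\psi_{\ell,t}\}$, $\|\hat\alpha-\alpha_0\|_{\mathcal A}=o_p(n^{-1/4})$, and $\mathbb K(g_{\hat\alpha},g_{\hat\alpha})=o_p(1)$; (d) $\frac1{\sqrt n}\sum_{t=0}^{n-1}(\psi_{\rho,t},\psi_{\ell,t})'\to_dN(0,V_{[2b]})$ for some finite matrix $V_{[2b]}$; (e) for some $s>2$, $\mathbb E[\sup_{\alpha\in\mathcal A}m(X_t,X_{t+1};\alpha)^s]<\infty$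 and either $\|\phi_k\|_{2s/(s-2)}=O(1)$ and $\|\phi^*\|_{2s/(s-2)}<\infty$, or $\|\phi_k^*\|_{2s/(s-2)}=O(1)$ and $\|\phi\|_{2s/(s-2)}<\infty$. Then $\sqrt n(\hat\rho-\rho)\to_dN(0,V_\rho^{[2b]})$, where $V_\rho^{[2b]}=h_{[2b]}'V_{[2b]}h_{[2b]}$ and $h_{[2b]}=(1,1)'$.
   Context: $X=\{X_t:t=0,1,2,\dots\}$ is a time-homogeneous, strictly stationary and ergodic first-order Markov process with values in $\mathcal X\subseteq\mathbb R^d$ and stationary distribution $Q$ (extended to $t\in\mathbb Z$ where needed). $m(\cdot,\cdot;\alpha)$, $\alpha\in\mathcal A$, are positive functions on $\mathcal X^2$ of known functional form. $L^2$ is the space of $\psi:\mathcal X\to\mathbb R$ with $\int\psi^2\,dQ<\infty$, with norm $\|\cdot\|$ and inner product $\langle\cdot,\cdot\rangle$; $\|\psi\|_p=(\int|\psi|^p\,dQ)^{1/p}$; functions are identified $Q$-a.e., and ''positive'' means positive $Q$-a.e. The operator $\mathbb M\psi(x)=\mathbb E[m(X_t,X_{t+1})\psi(X_{t+1})\mid X_t=x]$ acts on $L^2$; $\mathbb M_\tau=\mathbb M^\tau$; $\mathbb M^*$ is the adjoint, $\mathbb M^*\psi(x)=\mathbb E[m(X_t,X_{t+1})\psi(X_t)\mid X_{t+1}=x]$. $\|\cdot\|$ also denotes the operator norm on $L^2$ and the operator norm (largest singular value) of matrices. An eigenvalue is simple if it has a unique eigenfunction up to scale, and isolated if some neighborhood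 of it contains no other point of the spectrum. Sieve: for each $k$, $b_{k1},\dots,b_{kk}\in L^2$ are linearly independent, $B_k$ is their linear span, $b^k(x)=(b_{k1}(x),\dots,b_{kk}(x))'$, and $\Pi_k:L^2\to B_k$ is the orthogonal projection. The dimension $k=k(n)\to\infty$ as $n\to\infty$. $\mathbf G=\mathbb E[b^k(X_t)b^k(X_t)']$ (nonsingular) and $\mathbf M=\mathbb E[b^k(X_t)m(X_t,X_{t+1})b^k(X_{t+1})']$. $\rho_k$ is the largest real generalized eigenvalue of $(\mathbf M,\mathbf G)$ with eigenvectors $\mathbf Mc_k=\rho_k\mathbf Gc_k$, $c_k^{*\prime}\mathbf M=\rho_kc_k^{*\prime}\mathbf G$ (well defined for large $k$), and $\phi_k=b^{k\prime}c_k$, $\phi_k^*=b^{k\prime}c_k^*$, normalized so that $\|\phi_k\|=1$, $\langle\phi_k,\phi_k^*\rangle=1$. Estimators: $\hat\alpha\in\mathcal A$ is a first-stage estimator of $\alpha_0$. From data $X_0,\dots,X_n$, $\widehat{\mathbf G}=\frac1n\sum_{t=0}^{n-1}b^k(X_t)b^k(X_t)'$ and $\widehat{\mathbf M}=\frac1n\sum_{t=0}^{n-1}b^k(X_t)m(X_t,X_{t+1};\hat\alpha)b^k(X_{t+1})'$. $\hat\rho$ is the largest real generalized eigenvalue of $(\widehat{\mathbf M},\widehat{\mathbf G})$ (well defined with probability approaching one). $\mathbf M^o=\mathbf G^{-1/2}\mathbf M\mathbf G^{-1/2}$, $\widehat{\mathbf G}^o=\mathbf G^{-1/2}\widehat{\mathbf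 G}\mathbf G^{-1/2}$, $\widehat{\mathbf M}^o=\mathbf G^{-1/2}\widehat{\mathbf M}\mathbf G^{-1/2}$; $\mathbf I$ is the $k\times k$ identity. $\ell:\mathcal A\to\mathbb R$ is pathwise differentiable at $\alpha_0$ if $\lim_{\tau\to0^+}(\ell(\alpha_0+\tau[\alpha-\alpha_0])-\ell(\alpha_0))/\tau$ exists for every fixed $\alpha\in\mathcal A$; the limit is denoted $\dot\ell_{\alpha_0}[\alpha-\alpha_0]$. $\mathcal Z_n$ is the centered empirical process on $\mathcal G$: $\mathcal Z_n(g)=n^{-1/2}\sum_{t=0}^{n-1}(g(X_t,X_{t+1})-\mathbb E[g(X_t,X_{t+1})])$. $\mathcal G$ is Donsker if $\sum_{t\in\mathbb Z}\mathrm{Cov}(g(X_0,X_1),g(X_t,X_{t+1}))$ is absolutely convergent over $\mathcal G$ to a non-negative quadratic form $\mathbb K(g,g)$ and there exists a sequence of Gaussian processes $\mathcal Z^{(n)}$ indexed by $\mathcal G$ with covariance function $\mathbb K$ and a.s. uniformly continuous sample paths such that $\sup_{g\in\mathcal G}|\mathcal Z_n(g)-\mathcal Z^{(n)}(g)|\to_p0$. *)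

(* Defs.v *)
From HB Require Import structures.
From mathcomp Require Import all_boot all_order all_algebra.
From mathcomp Require Import all_classical all_reals all_analysis.
From mathcomp Require Import measurable_realfun.

Set Implicit Arguments.
Unset Strict Implicit.
Unset Printing Implicit Defensive.

Import Order.TTheory GRing.Theory Num.Theory.
Import numFieldNormedType.Exports.

Local Open Scope classical_set_scope.
Local Open Scope ring_scope.

Definition is_norm (R : realType) (V : lmodType R) (N : V -> R) : Prop :=
  [/\ forall x y, N (x + y) <= N x + N y,
      forall (a : R) x, N (a *: x) = `|a| * N x
    & forall x, N x = 0 -> x = 0].

Section matrices.
Context {R : realType}.

Definition enorm n (x : 'cV[R]_n) : R := Num.sqrt (\sum_i x i 0 ^+ 2).

Definition mxopnorm n (A : 'M[R]_n) : R :=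
  sup [set enorm (A *m x) | x in [set x : 'cV[R]_n | enorm x <= 1]].

Definition psdmx n (A : 'M[R]_n) : Prop :=
  A^T = A /\ forall x : 'cV[R]_n, 0 <= (x^T *m A *m x) 0 0.

(* G^{-1/2}, the positive semidefinite square root of the inverse of G. *)
Definition inv_sqrtmx n (G : 'M[R]_n) : 'M[R]_n :=
  xget 0 [set S | psdmx S /\ S *m S = invmx G].

Definition geigenvalue n (M G : 'M[R]_n) (r : R) : Prop :=
  exists2 c : 'cV[R]_n, c != 0 & M *m c = r *: (G *m c).

Definition largest_geigenvalue n (M G : 'M[R]_n) (r : R) : Prop :=
  geigenvalue M G r /\ forall r', geigenvalue M G r' -> r' <= r.

End matrices.

Section probability_notions.
Context {R : realType} {dO : measure_display} {Omega : measurableType dO}.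
Variable P : probability Omega R.

(* Y_n = o_p(a_n). Outer probability is used, so that Y_n need not be
   measurable (suprema over uncountable classes, plug-in estimators). *)
Definition is_op (a : nat -> R) (Y : nat -> Omega -> \bar R) : Prop :=
  forall eps : R, 0 < eps ->
    (mu_ext P [set w | (eps * a n)%:E < `|Y n w|]%E @[n --> \oo] --> 0%E).

(* The law N(0, v) for v >= 0; [normal_prob] is meant for a nonzero standard
   deviation only, and N(0, 0) is the point mass at 0. *)
Definition centered_normal (v : R) : probability (measurableTypeR R) R :=
  if v == 0 then (dirac (0 : measurableTypeR R) : probability _ R)
  else (normal_prob 0 (Num.sqrt v) : probability _ R).

Definition has_centered_normal_law (Y : Omega -> R) (v : R) : Prop :=
  0 <= v /\
  forall B : set R, measurable B -> P (Y @^-1` B) = centered_normal v B.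

Definition cvg_dist_normal (Y : nat -> Omega -> R) (v : R) : Prop :=
  0 <= v /\
  forall f : R -> R, continuous f -> (exists C, forall x, `|f x| <= C) ->
    ('E_P[f \o Y n]%E @[n --> \oo] --> (\int[centered_normal v]_x (f x)%:E)%E).

(* mu = N(0, V) on R^2, i.e. every linear functional is normal. *)
Definition is_normal2 (mu : probability (R * R)%type R) (V : 'M[R]_2) : Prop :=
  psdmx V /\
  forall (a : 'cV[R]_2) (B : set R), measurable B ->
    mu [set z | B (a 0 0 * z.1 + a 1 0 * z.2)]
    = centered_normal ((a^T *m V *m a) 0 0) B.

Definition cvg_dist_normal2 (Y Z : nat -> Omega -> R) (V : 'M[R]_2) : Prop :=
  exists2 mu : probability (R * R)%type R, is_normal2 mu V &
  forall f : R * R -> R, continuous f -> (exists C, forall x, `|f x| <= C) ->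
    ('E_P[fun w => f (Y n w, Z n w)]%E @[n --> \oo]
      --> (\int[mu]_x (f x)%:E)%E).

(* h(x) = E[Y | W = x]. *)
Definition is_cond_mean d' (E : measurableType d') (Y : Omega -> R)
    (W : Omega -> E) (h : E -> R) : Prop :=
  [/\ measurable_fun [set: E] h,
      P.-integrable [set: Omega] (EFin \o Y),
      P.-integrable [set: Omega] (EFin \o (h \o W))
    & forall A, measurable A ->
        (\int[P]_(w in W @^-1` A) (Y w)%:E
         = \int[P]_(w in W @^-1` A) (h (W w))%:E)%E].

Definition cond_mean d' (E : measurableType d') (Y : Omega -> R)
    (W : Omega -> E) : E -> R :=
  xget (cst 0) [set h | is_cond_mean Y W h].

End probability_notions.

(* Operators act on functions E -> R; members of L^2 are only considered up to
   Q-a.e. equality. *)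
Section L2_operators.
Context {R : realType} {dE : measure_display} {E : measurableType dE}.
Variable Q : probability E R.

Definition L2 (f : E -> R) : Prop := f \in Lfun Q 2%:E.

Definition L2norm (f : E -> R) : R := fine ('N[Q]_2%:E[EFin \o f])%E.

Definition L2inner (f g : E -> R) : R := \int[Q]_x (f x * g x).

Definition positive (f : E -> R) : Prop := {ae Q, forall x, 0 < f x}.

Definition L2opnorm (T : (E -> R) -> E -> R) : \bar R :=
  ereal_sup [set ('N[Q]_2%:E[EFin \o T f])%E
            | f in [set f | L2 f /\ L2norm f <= 1]].

Definition L2bounded (T : (E -> R) -> E -> R) : Prop :=
  exists C : R, forall f, L2 f -> L2 (T f) /\ L2norm (T f) <= C * L2norm f.

Definition eigenfunction (T : (E -> R) -> E -> R) (l : R) (f : E -> R) : Prop :=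
  [/\ L2 f, ~ {ae Q, forall x, f x = 0} & {ae Q, forall x, T f x = l * f x}].

Definition eigenvalue (T : (E -> R) -> E -> R) (l : R) : Prop :=
  exists f, eigenfunction T l f.

Definition simple_eigenvalue (T : (E -> R) -> E -> R) (l : R) : Prop :=
  eigenvalue T l /\
  forall f g, eigenfunction T l f -> eigenfunction T l g ->
    exists c : R, {ae Q, forall x, g x = c * f x}.

Definition largest_eigenvalue (T : (E -> R) -> E -> R) (l : R) : Prop :=
  eigenvalue T l /\ forall l', eigenvalue T l' -> l' <= l.

(* u + iv solves (T - (a + ib)) (u + iv) = f + ig in the complexified L^2. *)
Definition resolvent_eq (T : (E -> R) -> E -> R) (a b : R)
    (f g u v : E -> R) : Prop :=
  [/\ L2 u, L2 v,
      {ae Q, forall x, T u x - a * u x + b * v x = f x}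
    & {ae Q, forall x, T v x - a * v x - b * u x = g x}].

(* T - (a + ib) is a bijection of the complexified L^2 with bounded inverse. *)
Definition in_resolvent (T : (E -> R) -> E -> R) (a b : R) : Prop :=
  exists C : R, forall f g, L2 f -> L2 g ->
    exists u v, [/\ resolvent_eq T a b f g u v,
      forall u' v', resolvent_eq T a b f g u' v' ->
        {ae Q, forall x, u' x = u x /\ v' x = v x}
    & L2norm u + L2norm v <= C * (L2norm f + L2norm g)].

Definition isolated_in_spectrum (T : (E -> R) -> E -> R) (l : R) : Prop :=
  exists2 e : R, 0 < e &
    forall a b : R, (a - l) ^+ 2 + b ^+ 2 < e ^+ 2 -> ~ in_resolvent T a b ->
      a = l /\ b = 0.

Definition lincomb k (b : 'I_k -> E -> R) (c : 'cV[R]_k) : E -> R :=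
  fun x => \sum_i c i 0 * b i x.

Definition lin_indep k (b : 'I_k -> E -> R) : Prop :=
  forall c, {ae Q, forall x, lincomb b c x = 0} -> c = 0.

Definition sieve_proj k (b : 'I_k -> E -> R) (f : E -> R) : E -> R :=
  xget (cst 0) [set h | (exists c, h = lincomb b c) /\
                        forall i, L2inner (f \- h) (b i) = 0].

End L2_operators.

Section process.
Context {R : realType} {dO dE : measure_display}.
Context {Omega : measurableType dO} {E : measurableType dE}.
Variables (P : probability Omega R) (X : nat -> {RV P >-> E}).

Definition path_measurable : set (set (nat -> E)) :=
  <<s [set C | exists i (A : set E), measurable A /\ C = [set x | A (x i)]] >>.

Definition path_event (B : set (nat -> E)) : set Omega :=
  [set w | B (fun t => X t w)].

Definition shift (x : nat -> E) : nat -> E := fun t => x t.+1.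

Definition strictly_stationary : Prop :=
  forall B, path_measurable B -> P (path_event (shift @^-1` B)) = P (path_event B).

Definition ergodic : Prop :=
  forall B, path_measurable B -> shift @^-1` B = B ->
    P (path_event B) = 0%E \/ P (path_event B) = 1%E.

Definition past (t : nat) : set (set Omega) :=
  <<s [set C | exists i (A : set E),
         [/\ (i <= t)%N, measurable A & C = X i @^-1` A]] >>.

Definition homogeneous_markov : Prop :=
  exists p : R.-pker E ~> E, forall t B A, past t B -> measurable A ->
    P (B `&` X t.+1 @^-1` A) = (\int[P]_(w in B) p (X t w) A)%E.

Definition stat_dist : probability E R := distribution P (X 0).

Definition pair_at (h : E -> E -> R) (t : nat) : Omega -> R :=
  fun w => h (X t w) (X t.+1 w).

Definition pair_mean (h : E -> E -> R) : R := \int[P]_w pair_at h 0 w.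

(* psi |-> E[m(X_t, X_{t+1}) psi(X_{t+1}) | X_t = .]; by stationarity the
   choice of t is immaterial. *)
Definition opM (m : E -> E -> R) (psi : E -> R) : E -> R :=
  cond_mean P (pair_at (fun x y => m x y * psi y) 0) (X 0).

(* psi |-> E[m(X_t, X_{t+1}) psi(X_t) | X_{t+1} = .] *)
Definition opM_adj (m : E -> E -> R) (psi : E -> R) : E -> R :=
  cond_mean P (pair_at (fun x y => m x y * psi x) 0) (X 1).

Local Notation Q := stat_dist.

Record perron_frobenius (m : E -> E -> R) (rho : R) (phi phis : E -> R)
    : Prop := {
  (* the conditional mean defining the operator makes sense on L^2 *)
  pf_defined : forall psi, L2 Q psi ->
    P.-integrable [set: Omega] (EFin \o pair_at (fun x y => m x y * psi y) 0);
  pf_bounded : L2bounded Q (opM m);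
  pf_rho : 0 < rho;
  pf_right : [/\ L2 Q phi, positive Q phi
               & {ae Q, forall x, opM m phi x = rho * phi x}];
  pf_left : [/\ L2 Q phis, positive Q phis
              & {ae Q, forall x, opM_adj m phis x = rho * phis x}];
  pf_right_unique : forall psi, L2 Q psi -> positive Q psi ->
    {ae Q, forall x, opM m psi x = rho * psi x} ->
    exists c : R, {ae Q, forall x, psi x = c * phi x};
  pf_left_unique : forall psi, L2 Q psi -> positive Q psi ->
    {ae Q, forall x, opM_adj m psi x = rho * psi x} ->
    exists c : R, {ae Q, forall x, psi x = c * phis x};
  pf_simple : simple_eigenvalue Q (opM m) rho;
  pf_isolated : isolated_in_spectrum Q (opM m) rho;
  pf_largest : largest_eigenvalue Q (opM m) rho;
  (* a and c rescale phi and phis so that E[phi phis] = 1 *)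
  pf_limit : forall a c : R, 0 < a -> 0 < c ->
    L2inner Q (a \*o phi) (c \*o phis) = 1 ->
    forall psi, L2 Q psi -> {ae Q, forall x,
      rho ^- tau * iter tau (opM m) psi x @[tau --> \oo]
        --> L2inner Q psi (c \*o phis) * (a * phi x)}
}.

Section sieve.
Variables (m : E -> E -> R) (k : nat) (b : 'I_k -> E -> R).

Definition Gmx : 'M[R]_k := \matrix_(i, j) pair_mean (fun x _ => b i x * b j x).

Definition Mmx : 'M[R]_k :=
  \matrix_(i, j) pair_mean (fun x y => b i x * m x y * b j y).

Definition is_sieve_eigvecs (c cs : 'cV[R]_k) : Prop :=
  exists rho_k, [/\ largest_geigenvalue Mmx Gmx rho_k,
    Mmx *m c = rho_k *: (Gmx *m c),
    cs^T *m Mmx = rho_k *: (cs^T *m Gmx),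
    L2norm Q (lincomb b c) = 1
  & L2inner Q (lincomb b c) (lincomb b cs) = 1].

(* Determined up to a common sign of the two components when rho_k exists and
   is simple. *)
Definition sieve_eigvecs : 'cV[R]_k * 'cV[R]_k :=
  xget (0, 0) [set z | is_sieve_eigvecs z.1 z.2].

Definition phi_k : E -> R := lincomb b sieve_eigvecs.1.

Definition phis_k : E -> R := lincomb b sieve_eigvecs.2.

Definition Ghat (n : nat) (w : Omega) : 'M[R]_k :=
  \matrix_(i, j) (n%:R^-1 * \sum_(t < n) b i (X t w) * b j (X t w)).

(* [mhat w] is the estimated function m(., .; alphahat(w)). *)
Definition Mhat (mhat : Omega -> E -> E -> R) (n : nat) (w : Omega) : 'M[R]_k :=
  \matrix_(i, j) (n%:R^-1 * \sum_(t < n)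
    b i (X t w) * mhat w (X t w) (X t.+1 w) * b j (X t.+1 w)).

Definition orthog (A : 'M[R]_k) : 'M[R]_k :=
  inv_sqrtmx Gmx *m A *m inv_sqrtmx Gmx.

Definition Gerr (n : nat) (w : Omega) : R :=
  mxopnorm (orthog (Ghat n w) - 1%:M).

Definition Merr (mhat : Omega -> E -> E -> R) (n : nat) (w : Omega) : R :=
  mxopnorm (orthog (Mhat mhat n w) - orthog Mmx).

End sieve.

Definition normalized_sum (Y : nat -> Omega -> R) (n : nat) (w : Omega) : R :=
  (Num.sqrt n%:R)^-1 * \sum_(t < n) Y t w.

Definition empirical (n : nat) (g : E -> E -> R) : Omega -> R :=
  normalized_sum
    (fun t w => pair_at g t w - \int[P]_w' pair_at g t w') n.

Definition autocov (f g : E -> E -> R) (t : nat) : R :=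
  fine (covariance P (pair_at f 0) (pair_at g t)).

(* Sum over |t| < N of Cov(f(X_0, X_1), g(X_t, X_{t+1})); by stationarity the
   term at -t is Cov(g(X_0, X_1), f(X_t, X_{t+1})). *)
Definition longrun_partial (f g : E -> E -> R) (N : nat) : R :=
  autocov f g 0 + \sum_(1 <= t < N) (autocov f g t + autocov g f t).

Definition longrun_cov (f g : E -> E -> R) : R :=
  limn (longrun_partial f g).

Definition gaussian_process (G : set (E -> E -> R))
    (K : (E -> E -> R) -> (E -> E -> R) -> R)
    (Z : (E -> E -> R) -> Omega -> R) : Prop :=
  forall N (g : 'I_N -> E -> E -> R) (a : 'I_N -> R), (forall i, G (g i)) ->
    has_centered_normal_law P (fun w => \sum_i a i * Z (g i) w)
      (\sum_i \sum_j a i * a j * K (g i) (g j)).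

(* Continuity is with respect to the intrinsic semimetric of the process,
   d(f, g)^2 = Var (Z f - Z g) = K(f,f) - 2 K(f,g) + K(g,g). *)
Definition uniformly_continuous_path (G : set (E -> E -> R))
    (K : (E -> E -> R) -> (E -> E -> R) -> R) (z : (E -> E -> R) -> R)
    : Prop :=
  forall eps : R, 0 < eps -> exists2 delta : R, 0 < delta &
    forall f g, G f -> G g ->
      K f f - 2 * K f g + K g g < delta ^+ 2 -> `|z f - z g| < eps.

Record donsker (G : set (E -> E -> R)) : Prop := {
  donsker_L2 : forall g, G g -> pair_at g 0 \in Lfun P 2%:E;
  donsker_abs : forall g, G g -> cvgn (series (fun t => `|autocov g g t|));
  donsker_cov : forall f g, G f -> G g -> cvgn (longrun_partial f g);
  donsker_nonneg : forall g, G g -> 0 <= longrun_cov g g;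
  donsker_approx : exists Z : nat -> (E -> E -> R) -> {RV P >-> R},
    [/\ forall n, gaussian_process G longrun_cov (fun g => Z n g),
        forall n, {ae P, forall w,
          uniformly_continuous_path G longrun_cov (fun g => Z n g w)}
      & is_op P (fun=> 1) (fun n w =>
          ereal_sup [set (`|empirical n g w - Z n g w|)%:E | g in G])]
}.

Section parameter.
Variables (V : Type) (m : V -> E -> E -> R) (alpha0 : V) (phi phis : E -> R).

Definition psi_rho (rho : R) : nat -> Omega -> R := pair_at (fun x y =>
  phis x * m alpha0 x y * phi y - rho * (phis x * phi x)).

Definition ell (alpha : V) : R :=
  pair_mean (fun x y => phis x * phi y * m alpha x y).

Definition g_class (alpha : V) (x y : E) : R :=
  phis x * phi y * (m alpha x y - m alpha0 x y).

Definition sup_powR (A : set V) (s : R) (z : E * E) : \bar R :=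
  ereal_sup [set ((m alpha z.1 z.2) `^ s)%:E | alpha in A].

(* E[sup_alpha m(X_t, X_{t+1}; alpha)^s] is finite. *)
Definition finite_sup_moment (A : set V) (s : R) : Prop :=
  measurable_fun [set: E * E] (sup_powR A s) /\
  (\int[P]_w sup_powR A s (X 0 w, X 1 w) < +oo)%E.

End parameter.

End process.

Section pathwise_derivative.
Context {R : realType} {V : lmodType R}.

Definition diff_quotient (l : V -> R) (a h : V) (tau : R) : R :=
  (l (a + tau *: h) - l a) / tau.

Definition pathwise_derivative (l : V -> R) (a h : V) : R :=
  lim (diff_quotient l a h tau @[tau --> 0^'+]).

(* The path must stay in the domain A of l for the limit to make sense. *)
Definition pathwise_differentiable (A : set V) (l : V -> R) (a : V) : Prop :=
  forall a', A a' ->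
    (\forall tau \near 0^'+, A (a + tau *: (a' - a))) /\
    cvg (diff_quotient l a (a' - a) tau @[tau --> 0^'+]).

End pathwise_derivative.

(* Main.v *)
Require Import Defs.
From HB Require Import structures.
From mathcomp Require Import all_boot all_order all_algebra.
From mathcomp Require Import all_classical all_reals all_analysis.
From mathcomp Require Import measurable_realfun ring lra.
From mathcomp Require complex sesquilinear spectral.

Set Implicit Arguments.
Unset Strict Implicit.
Unset Printing Implicit Defensive.

Import Order.TTheory GRing.Theory Num.Theory.
Import numFieldNormedType.Exports.

Local Open Scope classical_set_scope.
Local Open Scope ring_scope.

(** Put [n]-dependent quantities in the coordinates [G^{-1/2}].  (A2) makes [M] a
norm limit of finite-rank operators; evaluating along an ultrafilter this yields
enough compactness to bound [M - rho] from below on the orthogonal complement of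
[phis], and [M - l] from below for [l] above [rho].  These two lower bounds are
stable under small perturbations, and a bordered linear system
[(A - l) x + m u = 0, v' x = 1] turns them into existence, uniqueness and
maximality of an eigenvalue near [rho], first for the sieve matrices (with an error
of the order of the sieve bias) and then for the estimated ones, for which
[rhohat = rho_k + c*' (Mhat - rho_k Ghat) c + O(|Ghat - G|^2 + |Mhat - M|^2)].

By Markov's and Hölder's inequalities [phi_k], [phis_k] can be replaced by [phi],
[phis] in the linear term, which then is the sum of [psi_rho], of the empirical
process at [g_alphahat] and of [ell alphahat - ell alpha0].

The empirical process is negligible at [g_alphahat] because
[K(g_alphahat, g_alphahat)] tends to 0, but the approximating Gaussian processes
change with [n] and each is only known to have uniformly continuous paths.  Their
finite-dimensional laws are determined by [K] (they are compared through means of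
cosines of linear combinations), so one modulus of continuity at the zero function
serves all [n] on countable subsets; path continuity forces small balls of [G] to be
separable, which passes from countable subsets to the whole class. *)

(** The sieve matrices are not symmetric and their size grows with the sample, so there is no
    variational description of the eigenvalue and every constant has to be independent of the
    dimension. This is why spectral information is carried by lower bounds: for a square system such
    a bound gives invertibility, and a perturbation only changes its constant by a fixed factor. The
    rates match the order of each error: the square of an error below $n^{-1/4}$ vanishes after
    multiplication by $\sqrt n$, and the sieve bias, below $n^{-1/2}$, is absorbed by a first-moment
    bound that holds under any dependence. On the Gaussian side only the laws of linear combinations
    are given. A product of cosines is again a sum of cosines, so means of products of trigonometric
    polynomials depend on [K] alone, and such polynomials imitate indicators on a bounded range.
    Separability comes from a dichotomy: infinitely many directions with residual variance bounded
    below would force the supremum over the ball to exceed 1 with probability near one. *)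

Import HBNNSimple.

(** * Measures given by a density *)

Section density.
Local Open Scope ereal_scope.
Context d (T : measurableType d) (R : realType).
Variable mu : {measure set T -> \bar R}.

(** Monotone convergence reduces the identity to simple functions. The measure [nu] is known by its
    values only, so that the lemma serves both [mdensity] and the normal law. *)
Lemma ge0_integral_density (nu : {measure set T -> \bar R}) (g : T -> R)
    (h : T -> \bar R) :
  measurable_fun [set: T] g -> (forall x, (0 <= g x)%R) ->
  (forall A, measurable A -> nu A = \int[mu]_(x in A) (g x)%:E) ->
  measurable_fun [set: T] h -> (forall x, 0 <= h x) ->
  \int[nu]_x h x = \int[mu]_x (h x * (g x)%:E).
Proof.
move=> mg g0 nuE mh h0.
have mEg : measurable_fun setT (EFin \o g) by exact/measurable_EFinP.
pose h_ := nnsfun_approx measurableT mh.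
have cvg_h x : EFin \o h_^~ x @ \oo --> h x by exact: cvg_nnsfun_approx.
have nd_h x : {homo (fun n => EFin (h_ n x)) : m n / (m <= n)%N >-> (m <= n)}.
  by move=> m n mn; rewrite lee_fin; exact/lefP/nd_nnsfun_approx.
have mh_ n : measurable_fun setT (fun x => (h_ n x)%:E) by apply/measurable_EFinP.
have lhs : \int[nu]_x (h_ n x)%:E @[n --> \oo] --> \int[nu]_x h x.
  have -> : \int[nu]_x h x = \int[nu]_x limn (EFin \o h_ ^~ x).
    by apply: eq_integral => x _; apply/esym/cvg_lim => //; exact: cvg_h.
  apply: cvg_monotone_convergence => //.
  by move=> n x _; rewrite lee_fin.
have rhs : \int[mu]_x ((h_ n x)%:E * (g x)%:E) @[n --> \oo]
    --> \int[mu]_x (h x * (g x)%:E).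
  have -> : \int[mu]_x (h x * (g x)%:E)
      = \int[mu]_x limn (fun n => (h_ n x)%:E * (g x)%:E).
    apply: eq_integral => x _; apply/esym/cvg_lim => //.
    by apply: cvgeZr => //; exact: cvg_h.
  apply: cvg_monotone_convergence => //.
  - by move=> n; apply: emeasurable_funM.
  - by move=> n x _; rewrite mule_ge0// lee_fin.
  - by move=> x _ m n mn; rewrite lee_wpmul2r ?lee_fin//; exact: nd_h.
suff hn n : \int[nu]_x (h_ n x)%:E = \int[mu]_x ((h_ n x)%:E * (g x)%:E).
  move: lhs; under eq_cvg do rewrite hn.
  by move=> lhs; exact: (cvg_unique _ lhs rhs).
have pre y : measurable (h_ n @^-1` [set y]) by exact: measurable_funPTI.
rewrite integral_nnsfun// sintegralE patch_setT.
transitivity (\int[mu]_x (\sum_(y \in range (h_ n))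
    (y * (\1_(h_ n @^-1` [set y]) x * g x))%:E)); last first.
  apply: eq_integral => x _; rewrite -EFinM fimfunE fsumEFin//; congr EFin.
  by rewrite (mulr_fsuml _); apply: eq_fsbigr => y _; rewrite mulrA.
rewrite ge0_integral_fsum//; last first.
(* A negative [y] is not a value of the nonnegative function [h_ n], so its indicator vanishes. *)
- move=> y x _; rewrite lee_fin.
  have [hy|hy] := leP 0%R y; first by rewrite mulr_ge0// mulr_ge0.
  rewrite indicE memNset ?mul0r ?mulr0//= => hxy.
  by move: hy; rewrite -hxy ltNge fun_ge0.
- move=> y; apply/measurable_EFinP; apply: measurable_funM => //.
  by apply: measurable_funM => //; exact: measurable_indic.
apply: eq_fsbigr => r rhn.
have r0 : (0 <= r)%R by move: rhn; rewrite inE => -[t _ <-].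
under eq_integral do rewrite EFinM.
rewrite ge0_integralZl//; last 2 first.
- by apply/measurable_EFinP/measurable_funM => //; exact: measurable_indic.
- by move=> x _; rewrite lee_fin mulr_ge0.
congr *%E; rewrite nuE// integral_mkcond; apply: eq_integral => x _.
rewrite patchE indicE; case: ifPn => _; by rewrite ?mul1r ?mul0r.
Qed.

Variables (g : T -> R).
Hypotheses (mg : measurable_fun [set: T] g) (g0 : forall x, (0 <= g x)%R).

Definition mdensity of measurable_fun [set: T] g & (forall x, (0 <= g x)%R) :=
  fun A : set T => \int[mu]_(x in A) (g x)%:E.

Local Notation nu := (mdensity mg g0).

Let nu0 : nu set0 = 0. Proof. by rewrite /mdensity integral_set0. Qed.

Let nu_ge0 A : 0 <= nu A.
Proof. by apply: integral_ge0 => x _; rewrite lee_fin. Qed.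

Let nu_sigma : semi_sigma_additive nu.
Proof.
by apply: semi_sigma_additive_nng_induced => //; exact/measurable_EFinP.
Qed.

HB.instance Definition _ := isMeasure.Build _ _ _ nu nu0 nu_ge0 nu_sigma.

End density.

(** * Integrals of real functions under a probability *)

Section real_integrals.
Context d (T : measurableType d) (R : realType).
Implicit Types (mu : {measure set T -> \bar R}) (P : probability T R) (f g : T -> R).

Lemma integrable_EFinD mu f g : mu.-integrable setT (EFin \o f) ->
  mu.-integrable setT (EFin \o g) -> mu.-integrable setT (EFin \o (fun x => f x + g x)).
Proof. by move=> f1 g1; exact: (integrableD measurableT f1 g1). Qed.

Lemma integrable_EFinB mu f g : mu.-integrable setT (EFin \o f) ->
  mu.-integrable setT (EFin \o g) -> mu.-integrable setT (EFin \o (fun x => f x - g x)).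
Proof. by move=> f1 g1; exact: (integrableB measurableT f1 g1). Qed.

Lemma integrable_EFinZl mu (a : R) f : mu.-integrable setT (EFin \o f) ->
  mu.-integrable setT (EFin \o (fun x => a * f x)).
Proof. by move=> f1; exact: (integrableZl measurableT a f1). Qed.

Lemma integral_EFin mu f : mu.-integrable setT (EFin \o f) ->
  (\int[mu]_x (f x)%:E = (\int[mu]_x f x)%:E)%E.
Proof. by move=> fi; rewrite /Rintegral fineK//; apply: integrable_fin_num. Qed.

Lemma integrable_EFin_sum mu (I : Type) (r : seq I) (F : I -> T -> R) :
  (forall i, mu.-integrable setT (EFin \o F i)) ->
  mu.-integrable setT (EFin \o (fun x => \sum_(i <- r) F i x)).
Proof.
move=> iF; elim: r => [|i r IH].
  by under eq_fun do rewrite big_nil; exact: integrable0.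
by under eq_fun do rewrite big_cons; exact: integrable_EFinD.
Qed.

Lemma Rintegral_sum mu (I : Type) (r : seq I) (F : I -> T -> R) :
  (forall i, mu.-integrable setT (EFin \o F i)) ->
  \int[mu]_x (\sum_(i <- r) F i x) = \sum_(i <- r) \int[mu]_x F i x.
Proof.
move=> iF; elim: r => [|i r IH].
  by under eq_Rintegral do rewrite big_nil; rewrite /Rintegral integral0 big_nil.
under eq_Rintegral do rewrite big_cons.
by rewrite RintegralD//= ?IH ?big_cons//; exact: integrable_EFin_sum.
Qed.

Lemma bounded_integrable P f C : measurable_fun setT f -> (forall x, `|f x| <= C) ->
  P.-integrable setT (EFin \o f).
Proof.
move=> mf fC; apply: measurable_bounded_integrable => //.
- exact: fin_num_fun_lty.
- exists C; split; first exact: num_real.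
  by move=> x Cx y _; apply: (le_trans (fC y)); rewrite ltW.
Qed.

Lemma Rintegral_prob_cst P (c : R) : \int[P]_x c = c.
Proof.
rewrite Rintegral_cst// [X in fine X](_ : _ = 1%E) ?mulr1//.
exact: probability_setT.
Qed.

End real_integrals.

Section probability_integrals.
Context d (T : measurableType d) (R : realType) (P : probability T R).

Lemma fine_probability (A : set T) : measurable A -> ((fine (P A))%:E = P A)%E.
Proof. by move=> mA; rewrite fineK// fin_num_measure. Qed.

Lemma integrable_indic_prob (A : set T) : measurable A ->
  P.-integrable setT (EFin \o (\1_A : T -> R)).
Proof.
move=> mA; apply: (@bounded_integrable _ _ _ _ _ 1); first exact: measurable_indic.
by move=> x; rewrite indicE; case: (_ \in _); rewrite ?normr1 ?normr0.
Qed.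

Lemma Rintegral_indic_prob (A : set T) : measurable A ->
  \int[P]_x (\1_A x : R) = fine (P A).
Proof. by move=> mA; rewrite /Rintegral integral_indic// setIT. Qed.

Lemma fine_probability_setC (A : set T) : measurable A ->
  fine (P (~` A)) = 1 - fine (P A).
Proof.
by move=> mA; rewrite probability_setC// fineB// fin_num_measure.
Qed.

Lemma le_fine_probability (A B : set T) : measurable A -> measurable B ->
  A `<=` B -> fine (P A) <= fine (P B).
Proof.
move=> mA mB AB; apply: fine_le; rewrite ?fin_num_measure//.
by apply: le_measure; rewrite ?inE.
Qed.

Lemma fine_probability_ge0 (A : set T) : 0 <= fine (P A).
Proof. exact: fine_ge0. Qed.

Lemma fine_probability_le1 (A : set T) : measurable A -> fine (P A) <= 1.
Proof. by move=> mA; rewrite -lee_fin fine_probability// probability_le1. Qed.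

Lemma Rintegral_law (mu : probability (measurableTypeR R) R) (Y f : T -> R)
    (g : R -> R) C :
  measurable_fun setT Y -> (forall B : set R, measurable B -> P (Y @^-1` B) = mu B) ->
  measurable_fun [set: R] g -> (forall x, `|g x| <= C) -> (forall w, f w = g (Y w)) ->
  \int[P]_w f w = \int[mu]_x g x.
Proof.
move=> mY law mg gC fE; under eq_Rintegral do rewrite fE.
have mgY : measurable_fun setT (g \o Y) by exact: measurableT_comp.
have ig : P.-integrable setT (EFin \o (g \o Y)).
  by apply: (@bounded_integrable _ _ _ _ _ C) => // w; exact: gC.
rewrite /Rintegral; congr fine.
transitivity (\int[pushforward P (Y : T -> measurableTypeR R)]_x (g x)%:E)%E.
  apply/esym.
  apply: (@integral_pushforward _ _ T (measurableTypeR R) _ Y mY P setT (EFin \o g)) => //.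
  exact/measurable_EFinP.
by apply: eq_measure_integral => A mA _; exact: law.
Qed.

End probability_integrals.

(** * A discriminant inequality and an intermediate value theorem *)

Section auxiliary.
Context {R : realType}.

Lemma discriminant_le (a b c : R) : 0 <= c ->
  (forall t, 0 <= a + 2 * (t * b) + t ^+ 2 * c) -> b ^+ 2 <= a * c.
Proof.
move=> c0 H; have [cz|cn] := eqVneq c 0.
  have [->|bn] := eqVneq b 0; first by rewrite cz expr0n mulr0.
  (* For [c = 0] the expression is affine in [t], and this [t] gives it the value -1. *)
  have := H (- (a + 1) / (2 * b)); rewrite cz mulr0 addr0.
  have -> : 2 * (- (a + 1) / (2 * b) * b) = - (a + 1) by field.
  lra.
have cp : 0 < c by rewrite lt_neqAle eq_sym cn.
have := H (- b / c).
have -> : a + 2 * (- b / c * b) + (- b / c) ^+ 2 * c = a - b ^+ 2 / c by field.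
by rewrite subr_ge0 ler_pdivrMr.
Qed.

(** Composing with the retraction [k] onto [[a, b]] gives a globally continuous function with the
    same end values, so control on the segment is enough. The intended [f] is the multiplier of the
    bordered system, which has a default value away from [rho]. *)
Lemma lipschitz_IVT (f : R -> R) (a b C : R) : a <= b ->
  (forall x y, a <= x <= b -> a <= y <= b -> `|f x - f y| <= C * `|x - y|) ->
  f a <= 0 -> 0 <= f b -> exists2 c, a <= c <= b & f c = 0.
Proof.
move=> ab lip fa fb.
pose k x := Num.max a (Num.min x b).
have kab x : a <= k x <= b.
  by rewrite /k le_max lexx/= ge_max ab/= ge_min lexx orbT.
have k1 x y : `|k x - k y| <= `|x - y|.
  rewrite /k !maxEle !minEle; have /ler_normlP[h1 h2] := lexx `|x - y|.
  by case: (leP x b) => xb; case: (leP y b) => yb;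
    do ?[case: (leP a _) => ?]; rewrite ler_norml; lra.
have C0 : 0 <= Num.max C 0 by rewrite le_max lexx orbT.
have cont : continuous (f \o k).
  move=> x; apply/cvgrPdist_lt => e e0.
  have D0 : 0 < e / (Num.max C 0 + 1) by rewrite divr_gt0// ltr_wpDl.
  near=> y.
  have : `|x - y| < e / (Num.max C 0 + 1) by near: y; apply: cvgr_dist_lt.
  rewrite ltr_pdivlMr ?ltr_wpDl// => xy.
  apply: le_lt_trans xy; apply: (le_trans (lip _ _ (kab x) (kab y))).
  apply: (@le_trans _ _ (Num.max C 0 * `|k x - k y|)).
    by rewrite ler_wpM2r// le_max lexx.
  apply: (@le_trans _ _ (Num.max C 0 * `|x - y|)); first by rewrite ler_wpM2l.
  by rewrite mulrC ler_wpM2l// lerDl.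
have ka : k a = a by rewrite /k (min_idPl ab) maxxx.
have kb : k b = b by rewrite /k minxx (max_idPr ab).
have [||c] := @IVT _ (f \o k) a b 0 ab.
- exact: continuous_subspaceT.
- by rewrite /= ka kb ge_min fa/= le_max fb orbT.
move=> _ fc; exists (k c) => //.
Unshelve. all: end_near. Qed.

End auxiliary.

(** * Euclidean norm and matrix operator norm *)

Section euclidean.
Context {R : realType}.

Definition dot n (x y : 'cV[R]_n) : R := (x^T *m y) 0 0.

Lemma dotE n (x y : 'cV[R]_n) : dot x y = \sum_i x i 0 * y i 0.
Proof. by rewrite /dot mxE; apply: eq_bigr => i _; rewrite mxE. Qed.

Lemma dotC n (x y : 'cV[R]_n) : dot x y = dot y x.
Proof. by rewrite !dotE; apply: eq_bigr => i _; rewrite mulrC. Qed.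

Lemma dotDr n (x y z : 'cV[R]_n) : dot x (y + z) = dot x y + dot x z.
Proof. by rewrite /dot mulmxDr mxE. Qed.

Lemma dotZr n a (x y : 'cV[R]_n) : dot x (a *: y) = a * dot x y.
Proof. by rewrite /dot -scalemxAr mxE. Qed.

Lemma dotNr n (x y : 'cV[R]_n) : dot x (- y) = - dot x y.
Proof. by rewrite -scaleN1r dotZr mulN1r. Qed.

Lemma dotBr n (x y z : 'cV[R]_n) : dot x (y - z) = dot x y - dot x z.
Proof. by rewrite dotDr dotNr. Qed.

Lemma dotDl n (x y z : 'cV[R]_n) : dot (y + z) x = dot y x + dot z x.
Proof. by rewrite dotC dotDr ![dot x _]dotC. Qed.

Lemma dotZl n a (x y : 'cV[R]_n) : dot (a *: y) x = a * dot y x.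
Proof. by rewrite dotC dotZr dotC. Qed.

Lemma dotBl n (x y z : 'cV[R]_n) : dot (y - z) x = dot y x - dot z x.
Proof. by rewrite dotC dotBr ![dot x _]dotC. Qed.

Lemma dot_mulmx n (A : 'M[R]_n) (x y : 'cV[R]_n) : dot x (A *m y) = dot (A^T *m x) y.
Proof. by rewrite /dot trmx_mul trmxK mulmxA. Qed.

Lemma dot0r n (x : 'cV[R]_n) : dot x 0 = 0.
Proof. by rewrite /dot mulmx0 mxE. Qed.

Lemma dot_ge0 n (x : 'cV[R]_n) : 0 <= dot x x.
Proof. by rewrite dotE sumr_ge0// => i _; rewrite -expr2 sqr_ge0. Qed.

Lemma enormE n (x : 'cV[R]_n) : enorm x = Num.sqrt (dot x x).
Proof. by rewrite /enorm dotE; congr Num.sqrt; apply: eq_bigr => i _; rewrite expr2. Qed.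

Lemma enorm_ge0 n (x : 'cV[R]_n) : 0 <= enorm x.
Proof. exact: sqrtr_ge0. Qed.

Lemma enorm_sqr n (x : 'cV[R]_n) : enorm x ^+ 2 = dot x x.
Proof. by rewrite enormE sqr_sqrtr ?dot_ge0. Qed.

Lemma dot_le n (x y : 'cV[R]_n) : `|dot x y| <= enorm x * enorm y.
Proof.
have H : dot x y ^+ 2 <= dot x x * dot y y.
  apply: discriminant_le; first exact: dot_ge0.
  move=> t; have := dot_ge0 (x + t *: y).
  rewrite !(dotDl, dotDr, dotZl, dotZr) (dotC y x).
  by congr (0 <= _); ring.
rewrite -(@ler_pXn2r _ 2)// ?nnegrE ?mulr_ge0 ?enorm_ge0// real_normK ?num_real//.
by rewrite exprMn !enorm_sqr.
Qed.

Lemma enorm_eq0 n (x : 'cV[R]_n) : enorm x = 0 -> x = 0.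
Proof.
move=> x0; have : dot x x = 0 by rewrite -enorm_sqr x0 expr0n.
rewrite dotE => /eqP; rewrite psumr_eq0; last by move=> i _; rewrite -expr2 sqr_ge0.
move=> /allP h; apply/matrixP => i j; rewrite ord1 [RHS]mxE.
have := h i (mem_index_enum _); rewrite /= -expr2 sqrf_eq0.
by move/eqP.
Qed.

Lemma enorm0 n : enorm (0 : 'cV[R]_n) = 0.
Proof. by rewrite enormE dot0r sqrtr0. Qed.

Lemma enormZ n a (x : 'cV[R]_n) : enorm (a *: x) = `|a| * enorm x.
Proof. by rewrite !enormE dotZl dotZr mulrA -expr2 sqrtrM ?sqr_ge0// sqrtr_sqr. Qed.

Lemma enormN n (x : 'cV[R]_n) : enorm (- x) = enorm x.
Proof. by rewrite -scaleN1r enormZ normrN1 mul1r. Qed.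

Lemma enormD n (x y : 'cV[R]_n) : enorm (x + y) <= enorm x + enorm y.
Proof.
rewrite -(@ler_pXn2r _ 2)// ?nnegrE ?addr_ge0 ?enorm_ge0//.
rewrite sqrrD !enorm_sqr dotDl !dotDr (dotC y x).
have := le_trans (ler_norm _) (dot_le x y).
rewrite mulr2n; lra.
Qed.

Lemma enormB n (x y : 'cV[R]_n) : enorm (x - y) <= enorm x + enorm y.
Proof. by rewrite -(enormN y) enormD. Qed.

Lemma enorm_dual n (x : 'cV[R]_n) (d : R) : 0 <= d ->
  (forall y, `|dot x y| <= d * enorm y) -> enorm x <= d.
Proof.
move=> d0 H; have [->|x0] := eqVneq x 0; first by rewrite enorm0.
have xp : 0 < enorm x.
  rewrite lt_neqAle enorm_ge0 andbT eq_sym; apply/eqP => /enorm_eq0 /eqP.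
  by apply/negP.
have := H x; rewrite -enorm_sqr ger0_norm ?exprn_ge0 ?enorm_ge0// expr2.
by rewrite ler_pM2r.
Qed.

(** A crude constant is enough: it makes the set whose supremum is [mxopnorm] bounded above, so that
    [sup] is a genuine supremum. *)
Lemma mulmx_bounded m n (A : 'M[R]_(m, n)) : exists C, forall x, enorm (A *m x) <= C * enorm x.
Proof.
exists (\sum_i \sum_j `|A i j|) => x.
have xj j : `|x j 0| <= enorm x.
  rewrite -(@ler_pXn2r _ 2)// ?nnegrE ?enorm_ge0// real_normK ?num_real//.
  rewrite enorm_sqr dotE (bigD1 j)//= -expr2 lerDl sumr_ge0// => k _.
  by rewrite -expr2 sqr_ge0.
have l1 (y : 'cV[R]_m) : enorm y <= \sum_i `|y i 0|.
  rewrite -(@ler_pXn2r _ 2)// ?nnegrE ?enorm_ge0 ?sumr_ge0// enorm_sqr dotE.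
  rewrite expr2 mulr_suml; apply: ler_sum => i _.
  rewrite (le_trans (ler_norm _))// normrM ler_wpM2l//.
  by rewrite (bigD1 i)//= lerDl sumr_ge0.
apply: (le_trans (l1 _)); rewrite mulr_suml; apply: ler_sum => i _.
rewrite mxE (le_trans (ler_norm_sum _ _ _))// mulr_suml; apply: ler_sum => j _.
by rewrite normrM ler_wpM2l.
Qed.

Lemma mxopnorm_has_ubound n (A : 'M[R]_n) :
  has_ubound [set enorm (A *m x) | x in [set x : 'cV[R]_n | enorm x <= 1]].
Proof.
have [C HC] := mulmx_bounded A; exists (Num.max C 0) => _ [x /= x1 <-].
apply: (le_trans (HC x)); apply: (@le_trans _ _ (Num.max C 0 * enorm x)).
  by rewrite ler_wpM2r ?enorm_ge0// le_max lexx.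
by rewrite ler_piMr// le_max lexx orbT.
Qed.

Lemma enorm_mulmx n (A : 'M[R]_n) (x : 'cV[R]_n) :
  enorm (A *m x) <= mxopnorm A * enorm x.
Proof.
have [->|x0] := eqVneq x 0; first by rewrite mulmx0 enorm0 mulr0.
have xp : 0 < enorm x.
  rewrite lt_neqAle enorm_ge0 andbT eq_sym; apply/eqP => /enorm_eq0 /eqP.
  by apply/negP.
rewrite -ler_pdivrMr// mulrC -[_^-1]ger0_norm ?invr_ge0 ?enorm_ge0//.
rewrite -enormZ scalemxAr; apply: ub_le_sup; first exact: mxopnorm_has_ubound.
exists ((enorm x)^-1 *: x) => //=.
by rewrite enormZ ger0_norm ?invr_ge0 ?enorm_ge0// mulVf// gt_eqF.
Qed.

Lemma mxopnorm_ge0 n (A : 'M[R]_n) : 0 <= mxopnorm A.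
Proof.
apply: ub_le_sup; first exact: mxopnorm_has_ubound.
by exists 0 => /=; rewrite ?mulmx0 enorm0.
Qed.

Lemma unitmx_inj n (A : 'M[R]_n) : (forall x : 'cV[R]_n, A *m x = 0 -> x = 0) ->
  A \in unitmx.
Proof.
move=> inj; rewrite -unitmx_tr -row_free_unit -kermx_eq0; apply/eqP/row_matrixP => i.
rewrite row0; apply: trmx_inj; rewrite trmx0; apply: inj.
by apply: trmx_inj; rewrite trmx_mul trmxK trmx0 -row_mul mulmx_ker row0.
Qed.

End euclidean.

(** * Dimension-free perturbation of a simple eigenvalue *)

Section perturbation.
Context {R : realType}.
Variables (c B : R).
Hypotheses (c0 : 0 < c) (B1 : 1 <= B).

(* [A] behaves like an operator with simple eigenvalue [rho] and approximate
   right and left eigenvectors [u], [v], with [A - rho] bounded below by [c]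
   on the complement of [v]. *)
Record near_simple n (A : 'M[R]_n) (u v : 'cV[R]_n) (rho d : R) : Prop := {
  ns_u : enorm u <= B;
  ns_v : enorm v <= B;
  ns_gap : forall x, dot v x = 0 -> c * enorm x <= enorm (A *m x - rho *: x);
  ns_right : enorm (A *m u - rho *: u) <= d;
  ns_left : forall x, `|dot v (A *m x - rho *: x)| <= d * enorm x;
  ns_dot : `|dot v u - 1| <= d
}.

(** [d0] keeps [dot v u] between 1/2 and 3/2 and is small enough for the terms in [d0 * enorm x] to
    be absorbed by the gap [c]. [K1] then bounds [x], and [K] bounds [x] and the multiplier
    together. They depend on [c] and [B] only, not on the dimension. *)
Let d0 := Num.min (1 / 2) (c / (2 * (1 + 2 * B))).
Let K1 := 2 * (1 + 2 * B ^+ 2 + B + 1 + 2 * B * c) / c.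
Let K := 2 * K1 + 2 * B + 1.

Let d00 : 0 < d0.
Proof. rewrite lt_min; apply/andP; split; first lra. by have := B1 => ?; rewrite divr_gt0//; lra. Qed.

Let d02 : d0 <= 1 / 2. Proof. by rewrite ge_min lexx. Qed.

Let d0c : d0 * (1 + 2 * B) <= c / 2.
Proof.
have := B1 => ?; rewrite -ler_pdivlMr; last lra.
by rewrite ge_min; apply/orP; right; rewrite invfM mulrA.
Qed.

Let K10 : 0 < K1.
Proof.
have := B1; have := c0 => ? ?; rewrite /K1 divr_gt0// mulr_gt0//.
have : 0 <= B * c by rewrite mulr_ge0//; lra.
have := sqr_ge0 B; nra.
Qed.

Let K1c : c * K1 = 2 * (1 + 2 * B ^+ 2 + B + 1 + 2 * B * c).
Proof. by rewrite /K1 mulrC divfK// gt_eqF. Qed.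

(** Testing the equation against [v] isolates the multiplier [m], because [v' (A - rho)] is small
    and [v' u] is close to 1. Removing from [x] a multiple of [u] leaves a vector orthogonal to [v],
    to which the gap applies. *)
Lemma bordered_bound n (A : 'M[R]_n) u v rho d l : near_simple A u v rho d ->
  d <= d0 -> `|l - rho| <= d0 -> forall x (m : R),
  enorm x + `|m| <= K * (enorm (A *m x - l *: x + m *: u) + `|dot v x|).
Proof.
move=> [uB vB gap right left duv] dd0 ld0 x m.
set r := enorm (_ + _ *: u); set X := enorm x; set al := dot v x.
have X0 : 0 <= X := enorm_ge0 x; have r0 : 0 <= r := enorm_ge0 _.
have al0 : 0 <= `|al| by [].
have d_ge0 : 0 <= d by exact: le_trans (enorm_ge0 _) right.
pose be := dot v u.
have [be1 be2] : 1 / 2 <= be /\ be <= 3 / 2.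
  by move: duv; rewrite ler_norml -/be => /andP[? ?]; split; move: d02; lra.
have be0 : 0 < be by lra.
pose g := x - (al / be) *: u.
have vg : dot v g = 0 by rewrite dotBr dotZr -/al -/be divfK ?gt_eqF// subrr.
have ab : `|al / be| <= 2 * `|al|.
  rewrite normrM [in leRHS]mulrC ler_wpM2l// normfV (gtr0_norm be0).
  rewrite -[leRHS]invrK lef_pV2 ?posrE// ?invr_gt0//; lra.
have hm : `|m| * be <= B * r + d0 * X + d0 * `|al|.
  have e1 : m * be = dot v (A *m x - l *: x + m *: u)
      - dot v (A *m x - rho *: x) + (l - rho) * al.
    rewrite /be /al !(dotDr, dotNr, dotZr); ring.
  rewrite -(gtr0_norm be0) -normrM e1.
  apply: (le_trans (ler_normD _ _)); apply: lerD; last first.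
    by rewrite normrM ler_wpM2r.
  apply: (le_trans (ler_normB _ _)); apply: lerD.
    by apply: (le_trans (dot_le _ _)); rewrite ler_wpM2r// enorm_ge0.
  by apply: (le_trans (left x)); rewrite ler_wpM2r.
have hm2 : `|m| <= 2 * (B * r + d0 * X + d0 * `|al|).
  have : `|m| * (1 / 2) <= `|m| * be by rewrite ler_wpM2l.
  lra.
have hg : c * enorm g <= r + d0 * X + `|m| * B + 2 * `|al| * d0.
  apply: (le_trans (gap g vg)).
  have -> : A *m g - rho *: g = (A *m x - l *: x + m *: u) + (l - rho) *: x
      - m *: u - (al / be) *: (A *m u - rho *: u).
    rewrite /g mulmxBr -scalemxAr !scalerBr !scalerBl !scalerA.
    rewrite [rho * _]mulrC.
    move: (A *m x) (A *m u) => a1 a2.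
    by apply/matrixP => i j; rewrite !mxE; ring.
  apply: (le_trans (enormB _ _)); apply: lerD.
    apply: (le_trans (enormB _ _)); apply: lerD.
      apply: (le_trans (enormD _ _)); apply: lerD => //.
      by rewrite enormZ ler_wpM2r// enorm_ge0.
    by rewrite enormZ ler_wpM2l.
  rewrite enormZ; apply: ler_pM => //; first exact: enorm_ge0.
  exact: le_trans right dd0.
have hX : X <= enorm g + 2 * `|al| * B.
  have -> : X = enorm (g + (al / be) *: u) by rewrite /g subrK.
  apply: (le_trans (enormD _ _)); rewrite lerD2l enormZ; apply: ler_pM => //.
  exact: enorm_ge0.
(* The bounds [hm2], [hg] and [hX] are combined; by [d0c] the terms in [d0 * X] total at most half
   of [c * X] and are absorbed. *)
have XK : X <= K1 * (r + `|al|).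
  have cX : c * X <= c * (enorm g + 2 * `|al| * B) by rewrite ler_wpM2l// ltW.
  rewrite -(ler_pM2l c0) [leRHS]mulrA K1c.
  have := ler_wpM2r X0 d0c.
  have : `|m| * B <= 2 * (B * r + d0 * X + d0 * `|al|) * B.
    by rewrite ler_wpM2r//; move: B1; lra.
  have : d0 * `|al| <= 1 / 2 * `|al| by rewrite ler_wpM2r.
  have : d0 * `|al| * B <= 1 / 2 * `|al| * B.
    by rewrite ler_wpM2r//; [move: B1; lra|rewrite ler_wpM2r].
  have : 0 <= B ^+ 2 * `|al| by rewrite mulr_ge0// sqr_ge0.
  have : 0 <= (B * c) * r by rewrite !mulr_ge0// ?(ltW c0)//; move: B1; lra.
  have : 0 <= B * r by rewrite !mulr_ge0//; move: B1; lra.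
  nra.
have : d0 * X <= 1 / 2 * X by rewrite ler_wpM2r.
have : d0 * `|al| <= 1 / 2 * `|al| by rewrite ler_wpM2r.
have : 0 <= B * `|al| by rewrite mulr_ge0//; move: B1; lra.
rewrite /K; nra.
Qed.

(** The bordered matrix is square and [bordered_bound] makes it injective, hence invertible. *)
Lemma bordered_unit n (A : 'M[R]_n) u v rho d l : near_simple A u v rho d ->
  d <= d0 -> `|l - rho| <= d0 -> forall (y : 'cV[R]_n) (nu : R),
  exists x m, A *m x - l *: x + m *: u = y /\ dot v x = nu.
Proof.
move=> H dd0 ld0 y nu.
pose N := block_mx (A - l%:M) u v^T (0 : 'M[R]_1).
have NE (z : 'cV[R]_(n + 1)) : N *m z = col_mx
    (A *m usubmx z - l *: usubmx z + dsubmx z 0 0 *: u) (dot v (usubmx z))%:M.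
  rewrite -[z in LHS]vsubmxK mul_block_col mul0mx addr0 mulmxBl mul_scalar_mx.
  congr col_mx; last by rewrite [LHS]mx11_scalar.
  by congr (_ + _); rewrite [dsubmx z in LHS]mx11_scalar mul_mx_scalar.
have Nu : N \in unitmx.
  apply: unitmx_inj => z; rewrite NE => Nz.
  have [z1 z2] : A *m usubmx z - l *: usubmx z + dsubmx z 0 0 *: u = 0 /\
      dot v (usubmx z) = 0.
    have := congr1 usubmx Nz; have := congr1 dsubmx Nz.
    rewrite col_mxKu col_mxKd linear0 linear0 => /matrixP /(_ 0 0).
    by rewrite !mxE eqxx mulr1n => -> ->.
  have := bordered_bound H dd0 ld0 (usubmx z) (dsubmx z 0 0).
  rewrite z1 z2 enorm0 normr0 addr0 mulr0 => h.
  have h1 := enorm_ge0 (usubmx z); have h2 := normr_ge0 (dsubmx z 0 0).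
  have u0 : usubmx z = 0 by apply: enorm_eq0; lra.
  have d0' : dsubmx z 0 0 = 0 by apply/normr0_eq0; lra.
  by rewrite -[z]vsubmxK u0 [dsubmx z]mx11_scalar d0' raddf0 col_mx0.
pose z := invmx N *m col_mx y nu%:M.
have : N *m z = col_mx y nu%:M by rewrite /z mulKVmx.
rewrite NE => Nz; exists (usubmx z), (dsubmx z 0 0).
have := congr1 usubmx Nz; have := congr1 dsubmx Nz.
rewrite !col_mxKu !col_mxKd => /matrixP /(_ 0 0).
by rewrite !mxE eqxx !mulr1n.
Qed.

(** By duality: the bordered system is solved with right-hand side [z]. As [z] is orthogonal to [u],
    pairing with the solution [x] gives $|z|^2 = (A' z - l z)' x$, where [x] is at most
    [K * enorm z]. *)
Lemma left_bound n (A : 'M[R]_n) u v rho d l : near_simple A u v rho d ->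
  d <= d0 -> `|l - rho| <= d0 -> forall z, dot u z = 0 ->
  enorm z <= K * enorm (A^T *m z - l *: z).
Proof.
move=> H dd0 ld0 z uz.
have [x [m [e1 e2]]] := bordered_unit H dd0 ld0 z 0.
have := bordered_bound H dd0 ld0 x m; rewrite e1 e2 normr0 addr0 => xb.
have [->|z0] := eqVneq z 0.
  by rewrite mulmx0 scaler0 subr0 enorm0 mulr0.
have zp : 0 < enorm z.
  rewrite lt_neqAle enorm_ge0 andbT eq_sym; apply/eqP => /enorm_eq0 /eqP.
  by apply/negP.
have zz : enorm z ^+ 2 = dot (A^T *m z - l *: z) x.
  rewrite enorm_sqr -[in X in dot _ X = _]e1 dotDr dotZr (dotC z u) uz mulr0 addr0.
  by rewrite dotBr dotBl dot_mulmx dotZr dotZl.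
rewrite -(ler_pM2r zp) -expr2 zz (le_trans (ler_norm _))// (le_trans (dot_le _ _))//.
rewrite [leRHS]mulrAC mulrC ler_wpM2r ?enorm_ge0//.
by have := normr_ge0 m; lra.
Qed.

Definition gap_radius := d0.
(** Twice [K] times the bound $4K^2B$ on the eigenvector error in units of [d]. Keeping
    [perturbation_cst * d] below [gap_radius] thus makes [K * enorm (x - u)] at most 1/2, which is
    what uniqueness of the eigenvalue rests on. *)
Definition perturbation_cst := 8 * K ^+ 3 * B.

Definition gap_cst := K.

Lemma near_simple_gap n (A : 'M[R]_n) u v rho d l x : near_simple A u v rho d ->
  d <= gap_radius -> `|l - rho| <= gap_radius -> dot v x = 0 ->
  enorm x <= gap_cst * enorm (A *m x - l *: x).
Proof.
move=> H dd ll vx; have := bordered_bound H dd ll x 0.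
by rewrite normr0 scale0r !addr0 vx normr0 addr0.
Qed.

Lemma gap_cst_gt0 : 0 < gap_cst.
Proof. by rewrite /gap_cst /K; have := K10; have := B1; lra. Qed.

Lemma perturbation_cst_gt0 : 0 < perturbation_cst.
Proof.
have B0 : 0 < B by exact: lt_le_trans B1.
have K0 : 0 < K by rewrite /K; have := K10; lra.
by rewrite /perturbation_cst !mulr_gt0// exprn_gt0.
Qed.

Lemma gap_radius_gt0 : 0 < gap_radius. Proof. exact: d00. Qed.

(* The eigenvalue is the root of the multiplier [m] in the bordered system
   [(A - l) x + m u = 0], [v' x = 1], which changes sign around [rho]. *)
Lemma simple_eigenvalue_perturbation n (A : 'M[R]_n) u v rho d :
  near_simple A u v rho d -> 0 <= d -> perturbation_cst * d <= gap_radius ->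
  exists r x y, [/\ [/\ A *m x = r *: x, A^T *m y = r *: y, dot v x = 1 & dot u y = dot u v],
    [/\ `|r - rho| <= perturbation_cst * d, enorm (x - u) <= perturbation_cst * d &
       enorm (y - v) <= perturbation_cst * d],
    (forall l x', `|l - rho| <= gap_radius -> A *m x' = l *: x' -> x' != 0 ->
       l = r /\ x' = dot v x' *: x) &
    (forall y', A^T *m y' = r *: y' -> y' = (dot u y' / dot u v) *: y)].
Proof.
move=> H d_ge0 dsmall.
have B0 : 0 < B by exact: lt_le_trans B1.
have B1' := B1; have K10' := K10.
have K3 : 3 <= K by rewrite /K; lra.
have K0 : 0 < K by lra.
have K31 : 1 <= K ^+ 3 by rewrite exprn_ege1//; lra.
have K23 : K ^+ 2 <= K ^+ 3 by rewrite exprS ler_peMl ?sqr_ge0//; lra.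
have K12 : K <= K ^+ 2 by rewrite expr2 ler_peMl//; lra.
have K20 : 0 <= 2 * K by rewrite mulr_ge0// ltW.
have K40 : 0 <= 4 * K ^+ 2 * B by rewrite !mulr_ge0 ?sqr_ge0// ltW.
have K48 : 4 * K ^+ 2 * B <= 8 * K ^+ 3 * B by rewrite ler_wpM2r ?(ltW B0)//; lra.
have KKB a : K <= a -> K <= a * B.
  by move=> Ka; rewrite -[leLHS]mulr1; apply: ler_pM => //; exact: ltW.
have K28 : 2 * K <= 8 * K ^+ 3 * B by have := KKB _ (le_trans K12 K23); lra.
have le1 a : 0 <= a -> a <= 8 * K ^+ 3 * B -> a * d <= perturbation_cst * d.
  by move=> a0 ab; rewrite ler_wpM2r.
have dd0 : d <= d0.
  apply: le_trans dsmall; rewrite -{1}[d]mul1r; apply: le1 => //.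
  by rewrite /perturbation_cst; nra.
have [uB vB gap right left duv] := H.
have d02' := d02; have d00' := d00.
have be1 : 1 / 2 <= dot v u by move: duv; rewrite ler_norml => /andP[? ?]; lra.
have be0 : 0 < dot v u by lra.
(* By [mE] the multiplier times [dot v u] is within [d * K] of [l - rho], so at distance [2 * K * d]
   on either side of [rho] its sign is known. *)
pose e := 2 * K * d.
have e0 : 0 <= e by rewrite /e !mulr_ge0//; lra.
have ed0 : e <= d0.
  by apply: le_trans dsmall; exact: le1.
have /choice[xm xmP] : forall l, exists xm : 'cV[R]_n * R, `|l - rho| <= d0 ->
    A *m xm.1 - l *: xm.1 + xm.2 *: u = 0 /\ dot v xm.1 = 1.
  move=> l; have [ld|ld] := pselect (`|l - rho| <= d0); last by exists (0, 0).
  by have [x [m [h1 h2]]] := bordered_unit H dd0 ld 0 1; exists (x, m).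
have xmK l : `|l - rho| <= d0 -> enorm (xm l).1 + `|(xm l).2| <= K.
  move=> ld; have [h1 h2] := xmP l ld.
  by have := bordered_bound H dd0 ld (xm l).1 (xm l).2; rewrite h1 h2 enorm0 normr1 add0r mulr1.
have itv_d0 l : rho - e <= l <= rho + e -> `|l - rho| <= d0.
  by move=> /andP[? ?]; rewrite (le_trans _ ed0)// ler_norml; lra.
have mE l : `|l - rho| <= d0 ->
    `|(xm l).2 * dot v u - (l - rho)| <= d * K.
  move=> ld; have [h1 h2] := xmP l ld.
  have -> : (xm l).2 * dot v u - (l - rho) = - dot v (A *m (xm l).1 - rho *: (xm l).1).
    have := congr1 (dot v) h1; rewrite !(dotDr, dotNr, dotZr) dot0r h2 !mulr1; lra.
  rewrite normrN (le_trans (left _))// ler_wpM2l//.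
  by have := xmK l ld; have := normr_ge0 (xm l).2; lra.
have [r r_itv r0] : exists2 r, rho - e <= r <= rho + e & (xm r).2 = 0.
  apply: (@lipschitz_IVT _ (fun l => (xm l).2) _ _ (K * K)); first lra.
  (* The difference of the solutions at [l] and [l'] solves the bordered system at [l] with
     right-hand side [l - l'] times the solution at [l']; hence the Lipschitz constant [K * K]. *)
  - move=> l l' /itv_d0 ld /itv_d0 l'd.
    have [h1 h2] := xmP l ld; have [h1' h2'] := xmP l' l'd.
    have := bordered_bound H dd0 ld ((xm l).1 - (xm l').1) ((xm l).2 - (xm l').2).
    have -> : A *m ((xm l).1 - (xm l').1) - l *: ((xm l).1 - (xm l').1)
       + ((xm l).2 - (xm l').2) *: u = (l - l') *: (xm l').1.
      have -> : (l - l') *: (xm l').1 = (l - l') *: (xm l').1 +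
         (A *m (xm l).1 - l *: (xm l).1 + (xm l).2 *: u) -
         (A *m (xm l').1 - l' *: (xm l').1 + (xm l').2 *: u) by rewrite h1 h1' subr0 addr0.
      rewrite mulmxBr; move: (A *m _) (A *m _) => a1 a2.
      by apply/matrixP => i j; rewrite !mxE; ring.
    rewrite dotBr h2 h2' subrr normr0 addr0 enormZ => h.
    have := enorm_ge0 ((xm l).1 - (xm l').1).
    have : K * (`|l - l'| * enorm (xm l').1) <= K * (`|l - l'| * K).
      rewrite ler_pM2l// ler_wpM2l//.
      by have := xmK l' l'd; have := normr_ge0 (xm l').2; lra.
    by rewrite (_ : K * K * `|l - l'| = K * (`|l - l'| * K)); [lra|ring].
  - have := mE (rho - e) (itv_d0 _ _); rewrite lexx/= => /(_ ltac:(lra)).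
    rewrite ler_norml => /andP[_ h].
    rewrite -(pmulr_lle0 _ be0); rewrite /e in h *; nra.
  - have := mE (rho + e) (itv_d0 _ _); rewrite lexx/= => /(_ ltac:(lra)).
    rewrite ler_norml => /andP[h _].
    rewrite -(pmulr_lge0 _ be0); rewrite /e in h *; nra.
have rd := itv_d0 _ r_itv.
have [h1 h2] := xmP r rd; rewrite r0 scale0r addr0 in h1.
set x := (xm r).1 in h1 h2.
have Ax : A *m x = r *: x by apply/eqP; rewrite -subr_eq0 h1.
have xK : enorm x <= K by have := xmK r rd; rewrite r0 normr0 addr0.
have re : `|r - rho| <= e by case/andP: r_itv => ? ?; rewrite ler_norml; lra.
have Au : enorm (A *m u - r *: u) <= d + e * B.
  have -> : A *m u - r *: u = (A *m u - rho *: u) - (r - rho) *: u.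
    by rewrite scalerBl; apply/matrixP => i j; rewrite !mxE; ring.
  apply: (le_trans (enormB _ _)); rewrite lerD// enormZ; apply: ler_pM => //.
  exact: enorm_ge0.
have xu : enorm (x - u) <= K * (2 * d + e * B).
  have := bordered_bound H dd0 rd (x - u) 0.
  rewrite normr0 addr0 scale0r addr0.
  have -> : A *m (x - u) - r *: (x - u) = - (A *m u - r *: u).
    by rewrite mulmxBr Ax; apply/matrixP => i j; rewrite !mxE; ring.
  rewrite enormN dotBr h2 distrC => h; apply: (le_trans h); rewrite ler_pM2l//; lra.
have pc1 : K * (2 * d + e * B) <= 4 * K ^+ 2 * B * d.
  have -> : K * (2 * d + e * B) = (2 * K + 2 * K ^+ 2 * B) * d by rewrite /e; ring.
  by rewrite ler_wpM2r//; have := KKB _ K12; lra.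
have pc2 : 4 * K ^+ 2 * B * d <= perturbation_cst * d by exact: le1.
have uniq l x' : `|l - rho| <= d0 -> A *m x' = l *: x' -> x' != 0 ->
    l = r /\ x' = dot v x' *: x.
  move=> ld Ax' x'0.
  have vx' : dot v x' != 0.
    apply/eqP => vx0; have := bordered_bound H dd0 ld x' 0.
    rewrite Ax' subrr scale0r addr0 enorm0 vx0 !normr0 !addr0 mulr0 => h.
    by move/eqP : x'0; apply; apply/enorm_eq0/eqP; rewrite eq_le h enorm_ge0.
  pose w := (dot v x')^-1 *: x'.
  have Aw : A *m w = l *: w by rewrite /w -scalemxAr Ax' !scalerA mulrC.
  have vw : dot v w = 1 by rewrite /w dotZr mulVf.
  (* The difference of the two normalized eigenvectors solves the bordered system with multiplier
     [l - r] and right-hand side [(r - l) *: (x - u)]. As [K * enorm (x - u)] is at most 1/2, this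
     forces [l = r] and [x = w]. *)
  have := bordered_bound H dd0 ld (x - w) (l - r).
  have -> : A *m (x - w) - l *: (x - w) + (l - r) *: u = (r - l) *: (x - u).
    by rewrite mulmxBr Ax Aw; apply/matrixP => i j; rewrite !mxE; ring.
  rewrite dotBr h2 vw subrr normr0 addr0 enormZ => h.
  have xu1 : K * enorm (x - u) <= 1 / 2.
    have : K * enorm (x - u) <= K * (4 * K ^+ 2 * B * d).
      by rewrite ler_pM2l// (le_trans xu).
    have -> : K * (4 * K ^+ 2 * B * d) = (perturbation_cst * d) / 2.
      by rewrite /perturbation_cst; field.
    by move: dsmall; rewrite /gap_radius; lra.
  have hh : K * (`|r - l| * enorm (x - u)) <= `|r - l| * (1 / 2).
    by rewrite mulrCA ler_wpM2l.
  have n1 := enorm_ge0 (x - w); have n2 := normr_ge0 (r - l).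
  rewrite (distrC l r) in h.
  have /eqP : `|r - l| = 0 by lra.
  rewrite normr_eq0 subr_eq0 => /eqP rl; split => //.
  have : enorm (x - w) = 0 by rewrite rl subrr normr0 in h; lra.
  by move=> /enorm_eq0 /eqP; rewrite subr_eq0 => /eqP ->; rewrite /w scalerA mulfV ?scale1r.
have x0 : x != 0.
  by apply/eqP => x0; move: h2; rewrite x0 dot0r => /esym/eqP; rewrite oner_eq0.
(* A matrix and its transpose have the same determinant, so [r] is also an eigenvalue of the
   transpose. *)
have [y0 y0n Ay0] : exists2 y : 'cV[R]_n, y != 0 & A^T *m y = r *: y.
  have /det0P[q qn qA] : \det (A - r%:M) == 0.
    rewrite -det_tr; apply/det0P; exists x^T; first by rewrite trmx_eq0.
    by rewrite -trmx_mul mulmxBl Ax mul_scalar_mx subrr trmx0.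
  exists q^T; first by rewrite trmx_eq0.
  apply/eqP; rewrite -subr_eq0 -trmx_mul -linearZ/= -linearB/=.
  by rewrite -[r *: q]mul_mx_scalar -mulmxBr qA trmx0.
have uy0 : dot u y0 != 0.
  apply/eqP => uy; have := left_bound H dd0 rd uy.
  rewrite Ay0 subrr enorm0 mulr0 => h.
  by move/eqP : y0n; apply; apply/enorm_eq0/eqP; rewrite eq_le h enorm_ge0.
(* This scaling makes [y - v] orthogonal to [u], as [left_bound] requires. *)
pose y := (dot u v / dot u y0) *: y0.
have Ay : A^T *m y = r *: y by rewrite /y -scalemxAr Ay0 !scalerA mulrC.
have uy : dot u y = dot u v by rewrite /y dotZr divfK.
exists r, x, y; split => //.
- split.
  + by apply: (le_trans re); exact: le1.
  + exact: (le_trans xu (le_trans pc1 pc2)).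
  + have uz : dot u (y - v) = 0 by rewrite dotBr uy subrr.
    apply: (le_trans (left_bound H dd0 rd uz)).
    apply: le_trans (le_trans pc1 pc2).
    rewrite ler_pM2l// mulmxBr Ay.
    have -> : r *: y - A^T *m v - r *: (y - v) =
        - (A^T *m v - rho *: v) + (r - rho) *: v.
      by apply/matrixP => i j; rewrite !mxE; ring.
    apply: (le_trans (enormD _ _)); rewrite enormN enormZ.
    have : enorm (A^T *m v - rho *: v) <= d.
      apply: enorm_dual => // q.
      have -> : dot (A^T *m v - rho *: v) q = dot v (A *m q - rho *: q).
        by rewrite dotBl dotBr dot_mulmx dotZl dotZr.
      exact: left.
    have : `|r - rho| * enorm v <= e * B by apply: ler_pM => //; exact: enorm_ge0.
    by move=> h3 h4; apply: le_trans (lerD h4 h3) _; rewrite lerD2r ler_peMl// ler1n.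
- move=> y' Ay'; pose z := y' - (dot u y' / dot u v) *: y.
  have uv0 : dot u v != 0 by rewrite dotC gt_eqF.
  have uz : dot u z = 0 by rewrite dotBr dotZr uy divfK// subrr.
  have Az : A^T *m z = r *: z.
    by rewrite /z mulmxBr -scalemxAr Ay Ay' scalerBr !scalerA [r * _]mulrC.
  have := left_bound H dd0 rd uz; rewrite Az subrr enorm0 mulr0 => h.
  have /eqP : z = 0 by apply/enorm_eq0/eqP; rewrite eq_le h enorm_ge0.
  by rewrite subr_eq0 => /eqP.
Qed.

End perturbation.

(** Newton's scheme: a new node is served by a multiple of the product vanishing at the earlier
    ones. It turns a function of the eigenvalues into a polynomial in the matrix. *)
Lemma interpolation (F : fieldType) (s : seq F) (g : F -> F) :
  exists p : {poly F}, forall x, x \in s -> p.[x] = g x.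
Proof.
elim: s => [|a s [p ps]]; first by exists 0.
have [as_|as_] := boolP (a \in s).
  by exists p => x; rewrite in_cons => /orP[/eqP->|]; exact: ps.
pose q := \prod_(z <- s) ('X - z%:P).
have qa : q.[a] != 0 by rewrite -[_ == 0]/(root q a) root_prod_XsubC.
exists (p + ((g a - p.[a]) / q.[a])%:P * q) => x.
rewrite in_cons hornerD hornerM hornerC => /orP[/eqP->|xs].
  by rewrite divfK// addrC subrK.
by rewrite (ps _ xs) (rootP _ : q.[x] = 0) ?mulr0 ?addr0// root_prod_XsubC.
Qed.

(** * Square root of a positive semidefinite matrix *)

Section matrix_square_root.
Import complex sesquilinear spectral.
Context {R : realType}.
Local Notation f := (real_complex R).

Lemma horner_mx_sym n (H : 'M[R]_n.+1) (p : {poly R}) :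
  H^T = H -> (horner_mx H p)^T = horner_mx H p.
Proof.
move=> Hs; elim/poly_ind: p => [|p c IH]; first by rewrite rmorph0 trmx0.
rewrite rmorphD rmorphM /= horner_mx_X horner_mx_C linearD /= tr_scalar_mx.
by rewrite trmx_mul IH Hs -[H *m _]/(H * _) -[X in X * horner_mx _ _]horner_mx_X
  -rmorphM/= mulrC rmorphM /= horner_mx_X.
Qed.

Lemma psdmx_eigen_ge0 n (H : 'M[R]_n) (d : R) :
  psdmx H -> mxalgebra.eigenvalue H d -> 0 <= d.
Proof.
move=> [Hs Hp] /eigenvalueP[v vH v0].
have := Hp v^T; rewrite trmxK vH -scalemxAl mxE.
have -> : (v *m v^T) 0 0 = enorm v^T ^+ 2.
  by rewrite enorm_sqr dotE mxE; apply: eq_bigr => i _; rewrite !mxE.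
rewrite pmulr_lge0// exprn_gt0// lt_def enorm_ge0 andbT.
by apply: contra_neq v0 => /enorm_eq0 /(congr1 trmx); rewrite trmxK trmx0.
Qed.

(** Over the complex numbers the matrix is normal, hence diagonalizable by the spectral theorem, so
    a polynomial in it depends only on its values at the eigenvalues. These are real and
    nonnegative, and real polynomials in [H] can be compared after the injection into complex
    matrices. *)
Lemma psdmx_polynomial_calculus n (H : 'M[R]_n.+1) : psdmx H ->
  exists (d : 'I_n.+1 -> R), (forall j, 0 <= d j) /\
   (forall p q : {poly R}, (forall j, p.[d j] = q.[d j]) ->
     horner_mx H p = horner_mx H q).
Proof.
move=> psdH; have [Hs Hp] := psdH.
pose Hc := map_mx f H.
have Hcs : Hc \is symmetricmx.
  apply/is_hermitianmxP; rewrite expr0 scale1r map_mx_id//.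
  by apply/matrixP => i j; rewrite !mxE -{1}Hs mxE.
have Hcr : Hc \is a realmx.
  by apply/mxOverP => i j; rewrite mxE complex_real.
have := hermitian_normalmx (realsym_hermsym Hcs Hcr) => /orthomx_spectralP.
have := hermitian_spectral_diag_real (realsym_hermsym Hcs Hcr).
have := spectral_unit Hc.
move: (spectralmx Hc) (spectral_diag Hc) => Q sp Qu spr HcE.
pose d j := complex.Re (sp 0 j).
have spE j : sp 0 j = f (d j).
  by rewrite /d RRe_real//; move/mxOverP: spr; apply.
have QE j : row j Q *m Hc = f (d j) *: row j Q.
  rewrite -row_mul HcE !mulmxA mulmxV// mul1mx row_mul row_diag_mx -scalemxAl.
  by rewrite -rowE spE.
exists d; split => [j|p q pq].
  apply: (psdmx_eigen_ge0 psdH).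
  rewrite eigenvalue_root_char -(fmorph_root f) map_char_poly.
  rewrite -eigenvalue_root_char; apply/eigenvalueP; exists (row j Q) => //.
  apply/eqP => rQ; have := Qu; rewrite -row_free_unit -kermx_eq0 => /eqP kQ.
  have /sub_kermxP : row j (1%:M : 'M[R[i]]_n.+1) *m Q = 0 by rewrite -row_mul mul1mx.
  by rewrite kQ submx0 => /eqP /rowP/(_ j) /eqP; rewrite !mxE eqxx oner_eq0.
apply: (@map_mx_inj _ _ f); rewrite !map_horner_mx -/Hc HcE.
have QU : Q \is a GRing.unit := Qu.
rewrite (horner_mx_uconjC (map_poly f p) (diag_mx sp) QU).
rewrite (horner_mx_uconjC (map_poly f q) (diag_mx sp) QU).
rewrite (horner_mx_diag sp (map_poly f p)).
rewrite (horner_mx_diag sp (map_poly f q)).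
congr (_ *m diag_mx _ *m _).
apply/rowP => j; rewrite !mxE spE.
by rewrite !horner_map pq.
Qed.

Lemma psdmx_sqrt n (H : 'M[R]_n) : psdmx H -> exists S, psdmx S /\ S *m S = H.
Proof.
case: n H => [|n] H psdH.
  by exists 0; rewrite mulmx0 [H]flatmx0; split=> //; split=> [|x];
    rewrite ?trmx0// mulmx0 mul0mx mxE.
have [d [d0 dE]] := psdmx_polynomial_calculus psdH.
have [p pE] := interpolation [seq d j | j : 'I_n.+1] Num.sqrt.
(* The fourth root [q] writes [horner_mx H p] as the square of a symmetric matrix, which makes it
   positive semidefinite. *)
have [q qE] := interpolation [seq d j | j : 'I_n.+1] (Num.sqrt \o Num.sqrt).
have dmem j : d j \in [seq d j | j : 'I_n.+1] by apply/mapP; exists j; rewrite ?mem_enum.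
have Sq : horner_mx H p = horner_mx H q *m horner_mx H q.
  rewrite -[_ *m _]/(_ * _) -rmorphM; apply: dE => j.
  by rewrite hornerM pE// qE//= -expr2 sqr_sqrtr// sqrtr_ge0.
have qs := horner_mx_sym q psdH.1.
exists (horner_mx H p); split; last first.
  rewrite -[_ *m _]/(_ * _) -rmorphM -[RHS](horner_mx_X H); apply: dE => j.
  by rewrite hornerM pE// hornerX -expr2 sqr_sqrtr.
split=> [|x]; first exact: horner_mx_sym psdH.1.
rewrite Sq mulmxA -mulmxA -{1}qs -trmx_mul.
have -> : ((horner_mx H q *m x)^T *m (horner_mx H q *m x)) 0 0 = enorm (horner_mx H q *m x) ^+ 2.
  by rewrite enorm_sqr dotE mxE; apply: eq_bigr => i _; rewrite !mxE.
exact: sqr_ge0.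
Qed.

Lemma inv_sqrtmxP n (G : 'M[R]_n) : G^T = G ->
  (forall x : 'cV_n, x != 0 -> 0 < (x^T *m G *m x) 0 0) ->
  let S := inv_sqrtmx G in [/\ S^T = S, S *m S *m G = 1%:M, S \in unitmx & S *m G *m S = 1%:M].
Proof.
move=> Gs Gp S.
have Gu : G \in unitmx.
  apply: unitmx_inj => x Gx; apply: contrapT => /eqP /Gp.
  by rewrite -mulmxA Gx mulmx0 mxE ltxx.
have psdI : psdmx (invmx G).
  split=> [|x]; first by rewrite trmx_inv Gs.
  have -> : x^T *m invmx G *m x = (invmx G *m x)^T *m G *m (invmx G *m x).
    by rewrite trmx_mul trmx_inv Gs !mulmxA mulmxKV.
  have [->|/Gp/ltW//] := eqVneq (invmx G *m x) 0.
  by rewrite mulmx0 mxE.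
have [S0 S0P] := psdmx_sqrt psdI.
have [[Ss _] SS] : psdmx S /\ S *m S = invmx G.
  by rewrite /S /inv_sqrtmx; case: xgetP => [x ->|/(_ S0)].
have SSG : S *m S *m G = 1%:M by rewrite SS mulVmx.
have SGS : S *m (S *m G) = 1%:M by rewrite mulmxA.
have [Su _] := mulmx1_unit SGS.
by split => //; apply: mulmx1C.
Qed.

End matrix_square_root.

(** * The space L2 up to almost everywhere equality *)

Section L2_facts.
Context {R : realType} {dE : measure_display} {E : measurableType dE}.
Variable Q : probability E R.
Implicit Types (f g h : E -> R) (a : R).
Local Notation L2 := (L2 Q).
Local Notation norm := (L2norm Q).
Local Notation inner := (L2inner Q).

Lemma L2_measurable f : L2 f -> measurable_fun [set: E] f.
Proof. by rewrite /Defs.L2 inE => /andP[]; rewrite inE. Qed.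

Lemma L2_integrable_sqr f : L2 f -> Q.-integrable [set: E] (EFin \o (fun x => f x ^+ 2)).
Proof. exact: Lfun2_integrable_sqr. Qed.

Lemma Lnorm2E f : Q.-integrable [set: E] (EFin \o (fun x => f x ^+ 2)) ->
  ('N[Q]_2%:E[EFin \o f] = (Num.sqrt (\int[Q]_x (f x ^+ 2)))%:E)%E.
Proof.
move=> fi; rewrite unlock /=.
rewrite (eq_integral (fun x => (f x ^+ 2)%:E)); last first.
  by move=> x _; rewrite /= -(real_normK (num_real (f x))) powR_mulrn.
by rewrite (integral_EFin fi) poweR_EFin powR12_sqrt// Rintegral_ge0// => x _; exact: sqr_ge0.
Qed.

Lemma L2_intro f : measurable_fun [set: E] f ->
  Q.-integrable [set: E] (EFin \o (fun x => f x ^+ 2)) -> L2 f.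
Proof.
move=> mf fi; rewrite /Defs.L2 inE; apply/andP; split; rewrite inE//=.
by rewrite /finite_norm (Lnorm2E fi) ltry.
Qed.

Lemma L2_Lnorm f : L2 f -> ('N[Q]_2%:E[EFin \o f] = (norm f)%:E)%E.
Proof. by move=> /L2_integrable_sqr fi; rewrite /L2norm (Lnorm2E fi). Qed.

Lemma L2normE f : L2 f -> norm f = Num.sqrt (inner f f).
Proof.
move=> /L2_integrable_sqr fi; rewrite /L2norm (Lnorm2E fi) /= /L2inner.
by under eq_Rintegral do rewrite expr2.
Qed.

Lemma L2norm_ge0 f : 0 <= norm f.
Proof. by apply: fine_ge0; exact: Lnorm_ge0. Qed.

Lemma inner_ge0 f : 0 <= inner f f.
Proof. by apply: Rintegral_ge0 => x _; rewrite -expr2 sqr_ge0. Qed.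

Lemma L2norm_sqr f : L2 f -> norm f ^+ 2 = inner f f.
Proof. by move=> /L2normE ->; rewrite sqr_sqrtr// inner_ge0. Qed.

Lemma L2_mul_integrable f g : L2 f -> L2 g ->
  Q.-integrable [set: E] (EFin \o (fun x => f x * g x)).
Proof. by move=> f2 g2; apply/Lfun1_integrable; exact: Lfun2_mul_Lfun1. Qed.

Lemma L2D f g : L2 f -> L2 g -> L2 (fun x => f x + g x).
Proof.
move=> f2 g2; apply: L2_intro.
  by apply: measurable_funD; exact: L2_measurable.
have -> : EFin \o (fun x => (f x + g x) ^+ 2) =
    EFin \o (fun x => (f x ^+ 2 + 2 * (f x * g x)) + g x ^+ 2).
  by apply/funext => x /=; congr EFin; ring.
apply: integrable_EFinD; last exact: L2_integrable_sqr.
apply: integrable_EFinD; first exact: L2_integrable_sqr.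
by apply: integrable_EFinZl; exact: L2_mul_integrable.
Qed.

Lemma L2Z a f : L2 f -> L2 (fun x => a * f x).
Proof.
move=> f2; apply: L2_intro; first by apply: measurable_funM => //; exact: L2_measurable.
have -> : EFin \o (fun x => (a * f x) ^+ 2) = EFin \o (fun x => a ^+ 2 * f x ^+ 2).
  by apply/funext => x /=; congr EFin; ring.
by apply: integrable_EFinZl; exact: L2_integrable_sqr.
Qed.

Lemma L2B f g : L2 f -> L2 g -> L2 (fun x => f x - g x).
Proof.
move=> f2 g2; have := L2D f2 (L2Z (-1) g2); congr L2.
by apply/funext => x; rewrite mulN1r.
Qed.

Lemma L2_bounded f C : measurable_fun [set: E] f -> (forall x, `|f x| <= C) -> L2 f.
Proof.
move=> mf fC; apply: L2_intro => //; apply: (@bounded_integrable _ _ _ _ _ (C ^+ 2)).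
  exact: measurable_funX.
move=> x; rewrite normrX ler_sqr ?nnegrE ?normr_ge0//.
exact: le_trans (normr_ge0 _) (fC x).
Qed.

Lemma L20 : L2 (fun=> 0).
Proof. by apply: (@L2_bounded _ 0) => // x; rewrite normr0. Qed.

Lemma L2_lincomb k (b : 'I_k -> E -> R) c : (forall i, L2 (b i)) -> L2 (lincomb b c).
Proof.
move=> b2; rewrite /lincomb; elim: (index_enum _) => [|i r IH].
  by under eq_fun do rewrite big_nil; exact: L20.
by under eq_fun do rewrite big_cons; apply: L2D => //; exact: L2Z.
Qed.

Lemma innerC f g : inner f g = inner g f.
Proof. by rewrite /L2inner; under eq_Rintegral do rewrite mulrC. Qed.

Lemma innerDl f g h : L2 f -> L2 g -> L2 h ->
  inner (fun x => f x + g x) h = inner f h + inner g h.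
Proof.
move=> f2 g2 h2; rewrite /L2inner; under eq_Rintegral do rewrite mulrDl.
by rewrite RintegralD//; exact: L2_mul_integrable.
Qed.

Lemma innerZl a f h : L2 f -> L2 h -> inner (fun x => a * f x) h = a * inner f h.
Proof.
move=> f2 h2; rewrite /L2inner; under eq_Rintegral do rewrite -mulrA.
by rewrite RintegralZl//; exact: L2_mul_integrable.
Qed.

Lemma innerBl f g h : L2 f -> L2 g -> L2 h ->
  inner (fun x => f x - g x) h = inner f h - inner g h.
Proof.
move=> f2 g2 h2; rewrite /L2inner; under eq_Rintegral do rewrite mulrBl.
by rewrite RintegralB//; exact: L2_mul_integrable.
Qed.

Lemma innerDr f g h : L2 f -> L2 g -> L2 h ->
  inner h (fun x => f x + g x) = inner h f + inner h g.
Proof. by move=> *; rewrite innerC innerDl// !(innerC h). Qed.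

Lemma innerZr a f h : L2 f -> L2 h -> inner h (fun x => a * f x) = a * inner h f.
Proof. by move=> *; rewrite innerC innerZl// !(innerC h). Qed.

Lemma innerBr f g h : L2 f -> L2 g -> L2 h ->
  inner h (fun x => f x - g x) = inner h f - inner h g.
Proof. by move=> *; rewrite innerC innerBl// !(innerC h). Qed.

Lemma inner_lincombl k (b : 'I_k -> E -> R) c h : (forall i, L2 (b i)) -> L2 h ->
  inner (lincomb b c) h = \sum_i c i 0 * inner (b i) h.
Proof.
move=> b2 h2; rewrite /L2inner /lincomb.
under eq_Rintegral do rewrite mulr_suml.
rewrite Rintegral_sum => [|i]; last by apply: L2_mul_integrable => //; exact: L2Z.
by apply: eq_bigr => i _; rewrite -innerZl.
Qed.

Lemma inner_le f g : L2 f -> L2 g -> `|inner f g| <= norm f * norm g.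
Proof.
move=> f2 g2; rewrite !L2normE// -sqrtrM ?inner_ge0// -sqrtr_sqr ler_wsqrtr//.
apply: discriminant_le => [|t]; first exact: inner_ge0.
have tg := L2Z t g2.
have := inner_ge0 (fun x => f x + t * g x).
rewrite innerDl ?innerDr ?innerZl ?innerZr ?(innerC g)//; last exact: L2D.
by congr (_ <= _); ring.
Qed.

Lemma L2normZ a f : L2 f -> norm (fun x => a * f x) = `|a| * norm f.
Proof.
move=> f2; have af := L2Z a f2; rewrite !L2normE// innerZl// innerZr// mulrA -expr2.
by rewrite sqrtrM ?sqr_ge0// sqrtr_sqr.
Qed.

Lemma L2normN f : L2 f -> norm (fun x => - f x) = norm f.
Proof.
move=> f2; rewrite -[RHS]mul1r -normr1 -normrN -L2normZ//.
by congr norm; apply/funext => x; rewrite mulN1r.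
Qed.

Lemma L2norm_cst1 : norm (fun=> 1) = 1.
Proof.
rewrite L2normE; last by apply: (@L2_bounded _ 1) => // x; rewrite normr1.
by rewrite /L2inner Rintegral_prob_cst mulr1 sqrtr1.
Qed.

Lemma L2normD_le f g : L2 f -> L2 g -> norm (fun x => f x + g x) <= norm f + norm g.
Proof.
move=> f2 g2; have fg := L2D f2 g2.
rewrite -ler_sqr ?nnegrE ?addr_ge0 ?L2norm_ge0// sqrrD !L2norm_sqr//.
rewrite innerDl// !innerDr// (innerC g f).
have := le_trans (ler_norm _) (inner_le f2 g2).
by move: (inner f g) (norm f * norm g) => u v uv; rewrite mulr2n; lra.
Qed.

Lemma L2normBC f g : L2 f -> L2 g ->
  norm (fun x => f x - g x) = norm (fun x => g x - f x).
Proof.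
move=> f2 g2; rewrite -[RHS]L2normN; last exact: L2B.
by congr norm; apply/funext => x; rewrite opprB.
Qed.

Lemma L2normB_le f g h : L2 f -> L2 g -> L2 h ->
  norm (fun x => f x - h x) <= norm (fun x => f x - g x) + norm (fun x => g x - h x).
Proof.
move=> f2 g2 h2; apply: le_trans (L2normD_le (L2B f2 g2) (L2B g2 h2)).
by rewrite le_eqVlt (_ : (fun x => f x - g x + (g x - h x)) = fun x => f x - h x)
  ?eqxx//; apply/funext => x; ring.
Qed.

Lemma inner_ae f g h : L2 f -> measurable_fun [set: E] g -> L2 h ->
  {ae Q, forall x, f x = g x} -> inner f h = inner g h.
Proof.
move=> f2 mg h2 fg; rewrite /L2inner /Rintegral; congr fine.
apply: ae_eq_integral => //.
- by apply/measurable_EFinP; apply: measurable_funM; exact: L2_measurable.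
- by apply/measurable_EFinP; apply: measurable_funM => //; exact: L2_measurable.
by apply: filterS fg => x /= -> _.
Qed.

Lemma L2_ae f g : L2 f -> measurable_fun [set: E] g ->
  {ae Q, forall x, f x = g x} -> L2 g.
Proof.
move=> f2 mg fg; apply: L2_intro => //.
have := L2_integrable_sqr f2 => /integrableP[_ fi]; apply/integrableP.
have mg2 : measurable_fun [set: E] (EFin \o (fun x => g x ^+ 2)).
  by apply/measurable_EFinP; exact: measurable_funX.
split=> //; apply: le_lt_trans fi; rewrite le_eqVlt; apply/orP; left; apply/eqP.
apply: ae_eq_integral => //; do ?exact: measurableT_comp.
  apply: measurableT_comp => //; apply/measurable_EFinP; apply: measurable_funX.
  exact: L2_measurable.
by apply: filterS fg => x /= -> _.
Qed.

Lemma L2norm_ae f g : L2 f -> measurable_fun [set: E] g ->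
  {ae Q, forall x, f x = g x} -> norm f = norm g.
Proof.
move=> f2 mg fg; have g2 := L2_ae f2 mg fg; rewrite !L2normE//; congr Num.sqrt.
by rewrite (inner_ae f2 mg f2 fg) innerC (inner_ae f2 mg g2 fg).
Qed.

Lemma L2norm_eq0 f : L2 f -> norm f = 0 -> {ae Q, forall x, f x = 0}.
Proof.
move=> f2 f0; have /Lnorm_eq0_eq0 : ('N[Q]_2%:E[EFin \o f])%E = 0%E by rewrite L2_Lnorm// f0.
move=> H; have {}H : (EFin \o f = \0 %[ae Q])%E.
  by apply: H => //; apply/measurable_EFinP; exact: L2_measurable.
by apply: filterS H => x /(_ I) [].
Qed.

Lemma L2norm_eq0_ae f : L2 f -> {ae Q, forall x, f x = 0} -> norm f = 0.
Proof.
move=> f2 f0; rewrite (L2norm_ae f2 _ f0)// L2normE; last exact: L20.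
by rewrite /L2inner Rintegral_prob_cst mulr0 sqrtr0.
Qed.

Lemma L2_abs f : L2 f -> L2 (fun x => `|f x|).
Proof.
move=> f2; apply: L2_intro; first by apply: measurableT_comp => //; exact: L2_measurable.
by under eq_fun do rewrite /= real_normK ?num_real//; exact: L2_integrable_sqr.
Qed.

Lemma L2_integrable f : L2 f -> Q.-integrable [set: E] (EFin \o f).
Proof.
move=> f2; have o2 : L2 (fun=> 1) by apply: (@L2_bounded _ 1) => // x; rewrite normr1.
by have := L2_mul_integrable f2 o2; under eq_fun do rewrite /= mulr1.
Qed.

Lemma L1_le_L2norm f : L2 f -> \int[Q]_x `|f x| <= norm f.
Proof.
move=> f2; have af := L2_abs f2.
have o2 : L2 (fun=> 1) by apply: (@L2_bounded _ 1) => // x; rewrite normr1.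
have -> : norm f = norm (fun x => `|f x|).
  rewrite !L2normE//; congr Num.sqrt; apply: eq_Rintegral => x _.
  by rewrite -!expr2 real_normK ?num_real.
rewrite -[leRHS]mulr1 -L2norm_cst1; apply: le_trans (inner_le af o2).
by apply: le_trans (ler_norm _); rewrite /L2inner; under [leRHS]eq_Rintegral do rewrite mulr1.
Qed.

(** Riesz-Fischer for geometric increments: their absolute sum has finite mean, because L1 norms are
    below L2 norms, and so is finite almost everywhere. Fatou's lemma turns the pointwise limit into
    a limit in norm with a rate. *)
Lemma L2_complete (f : nat -> E -> R) : (forall n, L2 (f n)) ->
  (forall n, norm (fun x => f n.+1 x - f n x) <= ((2 ^ n.+1)%:R)^-1) ->
  exists g, L2 g /\ forall n, norm (fun x => f n x - g x) <= ((2 ^ n)%:R)^-1.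
Proof.
move=> f2 fc.
have df n : L2 (fun x => f n.+1 x - f n x) by exact: L2B.
have mf n := L2_measurable (f2 n).
(* The bound is kept as a difference so that the induction on [j] closes. *)
have fnj n j : norm (fun x => f n x - f (n + j)%N x) <= ((2 ^ n)%:R)^-1 - ((2 ^ (n + j))%:R)^-1.
  elim: j => [|j IH].
    rewrite addn0 subrr L2norm_eq0_ae//; first exact: L2B.
    by apply: nearW => x; rewrite subrr.
  rewrite addnS; apply: le_trans (L2normB_le (f2 n) (f2 (n + j)%N) (f2 (n + j).+1)) _.
  rewrite (L2normBC (f2 (n + j)%N))//.
  have := fc (n + j)%N; rewrite expnS natrM invfM.
  by move: IH; set a := (_^-1); set b := (_^-1); set c := norm _; set e := norm _; lra.
pose D x := (\sum_(0 <= n <oo) `|f n.+1 x - f n x|%:E)%E.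
have mD : measurable_fun [set: E] D.
  apply: ge0_emeasurable_sum => // n _; apply/measurable_EFinP.
  by apply: measurableT_comp => //; exact: L2_measurable (df n).
have D0 x : (0 <= D x)%E by apply: nneseries_ge0 => n _ _; rewrite lee_fin.
have Dint : Q.-integrable [set: E] D.
  apply/integrableP; split => //.
  under eq_integral do rewrite gee0_abs//.
  rewrite integral_nneseries//; last first.
    move=> n; apply/measurable_EFinP.
    by apply: measurableT_comp => //; exact: L2_measurable (df n).
  apply: (@le_lt_trans _ _ 1%E); last exact: ltry.
  apply: le_trans (@epsilon_trick0 R 1 xpredT ler01).
  apply: lee_nneseries => [n _ _|n _]; first exact: integral_ge0.
  have Li : Q.-integrable [set: E] (EFin \o (fun x => `|f n.+1 x - f n x|)).
    by apply: L2_integrable; exact: L2_abs.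
  rewrite (integral_EFin Li) lee_fin mul1r; exact: le_trans (L1_le_L2norm (df n)) (fc n).
pose A := [set x | D x \is a fin_num].
have mA : measurable A by rewrite -[A]setTI; exact: emeasurable_fin_num.
have QA : {ae Q, forall x, A x}.
  by apply: filterS (integrable_ae measurableT Dint) => x /(_ I).
(* Setting the functions to zero off [A] makes them converge everywhere, which gives a measurable
   limit. *)
pose f' n x := f n x * \1_A x.
have mf' n : measurable_fun [set: E] (f' n) by apply: measurable_funM.
have ff' n : {ae Q, forall x, f n x = f' n x}.
  by apply: filterS QA => x Ax; rewrite /f' indicE mem_set// mulr1.
have f'2 n : L2 (f' n) by exact: L2_ae (ff' n).
have cf' x : cvgn (f' ^~ x).
  have [Ax|Ax] := pselect (A x); last first.
    rewrite (_ : f' ^~ x = fun=> 0); first exact: is_cvg_cst.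
    by apply/funext => n; rewrite /f' indicE memNset// mulr0.
  have : cvgn (series (fun n => f n.+1 x - f n x)).
    apply: normed_cvg; apply: nnseries_is_cvg => [i|]; first exact: normr_ge0.
    by move: Ax; rewrite /A /= ge0_fin_numE.
  move=> cs; rewrite (_ : f' ^~ x = fun n => f 0 x + series (fun n => f n.+1 x - f n x) n).
    by apply: is_cvgD => //; exact: is_cvg_cst.
  apply/funext => n; rewrite /f' indicE mem_set// mulr1 /series /=.
  by rewrite telescope_sumr// addrC subrK.
pose g x := limn (f' ^~ x).
have mg : measurable_fun [set: E] g.
  by apply: (measurable_fun_cvg mf') => x _; exact: cf'.
have bound n : (\int[Q]_x ((f' n x - g x) ^+ 2)%:E <= (((2 ^ n)%:R)^-1 ^+ 2)%:E)%E.
  pose u j x := ((f' n x - f' (n + j)%N x) ^+ 2)%:E.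
  have -> : (\int[Q]_x ((f' n x - g x) ^+ 2)%:E = \int[Q]_x limn_einf (u ^~ x))%E.
    apply: eq_integral => x _; apply/esym; apply: (fun H => (cvg_limn_einf_sup H).1).
    apply: cvg_EFin; first by apply: nearW.
    rewrite (_ : fine \o _ = fun j => (f' n x - f' (n + j)%N x) * (f' n x - f' (n + j)%N x)).
      2: by apply/funext => j; rewrite /u /= expr2.
    rewrite expr2.
    have cc : f' n x - f' (n + j)%N x @[j --> \oo] --> f' n x - g x.
      apply: cvgB; first exact: cvg_cst.
      have c : f' n' x @[n' --> \oo] --> g x by exact: cf'.
      move: c; rewrite -(cvg_shiftn n); apply: cvg_trans; apply: near_eq_cvg.
      by apply: nearW => j; rewrite /= addnC.
    exact: cvgM.
  apply: le_trans.
    apply: fatou => // [j|j x _]; last by rewrite lee_fin sqr_ge0.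
    by apply/measurable_EFinP; apply: measurable_funX; apply: measurable_funB.
  have uj j : (\int[Q]_x u j x <= (((2 ^ n)%:R)^-1 ^+ 2)%:E)%E.
    have h2 := L2B (f'2 n) (f'2 (n + j)%N).
    rewrite (integral_EFin (L2_integrable_sqr h2)) lee_fin.
    under eq_Rintegral do rewrite expr2.
    rewrite -[X in X <= _]/(inner _ _) -L2norm_sqr// ler_sqr ?nnegrE ?L2norm_ge0//.
    have <- : norm (fun x => f n x - f (n + j)%N x) = norm (fun x => f' n x - f' (n + j)%N x).
      apply: L2norm_ae; [exact: L2B|exact: L2_measurable|].
      by apply: filterS2 (ff' n) (ff' (n + j)%N) => x -> ->.
    by apply: le_trans (fnj n j) _; rewrite gerBl invr_ge0.
  rewrite limn_einf_lim; apply: lime_le; first exact: is_cvg_einfs.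
  apply: nearW => j; apply: le_trans (uj j); apply: ereal_inf_lbound.
  by exists j => //=.
have mh n : measurable_fun [set: E] (fun x => f' n x - g x) by exact: measurable_funB.
have h2 n : L2 (fun x => f' n x - g x).
  apply: L2_intro => //; apply/integrableP; split.
    by apply/measurable_EFinP; exact: measurable_funX.
  under eq_integral do rewrite /= ger0_norm ?sqr_ge0//.
  by apply: le_lt_trans (bound n) _; rewrite ltry.
have g2 : L2 g.
  have := L2B (f'2 0) (h2 0); congr L2; apply/funext => x; ring.
exists g; split=> // n.
rewrite (@L2norm_ae _ (fun x => f' n x - g x)) //; last 2 first.
- exact: L2B.
- by apply: filterS (ff' n) => x ->.
rewrite -ler_sqr ?nnegrE ?L2norm_ge0// L2norm_sqr// -lee_fin; apply: le_trans (bound n).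
rewrite (integral_EFin (L2_integrable_sqr (h2 n))) lee_fin.
by under [leRHS]eq_Rintegral do rewrite expr2.
Qed.

End L2_facts.

(** * Conditional means given a random variable *)

Section conditional_mean.
Context {R : realType} {dO dE : measure_display}.
Context {Omega : measurableType dO} {E : measurableType dE}.
Variables (P : probability Omega R) (W : {RV P >-> E}).
Implicit Types (Y : Omega -> R) (h g : E -> R).

Let mW : measurable_fun [set: Omega] W. Proof. by []. Qed.

Let mpre A : measurable A -> measurable (W @^-1` A).
Proof. by move=> mA; rewrite -[_ @^-1` _]setTI; exact: mW. Qed.

Let iS (Y : Omega -> R) B : P.-integrable [set: Omega] (EFin \o Y) -> measurable B ->
  P.-integrable B (EFin \o Y).
Proof. by move=> Yi mB; exact: (integrableS measurableT mB (@subsetT _ _) Yi). Qed.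

Local Notation Q := (distribution P W).

Lemma integrable_comp_distribution (f : E -> \bar R) :
  Q.-integrable [set: E] f -> P.-integrable [set: Omega] (f \o W).
Proof.
move=> /integrableP[mf fi]; apply/integrableP; split; first exact: measurableT_comp.
by move: fi; rewrite ge0_integral_distribution//; exact: measurableT_comp.
Qed.

(** The witness is the Radon-Nikodym derivative, with respect to the law of [W], of the image under
    [W] of the signed measure with density [Y]. *)
Lemma cond_mean_exists Y : P.-integrable [set: Omega] (EFin \o Y) ->
  exists h, is_cond_mean P Y W h.
Proof.
move=> iY.
pose nu := measure_function_pushforward__canonical__charge_Charge (induced_charge iY) mW.
have nuQ : nu `<< Q.
  apply/null_content_dominatesP => A mA QA; rewrite /nu /= /pushforward /induced_charge.
  apply: null_set_integral => //; first exact: mpre.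
  by apply: measurable_funTS; exact: measurable_int iY.
have fi := Radon_Nikodym_integrable nuQ.
have fE : EFin \o (fine \o Radon_Nikodym nu Q) = Radon_Nikodym nu Q.
  by apply/funext => x /=; rewrite fineK// Radon_Nikodym_fin_num.
have hi := integrable_comp_distribution fi.
exists (fine \o Radon_Nikodym nu Q); split => //.
- by apply: measurableT_comp => //; exact: measurable_int fi.
- by move: hi; rewrite -{1}fE.
- move=> A mA; transitivity (nu A) => //.
  rewrite (Radon_Nikodym_integral nuQ)// (integral_pushforward mW)//.
  + by apply: eq_integral => w _; rewrite -[in LHS]fE.
  + by apply: (integrableS measurableT (mpre mA) (@subsetT _ _)).
Qed.

Let integral_max0 (D : Omega -> R) B : P.-integrable [set: Omega] (EFin \o D) ->
  measurable B ->
  (\int[P]_(w in B) (D w)%:E = \int[P]_(w in B) (Num.max (D w) 0)%:E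
     - \int[P]_(w in B) (Num.max (- D w) 0)%:E)%E.
Proof.
move=> Di mB; rewrite integralE; congr (_ - _)%E; apply: eq_integral => w _.
  by rewrite funeposE EFin_max.
by rewrite funenegE EFin_max.
Qed.

(** The measures with densities $D^+$ and $D^-$ have the same image under [W], so a function of [W]
    has the same integral against both. Stated with extended values, it applies before the products
    are known to be integrable, and [cond_mean_integrable] relies on that. *)
Lemma cond_null_ge0 (D : Omega -> R) g : P.-integrable [set: Omega] (EFin \o D) ->
  (forall A, measurable A -> \int[P]_(w in W @^-1` A) (D w)%:E = 0)%E ->
  measurable_fun [set: E] g -> (forall x, 0 <= g x) ->
  (\int[P]_w (g (W w) * Num.max (D w) 0)%:E = \int[P]_w (g (W w) * Num.max (- D w) 0)%:E)%E.
Proof.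
move=> Di D0 mg g0.
have mD : measurable_fun [set: Omega] D by apply/measurable_EFinP; exact: measurable_int Di.
have mp : measurable_fun [set: Omega] (fun w => Num.max (D w) 0) by exact: measurable_maxr.
have mn : measurable_fun [set: Omega] (fun w => Num.max (- D w) 0).
  by apply: measurable_maxr => //; exact: measurableT_comp.
have p0 w : 0 <= Num.max (D w) 0 by rewrite le_max lexx orbT.
have n0 w : 0 <= Num.max (- D w) 0 by rewrite le_max lexx orbT.
have key (v : Omega -> R) (mv : measurable_fun [set: Omega] v) (v0 : forall w, 0 <= v w) :
    (\int[P]_w (g (W w) * v w)%:E = \int[pushforward (mdensity P mv v0 : {measure set _ -> \bar R}) W]_x (g x)%:E)%E.
  rewrite ge0_integral_pushforward//; last 2 first.
  - exact/measurable_EFinP.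
  - by move=> x _; rewrite lee_fin.
  rewrite preimage_setT (@ge0_integral_density _ _ _ P _ v _ mv v0)//.
  + by apply/measurable_EFinP; exact: measurableT_comp.
  + by move=> w; rewrite lee_fin.
rewrite (key _ mp p0) (key _ mn n0); apply: eq_measure_integral => A mA _.
have mWA := mpre mA.
have := D0 _ mA; rewrite (integral_max0 Di mWA) => /eqP.
have pi : P.-integrable [set: Omega] (fun w => (Num.max (D w) 0)%:E).
  have := integrable_funepos measurableT Di; congr (_.-integrable _ _).
  by apply/funext => w; rewrite funeposE EFin_max.
have ni : P.-integrable [set: Omega] (fun w => (Num.max (- D w) 0)%:E).
  have := integrable_funeneg measurableT Di; congr (_.-integrable _ _).
  by apply/funext => w; rewrite funenegE EFin_max.
have fp : (\int[P]_(w in W @^-1` A) (Num.max (D w) 0)%:E)%E \is a fin_num.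
  by apply: integrable_fin_num => //; exact: iS pi mWA.
have fn : (\int[P]_(w in W @^-1` A) (Num.max (- D w) 0)%:E)%E \is a fin_num.
  by apply: integrable_fin_num => //; exact: iS ni mWA.
by rewrite sube_eq ?add0e// => /eqP.
Qed.

Lemma cond_null (D : Omega -> R) g : P.-integrable [set: Omega] (EFin \o D) ->
  (forall A, measurable A -> \int[P]_(w in W @^-1` A) (D w)%:E = 0)%E ->
  measurable_fun [set: E] g ->
  P.-integrable [set: Omega] (EFin \o (fun w => g (W w) * D w)) ->
  \int[P]_w (g (W w) * D w) = 0.
Proof.
move=> Di D0 mg gDi.
have mgD := measurable_int _ gDi; have [/integrableP[_ gDi']] := (gDi, tt) => _.
pose gp x := Num.max (g x) 0; pose gn x := Num.max (- g x) 0.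
have mgp : measurable_fun [set: E] gp by exact: measurable_maxr.
have mgn : measurable_fun [set: E] gn by apply: measurable_maxr => //; exact: measurableT_comp.
have gp0 x : 0 <= gp x by rewrite le_max lexx orbT.
have gn0 x : 0 <= gn x by rewrite le_max lexx orbT.
have mD : measurable_fun [set: Omega] D by apply/measurable_EFinP; exact: measurable_int Di.
have mp : measurable_fun [set: Omega] (fun w => Num.max (D w) 0) by exact: measurable_maxr.
have mn : measurable_fun [set: Omega] (fun w => Num.max (- D w) 0).
  by apply: measurable_maxr => //; exact: measurableT_comp.
have dom (u : E -> R) (v : Omega -> R) : measurable_fun [set: E] u ->
    measurable_fun [set: Omega] v ->
    (forall w, `|u (W w) * v w| <= `|g (W w) * D w|) ->
    P.-integrable [set: Omega] (EFin \o (fun w => u (W w) * v w)).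
  move=> mu mv uv; apply: (le_integrable _ _ _ gDi) => //.
    by apply/measurable_EFinP; apply: measurable_funM => //; exact: measurableT_comp.
  by move=> w _; rewrite lee_fin.
have maxle (a : R) : `|Num.max a 0| <= `|a|.
  by rewrite ger0_norm ?le_max ?lexx ?orbT// ge_max ler_norm normr_ge0.
have gpg x : `|gp x| <= `|g x| by exact: maxle.
have gng x : `|gn x| <= `|g x| by rewrite -(normrN (g x)); exact: maxle.
have pD w : `|Num.max (D w) 0| <= `|D w| by exact: maxle.
have nD w : `|Num.max (- D w) 0| <= `|D w| by rewrite -(normrN (D w)); exact: maxle.
have I1 := dom gp _ mgp mp (fun w => _); have I2 := dom gp _ mgp mn (fun w => _).
have I3 := dom gn _ mgn mp (fun w => _); have I4 := dom gn _ mgn mn (fun w => _).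
have {}I1 := I1 ltac:(by move=> w; rewrite !normrM ler_pM).
have {}I2 := I2 ltac:(by move=> w; rewrite !normrM ler_pM).
have {}I3 := I3 ltac:(by move=> w; rewrite !normrM ler_pM).
have {}I4 := I4 ltac:(by move=> w; rewrite !normrM ler_pM).
have E1 := cond_null_ge0 Di D0 mgp gp0; have E2 := cond_null_ge0 Di D0 mgn gn0.
rewrite (integral_EFin I1) (integral_EFin I2) in E1.
rewrite (integral_EFin I3) (integral_EFin I4) in E2.
case: E1 => E1; case: E2 => E2.
have maxB (a : R) : a = Num.max a 0 - Num.max (- a) 0.
  by case: (leP a 0) => a0; case: (leP (- a) 0) => a1; lra.
transitivity (\int[P]_w ((gp (W w) * Num.max (D w) 0 - gp (W w) * Num.max (- D w) 0)
   - (gn (W w) * Num.max (D w) 0 - gn (W w) * Num.max (- D w) 0))).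
  by apply: eq_Rintegral => w _; rewrite [g (W w)]maxB [D w in LHS]maxB /gp /gn; ring.
rewrite RintegralB//; last 2 first.
- exact: integrable_EFinB.
- exact: integrable_EFinB.
by rewrite !RintegralB// E1 E2 !subrr.
Qed.

Lemma cond_mean_sub Y h : is_cond_mean P Y W h ->
  P.-integrable [set: Omega] (EFin \o (fun w => Y w - h (W w))) /\
  forall A, measurable A -> (\int[P]_(w in W @^-1` A) (Y w - h (W w))%:E = 0)%E.
Proof.
move=> [mh Yi hi Yh]; have Di := integrable_EFinB Yi hi; split => // A mA.
under eq_integral do rewrite EFinB.
rewrite integralB//; last 3 first.
- exact: mpre.
- exact: iS Yi (mpre mA).
- exact: iS hi (mpre mA).
rewrite Yh// subee//; apply: integrable_fin_num => //; first exact: mpre.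
exact: iS hi (mpre mA).
Qed.

Lemma cond_mean_ae Y h h' : is_cond_mean P Y W h -> is_cond_mean P Y W h' ->
  {ae Q, forall x, h x = h' x}.
Proof.
move=> [mh _ hi Yh] [mh' _ hi' Yh'].
have D g : measurable_fun [set: E] g -> P.-integrable [set: Omega] (EFin \o (g \o W)) ->
    Q.-integrable [set: E] (EFin \o g).
  by move=> mg gi; apply: (integrable_pushforward mW) => //; exact/measurable_EFinP.
have K g A : measurable_fun [set: E] g -> P.-integrable [set: Omega] (EFin \o (g \o W)) ->
    measurable A -> (\int[Q]_(x in A) (g x)%:E = \int[P]_(w in W @^-1` A) (g (W w))%:E)%E.
  move=> mg gi mA; rewrite (integral_pushforward mW)//; first exact/measurable_EFinP.
  exact: iS gi (mpre mA).
have : ae_eq Q [set: E] (EFin \o h) (EFin \o h').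
  apply: integral_ae_eq => //; [exact: D|exact/measurable_EFinP|].
  by move=> A _ mA; rewrite [LHS]K// [RHS]K// -Yh// Yh'.
by apply: filterS => x /(_ I) [].
Qed.

Lemma cond_mean_pull_out Y h g : is_cond_mean P Y W h -> measurable_fun [set: E] g ->
  P.-integrable [set: Omega] (EFin \o (fun w => g (W w) * Y w)) ->
  P.-integrable [set: Omega] (EFin \o (fun w => g (W w) * h (W w))) ->
  \int[P]_w (g (W w) * Y w) = \int[P]_w (g (W w) * h (W w)).
Proof.
move=> Yh mg gY gh; have [Di D0] := cond_mean_sub Yh.
have gD : P.-integrable [set: Omega] (EFin \o (fun w => g (W w) * (Y w - h (W w)))).
  by have := integrable_EFinB gY gh; under eq_fun do rewrite /= -mulrBr.
have := cond_null Di D0 mg gD; under eq_Rintegral do rewrite mulrBr.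
by rewrite RintegralB// => /eqP; rewrite subr_eq0 => /eqP.
Qed.

(** Since [Y] is nonnegative, the negative part of [Y - h(W)] is at most $|h(W)|$ and therefore
    integrable against [g(W)]; [cond_null_ge0] transfers this to the positive part. *)
Lemma cond_mean_integrable Y h g : is_cond_mean P Y W h -> (forall w, 0 <= Y w) ->
  measurable_fun [set: E] g ->
  P.-integrable [set: Omega] (EFin \o (fun w => g (W w) * h (W w))) ->
  P.-integrable [set: Omega] (EFin \o (fun w => g (W w) * Y w)).
Proof.
move=> Yh Y0 mg gh; have [Di D0] := cond_mean_sub Yh.
have [mh Yi hi _] := Yh.
have mY : measurable_fun [set: Omega] Y by apply/measurable_EFinP; exact: measurable_int Yi.
have mgW : measurable_fun [set: Omega] (fun w => g (W w)) by exact: measurableT_comp.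
have mag : measurable_fun [set: E] (fun x => `|g x|) by exact: measurableT_comp.
have mD : measurable_fun [set: Omega] (fun w => Y w - h (W w)).
  by apply: measurable_funB => //; exact: measurableT_comp.
have mp : measurable_fun [set: Omega] (fun w => Num.max (Y w - h (W w)) 0) by exact: measurable_maxr.
have mn : measurable_fun [set: Omega] (fun w => Num.max (- (Y w - h (W w))) 0).
  by apply: measurable_maxr => //; exact: measurableT_comp.
have E1 := cond_null_ge0 Di D0 mag (fun x => normr_ge0 (g x)).
have In : P.-integrable [set: Omega] (EFin \o (fun w => `|g (W w)| * Num.max (- (Y w - h (W w))) 0)).
  apply: (le_integrable _ _ _ gh) => //.
    by apply/measurable_EFinP; apply: measurable_funM => //; exact: measurableT_comp.
  move=> w _; rewrite lee_fin !normrM normr_id ler_wpM2l//.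
  rewrite ger0_norm ?le_max ?lexx ?orbT// ge_max normr_ge0 andbT opprB.
  by apply: le_trans (ler_norm _); rewrite gerBl.
have Ip : P.-integrable [set: Omega] (EFin \o (fun w => `|g (W w)| * Num.max (Y w - h (W w)) 0)).
  apply/integrableP; split.
    by apply/measurable_EFinP; apply: measurable_funM => //; exact: measurableT_comp.
  under eq_integral do rewrite gee0_abs ?lee_fin ?mulr_ge0 ?le_max ?lexx ?orbT//.
  by rewrite E1 (integral_EFin In) ltry.
have S := integrable_EFinD (integrable_EFinD Ip In) (integrable_norm gh).
apply: (le_integrable _ _ _ S) => //.
  by apply/measurable_EFinP; apply: measurable_funM.
move=> w _; rewrite lee_fin.
apply: le_trans (ler_norm _); rewrite /= !normrM -!mulrDr ler_wpM2l//.
have : `|Y w - h (W w)| <= Num.max (Y w - h (W w)) 0 + Num.max (- (Y w - h (W w))) 0.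
  by case: (leP (Y w - h (W w)) 0) => a0; case: (leP (- (Y w - h (W w))) 0) => a1;
    rewrite ler_norml; lra.
have := ler_normD (Y w - h (W w)) (h (W w)); rewrite subrK.
by move: (Num.max _ _) (Num.max _ _) => u v; lra.
Qed.

Lemma cond_meanP Y : P.-integrable [set: Omega] (EFin \o Y) ->
  is_cond_mean P Y W (cond_mean P Y W).
Proof.
move=> /cond_mean_exists[h hP]; rewrite /cond_mean.
by case: xgetP => [x ->//|/(_ h)].
Qed.

Lemma cond_mean_lin a Y Y' h h' : is_cond_mean P Y W h -> is_cond_mean P Y' W h' ->
  is_cond_mean P (fun w => a * Y w + Y' w) W (fun x => a * h x + h' x).
Proof.
move=> [mh Yi hi Yh] [mh' Yi' hi' Yh']; split.
- by apply: measurable_funD => //; exact: measurable_funM.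
- by apply: integrable_EFinD => //; exact: integrable_EFinZl.
- by apply: integrable_EFinD => //; exact: integrable_EFinZl.
move=> A mA; have mWA := mpre mA.
have I Z (Zi : P.-integrable [set: Omega] (EFin \o Z)) : P.-integrable (W @^-1` A) (EFin \o Z).
  exact: iS Zi mWA.
under eq_integral do rewrite EFinD EFinM.
under [RHS]eq_integral do rewrite EFinD EFinM.
rewrite !integralD//; try exact: I; try by apply: integrableZl => //; exact: I.
by rewrite !integralZl//; do ?[exact: I]; rewrite Yh// Yh'.
Qed.

End conditional_mean.

(** * Consecutive pairs have the same law at all times *)

Section stationarity.
Context {R : realType} {dO dE : measure_display}.
Context {Omega : measurableType dO} {E : measurableType dE}.
Variables (P : probability Omega R) (X : nat -> {RV P >-> E}).
Hypothesis Xs : strictly_stationary X.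
Local Notation Q := (stat_dist X).

Definition pair_rv (t : nat) (w : Omega) : E * E := (X t w, X t.+1 w).

Lemma measurable_pair_rv t : measurable_fun [set: Omega] (pair_rv t).
Proof. by apply: measurable_fun_pair. Qed.

(** Paths as a measurable type with the product sigma-algebra: its measurable sets are those of
    [path_measurable], and cylinder events are preimages under measurable coordinate maps. *)
Let paths := g_sigma_algebraType [set C : set (nat -> E) |
  exists i (A : set E), measurable A /\ C = [set x | A (x i)]].

Let measurable_coord i : measurable_fun [set: paths] (fun x : paths => (x : nat -> E) i).
Proof.
move=> _ A mA; rewrite setTI; apply: sub_gen_smallest; by exists i, A.
Qed.

Lemma pair_law t C : measurable C -> P (pair_rv t @^-1` C) = P (pair_rv 0 @^-1` C).
Proof.
move=> mC; elim: t => // t <-.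
pose B : set (nat -> E) := [set x | C (x t, x t.+1)].
have mB : path_measurable B.
  have : measurable_fun [set: paths] (fun x : paths => ((x : nat -> E) t, (x : nat -> E) t.+1)).
    by apply: measurable_fun_pair.
  by move=> /(_ measurableT _ mC); rewrite setTI.
exact: Xs mB.
Qed.

Lemma integral_pair t (h : E * E -> \bar R) : measurable_fun [set: E * E] h ->
  (\int[P]_w h (pair_rv t w) = \int[P]_w h (pair_rv 0 w))%E.
Proof.
move=> mh; have ge0 (g : E * E -> \bar R) : measurable_fun [set: E * E] g ->
    (forall z, (0 <= g z)%E) -> (\int[P]_w g (pair_rv t w) = \int[P]_w g (pair_rv 0 w))%E.
  move=> mg g0; have H u : (\int[P]_w g (pair_rv u w) =
      \int[measure_function_pushforward__canonical__measure_function_Measure P (measurable_pair_rv u)]_z g z)%E.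
    rewrite (ge0_integral_pushforward (measurable_pair_rv u))// => z _; exact: g0.
  by rewrite (H t) (H 0); apply: eq_measure_integral => A mA _; exact: pair_law.
rewrite [LHS]integralE [RHS]integralE; congr (_ - _)%E.
  have := ge0 _ (measurable_funepos mh) (fun z => funepos_ge0 h z).
  by congr (_ = _); apply: eq_integral => w _; rewrite !funeposE.
have := ge0 _ (measurable_funeneg mh) (fun z => funeneg_ge0 h z).
by congr (_ = _); apply: eq_integral => w _; rewrite !funenegE.
Qed.

Lemma integral_stat t (f : E -> \bar R) : measurable_fun [set: E] f ->
  (\int[P]_w f (X t w) = \int[Q]_x f x)%E.
Proof.
move=> mf; have H (g : E -> \bar R) : measurable_fun [set: E] g -> (forall z, (0 <= g z)%E) ->
    (\int[P]_w g (X t w) = \int[Q]_x g x)%E.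
  move=> mg g0; rewrite ge0_integral_distribution//.
  by apply: (@integral_pair t (fun z => g z.1)); exact: measurableT_comp.
rewrite [LHS]integralE [RHS]integralE; congr (_ - _)%E.
  rewrite -(H _ (measurable_funepos mf) (fun z => funepos_ge0 f z)).
  by apply: eq_integral => w _; rewrite !funeposE.
rewrite -(H _ (measurable_funeneg mf) (fun z => funeneg_ge0 f z)).
by apply: eq_integral => w _; rewrite !funenegE.
Qed.

Lemma Rintegral_stat t (f : E -> R) : measurable_fun [set: E] f ->
  \int[P]_w f (X t w) = \int[Q]_x f x.
Proof.
move=> mf; rewrite /Rintegral; congr fine.
by apply: (@integral_stat t (EFin \o f)); exact/measurable_EFinP.
Qed.

Lemma integrable_stat t (f : E -> R) : Q.-integrable [set: E] (EFin \o f) ->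
  P.-integrable [set: Omega] (fun w => (f (X t w))%:E).
Proof.
move=> /integrableP[mf fi]; apply/integrableP; split.
  by apply: (measurableT_comp mf).
have maf : measurable_fun [set: E] (fun x => `|(f x)%:E|%E) by exact: measurableT_comp.
by rewrite (integral_stat t maf).
Qed.

Lemma ae_stat t (A : set E) : {ae Q, forall x, A x} -> {ae P, forall w, A (X t w)}.
Proof.
move=> [N [mN N0 AN]]; exists (X t @^-1` N); split.
- by rewrite -[_ @^-1` _]setTI; exact: measurable_funP.
- have := @pair_law t (fst @^-1` N); rewrite /preimage /=; move=> ->//.
  by rewrite -[X in measurable X]setTI; exact: measurable_fst.
- by move=> w Aw; apply: AN.
Qed.

End stationarity.

(** * The operator as a pairing, and its left eigenfunction *)

Section markov_operator.
Context {R : realType} {dO dE : measure_display}.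
Context {Omega : measurableType dO} {E : measurableType dE}.
Variables (P : probability Omega R) (X : nat -> {RV P >-> E}).
Hypothesis Xs : strictly_stationary X.
Local Notation Q := (stat_dist X).
Variable m : E -> E -> R.
Hypothesis m_ge0 : forall w, 0 <= m (X 0 w) (X 1 w).
Hypothesis m_meas : measurable_fun [set: E * E] (fun z => m z.1 z.2).
Hypothesis m_int : forall psi, L2 Q psi ->
  P.-integrable [set: Omega] (EFin \o pair_at X (fun x y => m x y * psi y) 0).
Hypothesis T_L2 : forall psi, L2 Q psi -> L2 Q (opM X m psi).
Local Notation T := (opM X m).

Lemma opM_cond_mean psi : L2 Q psi ->
  is_cond_mean P (pair_at X (fun x y => m x y * psi y) 0) (X 0) (T psi).
Proof. by move=> psi2; apply: cond_meanP; exact: m_int. Qed.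

Lemma opM_lin a f g : L2 Q f -> L2 Q g ->
  {ae Q, forall x, T (fun y => a * f y + g y) x = a * T f x + T g x}.
Proof.
move=> f2 g2; apply: (@cond_mean_ae _ _ _ _ _ _ (X 0)
    (pair_at X (fun x y => m x y * (a * f y + g y)) 0)).
  by apply: opM_cond_mean; apply: L2D => //; exact: L2Z.
have := cond_mean_lin a (opM_cond_mean f2) (opM_cond_mean g2).
congr is_cond_mean; apply/funext => w; rewrite /pair_at; ring.
Qed.

Lemma L2_stat_integrable t f g : L2 Q f -> L2 Q g ->
  P.-integrable [set: Omega] (EFin \o (fun w => f (X t w) * g (X t w))).
Proof.
move=> f2 g2; exact: (integrable_stat Xs t (L2_mul_integrable f2 g2)).
Qed.

(** The operator applied to $|\psi|$ is square integrable, so its product with [h] is integrable;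
    [cond_mean_integrable] brings this back from the conditional mean to the product itself. *)
Lemma opM_integrable h psi : L2 Q h -> L2 Q psi ->
  P.-integrable [set: Omega] (EFin \o pair_at X (fun x y => h x * m x y * psi y) 0).
Proof.
move=> h2 psi2; have apsi2 := L2_abs psi2.
have I := @cond_mean_integrable _ _ _ _ _ P (X 0) _ _ h (opM_cond_mean apsi2).
have {}I : P.-integrable [set: Omega]
    (EFin \o (fun w => h (X 0 w) * pair_at X (fun x y => m x y * `|psi y|) 0 w)).
  apply: I; [by move=> w; exact: mulr_ge0|exact: L2_measurable h2|].
  by apply: L2_stat_integrable => //; exact: T_L2.
apply: (le_integrable _ _ _ I) => //.
  apply/measurable_EFinP; rewrite /pair_at; apply: measurable_funM.
    apply: measurable_funM; first by apply: (measurableT_comp (L2_measurable h2)).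
    exact: (measurableT_comp m_meas (measurable_pair_rv X 0)).
  by apply: (measurableT_comp (L2_measurable psi2)).
by move=> w _; rewrite lee_fin /= /pair_at !normrM normr_id mulrA.
Qed.

Lemma opM_inner h psi : L2 Q h -> L2 Q psi ->
  L2inner Q h (T psi) = pair_mean X (fun x y => h x * m x y * psi y).
Proof.
move=> h2 psi2; have T2 := T_L2 psi2.
have mh := L2_measurable h2; have mT := L2_measurable T2.
rewrite /L2inner -(Rintegral_stat Xs 0); last exact: measurable_funM.
rewrite -(cond_mean_pull_out (opM_cond_mean psi2))//.
- by apply: eq_Rintegral => w _; rewrite /pair_at mulrA.
- have := opM_integrable h2 psi2; congr (_.-integrable _ _).
  by apply/funext => w; rewrite /= /pair_at mulrA.
- exact: L2_stat_integrable.
Qed.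

(** The pairing is conditioned on [X 1] instead of [X 0], and the eigenfunction equation replaces
    the conditional mean of [m] times [phis (X 0)] by [rho] times [phis (X 1)]. *)
Lemma opM_left rho phis psi : 0 < rho -> L2 Q phis -> positive Q phis ->
  {ae Q, forall x, opM_adj X m phis x = rho * phis x} -> L2 Q psi ->
  L2inner Q phis (T psi) = rho * L2inner Q phis psi.
Proof.
move=> rho0 s2 s0 adjE psi2; rewrite opM_inner//.
pose Y := pair_at X (fun x y => m x y * phis x) 0.
have Yc : is_cond_mean P Y (X 1) (opM_adj X m phis).
  (* [opM_adj] is a choice with default 0: without a conditional mean, the eigenfunction equation
     would force [phis] to vanish, against its positivity. *)
  rewrite /opM_adj /cond_mean -/Y; case: xgetP => // nY; exfalso.
  have adj0 : opM_adj X m phis = cst 0.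
    by rewrite /opM_adj /cond_mean -/Y; case: xgetP => // x _ /nY.
  have : {ae Q, forall x : E, False}.
    apply: filterS2 adjE s0 => x; rewrite adj0 /cst => /esym/eqP.
    by rewrite mulf_eq0 gt_eqF//= => /eqP ->; rewrite ltxx.
  move=> [N [mN N0 sN]]; have NT : N = [set: E] by apply/seteqP; split => // x _; exact: sN.
  by move: N0; rewrite NT probability_setT => /eqP; rewrite onee_eq0.
have [mA Yi Ai _] := Yc.
have mpsi := L2_measurable psi2.
have aP := ae_stat Xs 1 adjE.
have EA : \int[P]_w (psi (X 1 w) * opM_adj X m phis (X 1 w)) = rho * L2inner Q phis psi.
  rewrite -innerZl//; have r2 := L2Z rho s2.
  rewrite (Rintegral_stat Xs 1 (f := fun x => psi x * opM_adj X m phis x)); last first.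
    exact: measurable_funM.
  rewrite -[LHS]/(L2inner Q _ _) innerC; apply/esym; apply: inner_ae => //.
  by apply: filterS adjE => x ->.
rewrite -EA -(cond_mean_pull_out Yc)//.
- by apply: eq_Rintegral => w _; rewrite /Y /pair_at; ring.
- have := opM_integrable s2 psi2; congr (_.-integrable _ _).
  by apply/funext => w; rewrite /= /Y /pair_at; congr EFin; ring.
- have I : P.-integrable [set: Omega] (EFin \o (fun w => psi (X 1 w) * (rho * phis (X 1 w)))).
    exact: (L2_stat_integrable 1 psi2 (L2Z rho s2)).
  apply/integrableP; split.
    by apply/measurable_EFinP; apply: measurable_funM; exact: measurableT_comp.
  have /integrableP[mI] := I; apply: le_lt_trans; rewrite le_eqVlt; apply/orP; left; apply/eqP.
  apply: ae_eq_integral => //.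
  + apply: measurableT_comp => //; apply/measurable_EFinP.
    by apply: measurable_funM; exact: measurableT_comp.
  + exact: measurableT_comp.
  + by apply: filterS aP => w /= -> _.
Qed.

Variables (k : nat) (b : 'I_k -> E -> R).
Hypothesis b2 : forall i, L2 Q (b i).

Lemma GmxE i j : Gmx X b i j = L2inner Q (b i) (b j).
Proof.
rewrite mxE /pair_mean /pair_at (Rintegral_stat Xs 0 (f := fun x => b i x * b j x))//.
by apply: measurable_funM; exact: L2_measurable.
Qed.

Lemma MmxE i j : Mmx X m b i j = L2inner Q (b i) (T (b j)).
Proof. by rewrite mxE opM_inner. Qed.

End markov_operator.

(** * Orthonormal coordinates of the sieve space *)

Section sieve_coordinates.
Context {R : realType} {dE : measure_display} {E : measurableType dE}.
Variables (Q : probability E R) (k : nat) (b : 'I_k -> E -> R).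
Hypotheses (b2 : forall i, L2 Q (b i)) (bI : lin_indep Q b).
Variable G : 'M[R]_k.
Hypothesis GE : forall i j, G i j = L2inner Q (b i) (b j).
Local Notation inner := (L2inner Q).
Local Notation norm := (L2norm Q).
Local Notation L2 := (L2 Q).

Lemma inner_lincomb c d : inner (lincomb b c) (lincomb b d) = dot c (G *m d).
Proof.
rewrite inner_lincombl//; last exact: L2_lincomb.
rewrite dotE; apply: eq_bigr => i _; congr (_ * _).
rewrite innerC inner_lincombl// mxE; apply: eq_bigr => j _.
by rewrite GE innerC mulrC.
Qed.

Lemma gram_sym : G^T = G.
Proof. by apply/matrixP => i j; rewrite mxE !GE innerC. Qed.

Lemma gram_pos (x : 'cV_k) : x != 0 -> 0 < (x^T *m G *m x) 0 0.
Proof.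
move=> x0; rewrite -mulmxA -[(_ *m _) 0 0]/(dot x (G *m x)) -inner_lincomb.
have x2 : L2 (lincomb b x) by exact: L2_lincomb.
rewrite -L2norm_sqr// exprn_gt0// lt_neqAle L2norm_ge0 andbT.
by apply: contra_neq x0 => /esym/(L2norm_eq0 x2)/bI.
Qed.

(** [sieve_fun] is an isometry of Euclidean space onto the sieve space and [sieve_coord] is its
    adjoint; their composition is the orthogonal projection. Norms of vectors and of functions thus
    agree exactly, whatever the conditioning of the basis. *)
Definition sieve_fun (x : 'cV[R]_k) : E -> R := lincomb b (inv_sqrtmx G *m x).

Definition sieve_coord (f : E -> R) : 'cV[R]_k :=
  inv_sqrtmx G *m \col_i inner (b i) f.

Local Notation F := sieve_fun.
Local Notation p := sieve_coord.
Local Notation S := (inv_sqrtmx G).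

Lemma sieve_fun_L2 x : L2 (F x). Proof. exact: L2_lincomb. Qed.

Lemma lincombD c d : lincomb b (c + d) = fun x => lincomb b c x + lincomb b d x.
Proof.
apply/funext => x; rewrite /lincomb -big_split; apply: eq_bigr => i _.
by rewrite mxE mulrDl.
Qed.

Lemma lincombZ a c : lincomb b (a *: c) = fun x => a * lincomb b c x.
Proof.
apply/funext => x; rewrite /lincomb mulr_sumr; apply: eq_bigr => i _.
by rewrite mxE mulrA.
Qed.

Lemma sieve_funD x y : F (x + y) = fun z => F x z + F y z.
Proof. by rewrite /F mulmxDr lincombD. Qed.

Lemma sieve_funZ a x : F (a *: x) = fun z => a * F x z.
Proof. by rewrite /F -scalemxAr lincombZ. Qed.

Lemma sieve_funB x y : F (x - y) = fun z => F x z - F y z.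
Proof. by rewrite sieve_funD -scaleN1r sieve_funZ; apply/funext => z; rewrite mulN1r. Qed.

Lemma inner_sieve_fun x y : inner (F x) (F y) = dot x y.
Proof.
have [Ss _ _ SGS] := inv_sqrtmxP gram_sym gram_pos.
by rewrite inner_lincomb -{1}Ss -dot_mulmx !mulmxA SGS mul1mx.
Qed.

Lemma norm_sieve_fun x : norm (F x) = enorm x.
Proof. by rewrite L2normE ?enormE ?inner_sieve_fun//; exact: sieve_fun_L2. Qed.

Lemma inner_sieve_coord x f : L2 f -> inner (F x) f = dot x (p f).
Proof.
have [Ss _ _ _] := inv_sqrtmxP gram_sym gram_pos.
move=> f2; rewrite /F inner_lincombl// /p dot_mulmx Ss dotE.
by apply: eq_bigr => i _; rewrite mxE.
Qed.

Lemma sieve_coordZ a f : L2 f -> p (fun x => a * f x) = a *: p f.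
Proof.
move=> f2; rewrite /p scalemxAr; congr (_ *m _); apply/colP => i.
by rewrite !mxE innerZr.
Qed.

Lemma sieve_coordB f g : L2 f -> L2 g -> p (fun x => f x - g x) = p f - p g.
Proof.
move=> f2 g2; rewrite /p -mulmxBr; congr (_ *m _); apply/colP => i.
by rewrite !mxE innerBr.
Qed.

Lemma sieve_coord_ae f g : L2 f -> L2 g -> {ae Q, forall x, f x = g x} -> p f = p g.
Proof.
move=> f2 g2 fg; rewrite /p; congr (_ *m _); apply/colP => i.
by rewrite !mxE ![inner (b i) _]innerC; apply: inner_ae => //; exact: L2_measurable g2.
Qed.

Lemma enorm_sieve_coord f : L2 f -> enorm (p f) <= norm f.
Proof.
move=> f2; apply: enorm_dual => [|y]; first exact: L2norm_ge0.
rewrite dotC -inner_sieve_coord// mulrC -norm_sieve_fun; apply: inner_le => //.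
exact: sieve_fun_L2.
Qed.

Lemma norm_sieve_residual f : L2 f -> norm (fun x => F (p f) x - f x) <= norm f.
Proof.
move=> f2; have F2 := sieve_fun_L2 (p f).
rewrite -ler_sqr ?nnegrE ?L2norm_ge0// !L2norm_sqr//; last exact: L2B.
rewrite innerBl// ?innerBr//; last exact: L2B.
rewrite (innerC Q f (F _)) inner_sieve_fun inner_sieve_coord//.
by have := dot_ge0 (p f); lra.
Qed.

(** The coefficients of a projection are determined by the Gram matrix, so the chosen projection
    equals the formula at every point and not only almost everywhere. *)
Lemma sieve_projE f : L2 f -> sieve_proj Q b f = F (p f).
Proof.
move=> f2; have [Ss SSG Su SGS] := inv_sqrtmxP gram_sym gram_pos.
have coef c : (forall i, inner (f \- lincomb b c) (b i) = 0) -> lincomb b c = F (p f).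
  move=> H; have Gc : G *m c = \col_i inner (b i) f.
    apply/colP => i; rewrite !mxE; have := H i.
    rewrite innerBl//; last exact: L2_lincomb.
    rewrite (innerC Q f) => /eqP; rewrite subr_eq0 => /eqP ->.
    by rewrite inner_lincombl//; apply: eq_bigr => j _; rewrite GE innerC mulrC.
  by rewrite /F /p -Gc !mulmxA SSG mul1mx.
have orth i : inner (f \- F (p f)) (b i) = 0.
  have -> : b i = F (invmx S *m delta_mx i 0).
    rewrite /F mulKVmx//; apply/funext => x; rewrite /lincomb (bigD1 i)//= mxE !eqxx mul1r.
    by rewrite big1 ?addr0// => j ji; rewrite mxE (negbTE ji) mul0r.
  rewrite innerBl//; [|exact: sieve_fun_L2..].
  by rewrite inner_sieve_fun (innerC Q f) inner_sieve_coord// dotC subrr.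
rewrite /sieve_proj; case: xgetP => [h -> [[c ->] H]|/(_ (F (p f)))[]].
  exact: coef.
by split; first by exists (S *m p f).
Qed.

End sieve_coordinates.

Lemma cvge0_near_lt {R : realType} (u : nat -> \bar R) (e : R) :
  u n @[n --> \oo] --> 0%E -> 0 < e -> \forall n \near \oo, (u n < e%:E)%E.
Proof.
move=> u0 e0; apply: (u0 [set x | (x < e%:E)%E]); apply: open_nbhs_nbhs; split.
  exact: open_ereal_lt_ereal.
by rewrite /= lte_fin.
Qed.

(** * Ultrafilter limits in place of subsequences *)

Section ultrafilters.
Context {R : realType}.

Lemma fmap_ultra {T T' : Type} (U : set_system T) (u : T -> T') :
  UltraFilter U -> UltraFilter (u @ U).
Proof.
move=> UF; have PU : ProperFilter (u @ U) by exact: fmap_proper_filter.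
split=> // G PG UG; apply/seteqP; split=> // A GA.
have [//|nA] := in_ultra_setVsetC (u @^-1` A) UF.
have /filter_ex[x [Ax]] : G (A `&` ~` A) by apply: filterI => //; exact: UG.
by [].
Qed.

(** One ultrafilter makes all bounded real sequences converge at once, which replaces the repeated
    extraction of subsequences. *)
Lemma bounded_ultra_cvg (U : set_system nat) (u : nat -> R) (a c : R) :
  UltraFilter U -> (forall j, a <= u j <= c) ->
  exists2 l, a <= l <= c & forall e, 0 < e -> U [set j | `|l - u j| < e].
Proof.
move=> UF ub; have VF := fmap_ultra u UF.
have := @segment_compact R a c; rewrite compact_ultra => /(_ _ VF)[].
  rewrite /fmap /=; rewrite (_ : _ @^-1` _ = setT); first exact: filterT.
  by apply/seteqP; split => // j _ /=; rewrite in_itv /=.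
move=> l /= [lac]; rewrite in_itv /= in lac => cv; exists l => // e e0.
by have /cvgrPdist_lt := cv; apply.
Qed.

End ultrafilters.

(** * Lower bounds from compactness *)

Section compact_operator.
Context {R : realType} {dE : measure_display} {E : measurableType dE}.
Variables (Q : probability E R) (T : (E -> R) -> E -> R) (C : R).
Local Notation L2 := (L2 Q).
Local Notation norm := (L2norm Q).
Local Notation inner := (L2inner Q).
Hypothesis C0 : 0 <= C.
Hypothesis T_L2 : forall f, L2 f -> L2 (T f).
Hypothesis T_bound : forall f, L2 f -> norm (T f) <= C * norm f.
Hypothesis T_lin : forall a f g, L2 f -> L2 g ->
  {ae Q, forall x, T (fun y => a * f y + g y) x = a * T f x + T g x}.

Lemma opB f g : L2 f -> L2 g ->
  {ae Q, forall x, T (fun y => f y - g y) x = T f x - T g x}.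
Proof.
move=> f2 g2; have := T_lin (-1) g2 f2.
rewrite (_ : (fun y => -1 * g y + f y) = fun y => f y - g y); last first.
  by apply/funext => x; rewrite mulN1r addrC.
by apply: filterS => x ->; rewrite mulN1r addrC.
Qed.

Lemma norm_opB f g : L2 f -> L2 g ->
  norm (fun x => T f x - T g x) <= C * norm (fun x => f x - g x).
Proof.
move=> f2 g2; have fg2 := L2B f2 g2.
rewrite -(@L2norm_ae _ _ _ _ (T (fun x => f x - g x))).
- exact: T_bound.
- exact: T_L2.
- by apply: L2_measurable; apply: L2B; exact: T_L2.
- exact: opB.
Qed.

Lemma opZ a f : L2 f -> {ae Q, forall x, T (fun y => a * f y) x = a * T f x}.
Proof.
move=> f2; have z2 := L20 Q.
have T0 : {ae Q, forall x, T (fun=> 0) x = 0}.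
  apply: L2norm_eq0; first exact: T_L2.
  apply/eqP; rewrite eq_le L2norm_ge0 andbT; apply: le_trans (T_bound z2) _.
  by rewrite (L2norm_eq0_ae z2) ?mulr0//; exact: nearW.
have := T_lin a f2 z2; rewrite (_ : (fun y => a * f y + 0) = fun y => a * f y); last first.
  by apply/funext => x; rewrite addr0.
by apply: filterS2 T0 => x T0 ->; rewrite T0 addr0.
Qed.

Lemma L2_shift l f : L2 f -> L2 (fun x => T f x - l * f x).
Proof. by move=> f2; apply: L2B; [exact: T_L2|exact: L2Z]. Qed.

Lemma norm_shiftZ l a f : L2 f ->
  norm (fun x => T (fun y => a * f y) x - l * (a * f x)) =
  `|a| * norm (fun x => T f x - l * f x).
Proof.
move=> f2; have s2 := L2_shift l f2; rewrite -L2normZ//.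
apply: L2norm_ae.
- by apply: (@L2_shift l (fun y => a * f y)); exact: L2Z.
- by apply: (@L2_measurable _ _ _ Q); exact: L2Z.
- by apply: filterS (opZ a f2) => x ->; ring.
Qed.

Variables (b : forall j : nat, 'I_j -> E -> R) (k : nat -> nat).
Hypothesis b2 : forall j (i : 'I_j), L2 (b i).
Hypothesis bI : forall j, lin_indep Q (@b j).
Hypothesis A2 : L2opnorm Q
  (fun psi => sieve_proj Q (@b (k n)) (T psi) \- T psi) @[n --> \oo] --> 0%E.

(** The operator norm is a supremum over the unit ball and homogeneity extends the bound to all
    functions. Functions of norm zero cannot be rescaled and are treated through the boundedness of
    [T]. *)
Lemma sieve_op_approx e : 0 < e -> exists N, forall n, (N <= n)%N -> forall f, L2 f ->
  norm (fun x => sieve_proj Q (@b (k n)) (T f) x - T f x) <= e * norm f.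
Proof.
move=> e0; have [N _ HN] := cvge0_near_lt A2 e0; exists N => n Nn f f2.
pose Gn : 'M[R]_(k n) := \matrix_(i, j) inner (b i) (b j).
have GE i j : Gn i j = inner (b i) (b j) by rewrite mxE.
have PE g : L2 g -> sieve_proj Q (@b (k n)) g = sieve_fun (@b (k n)) Gn (sieve_coord Q (@b (k n)) Gn g).
  by move=> g2; exact: sieve_projE.
have P2 g : L2 g -> L2 (fun x => sieve_proj Q (@b (k n)) g x - g x).
  by move=> g2; apply: L2B => //; rewrite PE//; exact: sieve_fun_L2.
have unit g : L2 g -> norm g <= 1 ->
    norm (fun x => sieve_proj Q (@b (k n)) (T g) x - T g x) <= e.
  move=> g2 g1; rewrite -lee_fin -L2_Lnorm; last by apply: P2; exact: T_L2.
  apply: le_trans (ltW (HN n Nn)); apply: ereal_sup_ubound.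
  by exists g.
have Tf2 := T_L2 f2.
have [f0|fn] := eqVneq (norm f) 0.
  rewrite f0 mulr0 PE//; apply: le_trans (norm_sieve_residual _ _ _ _) _ => //.
  by apply: le_trans (T_bound f2) _; rewrite f0 mulr0.
have fp : 0 < norm f by rewrite lt_neqAle eq_sym fn L2norm_ge0.
have g2 := L2Z (norm f)^-1 f2.
have := unit _ g2; rewrite L2normZ// ger0_norm ?invr_ge0 ?L2norm_ge0// mulVf// => /(_ (lexx _)).
rewrite -ler_pdivrMr// mulrC.
have <- : norm (fun x => (norm f)^-1 * (sieve_proj Q (@b (k n)) (T f) x - T f x)) =
    (norm f)^-1 * norm (fun x => sieve_proj Q (@b (k n)) (T f) x - T f x).
  by rewrite L2normZ ?ger0_norm ?invr_ge0 ?L2norm_ge0//; exact: P2.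
congr (_ <= _); apply: L2norm_ae.
- by apply: P2; exact: T_L2.
- by apply: (@L2_measurable _ _ _ Q); apply: L2Z; exact: P2.
have Tg : {ae Q, forall x, T (fun y => (norm f)^-1 * f y) x = (norm f)^-1 * T f x} by exact: opZ.
have Tfz := L2Z (norm f)^-1 Tf2.
apply: filterS Tg => x Tgx; rewrite !PE//; last exact: T_L2.
rewrite (sieve_coord_ae (@b2 (k n)) Gn (T_L2 g2) Tfz); last exact: opZ.
by rewrite sieve_coordZ// sieve_funZ Tgx; ring.
Qed.

(* Along an ultrafilter the image of a bounded sequence is Cauchy, because its
   finite-dimensional projections converge. *)
Lemma compact_limit (U : set_system nat) (f : nat -> E -> R) : UltraFilter U ->
  (forall j, L2 (f j)) -> (forall j, norm (f j) <= 1) ->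
  exists2 g, L2 g & forall e, 0 < e -> U [set j | norm (fun x => T (f j) x - g x) < e].
Proof.
move=> UF f2 f1; have Tf2 j := T_L2 (f2 j).
have cauchy e : 0 < e -> exists2 A, U A &
    forall i j, A i -> A j -> norm (fun x => T (f i) x - T (f j) x) <= e.
  move=> e0; have e40 : 0 < e / 4 by rewrite divr_gt0.
  have [N HN] := sieve_op_approx e40; have {}HN := HN N (leqnn N).
  pose Gn : 'M[R]_(k N) := \matrix_(i, j) inner (b i) (b j).
  have GE i j : Gn i j = inner (b i) (b j) by rewrite mxE.
  pose p j := sieve_coord Q (@b (k N)) Gn (T (f j)).
  have PE j : sieve_proj Q (@b (k N)) (T (f j)) = sieve_fun (@b (k N)) Gn (p j).
    exact: sieve_projE.
  have pb i j : - C <= p j i 0 <= C.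
    rewrite -ler_norml; apply: (@le_trans _ _ (enorm (p j))).
      rewrite /enorm -sqrtr_sqr ler_wsqrtr// (bigD1 i)//= lerDl.
      by apply: sumr_ge0 => l _; exact: sqr_ge0.
    apply: le_trans (enorm_sieve_coord (@b2 _) (@bI _) GE (Tf2 j)) _.
    apply: le_trans (T_bound (f2 j)) _; by rewrite -[leRHS]mulr1 ler_wpM2l.
  (* Two coordinate vectors differ by at most [2 * eta] in each of the [k N] coordinates, and the
     crude bound [k N] times [2 * eta] on the norm of the difference stays below [e / 2]. *)
  pose eta := e / (8 * ((k N)%:R + 1)).
  have kp : 0 < (k N)%:R + 1 :> R by rewrite ltr_wpDl.
  have eta0 : 0 < eta by rewrite divr_gt0// mulr_gt0.
  have /choice[l lP] : forall i, exists l, U [set j | `|l - p j i 0| < eta].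
    move=> i; have [l _ lU] := bounded_ultra_cvg UF (pb i).
    by exists l; exact: lU.
  exists [set j | forall i, `|l i - p j i 0| < eta]; first exact: filter_forall.
  move=> i j Ai Aj.
  have pij : enorm (p i - p j) <= e / 2.
    have sq : enorm (p i - p j) ^+ 2 <= ((k N)%:R * (2 * eta)) ^+ 2.
      rewrite enorm_sqr dotE.
      apply: (@le_trans _ _ (\sum_(u < k N) (2 * eta) ^+ 2)).
        apply: ler_sum => u _; rewrite -expr2 -real_normK ?num_real//.
        rewrite ler_sqr ?nnegrE//; last by rewrite mulr_ge0// ltW.
        rewrite [(p i - p j) u 0]mxE [(- p j) u 0]mxE; have := Ai u; have := Aj u.
        by rewrite !ltr_norml ler_norml => /andP[? ?] /andP[? ?]; lra.
      rewrite sumr_const card_ord -[leLHS]mulr_natl [leRHS]exprMn ler_wpM2r ?sqr_ge0//.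
      by rewrite -natrX ler_nat; case: (k N) => // v; rewrite expnS leq_pmulr// expn_gt0.
    rewrite ler_sqr ?nnegrE ?enorm_ge0// in sq; last by rewrite !mulr_ge0// ltW.
    apply: le_trans sq _; rewrite /eta.
    rewrite mulrA mulrA ler_pdivrMr ?mulr_gt0//.
    have : 0 <= (k N)%:R :> R by [].
    by move: ((k N)%:R : R) => v v0; nra.
  have Pi : L2 (sieve_fun (@b (k N)) Gn (p i)) by exact: sieve_fun_L2.
  have Pj : L2 (sieve_fun (@b (k N)) Gn (p j)) by exact: sieve_fun_L2.
  apply: le_trans (L2normB_le (Tf2 i) Pi (Tf2 j)) _.
  apply: (@le_trans _ _ (e / 4 + (e / 2 + e / 4))); last lra.
  apply: lerD.
    rewrite L2normBC// -PE; apply: le_trans (HN _ (f2 i)) _.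
    by rewrite -[leRHS]mulr1 ler_wpM2l// ltW.
  apply: le_trans (L2normB_le Pi Pj (Tf2 j)) _; apply: lerD.
    by rewrite -sieve_funB (norm_sieve_fun (@b2 _) (@bI _) GE).
  rewrite -PE; apply: le_trans (HN _ (f2 j)) _.
  by rewrite -[leRHS]mulr1 ler_wpM2l// ltW.
(* These are the radii asked for by [L2_complete]; taking [jn n] in all the sets [A i] with [i <= n]
   makes consecutive terms that close. *)
pose dl n : R := ((2 ^ n.+1)%:R)^-1.
have dl0 n : 0 < dl n by rewrite invr_gt0 ltr0n expn_gt0.
have /choice[A AP] : forall n, exists A, U A /\
    forall i j, A i -> A j -> norm (fun x => T (f i) x - T (f j) x) <= dl n.
  by move=> n; have [A UA HA] := cauchy _ (dl0 n); exists A.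
pose B n := [set j | forall i, (i <= n)%N -> A i j].
have UB n : U (B n).
  elim: n => [|n IH].
    by apply: filterS (AP 0).1 => j A0 i; rewrite leqn0 => /eqP ->.
  apply: filterS2 IH (AP n.+1).1 => j Bj Aj i; rewrite leq_eqVlt => /predU1P[->//|].
  exact: Bj.
have /choice[jn jnP] : forall n, exists j, B n j by move=> n; exact: filter_ex (UB n).
have [|g [g2 gP]] := @L2_complete _ _ _ Q (fun n => T (f (jn n))) (fun n => Tf2 (jn n)).
  move=> n; rewrite L2normBC//; apply: (AP n).2; first exact: (jnP n n (leqnn n)).
  exact: (jnP n.+1 n (leqnSn n)).
exists g => // e e0.
have [n ne] : exists n, ((2 ^ n)%:R)^-1 < e / 2 :> R.
  exists (Num.bound (e / 2)^-1); rewrite -[ltRHS]invrK ltf_pV2 ?posrE ?ltr0n ?expn_gt0//.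
    apply: lt_le_trans (archi_boundP _) _; first by rewrite invr_ge0; lra.
    by rewrite ler_nat ltnW// ltn_expl.
  by rewrite invr_gt0; lra.
apply: filterS (UB n) => j Bj /=.
apply: le_lt_trans (L2normB_le (Tf2 j) (Tf2 (jn n)) g2) _.
have := gP n; have := (AP n).2 j (jn n) (Bj n (leqnn n)) (jnP n n (leqnn n)).
have : dl n <= ((2 ^ n)%:R)^-1.
  by rewrite /dl lef_pV2 ?posrE ?ltr0n ?expn_gt0// ler_nat leq_exp2l.
move: ne; move: (norm _) (norm _) (dl n) (_^-1) => a1 a2 a3 a4; lra.
Qed.

(** Since [l j] stays away from 0, convergence of [T (f j)] along the ultrafilter forces that of
    [f j], which is nearly [T (f j)] divided by [l j]. The norm, the eigenvalue equation and
    orthogonality relations pass to the limit. *)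
Lemma approximate_eigenfunction (a c : R) (l : nat -> R) (f : nat -> E -> R) :
  0 < a -> (forall j, a <= l j <= c) -> (forall j, L2 (f j)) -> (forall j, norm (f j) = 1) ->
  (forall j, norm (fun x => T (f j) x - l j * f j x) <= j.+1%:R^-1) ->
  exists l0 f0, [/\ a <= l0 <= c, L2 f0, norm f0 = 1,
    {ae Q, forall x, T f0 x = l0 * f0 x} &
    forall h, L2 h -> (forall j, inner (f j) h = 0) -> inner f0 h = 0].
Proof.
move=> a0 lac f2 f1 fl.
have [U [UF UN]] := ultraFilterLemma (F := \oo) _.
have [l0 l0ac l0U] := bounded_ultra_cvg UF lac.
have [g g2 gU] : exists2 g, L2 g & forall e, 0 < e -> U [set j | norm (fun x => T (f j) x - g x) < e].
  by apply: compact_limit => // j; rewrite f1.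
have l00 : 0 < l0 by case/andP: l0ac => + _; exact: lt_le_trans.
have f02 : L2 (fun x => l0^-1 * g x) by exact: L2Z.
set f0 := (fun x => l0^-1 * g x) in f02 *.
have ff0 j : norm (fun x => f j x - f0 x) <=
    l0^-1 * (`|l0 - l j| + j.+1%:R^-1 + norm (fun x => T (f j) x - g x)).
  have A2' : L2 (fun x => (l0 - l j) * f j x) by exact: L2Z.
  have B2' : L2 (fun x => T (f j) x - l j * f j x) by exact: L2_shift.
  have D2' : L2 (fun x => T (f j) x - g x) := L2B (T_L2 (f2 j)) g2.
  have AB2 : L2 (fun x => (l0 - l j) * f j x - (T (f j) x - l j * f j x)) by exact: L2B.
  have S2 : L2 (fun x => ((l0 - l j) * f j x - (T (f j) x - l j * f j x)) + (T (f j) x - g x)) by exact: L2D.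
  have -> : (fun x => f j x - f0 x) = fun x => l0^-1 * (((l0 - l j) * f j x - (T (f j) x - l j * f j x)) + (T (f j) x - g x)).
    by apply/funext => x; rewrite /f0; field; rewrite gt_eqF.
  rewrite L2normZ// ger0_norm ?invr_ge0 ?ler_wpM2l ?invr_ge0//; try exact: ltW.
  apply: le_trans (L2normD_le AB2 D2') _; rewrite lerD2r.
  have z2 := L20 Q.
  have := L2normB_le A2' z2 B2'.
  rewrite (_ : (fun x => (l0 - l j) * f j x - 0) = fun x => (l0 - l j) * f j x); last first.
    by apply/funext => x; rewrite subr0.
  rewrite (L2normBC z2 B2').
  rewrite (_ : (fun x => T (f j) x - l j * f j x - 0) = fun x => T (f j) x - l j * f j x); last first.
    by apply/funext => x; rewrite subr0.
  rewrite L2normZ// f1 mulr1; move=> H; apply: le_trans H _; exact: lerD.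
have ff0U e : 0 < e -> U [set j | norm (fun x => f j x - f0 x) < e].
  move=> e0; have e3 : 0 < l0 * (e / 3) by rewrite mulr_gt0// divr_gt0.
  have UI : U [set j | j.+1%:R^-1 < l0 * (e / 3)].
    apply: UN; exists (Num.bound (l0 * (e / 3))^-1) => // j /= jb.
    rewrite -[ltRHS]invrK ltf_pV2 ?posrE ?ltr0n ?invr_gt0//.
    apply: lt_le_trans (archi_boundP _) _; first by rewrite invr_ge0 ltW.
    by rewrite ler_nat ltnW.
  apply: filterS3 (l0U _ e3) UI (gU _ e3) => j /= h1 h2 h3.
  apply: le_lt_trans (ff0 j) _; rewrite mulrC ltr_pdivrMr//.
  move: h1 h2 h3; move: `|l0 - l j| (j.+1%:R^-1) (norm _) => x1 x2 x3; lra.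
have small (x M : R) : 0 <= M -> (forall e, 0 < e -> x <= M * e) -> x <= 0.
  move=> M0 H; rewrite leNgt; apply/negP => x0.
  have := H (x / (2 * (M + 1))) (divr_gt0 x0 _).
  have M1 : 0 < 2 * (M + 1) by lra.
  move=> /(_ M1); rewrite mulrA ler_pdivlMr//.
  have : 0 <= x * M by rewrite mulr_ge0// ltW.
  lra.
have f0j e : 0 < e -> exists j, norm (fun x => f j x - f0 x) < e.
  by move=> e0; have /filter_ex := ff0U _ e0.
exists l0, f0; split => //.
- have n0 : `|norm f0 - 1| <= 0.
    apply: (small _ 1) => // e e0; rewrite mul1r.
    have [j /ltW fj] := f0j _ e0; apply: le_trans fj.
    have z2 := L20 Q.
    have E0 h : (fun x => h x - (fun=> 0 : R) x) = h :> (E -> R).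
      by apply/funext => x; rewrite subr0.
    have := L2normB_le (f2 j) f02 z2; have := L2normB_le f02 (f2 j) z2.
    rewrite !E0 (L2normBC f02 (f2 j)) f1 ler_norml.
    by move=> ? ?; apply/andP; split; lra.
  by apply/eqP; rewrite -subr_eq0 -normr_eq0 eq_le normr_ge0 andbT.
- have Tf02 : L2 (fun x => T f0 x - l0 * f0 x) by exact: L2_shift.
  have n0 : norm (fun x => T f0 x - l0 * f0 x) <= 0.
    apply: (small _ (C + 1)); first by have := C0; lra.
    move=> e e0; have UI : U ([set j | norm (fun x => f j x - f0 x) < e] `&` [set j | norm (fun x => T (f j) x - g x) < e]).
      by apply: filterI; [exact: ff0U|exact: gU].
    have [j [/= /ltW h1 /ltW h2]] := filter_ex UI.
    have -> : (fun x => T f0 x - l0 * f0 x) = fun x => T f0 x - g x.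
      by apply/funext => x; rewrite /f0 mulrA mulfV ?gt_eqF// mul1r.
    apply: le_trans (L2normB_le (T_L2 f02) (T_L2 (f2 j)) g2) _.
    rewrite mulrDl mul1r; apply: lerD => //.
    apply: le_trans (norm_opB f02 (f2 j)) _.
    by rewrite ler_wpM2l// L2normBC.
  have /(L2norm_eq0 Tf02) : norm (fun x => T f0 x - l0 * f0 x) = 0.
    by apply/eqP; rewrite eq_le n0 L2norm_ge0.
  by apply: filterS => x /eqP; rewrite subr_eq0 => /eqP.
- move=> h h2 fh; have n0 : `|inner f0 h| <= 0.
    apply: (small _ (norm h)); first exact: L2norm_ge0.
    move=> e e0; have [j /ltW fj] := f0j _ e0.
    have -> : inner f0 h = - inner (fun x => f j x - f0 x) h.
      by rewrite innerBl// fh sub0r opprK.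
    rewrite normrN; apply: le_trans (inner_le (L2B (f2 j) f02) h2) _.
    by rewrite mulrC ler_wpM2l// L2norm_ge0.
  by apply/eqP; rewrite -normr_eq0 eq_le n0 normr_ge0.
Qed.

Lemma scaled_lower_bound (l c : R) (f : E -> R) : L2 f -> norm f != 0 ->
  norm (fun x => T f x - l * f x) < c * norm f ->
  exists2 g, norm g = 1 /\ L2 g & norm (fun x => T g x - l * g x) < c /\
    exists a, g = fun x => a * f x.
Proof.
move=> f2 fn H; have fp : 0 < norm f by rewrite lt_neqAle eq_sym fn L2norm_ge0.
have fi : 0 <= (norm f)^-1 by rewrite invr_ge0 L2norm_ge0.
exists (fun x => (norm f)^-1 * f x); first split.
- by rewrite L2normZ// ger0_norm// mulVf.
- exact: L2Z.
split; last by exists (norm f)^-1.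
by rewrite norm_shiftZ// ger0_norm// mulrC ltr_pdivrMr.
Qed.

(** Otherwise normalized approximate eigenfunctions orthogonal to [phis] would have an eigenfunction
    as limit, a multiple of [phi] by simplicity. Being orthogonal to [phis] it would vanish, as
    [phi] and [phis] pair to 1. *)
Lemma lower_bound_complement (rho : R) (phi phis : E -> R) : 0 < rho ->
  L2 phi -> L2 phis -> inner phi phis = 1 ->
  (forall f, eigenfunction Q T rho f -> exists c, {ae Q, forall x, f x = c * phi x}) ->
  exists2 c, 0 < c & forall f, L2 f -> inner f phis = 0 ->
    c * norm f <= norm (fun x => T f x - rho * f x).
Proof.
move=> r0 p2 s2 ps simple; apply: contrapT => H.
have /choice[f fP] : forall j : nat, exists f, [/\ L2 f, norm f = 1, inner f phis = 0 &
    norm (fun x => T f x - rho * f x) <= j.+1%:R^-1].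
  move=> j; apply: contrapT => Hj; apply: H; exists j.+1%:R^-1; first by rewrite invr_gt0.
  move=> f f2 fs; rewrite leNgt; apply/negP => lt.
  have [f0|fn] := eqVneq (norm f) 0; first by move: lt; rewrite f0 mulr0 ltNge L2norm_ge0.
  have [g [g1 g2] [gj [a gE]]] := scaled_lower_bound f2 fn lt.
  by apply: Hj; exists g; split => //; [rewrite gE innerZl// fs mulr0|exact: ltW].
have [||||l0 [f0 [l01 f02 f01 Tf0 f0s]]] :=
  @approximate_eigenfunction rho rho (fun=> rho) f r0.
- by rewrite lexx.
- by move=> j; have [] := fP j.
- by move=> j; have [] := fP j.
- by move=> j; have [] := fP j.
have l0E : l0 = rho by apply/eqP; rewrite eq_le andbC.
rewrite l0E in Tf0.
have f0phis : inner f0 phis = 0 by apply: f0s => // j; have [] := fP j.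
have [|c fc] := simple f0.
  split => // f00; have := f01; rewrite (L2norm_eq0_ae f02 f00) => /eqP.
  by rewrite eq_sym oner_eq0.
have cp2 := L2Z c p2.
have : inner f0 phis = inner (fun x => c * phi x) phis.
  by apply: inner_ae => //; exact: L2_measurable cp2.
rewrite innerZl// ps mulr1 f0phis => /esym c0.
have := f01; rewrite (L2norm_ae f02 (L2_measurable cp2) fc) L2normZ// c0 normr0 mul0r => /eqP.
by rewrite eq_sym oner_eq0.
Qed.

(** A failing sequence of pairs would yield an eigenvalue of at least [rho + e]. Compactness in [l]
    holds because an approximate eigenvalue exceeds the norm bound [C] by at most its residual,
    whence the bound [C + 1]. *)
Lemma lower_bound_above (rho e : R) : 0 < rho -> 0 < e ->
  (forall l, Defs.eigenvalue Q T l -> l <= rho) ->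
  exists2 c, 0 < c & forall l f, rho + e <= l -> L2 f ->
    c * norm f <= norm (fun x => T f x - l * f x).
Proof.
move=> r0 e0 largest; apply: contrapT => H.
have /choice[lf lfP] : forall j : nat, exists lf : R * (E -> R),
    [/\ rho + e <= lf.1, L2 lf.2, norm lf.2 = 1 &
      norm (fun x => T lf.2 x - lf.1 * lf.2 x) <= j.+1%:R^-1].
  move=> j; apply: contrapT => Hj; apply: H; exists j.+1%:R^-1; first by rewrite invr_gt0.
  move=> l f le_l f2; rewrite leNgt; apply/negP => lt.
  have [f0|fn] := eqVneq (norm f) 0; first by move: lt; rewrite f0 mulr0 ltNge L2norm_ge0.
  have [g [g1 g2] [gj _]] := scaled_lower_bound f2 fn lt.
  by apply: Hj; exists (l, g); split => //; exact: ltW.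
have re0 : 0 < rho + e by rewrite addr_gt0.
have bd j : rho + e <= (lf j).1 <= C + 1.
  have [h1 h2 h3 h4] := lfP j; rewrite h1/=.
  have Tl := T_L2 h2; have ll := L2Z (lf j).1 h2; have z2 := L20 Q.
  have E0 (h : E -> R) : (fun x => h x - (fun=> 0 : R) x) = h by apply/funext => x; rewrite subr0.
  have := L2normB_le ll Tl z2; rewrite !E0 L2normZ// h3 mulr1 ger0_norm; last first.
    exact: le_trans (ltW re0) h1.
  rewrite (L2normBC ll Tl); have := T_bound h2; rewrite h3 mulr1.
  have : j.+1%:R^-1 <= 1 :> R by rewrite invf_le1// ler1n.
  by move=> /(le_trans h4); lra.
have [|||l0 [f0 [/andP[l1 _] f02 f01 Tf0 _]]] :=
  @approximate_eigenfunction (rho + e) (C + 1) (fun j => (lf j).1) (fun j => (lf j).2) re0 bd.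
- by move=> j; have [] := lfP j.
- by move=> j; have [] := lfP j.
- by move=> j; have [] := lfP j.
have /largest : Defs.eigenvalue Q T l0.
  exists f0; split => // f00; have := f01; rewrite (L2norm_eq0_ae f02 f00) => /eqP.
  by rewrite eq_sym oner_eq0.
by move: l1 e0; lra.
Qed.

End compact_operator.

(** * Perturbation of a generalized eigenvalue *)

Section generalized_perturbation.
Context {R : realType}.

Lemma near_simple_le (c c' B rho d d' : R) n (A : 'M[R]_n) u v : c' <= c -> d <= d' ->
  near_simple c B A u v rho d -> near_simple c' B A u v rho d'.
Proof.
move=> cc dd [hu hv gap right left duv]; split => //.
- by move=> x vx; apply: le_trans (gap x vx); rewrite ler_wpM2r ?enorm_ge0.
- exact: le_trans right dd.
- by move=> x; apply: le_trans (left x) _; rewrite ler_wpM2r ?enorm_ge0.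
- exact: le_trans duv dd.
Qed.

Lemma near_simple_perturb (c B rho d e : R) n (A A' : 'M[R]_n) u v :
  near_simple c B A u v rho d -> 0 <= e -> e <= c / 2 ->
  (forall x, enorm (A' *m x - A *m x) <= e * enorm x) ->
  near_simple (c / 2) B A' u v rho (d + B * e).
Proof.
move=> [hu hv gap right left duv] e0 ec AA'.
have B0 : 0 <= B by exact: le_trans (enorm_ge0 u) hu.
have split x l : A' *m x - l *: x = (A *m x - l *: x) + (A' *m x - A *m x).
  by rewrite [RHS]addrC addrA subrK.
split => //.
- move=> x vx; have := gap x vx.
  have -> : A *m x - rho *: x = (A' *m x - rho *: x) - (A' *m x - A *m x).
    by rewrite split addrK.
  move=> /le_trans/(_ (enormB _ _)) H; have := AA' x; have : e * enorm x <= c / 2 * enorm x.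
    by rewrite ler_wpM2r ?enorm_ge0.
  lra.
- rewrite split; apply: le_trans (enormD _ _) _; apply: lerD => //.
  by apply: le_trans (AA' u) _; rewrite mulrC ler_wpM2r.
- move=> x; rewrite split dotDr mulrDl; apply: le_trans (ler_normD _ _) _; apply: lerD => //.
  apply: le_trans (dot_le _ _) _; rewrite -mulrA; apply: ler_pM => //; exact: enorm_ge0.
- by apply: le_trans duv _; rewrite lerDl mulr_ge0.
Qed.

(** Pairing the perturbed equation with the left eigenvector gives
    [(rh - r) * dot y xh = dot y (W rh *m xh)] exactly. This yields a first-order bound [a1] for the
    eigenvalue and, through the gap, [a2] for the eigenvector; replacing [xh] and [rh] by [x] and
    [r] then costs only products of two first-order errors. *)
Lemma generalized_expansion n (A Go Mo : 'M[R]_n) (v x y xh : 'cV[R]_n)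
    (r rh g h H K L a1 a2 : R) :
  0 <= g -> 0 <= h -> 1 <= H -> 0 <= K -> 0 <= L ->
  (forall z, enorm ((Go - 1%:M) *m z) <= g * enorm z) ->
  (forall z, enorm ((Mo - A) *m z) <= h * enorm z) ->
  A *m x = r *: x -> A^T *m y = r *: y -> Mo *m xh = rh *: (Go *m xh) ->
  dot v x = 1 -> dot v xh = 1 ->
  enorm x <= H -> enorm y <= H -> enorm xh <= H ->
  `|r| <= L -> `|rh| <= L -> 1 / 2 <= dot y x -> 1 / 2 <= dot y xh ->
  (forall z, dot v z = 0 -> enorm z <= K * enorm (A *m z - r *: z)) ->
  a1 = 2 * H ^+ 2 * (1 + L) -> a2 = K * ((1 + L) * H + a1 * H) ->
  `|rh - r - dot y ((Mo - r *: Go) *m x) / dot y x| <=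
    2 * H * (a1 * a2 + (1 + L) * a2 + a1 * H) * (g + h) ^+ 2.
Proof.
move=> g0 h0 H1 K0 L0 gP hP Ax Ay xhP vx vxh xH yH xhH rL rhL yx yxh gap a1E a2E.
pose dl := g + h; have dl0 : 0 <= dl by exact: addr_ge0.
(* The perturbation of the pencil: [Mo - t *: Go] is [A - t%:M + W t]. *)
pose W t := (Mo - A) - t *: (Go - 1%:M).
have H0 : 0 <= H by lra.
have WP t z : `|t| <= L -> enorm (W t *m z) <= (1 + L) * dl * enorm z.
  move=> tL; rewrite /W mulmxBl -scalemxAl; apply: le_trans (enormB _ _) _.
  rewrite enormZ; have := hP z; have := gP z; set e1 := enorm (_ *m z); set e2 := enorm (_ *m z).
  move=> e1P e2P.
  apply: (@le_trans _ _ (h * enorm z + L * (g * enorm z))).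
    by apply: lerD => //; apply: ler_pM => //; exact: enorm_ge0.
  have zn := enorm_ge0 z.
  have : 0 <= g * enorm z by exact: mulr_ge0.
  have : 0 <= L * (h * enorm z) by rewrite !mulr_ge0.
  by rewrite /dl; clear; lra.
have yW t z : `|t| <= L -> `|dot y (W t *m z)| <= H * ((1 + L) * dl * enorm z).
  move=> tL; apply: le_trans (dot_le _ _) _; apply: ler_pM => //; [exact: enorm_ge0..|exact: WP].
have Axh : A *m xh - rh *: xh = - (W rh *m xh).
  rewrite /W !mulmxBl -scalemxAl mulmxBl mul1mx xhP scalerBr.
  by move: (A *m xh) (Go *m xh) => p q; apply/matrixP => i j; rewrite !mxE; ring.
have e1 : (rh - r) * dot y xh = dot y (W rh *m xh).
  have : dot y (A *m xh) = r * dot y xh by rewrite dot_mulmx Ay dotZl.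
  have -> : A *m xh = rh *: xh - W rh *m xh by rewrite -Axh addrC subrK.
  by rewrite dotBr dotZr; clear; lra.
have b1 : `|rh - r| <= a1 * dl.
  have : `|rh - r| * dot y xh <= H * ((1 + L) * dl * H).
    have -> : `|rh - r| * dot y xh = `|(rh - r) * dot y xh|.
      by rewrite normrM (ger0_norm (_ : 0 <= dot y xh))//; move: yxh; clear; lra.
    rewrite e1; apply: le_trans (yW _ _ rhL) _; rewrite ler_wpM2l// ler_wpM2l//.
    by rewrite mulr_ge0// addr_ge0.
  have : `|rh - r| * (1 / 2) <= `|rh - r| * dot y xh by rewrite ler_wpM2l.
  by rewrite a1E expr2; clear; lra.
have a10 : 0 <= a1 by rewrite a1E !mulr_ge0 ?sqr_ge0// addr_ge0.
have b2 : enorm (xh - x) <= a2 * dl.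
  have /gap : dot v (xh - x) = 0 by rewrite dotBr vx vxh subrr.
  move=> /le_trans; apply; rewrite a2E -mulrA ler_wpM2l//.
  have -> : A *m (xh - x) - r *: (xh - x) = (rh - r) *: xh - W rh *m xh.
    rewrite -Axh mulmxBr Ax scalerBr scalerBl; apply/matrixP => i j; rewrite !mxE; ring.
  apply: le_trans (enormB _ _) _; rewrite enormZ.
  have h1 : `|rh - r| * enorm xh <= a1 * dl * H by apply: ler_pM => //; exact: enorm_ge0.
  have h2 : enorm (W rh *m xh) <= (1 + L) * dl * H.
    by apply: le_trans (WP _ _ rhL) _; rewrite ler_wpM2l// mulr_ge0// addr_ge0.
  by move: h1 h2; clear; lra.
have a20 : 0 <= a2.
  by rewrite a2E mulr_ge0// addr_ge0// mulr_ge0// addr_ge0.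
have e3 : dot y ((Mo - r *: Go) *m x) = dot y (W r *m x).
  have -> : (Mo - r *: Go) *m x = W r *m x + (A *m x - r *: x).
    rewrite /W !mulmxBl -!scalemxAl !mulmxBl mul1mx scalerBr.
    by apply/matrixP => i j; rewrite !mxE; ring.
  by rewrite Ax subrr addr0.
have yx0 : 0 < dot y x by apply: lt_le_trans yx; rewrite divr_gt0.
have -> : rh - r - dot y ((Mo - r *: Go) *m x) / dot y x =
   ((rh - r) * dot y x - dot y (W r *m x)) / dot y x.
  by rewrite e3; field; rewrite gt_eqF.
rewrite normrM normfV (gtr0_norm yx0) ler_pdivrMr//.
(* The exact remainder: each of its three terms is a product of two factors of order [dl]. *)
have -> : (rh - r) * dot y x - dot y (W r *m x) =
    (rh - r) * dot y (x - xh) + dot y (W rh *m (xh - x)) - (rh - r) * dot y ((Go - 1%:M) *m x).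
  have : dot y (W rh *m x) = dot y (W r *m x) - (rh - r) * dot y ((Go - 1%:M) *m x).
    have Wx t : W t *m x = (Mo - A) *m x - t *: ((Go - 1%:M) *m x).
      by rewrite /W mulmxBl -scalemxAl.
    rewrite -dotZr -dotBr !Wx; congr (dot y _).
    by move: (_ *m x) (_ *m x) => p q; apply/matrixP => i j; rewrite !mxE; ring.
  by move: e1; rewrite mulmxBr !dotBr; clear; lra.
have t1 : `|(rh - r) * dot y (x - xh)| <= a1 * dl * (H * (a2 * dl)).
  rewrite normrM; apply: ler_pM => //; apply: le_trans (dot_le _ _) _.
  by apply: ler_pM => //; rewrite ?enorm_ge0// -enormN opprB.
have t2 : `|dot y (W rh *m (xh - x))| <= H * ((1 + L) * dl * (a2 * dl)).
  by apply: le_trans (yW _ _ rhL) _; rewrite ler_wpM2l// ler_wpM2l// mulr_ge0// addr_ge0.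
have t3 : `|(rh - r) * dot y ((Go - 1%:M) *m x)| <= a1 * dl * (H * (dl * H)).
  rewrite normrM; apply: ler_pM => //; apply: le_trans (dot_le _ _) _.
  apply: ler_pM => //; [exact: enorm_ge0..|].
  apply: le_trans (gP x) _; apply: ler_pM => //; first exact: enorm_ge0.
  by rewrite /dl lerDl.
apply: le_trans (ler_normB _ _) _; apply: le_trans (lerD (ler_normD _ _) (lexx _)) _.
apply: (@le_trans _ _ (H * (a1 * a2 + (1 + L) * a2 + a1 * H) * dl ^+ 2)); first by rewrite expr2; move: t1 t2 t3; clear; lra.
have -> : 2 * H * (a1 * a2 + (1 + L) * a2 + a1 * H) * (g + h) ^+ 2 * dot y x =
  (H * (a1 * a2 + (1 + L) * a2 + a1 * H) * dl ^+ 2) * (2 * dot y x) by rewrite /dl; ring.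
rewrite ler_peMr//; last by move: yx; clear; lra.
by rewrite !mulr_ge0 ?sqr_ge0// !addr_ge0// !mulr_ge0// addr_ge0.
Qed.

Lemma dot_near n (u v x y : 'cV[R]_n) (B eta : R) : 1 <= B -> 0 <= eta -> eta <= 1 / (16 * (B + 1)) ->
  enorm v <= B -> enorm x <= B + 1 -> enorm (y - v) <= eta -> enorm (x - u) <= eta ->
  `|dot v u - 1| <= 1 / 4 -> 1 / 2 <= dot y x.
Proof.
move=> B1 eta0 etaB vB xB yv xu vu.
have -> : dot y x = dot (y - v) x + dot v (x - u) + dot v u.
  by rewrite dotBl dotBr; ring.
have H1 : `|dot (y - v) x| <= eta * (B + 1).
  by apply: le_trans (dot_le _ _) _; apply: ler_pM => //; exact: enorm_ge0.
have H2 : `|dot v (x - u)| <= (B + 1) * eta.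
  apply: le_trans (dot_le _ _) _; apply: ler_pM => //; try exact: enorm_ge0.
  by apply: le_trans vB _; lra.
have H3 : eta * (B + 1) <= 1 / 16.
  by rewrite -ler_pdivlMr; [apply: le_trans etaB _; rewrite invfM mulrA|lra].
by move: H1 H2 vu; rewrite !ler_norml => /andP[? ?] /andP[? ?] /andP[? ?]; lra.
Qed.

Lemma resolvent_upper n (A A' : 'M[R]_n) (c e l : R) (z : 'cV_n) : e < c ->
  c * enorm z <= enorm (A *m z - l *: z) -> enorm (A' *m z - A *m z) <= e * enorm z ->
  A' *m z = l *: z -> z = 0.
Proof.
move=> ec lb AA' Az; apply: enorm_eq0; apply/eqP; rewrite eq_le enorm_ge0 andbT leNgt.
apply/negP => z0; move: AA'; rewrite Az -enormN opprB => AA'.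
have := le_trans lb AA'; rewrite ler_pM2r// leNgt ec //.
Qed.

(** All thresholds and constants are fixed before the dimension and the matrices. The generalized
    problem for [Mo] and [Go] is turned into the ordinary one for [invmx Go *m Mo], to which the
    same perturbation result applies as to [A]. *)
Lemma sieve_matrix_eigenvalue (c B Lam c2 rho : R) : 0 < c -> 1 <= B -> 0 <= Lam -> 0 < c2 ->
  0 < rho -> exists tau K0, [/\ 0 < tau, 0 <= K0 &
  forall n (A : 'M[R]_n) (u v : 'cV[R]_n) d,
  near_simple c B A u v rho d -> 0 <= d -> d <= tau ->
  (forall z, enorm (A *m z) <= Lam * enorm z) ->
  (forall l z, rho + gap_radius (c / 2) B <= l -> c2 * enorm z <= enorm (A *m z - l *: z)) ->
  exists r x y,
  [/\ [/\ A *m x = r *: x, A^T *m y = r *: y, dot v x = 1, 1 / 2 <= dot y x & 1 / 2 <= dot u v],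
   [/\ `|r - rho| <= K0 * d, enorm (x - u) <= K0 * d & enorm (y - v) <= K0 * d],
   (forall l (z : 'cV[R]_n), z != 0 -> A *m z = l *: z -> l <= r),
   (forall z : 'cV[R]_n, A *m z = r *: z -> exists a, z = a *: x) /\
   (forall z : 'cV[R]_n, A^T *m z = r *: z -> exists a, z = a *: y) &
   forall (Go Mo : 'M[R]_n) g h, 0 <= g -> 0 <= h -> g + h <= tau ->
     (forall z, enorm ((Go - 1%:M) *m z) <= g * enorm z) ->
     (forall z, enorm ((Mo - A) *m z) <= h * enorm z) ->
     exists rh, [/\ exists2 z : 'cV[R]_n, z != 0 & Mo *m z = rh *: (Go *m z),
       forall l (z : 'cV[R]_n), z != 0 -> Mo *m z = l *: (Go *m z) -> l <= rh &
       `|rh - r - dot y ((Mo - r *: Go) *m x) / dot y x| <= K0 * (g + h) ^+ 2]]].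
Proof.
move=> c0 B1 Lam0 c20 rho0.
have c0' : 0 < c / 2 by rewrite divr_gt0.
have e0 := gap_radius_gt0 c0' B1; have pc0 := perturbation_cst_gt0 c0' B1.
have K0 := gap_cst_gt0 c0' B1.
have pert := @simple_eigenvalue_perturbation R _ _ c0' B1.
have gapP := @near_simple_gap R _ _ c0' B1.
move: (gap_radius _ _) (perturbation_cst _ _) (gap_cst _ _) e0 pc0 K0 pert gapP => e k1 K e0 k10 K0 pert gapP.
have B10 : 0 < 16 * (B + 1) by lra.
have [t1 t10 t1P] : exists2 t1, 0 < t1 &
    [/\ t1 <= 1 / 4, t1 <= e, k1 * t1 <= e, k1 * t1 <= 1 & k1 * t1 <= 1 / (16 * (B + 1))].
  exists (Num.min (1 / 4) (Num.min e (Num.min (e / k1) (Num.min (1 / k1) (1 / (16 * (B + 1)) / k1))))).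
    by rewrite !lt_min e0 !divr_gt0.
  set t1 := (X in [/\ X <= _, _, _, _ & _]).
  have : t1 <= t1 by []; rewrite {2}/t1 !le_min => /and5P[h1 h2 h3 h4 h5].
  by split => //; rewrite mulrC -ler_pdivlMr.
(* Chosen so that [tau * M1] bounds the defect [d + B * e'] of the estimated matrix [A'] below. *)
have [M1 M1E] : exists M1, M1 = 1 + 2 * B * (1 + Lam) by eexists.
have BL : 0 <= B * Lam by rewrite mulr_ge0//; lra.
have M10 : 0 < M1 by rewrite M1E; lra.
have L10 : 0 < 2 * (1 + Lam) by lra.
have [tau tau0 tauP] : exists2 tau, 0 < tau & [/\ tau <= 1 / 2, tau * M1 <= t1,
    tau * (2 * (1 + Lam)) <= c / 2 & tau * (2 * (1 + Lam)) <= c2 / 2].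
  exists (Num.min (1 / 2) (Num.min (t1 / M1) (Num.min (c / 2 / (2 * (1 + Lam))) (c2 / 2 / (2 * (1 + Lam)))))).
    by rewrite !lt_min !divr_gt0.
  set tau := (X in [/\ X <= _, _, _ & _]).
  have : tau <= tau by []; rewrite {2}/tau !le_min => /and4P[h1 h2 h3 h4].
  by split => //; rewrite -ler_pdivlMr.
have [H HE] : exists H, H = B + 1 by eexists.
have [L LE] : exists L, L = rho + 1 by eexists.
have H1 : 1 <= H by lra.
have L0 : 0 <= L by lra.
have H0 : 0 <= H by lra.
have L1 : 0 <= 1 + L by lra.
have [a1 a1E] : exists a1, a1 = 2 * H ^+ 2 * (1 + L) by eexists.
have a10 : 0 <= a1 by rewrite a1E !mulr_ge0 ?sqr_ge0.
have [a2 a2E] : exists a2, a2 = K * ((1 + L) * H + a1 * H) by eexists.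
have a20 : 0 <= a2 by rewrite a2E mulr_ge0 ?addr_ge0 ?mulr_ge0// ltW.
have [K2 K2E] : exists K2, K2 = 2 * H * (a1 * a2 + (1 + L) * a2 + a1 * H) by eexists.
have K20 : 0 <= K2 by rewrite K2E mulr_ge0 ?addr_ge0 ?mulr_ge0.
exists tau, (k1 + K2); split => [//||n A u v d NS d0 dtau ALam upper].
  by rewrite addr_ge0// ltW.
have [t1a t1b t1c t1d t1e] := t1P; have [taua taub tauc taud] := tauP.
have NS' : near_simple (c / 2) B A u v rho d by apply: near_simple_le NS => //; move: c0; clear; lra.
have M1ge1 : 1 <= M1 by rewrite M1E; move: BL B1; clear; lra.
have dt1 : d <= t1.
  by apply: le_trans dtau (le_trans _ taub); rewrite ler_peMr// ltW.
have k1d : k1 * d <= k1 * t1 by rewrite ler_wpM2l// ltW.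
have main (A' : 'M[R]_n) d' e' : near_simple (c / 2) B A' u v rho d' -> 0 <= d' -> d' <= t1 ->
    e' < c2 -> (forall z, enorm (A' *m z - A *m z) <= e' * enorm z) ->
    exists r x y, [/\ [/\ A' *m x = r *: x, A'^T *m y = r *: y, dot v x = 1 & dot u y = dot u v],
      [/\ `|r - rho| <= k1 * d', enorm (x - u) <= k1 * d' & enorm (y - v) <= k1 * d'],
      (forall l (z : 'cV[R]_n), z != 0 -> A' *m z = l *: z -> l <= r),
      (forall z : 'cV[R]_n, A' *m z = r *: z -> exists a, z = a *: x) &
      (forall z : 'cV[R]_n, A'^T *m z = r *: z -> exists a, z = a *: y)].
  move=> NSA d'0 d't1 e'c AA'.
  have kd : k1 * d' <= e by apply: le_trans t1c; rewrite ler_wpM2l// ltW.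
  have [r [x [y [[Ax Ay vx uy] [rr xu yv] uniq luniq]]]] :=
    pert _ _ _ _ _ _ NSA d'0 kd.
  exists r, x, y; split => //.
  (* Maximality: from [rho + e] on, the bound [upper] excludes eigenvalues; within [e] of [rho] the
     eigenvalue is unique; below that window it is smaller than [r]. *)
  - move=> l z z0 Az; have [lbig|lsm] := leP (rho + e) l.
      by have := resolvent_upper e'c (upper l z lbig) (AA' z) Az => z00; rewrite z00 eqxx in z0.
    have [lge|llt] := leP (rho - e) l.
      have [|-> _] := uniq l z _ Az z0; last exact: lexx.
      by rewrite ler_distl lge ltW.
    have := le_trans rr kd; rewrite ler_distl => /andP[h1 _].
    exact: le_trans (ltW llt) h1.
  - move=> z Az; have [->|z0] := eqVneq z 0; first by exists 0; rewrite scale0r.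
    have [|_ ->] := uniq r z _ Az z0; first exact: le_trans rr kd.
    by exists (dot v z).
  - by move=> z /luniq ->; exists (dot u z / dot u v).
have [|r [x [y [[Ax Ay vx uy] [rr xu yv] largest uniq luniq]]]] := main A d 0 NS' d0 dt1 c20.
  by move=> z; rewrite subrr enorm0 mul0r.
have vu4 : `|dot v u - 1| <= 1 / 4 by apply: le_trans (ns_dot NS) (le_trans dt1 t1a).
have uB := ns_u NS; have vB := ns_v NS.
have xH : enorm x <= B + 1.
  have -> : x = u + (x - u) by rewrite addrC subrK.
  apply: le_trans (enormD _ _) _; apply: lerD => //.
  by apply: le_trans xu (le_trans k1d t1d).
have yH : enorm y <= B + 1.
  have -> : y = v + (y - v) by rewrite addrC subrK.
  apply: le_trans (enormD _ _) _; apply: lerD => //.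
  by apply: le_trans yv (le_trans k1d t1d).
have k1d0 : 0 <= k1 * d by rewrite mulr_ge0// ltW.
have yx : 1 / 2 <= dot y x.
  by apply: (dot_near B1 (eta := k1 * d) _ _ vB xH yv xu vu4) => //; exact: le_trans k1d t1e.
have kK : k1 * d <= (k1 + K2) * d by rewrite ler_wpM2r// lerDl.
exists r, x, y; split => //.
- split => //; rewrite dotC; move: vu4; rewrite ler_norml; clear => /andP[? _]; lra.
- by split; apply: le_trans kK.
move=> Go Mo g h g0 h0 ght gP hP.
have rL : `|r| <= L.
  rewrite -[r](subrK rho) LE; apply: le_trans (ler_normD _ _) _.
  by rewrite addrC lerD ?(gtr0_norm rho0)//; exact: le_trans rr (le_trans k1d t1d).
have Gu : Go \in unitmx.
  apply: unitmx_inj => z Gz; apply: enorm_eq0; apply/eqP; rewrite eq_le enorm_ge0 andbT leNgt.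
  apply/negP => z0; have := gP z; rewrite mulmxBl Gz mul1mx sub0r enormN.
  by rewrite -[leLHS]mul1r ler_pM2r//; move: ght taua h0; clear; lra.
have Ginv z : enorm (invmx Go *m z) <= 2 * enorm z.
  have := gP (invmx Go *m z); rewrite mulmxBl mul1mx mulKVmx// => HG1.
  have HG2 : enorm (invmx Go *m z) <= enorm z + enorm (z - invmx Go *m z).
    by rewrite -[in leLHS](subKr z (invmx Go *m z)); exact: enormB.
  have HG3 : g * enorm (invmx Go *m z) <= 1 / 2 * enorm (invmx Go *m z).
    by rewrite ler_wpM2r ?enorm_ge0//; move: ght taua h0; clear; lra.
  by move: HG1 HG2 HG3; clear; lra.
(* In [e'] the factor 2 bounds the inverse of [Go], as [g] is at most 1/2; the rest bounds the
   difference of [Mo - A] and [(Go - 1%:M) *m A]. *)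
pose A' := invmx Go *m Mo; pose e' := 2 * (1 + Lam) * (g + h).
have AA' z : enorm (A' *m z - A *m z) <= e' * enorm z.
  have -> : A' *m z - A *m z = invmx Go *m ((Mo - A) *m z - (Go - 1%:M) *m (A *m z)).
    rewrite mulmxBr !mulmxBl mulmxBr mulmxBr mul1mx mulKmx// /A' mulmxA.
    by rewrite opprB addrA subrK.
  apply: le_trans (Ginv _) _; rewrite /e' -!mulrA ler_wpM2l//.
  apply: le_trans (enormB _ _) _; apply: le_trans (lerD (hP z) (gP _)) _.
  have := ALam z; have zn := enorm_ge0 z => /(ler_wpM2l g0) HA1.
  have : 0 <= g * enorm z by rewrite mulr_ge0.
  have : 0 <= Lam * (h * enorm z) by rewrite !mulr_ge0.
  by rewrite mulrDl; move: HA1; clear; lra.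
have gh0 : 0 <= g + h by exact: addr_ge0.
have e'0 : 0 <= e' by rewrite /e' mulr_ge0// ltW.
have e'tau : e' <= tau * (2 * (1 + Lam)) by rewrite /e' mulrC ler_wpM2r// ltW.
have NSA : near_simple (c / 2) B A' u v rho (d + B * e').
  by apply: near_simple_perturb NS _ _ _ => //; exact: le_trans e'tau tauc.
have d't1 : d + B * e' <= t1.
  apply: le_trans taub; rewrite M1E mulrDr mulr1; apply: lerD => //.
  have : B * e' <= B * (tau * (2 * (1 + Lam))).
    by rewrite ler_wpM2l// (le_trans ler01).
  by move: dtau; clear; lra.
have d'0 : 0 <= d + B * e' by rewrite addr_ge0// mulr_ge0// (le_trans ler01).
have e'c2 : e' < c2 by apply: le_lt_trans (le_trans e'tau taud) _; move: c20; clear; lra.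
have [rh [xh [yh [[Axh _ vxh _] [rrh xuh _] largesth _ _]]]] := main A' _ e' NSA d'0 d't1 e'c2 AA'.
have k1d' : k1 * (d + B * e') <= k1 * t1 by rewrite ler_wpM2l// ltW.
have MG l (z : 'cV[R]_n) : Mo *m z = l *: (Go *m z) <-> A' *m z = l *: z.
  split=> [Mz|Az]; first by rewrite /A' -mulmxA Mz -scalemxAr mulKmx.
  by rewrite scalemxAr -Az /A' -mulmxA mulKVmx.
exists rh; split.
- exists xh; last exact/MG.
  by apply/eqP => xh0; move: vxh; rewrite xh0 dot0r => /eqP; rewrite eq_sym oner_eq0.
- by move=> l z z0 /MG; exact: largesth.
have xhH : enorm xh <= B + 1.
  have -> : xh = u + (xh - u) by rewrite addrC subrK.
  apply: le_trans (enormD _ _) _; apply: lerD => //.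
  by apply: le_trans xuh (le_trans k1d' t1d).
have rhL : `|rh| <= L.
  rewrite -[rh](subrK rho) LE; apply: le_trans (ler_normD _ _) _.
  by rewrite addrC lerD ?(gtr0_norm rho0)//; exact: le_trans rrh (le_trans k1d' t1d).
have yxh : 1 / 2 <= dot y xh.
  apply: (dot_near B1 (eta := k1 * t1) _ _ vB xhH _ _ vu4) => //.
  + by rewrite mulr_ge0// ltW.
  + exact: le_trans yv k1d.
  + exact: le_trans xuh k1d'.
rewrite -HE in xH yH xhH.
apply: le_trans (generalized_expansion (K := K) g0 h0 H1 (ltW K0) L0 gP hP Ax Ay _ vx vxh xH yH xhH
  rL rhL yx yxh _ a1E a2E) _.
- exact/MG.
- move=> z vz; apply: (gapP _ _ _ _ _ _ _ _ NS') => //; first exact: le_trans dt1 t1b.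
  exact: le_trans rr (le_trans k1d t1c).
by rewrite -K2E ler_wpM2r ?sqr_ge0// lerDr ltW.
Qed.

End generalized_perturbation.

(** * The operator compressed to the sieve *)

Section sieve_operator.
Context {R : realType} {dE : measure_display} {E : measurableType dE}.
Variables (Q : probability E R) (T : (E -> R) -> E -> R) (C : R).
Local Notation L2 := (L2 Q).
Local Notation norm := (L2norm Q).
Local Notation inner := (L2inner Q).
Hypothesis C0 : 0 <= C.
Hypothesis T_L2 : forall f, L2 f -> L2 (T f).
Hypothesis T_bound : forall f, L2 f -> norm (T f) <= C * norm f.
Hypothesis T_lin : forall a f g, L2 f -> L2 g ->
  {ae Q, forall x, T (fun y => a * f y + g y) x = a * T f x + T g x}.
Variables (rho : R) (phi phis : E -> R).
Hypotheses (phi2 : L2 phi) (phis2 : L2 phis) (phi_norm : norm phi = 1).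
Hypothesis phi_phis : inner phi phis = 1.
Hypothesis Tphi : {ae Q, forall x, T phi x = rho * phi x}.
Hypothesis Tleft : forall f, L2 f -> inner phis (T f) = rho * inner phis f.
Variable c1 : R.
Hypothesis gap : forall f, L2 f -> inner f phis = 0 ->
  c1 * norm f <= norm (fun x => T f x - rho * f x).

Variables (k : nat) (b : 'I_k -> E -> R).
Hypotheses (b2 : forall i, L2 (b i)) (bI : lin_indep Q b).
Variables (G M : 'M[R]_k).
Hypothesis GE : forall i j, G i j = inner (b i) (b j).
Hypothesis ME : forall i j, M i j = inner (b i) (T (b j)).
Local Notation S := (inv_sqrtmx G).
Local Notation A := (S *m M *m S).
Local Notation F := (sieve_fun b G).
Local Notation p := (sieve_coord Q b G).

(** [T] is linear only almost everywhere, so linearity is used inside an inner product, one term at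
    a time. *)
Lemma inner_op_lincomb h c : L2 h -> inner h (T (lincomb b c)) = \sum_i c i 0 * inner h (T (b i)).
Proof.
move=> h2; rewrite /lincomb; elim: (index_enum _) => [|i r IH].
  have z2 := L20 Q; rewrite big_nil.
  rewrite (_ : (fun x => \sum_(i <- [::]) c i 0 * b i x) = fun=> 0); last first.
    by apply/funext => x; rewrite big_nil.
  have T0 : {ae Q, forall x, T (fun=> 0) x = (fun=> 0) x}.
    have := opZ T_L2 T_bound T_lin 0 z2; apply: filterS => x.
    by rewrite (_ : (fun y => 0 * 0) = (fun=> 0)) ?mul0r//; apply/funext => ?; rewrite mul0r.
  rewrite innerC (inner_ae (T_L2 z2) _ h2 T0)//.
  by rewrite /L2inner; under eq_Rintegral do rewrite mul0r; exact: Rintegral_prob_cst.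
rewrite big_cons -IH.
have s2 : L2 (fun x => \sum_(j <- r) c j 0 * b j x).
  elim: {IH} r => [|j r IH].
    by under eq_fun do rewrite big_nil; exact: L20.
  by under eq_fun do rewrite big_cons; apply: L2D => //; exact: L2Z.
rewrite (_ : (fun x => \sum_(j <- i :: r) c j 0 * b j x) =
    fun x => c i 0 * b i x + \sum_(j <- r) c j 0 * b j x); last first.
  by apply/funext => x; rewrite big_cons.
have Ti := T_L2 (b2 i); have Ts := T_L2 s2; have cT := L2Z (c i 0) Ti.
rewrite innerC (inner_ae (T_L2 (L2D (L2Z (c i 0) (b2 i)) s2)) _ h2 (T_lin (c i 0) (b2 i) s2)); last first.
  by apply: (@L2_measurable _ _ _ Q); exact: L2D.
by rewrite innerDl// innerZl// !(innerC Q h).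
Qed.

Lemma sieve_mulmx x : A *m x = p (T (F x)).
Proof.
rewrite -!mulmxA /sieve_coord; congr (_ *m _); apply/colP => i; rewrite [LHS]mxE [RHS]mxE.
rewrite /sieve_fun inner_op_lincomb//; apply: eq_bigr => j _.
by rewrite ME mulrC.
Qed.

Lemma sieve_mulmx_bound x : enorm (A *m x) <= C * enorm x.
Proof.
have F2 := sieve_fun_L2 b2 G x; rewrite sieve_mulmx.
apply: le_trans (enorm_sieve_coord b2 bI GE (T_L2 F2)) _.
by apply: le_trans (T_bound F2) _; rewrite (norm_sieve_fun b2 bI GE).
Qed.

Variable ek : R.
Hypothesis proj_op : forall f, L2 f -> norm (fun x => F (p (T f)) x - T f x) <= ek * norm f.

Lemma shift_le_sieve x l : norm (fun z => T (F x) z - l * F x z) <=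
  enorm (A *m x - l *: x) + ek * enorm x.
Proof.
have F2 := sieve_fun_L2 b2 G x; have TF2 := T_L2 F2; have lF2 := L2Z l F2.
have P2 := sieve_fun_L2 b2 G (p (T (F x))).
have -> : enorm (A *m x - l *: x) = norm (fun z => F (p (T (F x))) z - l * F x z).
  rewrite sieve_mulmx -(norm_sieve_fun b2 bI GE) sieve_funB sieve_funZ//.
rewrite addrC; apply: le_trans (L2normB_le TF2 P2 lF2) _; apply: lerD => //.
rewrite L2normBC// -(norm_sieve_fun b2 bI GE); exact: proj_op.
Qed.

Local Notation d1 := (norm (fun x => F (p phi) x - phi x)).
Local Notation d2 := (norm (fun x => F (p phis) x - phis x)).
Local Notation d := ((C + 1) * (d1 + d2)).

(** The projection of [phi] misses the eigenvalue equation by the image under [T] of its bias, that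
    of [phis] by its bias paired with [T (F x)]. The gap of [T] loses [ek], the projection error of
    its range, hence the halved constant. *)
Lemma near_simple_sieve : ek <= c1 / 2 ->
  near_simple (c1 / 2) (1 + norm phis) A (p phi) (p phis) rho d.
Proof.
move=> ekc; have d10 : 0 <= d1 := L2norm_ge0 Q _; have d20 : 0 <= d2 := L2norm_ge0 Q _.
have le1 : d1 + d2 <= d by rewrite ler_peMl ?addr_ge0// lerDr.
have Cd1 : 0 <= C * d1 by rewrite mulr_ge0.
have Cd2 : 0 <= C * d2 by rewrite mulr_ge0.
have sn := L2norm_ge0 Q phis.
have Fs2 := sieve_fun_L2 b2 G (p phis); have Fp2 := sieve_fun_L2 b2 G (p phi).
have vx x : dot (p phis) x = inner phis (F x).
  by rewrite dotC -inner_sieve_coord// innerC.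
split.
- by apply: le_trans (enorm_sieve_coord b2 bI GE phi2) _; rewrite phi_norm lerDl.
- by apply: le_trans (enorm_sieve_coord b2 bI GE phis2) _; rewrite lerDr.
- move=> x; rewrite vx innerC => /(gap (sieve_fun_L2 b2 G x)).
  rewrite (norm_sieve_fun b2 bI GE) => /le_trans/(_ (shift_le_sieve x rho)) H.
  have : ek * enorm x <= c1 / 2 * enorm x by rewrite ler_wpM2r ?enorm_ge0.
  by move: H; lra.
- have Tp2 := T_L2 phi2; have TF2 := T_L2 Fp2; have rp2 := L2Z rho phi2.
  have -> : A *m p phi - rho *: p phi = p (fun x => T (F (p phi)) x - T phi x).
    rewrite sieve_coordB// sieve_mulmx; congr (_ - _).
    by rewrite -sieve_coordZ//; apply/esym; apply: sieve_coord_ae.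
  apply: le_trans (enorm_sieve_coord b2 bI GE (L2B TF2 Tp2)) _.
  apply: le_trans (norm_opB T_L2 T_bound T_lin Fp2 phi2) _.
  by move: Cd2 d10 d20; lra.
- move=> x; have Fx2 := sieve_fun_L2 b2 G x; have TFx2 := T_L2 Fx2.
  have -> : dot (p phis) (A *m x - rho *: x) = inner (fun z => F (p phis) z - phis z) (T (F x)).
    rewrite dotBr dotZr (vx x) -Tleft// innerBl//; congr (_ - _).
    by rewrite sieve_mulmx -inner_sieve_coord.
  apply: le_trans (inner_le (L2B Fs2 phis2) TFx2) _.
  apply: (@le_trans _ _ (d2 * (C * enorm x))).
    rewrite ler_wpM2l//; apply: le_trans (T_bound Fx2) _.
    by rewrite (norm_sieve_fun b2 bI GE).
  by rewrite mulrA ler_wpM2r ?enorm_ge0//; move: Cd1 d10 d20; lra.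
- rewrite -(inner_sieve_coord b2 bI GE)//.
  have -> : inner (F (p phis)) phi - 1 = inner (fun z => F (p phis) z - phis z) phi.
    by rewrite innerBl// (innerC Q phis) phi_phis.
  apply: le_trans (inner_le (L2B Fs2 phis2) phi2) _; rewrite phi_norm mulr1.
  by move: le1 d10; lra.
Qed.

Lemma sieve_upper (c2 l : R) : (forall f, L2 f -> c2 * norm f <= norm (fun x => T f x - l * f x)) ->
  ek <= c2 / 2 -> forall x, c2 / 2 * enorm x <= enorm (A *m x - l *: x).
Proof.
move=> H ekc x; have := H _ (sieve_fun_L2 b2 G x); rewrite (norm_sieve_fun b2 bI GE).
move=> /le_trans/(_ (shift_le_sieve x l)).
have : ek * enorm x <= c2 / 2 * enorm x by rewrite ler_wpM2r ?enorm_ge0.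
by lra.
Qed.

End sieve_operator.

(** * Sieve eigenvectors in orthonormal coordinates *)

Section orthogonalized.
Context {R : realType} {dO dE : measure_display}.
Context {Omega : measurableType dO} {E : measurableType dE}.
Variables (P : probability Omega R) (X : nat -> {RV P >-> E}).
Hypothesis Xs : strictly_stationary X.
Local Notation Q := (stat_dist X).
Variables (k : nat) (b : 'I_k -> E -> R).
Hypotheses (b2 : forall i, L2 Q (b i)) (bI : lin_indep Q b).
Local Notation G := (Gmx X b).
Local Notation S := (inv_sqrtmx G).
Local Notation F := (sieve_fun b G).

Let GE := GmxE Xs b2.

Let SP := inv_sqrtmxP (gram_sym GE) (gram_pos b2 bI GE).

Lemma geig_orthog (M' G' : 'M[R]_k) l (z : 'cV[R]_k) :
  M' *m (S *m z) = l *: (G' *m (S *m z)) <-> orthog X b M' *m z = l *: (orthog X b G' *m z).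
Proof.
have [Ss _ Su SGS] := SP; rewrite /orthog -!mulmxA; split => [->|]; first by rewrite -scalemxAr.
by move=> /(congr1 (mulmx (invmx S))); rewrite -scalemxAr !mulKmx.
Qed.

Lemma orthog_Gmx : orthog X b G = 1%:M.
Proof. by have [_ _ _ SGS] := SP. Qed.

Lemma orthog_tr (M' : 'M[R]_k) : (orthog X b M')^T = orthog X b M'^T.
Proof. by have [Ss _ _ _] := SP; rewrite /orthog !trmx_mul Ss mulmxA. Qed.

Lemma orthog_dot (M' : 'M[R]_k) (x y : 'cV[R]_k) :
  dot (S *m y) (M' *m (S *m x)) = dot y (orthog X b M' *m x).
Proof. by have [Ss _ _ _] := SP; rewrite /orthog -!mulmxA [RHS]dot_mulmx Ss. Qed.

Lemma orthogB (M1 M2 : 'M[R]_k) : orthog X b (M1 - M2) = orthog X b M1 - orthog X b M2.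
Proof. by rewrite /orthog mulmxBr mulmxBl. Qed.

Lemma orthogZ a (M1 : 'M[R]_k) : orthog X b (a *: M1) = a *: orthog X b M1.
Proof. by rewrite /orthog -scalemxAr -scalemxAl. Qed.

Lemma geigenvalue_orthog (M' G' : 'M[R]_k) l : geigenvalue M' G' l <->
  exists2 z : 'cV[R]_k, z != 0 & orthog X b M' *m z = l *: (orthog X b G' *m z).
Proof.
have [_ _ Su _] := SP; split => [[c c0 Mc]|[z z0 /geig_orthog Mz]].
  exists (invmx S *m c); last by apply/geig_orthog; rewrite mulKVmx.
  by apply: contra_neq c0 => /(congr1 (mulmx S)); rewrite mulKVmx// mulmx0.
exists (S *m z) => //; apply: contra_neq z0 => /(congr1 (mulmx (invmx S))).
by rewrite mulKmx// mulmx0.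
Qed.

Variables (m : E -> E -> R).
Local Notation M := (Mmx X m b).
Local Notation A := (orthog X b M).

(* The population eigenvectors, up to the sign s that the definition leaves
   open. *)
Lemma sieve_eigvecs_orthog (r : R) (x y : 'cV[R]_k) :
  A *m x = r *: x -> A^T *m y = r *: y -> 1 / 2 <= dot y x ->
  (forall l (z : 'cV[R]_k), z != 0 -> A *m z = l *: z -> l <= r) ->
  (forall z : 'cV[R]_k, A *m z = r *: z -> exists a, z = a *: x) ->
  (forall z : 'cV[R]_k, A^T *m z = r *: z -> exists a, z = a *: y) ->
  exists s, [/\ `|s| = 1,
    forall w, s * phi_k X m b w = F ((enorm x)^-1 *: x) w,
    forall w, s * phis_k X m b w = F ((enorm x / dot y x) *: y) w &
    forall M', dot (sieve_eigvecs X m b).2 (M' *m (sieve_eigvecs X m b).1) =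
      dot y (orthog X b M' *m x) / dot y x].
Proof.
move=> Ax Ay yx large uniq luniq; have [Ss _ Su SGS] := SP.
have Gs : G^T = G by exact: gram_sym GE.
have x0 : x != 0 by apply/eqP => x0; move: yx; rewrite x0 dot0r; lra.
have yx0 : dot y x != 0 by rewrite gt_eqF//; lra.
have xn : 0 < enorm x.
  rewrite lt_neqAle enorm_ge0 andbT eq_sym; apply: contra_neq x0; exact: enorm_eq0.
have rlarge : largest_geigenvalue M G r.
  split; first by apply/geigenvalue_orthog; exists x => //; rewrite orthog_Gmx mul1mx.
  by move=> l /geigenvalue_orthog[z z0]; rewrite orthog_Gmx mul1mx; exact: large.
have left_eq (z : 'cV[R]_k) l : (S *m z)^T *m M = l *: ((S *m z)^T *m G) <-> A^T *m z = l *: z.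
  have -> : A^T *m z = l *: z <-> M^T *m (S *m z) = l *: (G *m (S *m z)).
    by rewrite orthog_tr -{2}[z]mul1mx -orthog_Gmx; split => /geig_orthog.
  by split=> /(congr1 trmx); rewrite linearZ /= !trmx_mul ?trmxK ?Gs.
have P0 : is_sieve_eigvecs X m b (S *m ((enorm x)^-1 *: x)) (S *m ((enorm x / dot y x) *: y)).
  exists r; split => //.
  - by apply/geig_orthog; rewrite orthog_Gmx mul1mx -scalemxAr Ax !scalerA mulrC.
  - by apply/left_eq; rewrite -scalemxAr Ay !scalerA mulrC.
  - by rewrite (norm_sieve_fun b2 bI GE) enormZ ger0_norm ?invr_ge0 ?enorm_ge0// mulVf ?gt_eqF.
  - rewrite (inner_sieve_fun b2 bI GE) dotZl dotZr (dotC x y).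
    by field; rewrite yx0 gt_eqF.
have : is_sieve_eigvecs X m b (sieve_eigvecs X m b).1 (sieve_eigvecs X m b).2.
  rewrite /sieve_eigvecs; case: xgetP => [z -> //|/(_ (S *m ((enorm x)^-1 *: x), S *m ((enorm x / dot y x) *: y)))].
  by [].
rewrite /phi_k /phis_k; move: (sieve_eigvecs X m b) => [c cs] /= [r' [[r'1 r'2] Mc Mcs nc ncs]].
have rr' : r' = r by apply/le_anti; rewrite (rlarge.2 _ r'1) (r'2 _ rlarge.1).
rewrite {}rr' {r' r'1 r'2} in Mc Mcs *.
have [a aE] : exists a, invmx S *m c = a *: x.
  by apply: uniq; rewrite -[RHS]mul1mx -orthog_Gmx -scalemxAr; apply/geig_orthog; rewrite mulKVmx.
have [a' a'E] : exists a, invmx S *m cs = a *: y.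
  by apply: luniq; apply/left_eq; rewrite mulKVmx.
have cE : c = S *m (a *: x) by rewrite -aE mulKVmx.
have csE : cs = S *m (a' *: y) by rewrite -a'E mulKVmx.
have na : `|a| = (enorm x)^-1.
  move: nc; rewrite cE (norm_sieve_fun b2 bI GE) enormZ => H.
  by rewrite -[LHS]mulr1 -(mulfV (lt0r_neq0 xn)) mulrA H mul1r.
have aa' : a * a' * dot y x = 1.
  by move: ncs; rewrite cE csE (inner_sieve_fun b2 bI GE) dotZl dotZr (dotC x y) mulrA.
have a0 : a != 0 by apply/eqP => a0; move: aa'; rewrite a0 !mul0r => /eqP; rewrite eq_sym oner_eq0.
(* Normalization fixes the modulus of [a], so only its sign is free, and [a'] is then determined by
   [aa']. *)
exists (Num.sg a); split.
- by rewrite normr_sg a0.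
- by move=> w; rewrite cE -na -[lincomb _ _ w]/(F _ w) !sieve_funZ mulrA -normrEsg.
- move=> w; rewrite csE -[lincomb _ _ w]/(F _ w) !sieve_funZ mulrA; congr (_ * _).
  apply: (mulIf yx0); rewrite divfK// -[RHS]mulr1 -aa' [a in RHS]numEsg na.
  by field; rewrite gt_eqF.
- move=> M'; rewrite cE csE -!scalemxAr dotZl dotZr orthog_dot.
  by apply: (mulIf yx0); rewrite divfK// mulrA mulrAC (mulrC a') aa' mul1r.
Qed.

End orthogonalized.

Section distances.
Context {R : realType}.

Lemma enorm_dist n (x y : 'cV[R]_n) : `|enorm x - enorm y| <= enorm (x - y).
Proof.
have := enormD (x - y) y; have := enormD (y - x) x; rewrite !subrK -(enormN (y - x)) opprB.
by rewrite ler_norml => ? ?; apply/andP; split; lra.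
Qed.

Lemma L2norm_dist dE (E : measurableType dE) (Q : probability E R) (f g : E -> R) :
  L2 Q f -> L2 Q g -> `|L2norm Q f - L2norm Q g| <= L2norm Q (fun x => f x - g x).
Proof.
move=> f2 g2; have := L2normD_le (L2B f2 g2) g2; have := L2normD_le (L2B g2 f2) f2.
under eq_fun do rewrite subrK; under [X in _ -> L2norm _ X <= _ -> _]eq_fun do rewrite subrK.
by rewrite (L2normBC g2 f2) ler_norml => ? ?; apply/andP; split; lra.
Qed.

End distances.

(** * Arithmetic of the normalization errors *)

Section budgets.
Context {R : realFieldType}.
Implicit Types K D d q kap B : R.

Lemma common_bound K K1 K2 : 0 <= K -> 0 <= K1 -> 0 <= K2 ->
  exists KK, [/\ 0 <= KK, K <= KK, K1 <= KK, 2 * K1 + 2 <= KK & K2 <= KK].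
Proof. by move=> K0 K10 K20; exists (K + K1 + (2 * K1 + 2) + K2); split; lra. Qed.

Lemma normalization_budget K D d q q1 q2 : q <= q1 + q2 -> q1 <= K * D + d ->
  q2 <= K * D -> d <= D -> q + d <= (2 * K + 2) * D.
Proof. lra. Qed.

Lemma dual_normalization_budget K D B kap d q q1 q2 : q <= q1 + q2 ->
  q1 <= 2 * (K * D + D + K * D * kap) * (B + kap) -> q2 <= K * D -> d <= D ->
  q + d <= (2 * (K + 1 + K * kap) * (B + kap) + K + 1) * D.
Proof. lra. Qed.

End budgets.

(** * Population and estimated eigenvalues for large sieves *)

Section sieve_limit.
Context {R : realType} {dO dE : measure_display}.
Context {Omega : measurableType dO} {E : measurableType dE}.
Variables (P : probability Omega R) (X : nat -> {RV P >-> E}).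
Hypothesis Xs : strictly_stationary X.
Local Notation Q := (stat_dist X).
Variables (m : E -> E -> R) (rho : R) (phi phis : E -> R).
Hypothesis m_ge0 : forall w, 0 <= m (X 0 w) (X 1 w).
Hypothesis m_meas : measurable_fun [set: E * E] (fun z => m z.1 z.2).
Hypothesis A1 : perron_frobenius X m rho phi phis.
Hypotheses (phi_norm : L2norm Q phi = 1) (phi_phis : L2inner Q phi phis = 1).
Variables (b : forall j : nat, 'I_j -> E -> R) (k : nat -> nat).
Hypothesis b2 : forall j (i : 'I_j), L2 Q (b i).
Hypothesis bI : forall j, lin_indep Q (@b j).
Hypothesis A2 : L2opnorm Q (fun psi =>
  sieve_proj Q (@b (k n)) (opM X m psi) \- opM X m psi) @[n --> \oo] --> 0%E.
Local Notation T := (opM X m).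

Definition sieve_bias (n : nat) : R :=
  L2norm Q (sieve_proj Q (@b (k n)) phi \- phi) + L2norm Q (sieve_proj Q (@b (k n)) phis \- phis).

Hypothesis bias0 : sieve_bias n @[n --> \oo] --> (0 : R).

(** The expansion is deterministic: it holds for any two matrices whose errors add up to at most
    [tau], so that randomness enters later only through this event. The sign [s] is the one left
    open by the choice of the sieve eigenvectors. *)
Theorem sieve_eigenvalue : exists K0 tau N, [/\ 0 <= K0, 0 < tau &
  forall n, (N <= n)%N -> exists rk s,
  [/\ `|s| = 1, `|rk - rho| <= K0 * sieve_bias n,
    L2norm Q (fun x => s * phi_k X m (@b (k n)) x - phi x) <= K0 * sieve_bias n,
    L2norm Q (fun x => s * phis_k X m (@b (k n)) x - phis x) <= K0 * sieve_bias n &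
    forall Gh Mh : 'M[R]_(k n),
      let g := mxopnorm (orthog X (@b (k n)) Gh - 1%:M) in
      let h := mxopnorm (orthog X (@b (k n)) Mh - orthog X (@b (k n)) (Mmx X m (@b (k n)))) in
      (g + h <= tau)%R -> exists rh, largest_geigenvalue Mh Gh rh /\
      `|rh - rk - dot (sieve_eigvecs X m (@b (k n))).2
          ((Mh - rk *: Gh) *m (sieve_eigvecs X m (@b (k n))).1)| <= K0 * (g + h) ^+ 2]].
Proof.
have [T_L2 [C [C0 T_bound]]] : (forall f, L2 Q f -> L2 Q (T f)) /\
    exists C, 0 <= C /\ forall f, L2 Q f -> L2norm Q (T f) <= C * L2norm Q f.
  have [C HC] := pf_bounded A1; split => [f /HC[]//|].
  exists `|C|; split => // f /HC[_ H]; apply: le_trans H _.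
  by rewrite ler_wpM2r ?L2norm_ge0// ler_norm.
have T_lin a f g := @opM_lin _ _ _ _ _ P X m (pf_defined A1) a f g.
have [phi2 _ Tphi] := pf_right A1; have [phis2 phis0 Tphis] := pf_left A1.
have rho0 := pf_rho A1.
have Tleft f : L2 Q f -> L2inner Q phis (T f) = rho * L2inner Q phis f.
  exact: (opM_left Xs m_ge0 m_meas (pf_defined A1) T_L2 rho0 phis2 phis0 Tphis).
have phin0 : ~ {ae Q, forall x, phi x = 0}.
  by move=> p0; move: phi_norm; rewrite (L2norm_eq0_ae phi2 p0) => /eqP; rewrite eq_sym oner_eq0.
have [c1 c10 gap] : exists2 c, 0 < c & forall f, L2 Q f -> L2inner Q f phis = 0 ->
    c * L2norm Q f <= L2norm Q (fun x => T f x - rho * f x).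
  apply: (lower_bound_complement C0 T_L2 T_bound T_lin b2 bI A2 rho0 phi2 phis2 phi_phis).
  by move=> f ef; have [_] := pf_simple A1; apply => //.
pose B := 1 + L2norm Q phis.
have B1 : 1 <= B by rewrite lerDl L2norm_ge0.
have c20 : 0 < c1 / 2 by rewrite divr_gt0.
(* The gap is halved twice, in [near_simple_sieve] for the discretization and in
   [sieve_matrix_eigenvalue] for the estimation; the lower bound above [rho] has to start at the
   resulting radius. *)
have e0 : 0 < gap_radius (c1 / 2 / 2) B by apply: gap_radius_gt0 => //; rewrite divr_gt0.
have [c2 c2gt0 upper] := lower_bound_above C0 T_L2 T_bound T_lin b2 bI A2 rho0 e0 (pf_largest A1).2.
have c22 : 0 < c2 / 2 by rewrite divr_gt0.
have [tau [K [tau0 K0 master]]] := sieve_matrix_eigenvalue c20 B1 C0 c22 rho0.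
have ek0 : 0 < Num.min (c1 / 2) (c2 / 2) by rewrite lt_min c20.
have [N1 HN1] := sieve_op_approx T_L2 T_bound T_lin b2 bI A2 ek0.
have tauC : 0 < tau / (C + 1) by rewrite divr_gt0// ltr_wpDl.
have [N2 _ HN2] : \forall n \near \oo, sieve_bias n < tau / (C + 1).
  by move/cvgrPdist_lt: bias0 => /(_ _ tauC); apply: filterS => n; rewrite sub0r normrN => /(le_lt_trans (ler_norm _)).
have [K1 K1E] : exists K1, K1 = K * (C + 1) by eexists.
have K10 : 0 <= K1 by rewrite K1E mulr_ge0// addr_ge0.
(* This bounds [enorm x], since [u] has norm at most 1 and [x - u] at most [K * tau]. *)
have [kap kapE] : exists kap, kap = 1 + K * tau by eexists.
have kap1 : 1 <= kap by rewrite kapE lerDl mulr_ge0// ltW.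
have kap0 : 0 <= kap by exact: le_trans ler01 kap1.
have Kkap : 0 <= K1 * kap by exact: mulr_ge0.
have Bkap : 0 <= B + kap by rewrite addr_ge0// (le_trans ler01 B1).
have [K2 K2E] : exists K2, K2 = 2 * (K1 + 1 + K1 * kap) * (B + kap) + K1 + 1 by eexists.
have K2ge : 0 <= K2.
  by rewrite K2E -addrA addr_ge0 ?mulr_ge0// ?addr_ge0.
have [KK [KK0 KKK KK1 KK2 KK3]] : exists KK, [/\ 0 <= KK, K <= KK, K1 <= KK, 2 * K1 + 2 <= KK & K2 <= KK]
  := common_bound K0 K10 K2ge.
have K120 : 0 <= 2 * K1 + 2 by rewrite addr_ge0// mulr_ge0.
exists KK, tau, (maxn N1 N2); split => //.
move=> n; rewrite geq_max => /andP[nN1 nN2].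
set bn := @b (k n); set D := sieve_bias n.
have GE i j : Gmx X bn i j = L2inner Q (bn i) (bn j) by exact: (GmxE Xs (@b2 (k n)) i j).
have ME i j : Mmx X m bn i j = L2inner Q (bn i) (T (bn j)) by exact: (MmxE Xs m_ge0 m_meas (pf_defined A1) T_L2 (@b2 (k n)) i j).
have PE f : L2 Q f -> sieve_proj Q bn f = sieve_fun bn (Gmx X bn) (sieve_coord Q bn (Gmx X bn) f).
  by move=> f2; exact: (sieve_projE (@b2 (k n)) (@bI (k n)) GE f2).
pose u := sieve_coord Q bn (Gmx X bn) phi; pose v := sieve_coord Q bn (Gmx X bn) phis.
pose d1 := L2norm Q (fun x => sieve_fun bn (Gmx X bn) u x - phi x).
pose d2 := L2norm Q (fun x => sieve_fun bn (Gmx X bn) v x - phis x).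
have DE : D = d1 + d2 by rewrite /D /sieve_bias !PE.
have d10 : 0 <= d1 := L2norm_ge0 Q _; have d20 : 0 <= d2 := L2norm_ge0 Q _.
have proj_op f : L2 Q f -> L2norm Q (fun x => sieve_fun bn (Gmx X bn) (sieve_coord Q bn (Gmx X bn) (T f)) x - T f x)
    <= Num.min (c1 / 2) (c2 / 2) * L2norm Q f.
  by move=> f2; have := HN1 n nN1 f f2; rewrite PE//; exact: T_L2.
have NS : near_simple (c1 / 2) B (orthog X bn (Mmx X m bn)) u v rho ((C + 1) * D).
  rewrite DE; apply: (near_simple_sieve C0 T_L2 T_bound T_lin phi2 phis2 phi_norm phi_phis Tphi
    Tleft gap (@b2 _) (@bI _) GE ME proj_op).
  by rewrite ge_min lexx.
have D0 : 0 <= D by rewrite DE addr_ge0.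
have d'0 : 0 <= (C + 1) * D by rewrite mulr_ge0// addr_ge0.
have d'tau : (C + 1) * D <= tau.
  by rewrite mulrC -ler_pdivlMr ?ltW//; [exact: HN2|rewrite ltr_wpDl].
have [||r [x [y [[Ax Ay vx yx uv] [rr xu yv] large [uniq luniq] expan]]]] :=
  master _ _ _ _ _ NS d'0 d'tau.
- exact: (sieve_mulmx_bound T_L2 T_bound T_lin (@b2 _) (@bI _) GE ME).
- move=> l z le_l; apply: (sieve_upper T_L2 T_bound T_lin (@b2 _) (@bI _) GE ME proj_op) => //.
    by move=> f f2; exact: upper.
  by rewrite ge_min lexx orbT.
rewrite mulrA -K1E in rr xu yv.
have [s [s1 phikE phiskE dotE']] := sieve_eigvecs_orthog Xs (@b2 (k n)) (@bI (k n)) Ax Ay yx large uniq luniq.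
have phi2' := sieve_fun_L2 (@b2 (k n)) (Gmx X bn).
have KD : K1 * D <= K * tau by rewrite K1E -mulrA ler_wpM2l.
have d1D : d1 <= D by rewrite DE lerDl.
have d2D : d2 <= D by rewrite DE lerDr.
have un : `|enorm u - 1| <= d1.
  rewrite -(norm_sieve_fun (@b2 (k n)) (@bI (k n)) GE) -phi_norm; exact: L2norm_dist.
have xn1 : `|enorm x - 1| <= K1 * D + d1.
  rewrite (_ : enorm x - 1 = (enorm x - enorm u) + (enorm u - 1)); last by ring.
  apply: le_trans (ler_normD _ _) _; apply: lerD => //.
  exact: le_trans (enorm_dist _ _) xu.
have uB : enorm u <= 1 by have := enorm_sieve_coord (@b2 (k n)) (@bI (k n)) GE phi2; rewrite phi_norm.
have vB : enorm v <= B.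
  have := enorm_sieve_coord (@b2 (k n)) (@bI (k n)) GE phis2; rewrite -/v => /le_trans; apply.
  by rewrite /B lerDr.
have xk : enorm x <= kap.
  have -> : x = u + (x - u) by rewrite addrC subrK.
  apply: le_trans (enormD _ _) _; rewrite kapE; apply: lerD => //; exact: le_trans xu KD.
have yk : enorm y <= B + kap.
  have -> : y = v + (y - v) by rewrite addrC subrK.
  apply: le_trans (enormD _ _) _; apply: lerD => //; apply: le_trans yv (le_trans KD _).
  by rewrite kapE lerDr.
have xn : 0 < enorm x.
  rewrite lt_neqAle enorm_ge0 andbT eq_sym; apply/eqP => /enorm_eq0 x0.
  by move: vx; rewrite x0 dot0r => /eqP; rewrite eq_sym oner_eq0.
have yx0 : 0 < dot y x by apply: lt_le_trans yx; rewrite divr_gt0.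
have bigK a : a <= KK -> a * D <= KK * D by move=> aK; rewrite ler_wpM2r.
exists r, s; split => //.
- exact: le_trans rr (bigK _ KK1).
- apply: (@le_trans _ _ ((2 * K1 + 2) * D)); last exact: bigK.
  have -> : (fun w => s * phi_k X m bn w - phi w) =
      fun w => sieve_fun bn (Gmx X bn) ((enorm x)^-1 *: x) w - phi w.
    by apply/funext => w; rewrite phikE.
  apply: le_trans (L2normB_le (phi2' _) (phi2' u) phi2) _; rewrite -/d1.
  rewrite -sieve_funB (norm_sieve_fun (@b2 (k n)) (@bI (k n)) GE).
  have -> : (enorm x)^-1 *: x - u = ((enorm x)^-1 - 1) *: x + (x - u).
    by rewrite scalerBl scale1r addrA subrK.
  have := enormD (((enorm x)^-1 - 1) *: x) (x - u); rewrite enormZ.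
  have -> : `|(enorm x)^-1 - 1| * enorm x = `|enorm x - 1|.
    rewrite -{2}(gtr0_norm xn) -normrM mulrBl mulVf ?gt_eqF// mul1r distrC//.
  by move=> tri; exact: normalization_budget tri xn1 xu d1D.
- apply: (@le_trans _ _ (K2 * D)); last exact: bigK.
  have -> : (fun w => s * phis_k X m bn w - phis w) =
      fun w => sieve_fun bn (Gmx X bn) ((enorm x / dot y x) *: y) w - phis w.
    by apply/funext => w; rewrite phiskE.
  apply: le_trans (L2normB_le (phi2' _) (phi2' v) phis2) _; rewrite -/d2.
  rewrite -sieve_funB (norm_sieve_fun (@b2 (k n)) (@bI (k n)) GE).
  set t := enorm x / dot y x.
  have -> : t *: y - v = (t - 1) *: y + (y - v) by rewrite scalerBl scale1r addrA subrK.
  have := enormD ((t - 1) *: y) (y - v); rewrite enormZ.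
  have dyx : `|dot y x - 1| <= K1 * D * kap.
    rewrite -vx -dotBl; apply: le_trans (dot_le _ _) _; apply: ler_pM => //; exact: enorm_ge0.
  have t1 : `|t - 1| <= 2 * (K1 * D + d1 + K1 * D * kap).
    have -> : t - 1 = (enorm x - dot y x) / dot y x by rewrite /t; field; rewrite gt_eqF.
    rewrite normrM normfV (gtr0_norm yx0) ler_pdivrMr//.
    apply: (@le_trans _ _ (K1 * D + d1 + K1 * D * kap)).
      have -> : enorm x - dot y x = (enorm x - 1) - (dot y x - 1) by ring.
      by apply: le_trans (ler_normB _ _) _; exact: lerD.
    have : 0 <= K1 * D + d1 + K1 * D * kap by rewrite !addr_ge0 ?mulr_ge0.
    by move: (_ + _ * kap) => q q0; rewrite (mulrC 2) -mulrA ler_peMr// -ler_pdivrMl// mulr1 -div1r.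
  have H : `|t - 1| * enorm y <= 2 * (K1 * D + D + K1 * D * kap) * (B + kap).
    apply: ler_pM => //; first exact: enorm_ge0.
    by apply: le_trans t1 _; rewrite ler_wpM2l// lerD2r lerD2l.
  by move=> tri; rewrite K2E; exact: dual_normalization_budget tri H yv d2D.
- move=> Gh Mh g h gh.
  have [|||||rh [[z z0 Mz] rlarge rhexp]] := expan (orthog X bn Gh) (orthog X bn Mh) g h.
  + exact: mxopnorm_ge0.
  + exact: mxopnorm_ge0.
  + exact: gh.
  + by move=> z; exact: enorm_mulmx.
  + by move=> z; exact: enorm_mulmx.
  exists rh; split.
    split; first by apply/(geigenvalue_orthog Xs (@b2 (k n)) (@bI (k n))); exists z.
    by move=> l /(geigenvalue_orthog Xs (@b2 (k n)) (@bI (k n)))[z' z'0]; exact: rlarge.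
  rewrite dotE' orthogB orthogZ; apply: le_trans rhexp _.
  by rewrite ler_wpM2r ?sqr_ge0.
Qed.

End sieve_limit.

(** * Events of outer probability tending to one *)

Section whp.
Context {R : realType} {dO : measure_display} {Omega : measurableType dO}.
Variable P : probability Omega R.

Definition whp (S : nat -> set Omega) : Prop :=
  mu_ext P (~` S n) @[n --> \oo] --> 0%E.

Lemma mu_ext_prob_ge0 A : (0 <= mu_ext P A)%E.
Proof. by apply: mu_ext_ge0. Qed.

Lemma whpS (S S' : nat -> set Omega) : (\forall n \near \oo, S n `<=` S' n) ->
  whp S -> whp S'.
Proof.
move=> SS' wS; apply: (squeeze_cvge _ (cvg_cst 0%E) wS).
apply: filterS SS' => n SS'; rewrite mu_ext_prob_ge0/=.
by apply: le_mu_ext; exact: subsetC.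
Qed.

Lemma whpI (S S' : nat -> set Omega) : whp S -> whp S' -> whp (fun n => S n `&` S' n).
Proof.
move=> wS wS'; have w : (mu_ext P (~` S n) + mu_ext P (~` S' n))%E @[n --> \oo] --> (0 + 0)%E by exact: cvgeD.
rewrite adde0 in w.
apply: (squeeze_cvge _ (cvg_cst 0%E) w); apply: nearW => n.
rewrite mu_ext_prob_ge0/= setCI; exact: outer_measureU2.
Qed.

Lemma is_opP (a : nat -> R) (Y : nat -> Omega -> R) :
  is_op P a (fun n w => (Y n w)%:E) <->
  forall eps, 0 < eps -> whp (fun n => [set w | `|Y n w| <= eps * a n]).
Proof.
have E eps n : [set w | ((eps * a n)%:E < `|(Y n w)%:E|)%E] =
    ~` [set w | `|Y n w| <= eps * a n].
  by apply/seteqP; split=> w /=; rewrite lte_fin ltNge => /negP.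
split=> H eps e0; apply: cvg_trans (H eps e0); apply: near_eq_cvg; apply: nearW => n;
  by rewrite -E.
Qed.

Lemma whp_markov (H : nat -> Omega -> R) (r : nat -> R) :
  (forall n, measurable_fun setT (H n)) -> (forall n w, 0 <= H n w) ->
  (\forall n \near \oo, (\int[P]_w (H n w)%:E <= (r n)%:E)%E) -> r n @[n --> \oo] --> (0 : R) ->
  forall eps, 0 < eps -> whp (fun n => [set w | H n w <= eps]).
Proof.
move=> mH H0 Hr r0 eps e0.
have mA n : measurable [set w | eps <= H n w].
  rewrite (_ : [set w | _] = H n @^-1` `[eps, +oo[); last first.
    by apply/seteqP; split => w /=; rewrite in_itv/= andbT.
  by rewrite -[_ @^-1` _]setTI; exact: mH.
have re : ((eps^-1 * r n)%:E @[n --> \oo] --> 0%E)%E.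
  apply: cvg_EFin; first exact: nearW.
  by rewrite -(mulr0 eps^-1); apply: cvgM => //; exact: cvg_cst.
apply: (squeeze_cvge _ (cvg_cst 0%E) re); apply: filterS Hr => n Hr.
rewrite mu_ext_prob_ge0/=.
apply: (@le_trans _ _ (P [set w | eps <= H n w])).
  rewrite -(measurable_mu_extE _ (mA n)); apply: le_mu_ext => w /= /negP.
  by rewrite -ltNge => /ltW.
rewrite EFinM lee_pdivlMl//.
apply: le_trans Hr; rewrite -integral_cst//.
have mHe : measurable_fun setT (fun w => (H n w)%:E) by exact/measurable_EFinP.
apply: (@le_trans _ _ (\int[P]_(w in [set w | (eps <= H n w)%R]) (H n w)%:E)%E).
  apply: ge0_le_integral => //.
  - by move=> w _; rewrite lee_fin ltW.
  - exact: measurable_funTS.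
apply: ge0_subset_integral => //.
by move=> w _; rewrite lee_fin.
Qed.

End whp.

(** * Convergence in distribution *)

Section convergence_in_distribution.
Context {R : realType} {dO : measure_display} {Omega : measurableType dO}.
Variable P : probability Omega R.

(** Only [x] is confined to the segment. A failing sequence of pairs would converge along an
    ultrafilter to a single point, at which [f] would be discontinuous. *)
Lemma uniformly_continuous_segment (f : R -> R) (M eps : R) : continuous f -> 0 < eps ->
  exists2 delta, 0 < delta & forall x y, `|x| <= M -> `|x - y| <= delta -> `|f x - f y| <= eps.
Proof.
move=> cf e0; apply: contrapT => H.
have /choice[xy xyP] : forall j : nat, exists xy : R * R,
    [/\ - M <= xy.1 <= M, `|xy.1 - xy.2| <= j.+1%:R^-1 & eps < `|f xy.1 - f xy.2|].
  move=> j; apply: contrapT => Hj; apply: H; exists j.+1%:R^-1; first by rewrite invr_gt0.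
  move=> x y xM xyj; rewrite leNgt; apply/negP => lt; apply: Hj; exists (x, y); split => //=.
  by rewrite -ler_norml.
have [U [UF UN]] := ultraFilterLemma (F := \oo) _.
have xyM j : - M <= (xy j).1 <= M by have [] := xyP j.
have [l _ lU] := bounded_ultra_cvg UF xyM.
have e2 : 0 < eps / 2 by rewrite divr_gt0.
have /cvgrPdist_lt/(_ _ e2)/nbhs_ballP[d /= d0 dP] : f x @[x --> l] --> f l by exact: cf.
have d20 : 0 < d / 2 by rewrite divr_gt0.
have U1 : U [set j | j.+1%:R^-1 < d / 2].
  apply: UN; exists (Num.bound (d / 2)^-1) => // j /= jb.
  rewrite -[ltRHS]invrK ltf_pV2 ?posrE ?ltr0n ?invr_gt0//.
  apply: lt_le_trans (archi_boundP _) _; first by rewrite invr_ge0 ltW.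
  by rewrite ler_nat ltnW.
have [j [/= h1 h2]] := filter_ex (filterI (lU _ d20) U1).
have [_ h3 h4] := xyP j.
have f1 : `|f l - f (xy j).1| < eps / 2 by apply: dP; rewrite /ball /=; lra.
have f2 : `|f l - f (xy j).2| < eps / 2.
  apply: dP; rewrite /ball /=.
  have -> : l - (xy j).2 = (l - (xy j).1) + ((xy j).1 - (xy j).2) by ring.
  have h3' := le_lt_trans h3 h2.
  by apply: le_lt_trans (ler_normD _ _) _; move: h1 h3'; lra.
have : `|f (xy j).1 - f (xy j).2| <= `|f l - f (xy j).2| + `|f l - f (xy j).1|.
  have -> : f (xy j).1 - f (xy j).2 = (f l - f (xy j).2) - (f l - f (xy j).1) by ring.
  exact: ler_normB.
by move: f1 f2 h4; lra.
Qed.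

(** A continuous stand-in for the indicator of large values, so that tightness of a sequence can be
    read off its convergence in distribution. *)
Definition ramp (M x : R) : R := Num.min 1 (Num.max 0 (`|x| - M)).

Lemma ramp_ge0 M x : 0 <= ramp M x.
Proof. by rewrite le_min ler01 le_max lexx. Qed.

Lemma ramp_le1 M x : ramp M x <= 1.
Proof. by rewrite ge_min lexx. Qed.

Lemma ramp_eq1 M x : M + 1 <= `|x| -> ramp M x = 1.
Proof. by move=> Mx; apply/min_idPl; rewrite le_max; apply/orP; right; lra. Qed.

Lemma ramp_eq0 M x : `|x| <= M -> ramp M x = 0.
Proof. by move=> xM; rewrite /ramp (max_idPl _) ?subr_le0//; apply/min_idPr. Qed.

Lemma continuous_ramp M : continuous (ramp M).
Proof.
move=> x.
have c1 : {for x, continuous ((fun=> 1) : R -> R)} by exact: cvg_cst.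
have c0 : {for x, continuous ((fun=> 0) : R -> R)} by exact: cvg_cst.
have cM : {for x, continuous ((fun y => `|y| - M) : R -> R)}.
  by apply: cvgB; [apply: cvg_norm|exact: cvg_cst].
exact: (continuous_min c1 (continuous_max c0 cM)).
Qed.

Lemma ramp_tight (mu : probability (measurableTypeR R) R) (eps : R) : 0 < eps ->
  exists2 M, 0 <= M & (\int[mu]_x (ramp M x)%:E <= eps%:E)%E.
Proof.
move=> e0; pose F (j : nat) : set (measurableTypeR R) := [set x : R | j%:R <= `|x|].
have mF j : measurable (F j).
  rewrite (_ : F j = Num.norm @^-1` `[j%:R, +oo[); last first.
    by apply/seteqP; split => w /=; rewrite in_itv/= andbT.
  by rewrite -[_ @^-1` _]setTI; exact: normr_measurable.
have F0 : \bigcap_j F j = set0.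
  apply/seteqP; split => // x Fx; have := Fx (Num.bound `|x|) I.
  rewrite /F /= leNgt archi_boundP//.
have : mu (F j) @[j --> \oo] --> mu (\bigcap_j F j).
  apply: nonincreasing_cvg_mu => //.
  - by rewrite -ge0_fin_numE// fin_num_measure.
  - exact: bigcap_measurableType.
  - by apply/nonincreasing_seqP => j; apply/subsetPset => x /=; apply: le_trans; rewrite ler_nat.
rewrite F0 measure0 => /cvge0_near_lt/(_ e0)[N _ HN].
exists N%:R => //; apply: le_trans (ltW (HN N (leqnn N))).
have -> : mu (F N) = (\int[mu]_x (\1_(F N) x)%:E)%E by rewrite integral_indic// setIT.
apply: ge0_le_integral => //.
- by move=> x _; rewrite lee_fin ramp_ge0.
- by apply/measurable_EFinP; apply: continuous_measurable_fun; exact: continuous_ramp.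
- by apply/measurable_EFinP; exact: measurable_indic.
move=> x _; rewrite lee_fin indicE.
have [xN|/negP] := boolP (x \in F N); first by rewrite ramp_le1.
rewrite inE /F /= => /negP; rewrite -ltNge => xN; by rewrite ramp_eq0// ltW.
Qed.

Lemma expectation_bounded (f : R -> R) (Y : Omega -> R) (C : R) : continuous f ->
  (forall x, `|f x| <= C) -> measurable_fun setT Y ->
  P.-integrable setT (EFin \o (fun w => f (Y w))) /\
  ('E_P[f \o Y] = (\int[P]_w f (Y w))%:E)%E.
Proof.
move=> cf fC mY; have fi : P.-integrable setT (EFin \o (fun w => f (Y w))).
  apply: (@bounded_integrable _ _ _ _ _ C) => //.
  by apply: measurableT_comp => //; exact: continuous_measurable_fun.
by split=> //; rewrite unlock -(integral_EFin fi).
Qed.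

(** The test function is uniformly continuous on a segment only. Outside it the ramp controls the
    mass of [W], and the event that [Y] and [W] differ by more than [delta] has small
    probability. *)
Lemma slutsky (Y W : nat -> Omega -> R) (v : R) :
  (forall n, measurable_fun setT (Y n)) -> (forall n, measurable_fun setT (W n)) ->
  cvg_dist_normal P W v ->
  (forall eps, 0 < eps -> whp P (fun n => [set w | `|Y n w - W n w| <= eps])) ->
  cvg_dist_normal P Y v.
Proof.
move=> mY mW [v0 Wv] YW; split => // f cf [C fC].
have C0 : 0 <= C by exact: le_trans (normr_ge0 _) (fC 0).
have cvgR (g : R -> R) (D : R) : continuous g -> (forall x, `|g x| <= D) ->
    exists l : R, (\int[centered_normal v]_x (g x)%:E)%E = l%:E /\
    \int[P]_w g (W n w) @[n --> \oo] --> l.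
  move=> cg gD; have gi : (centered_normal v).-integrable setT (EFin \o g).
    by apply: (@bounded_integrable _ _ _ _ _ D) => //; exact: continuous_measurable_fun.
  exists (\int[centered_normal v]_x g x); split; first exact: integral_EFin.
  have := Wv g cg (ex_intro _ D gD); rewrite (integral_EFin gi) => /fine_cvgP[_].
  apply: cvg_trans; apply: near_eq_cvg; apply: nearW => n /=.
  by rewrite (expectation_bounded cg gD (mW n)).2.
have [l [lE fl]] := cvgR f C cf fC; rewrite lE.
apply: cvg_EFin; first by apply: nearW => n; rewrite (expectation_bounded cf fC (mY n)).2.
apply/cvgrPdist_le => eps e0.
(* Sized for the final sum, where [6 * C * e1] has to stay below [eps / 2]. *)
have [e1 e1E] : exists e1, e1 = eps / (16 * (C + 1)) by eexists.
have C1 : 0 < 16 * (C + 1) by lra.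
have e10 : 0 < e1 by rewrite e1E divr_gt0.
have Ce1 : 16 * (C + 1) * e1 = eps by rewrite e1E mulrC divfK// gt_eqF.
have e40 : 0 < eps / 4 by rewrite divr_gt0.
have [M M0 rampM] := ramp_tight (centered_normal v) e10.
have [delta d0 ucf] := uniformly_continuous_segment (M + 1) cf e40.
have ramp1 x : `|ramp M x| <= 1 by rewrite ger0_norm ?ramp_ge0// ramp_le1.
have [l' [l'E rl']] := cvgR (ramp M) 1 (@continuous_ramp M) ramp1.
have l'e : l' <= e1 by rewrite -lee_fin -l'E.
have mB n : measurable [set w | delta < `|Y n w - W n w|].
  rewrite (_ : [set w | _] = (fun w => `|Y n w - W n w|) @^-1` `]delta, +oo[); last first.
    by apply/seteqP; split => w /=; rewrite in_itv/= andbT.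
  by rewrite -[_ @^-1` _]setTI; apply: measurableT_comp => //; exact: measurable_funB.
have PB : \forall n \near \oo, (P [set w | (delta < `|Y n w - W n w|)%R] < e1%:E)%E.
  have := cvge0_near_lt (YW _ d0) e10; apply: filterS => n; apply: le_lt_trans.
  rewrite -(measurable_mu_extE _ (mB n)); apply: le_mu_ext => w /= lt.
  by apply/negP; rewrite -ltNge.
near=> n.
have H1 : `|l - \int[P]_w f (W n w)| <= eps / 4.
  by near: n; move/cvgrPdist_le: fl; apply.
have H2 : \int[P]_w ramp M (W n w) <= 2 * e1.
  have : `|l' - \int[P]_w ramp M (W n w)| <= e1 by near: n; move/cvgrPdist_le: rl'; apply.
  by rewrite ler_distl => /andP[+ _]; move: l'e; clear -P; lra.
have H3 : fine (P [set w | delta < `|Y n w - W n w|]) <= e1.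
  rewrite -lee_fin fine_probability//; apply: ltW; near: n; exact: PB.
have [fWi _] := expectation_bounded cf fC (mW n).
have [fYi fYE] := expectation_bounded cf fC (mY n).
have [rWi _] := expectation_bounded (@continuous_ramp M) ramp1 (mW n).
have Bi := integrable_indic_prob P (mB n).
rewrite /= fYE /=.
have H4 : `|\int[P]_w f (W n w) - \int[P]_w f (Y n w)| <= eps / 4 + 2 * C * (2 * e1) + 2 * C * e1.
  rewrite -RintegralB//.
  have Di := integrable_EFinB fWi fYi.
  apply: le_trans (le_normr_Rintegral measurableT Di) _.
  (* The difference is at most [eps / 4] when both values are close and [W] is in the segment, and
     at most [2 * C] otherwise; then the ramp or the indicator equals 1. *)
  pose dom w := eps / 4 + 2 * C * ramp M (W n w) + 2 * C * \1_[set w | delta < `|Y n w - W n w|] w.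
  have c4i : P.-integrable setT (EFin \o (fun=> eps / 4)).
    by apply: (@bounded_integrable _ _ _ _ _ (eps / 4)) => // x; rewrite ger0_norm// ltW.
  have d1i := integrable_EFinD c4i (integrable_EFinZl (2 * C) rWi).
  have d2i := integrable_EFinZl (2 * C) Bi.
  have domi := integrable_EFinD d1i d2i.
  apply: (@le_trans _ _ (\int[P]_w dom w)).
    apply: le_Rintegral => //; first exact: integrable_norm Di.
    move=> w _; rewrite /dom indicE /=.
    have tri : `|f (W n w) - f (Y n w)| <= 2 * C.
      by apply: le_trans (ler_normB _ _) _; have := fC (W n w); have := fC (Y n w); clear -P; lra.
    have r0 := ramp_ge0 M (W n w).
    have r1 : 0 <= 2 * C * ramp M (W n w) by rewrite !mulr_ge0.
    have [dw|dw] := ltP delta `|Y n w - W n w|.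
      by rewrite mem_set// mulr1; move: tri r1 (ltW e40); clear -P; lra.
    rewrite memNset/=; last by apply/negP; rewrite -leNgt.
    rewrite mulr0 addr0; have [wM|Mw] := leP `|W n w| (M + 1).
      have : `|f (W n w) - f (Y n w)| <= eps / 4 by apply: ucf => //; rewrite distrC.
      by move: r1; clear -P; lra.
    by rewrite ramp_eq1 ?(ltW Mw)// mulr1; move: tri (ltW e40); clear -P; lra.
  rewrite /dom RintegralD// RintegralD//; last exact: (integrable_EFinZl (2 * C) rWi).
  have -> : \int[P]_w (2 * C * ramp M (W n w)) = 2 * C * \int[P]_w ramp M (W n w).
    by apply: RintegralZl.
  have -> : \int[P]_w (2 * C * \1_[set w | delta < `|Y n w - W n w|] w) =
      2 * C * \int[P]_w (\1_[set w | delta < `|Y n w - W n w|] w).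
    by apply: RintegralZl.
  rewrite Rintegral_prob_cst Rintegral_indic_prob//.
  by apply: lerD; [rewrite lerD2l|]; rewrite ler_wpM2l// mulr_ge0.
have -> : l - \int[P]_w f (Y n w) = (l - \int[P]_w f (W n w)) + (\int[P]_w f (W n w) - \int[P]_w f (Y n w)).
  by rewrite addrA subrK.
apply: le_trans (ler_normD _ _) _; apply: le_trans (lerD H1 H4) _.
have : 0 <= C * e1 by rewrite mulr_ge0// ltW.
by move: Ce1 (ltW e10); clear -P; lra.
Unshelve. all: by end_near. Qed.

Lemma cvg_dist_normal_sum (Y Z : nat -> Omega -> R) (V : 'M[R]_2) :
  cvg_dist_normal2 P Y Z V ->
  let h : 'cV[R]_2 := const_mx 1 in
  cvg_dist_normal P (fun n w => Y n w + Z n w) ((h^T *m V *m h) 0 0).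
Proof.
move=> [mu [[Vs Vp] muV] YZ] h; split; first exact: Vp.
move=> f cf [C fC].
have -> : (\int[centered_normal ((h^T *m V *m h) 0 0)%R]_x (f x)%:E = \int[mu]_z (f (z.1 + z.2)%R)%:E)%E.
  have ms : measurable_fun setT (fun z : R * R => z.1 + z.2) by exact: measurable_funD.
  have mf : measurable_fun setT f by exact: continuous_measurable_fun.
  have fi : mu.-integrable setT (EFin \o (fun z => f (z.1 + z.2))).
    by apply: (@bounded_integrable _ _ _ _ _ C) => //; exact: measurableT_comp.
  have ni : (centered_normal ((h^T *m V *m h) 0 0)).-integrable setT (EFin \o f).
    exact: (@bounded_integrable _ _ _ _ _ C).
  rewrite (integral_EFin fi) (integral_EFin ni); congr EFin; apply/esym.
  apply: (Rintegral_law ms _ mf fC) => // B mB.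
  rewrite -muV//; congr (mu _); apply/seteqP; split=> z /=; by rewrite !mxE !mul1r.
have := YZ (fun z => f (z.1 + z.2)) _ (ex_intro _ C (fun z => fC (z.1 + z.2))).
apply; move=> z; apply: continuous_comp; last exact: cf.
by apply: cvgD; [exact: cvg_fst|exact: cvg_snd].
Qed.

End convergence_in_distribution.

(** * Convolution of centered normal laws *)

Section normal_law.
Context {R : realType}.
Local Notation leb := (@lebesgue_measure R).

Lemma ge0_integral_normal (s : R) (f : R -> \bar R) : s != 0 ->
  measurable_fun [set: R] f -> (forall x, 0 <= f x)%E ->
  (\int[normal_prob 0 s]_x f x = \int[leb]_x (f x * (normal_pdf 0 s x)%:E))%E.
Proof.
move=> s0 mf f0; apply: (@ge0_integral_density _ _ _ leb (normal_prob 0 s)) => //.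
- exact: measurable_normal_pdf.
- by move=> x; exact: normal_pdf_ge0.
Qed.

Lemma normal_peak_mul (s t r : R) : 0 < s -> 0 < t -> 0 < r ->
  normal_peak s * normal_peak t = normal_peak r * normal_peak (s * t / r).
Proof.
move=> s0 t0 r0.
have pk x : 0 < x -> normal_peak x = (x * Num.sqrt (pi *+ 2))^-1.
  move=> x0; rewrite /normal_peak -mulrnAr sqrtrM ?sqr_ge0// sqrtr_sqr.
  by rewrite gtr0_norm.
rewrite !pk ?divr_gt0 ?mulr_gt0//.
have : Num.sqrt (pi *+ 2 : R) != 0.
  by rewrite gt_eqF// sqrtr_gt0 pmulrn_lgt0// pi_gt0.
set c := Num.sqrt _ => c0.
by field; rewrite c0 !gt_eqF.
Qed.

(** Completing the square: given the sum [z], the first summand is normal with mean $z s^2/r^2$ and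
    standard deviation $st/r$. *)
Lemma normal_pdf_convolution (s t r : R) (x z : R) : 0 < s -> 0 < t -> 0 < r ->
  r ^+ 2 = s ^+ 2 + t ^+ 2 ->
  normal_pdf 0 s x * normal_pdf 0 t (z - x)
  = normal_pdf 0 r z * normal_pdf (z * s ^+ 2 / r ^+ 2) (s * t / r) x.
Proof.
move=> s0 t0 r0 rE.
have u0 : 0 < s * t / r by rewrite divr_gt0 ?mulr_gt0.
rewrite !normal_pdfE ?gt_eqF// [LHS]mulrACA [RHS]mulrACA.
rewrite (normal_peak_mul s0 t0 r0); congr (_ * _).
rewrite /normal_fun -!expRD; congr expR.
have tE : t ^+ 2 = r ^+ 2 - s ^+ 2 by rewrite rE addrC addKr.
have : t ^+ 2 != 0 by rewrite sqrf_eq0 gt_eqF.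
have : s ^+ 2 != 0 by rewrite sqrf_eq0 gt_eqF.
have : r ^+ 2 != 0 by rewrite sqrf_eq0 gt_eqF.
rewrite expr_div_n exprMn !subr0 !mulNr !mulr2n tE.
move: (r ^+ 2) (s ^+ 2) => a c a0 c0 ac.
have dbl y : y + y = 2 * y :> R by ring.
rewrite !dbl; field.
by rewrite ?a0 ?c0 ?ac ?pnatr_eq0.
Qed.

(** Tonelli after the substitution [z = x + y]; the conditional density of [normal_pdf_convolution]
    integrates to one. *)
Lemma ge0_convolution_normal (s t r : R) (F : R -> R) : 0 < s -> 0 < t -> 0 < r ->
  r ^+ 2 = s ^+ 2 + t ^+ 2 -> continuous F -> (forall x, 0 <= F x) ->
  (\int[normal_prob 0 s]_x \int[normal_prob 0 t]_y (F (x + y))%:E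
   = \int[normal_prob 0 r]_z (F z)%:E)%E.
Proof.
move=> s0 t0 r0 rE cF F0.
have mF : measurable_fun setT F by exact: continuous_measurable_fun.
have pdf0 a b c : (0 <= (normal_pdf a b c : R)%:E)%E by rewrite lee_fin normal_pdf_ge0.
have mpdf a b : measurable_fun setT (normal_pdf a b : R -> R).
  exact: measurable_normal_pdf.
pose k (z x : R) := ((F z)%:E * ((normal_pdf 0 s x)%:E * (normal_pdf 0 t (z - x))%:E))%E.
have mk : measurable_fun setT (fun p : R * R => k p.2 p.1).
  apply/measurable_EFinP; apply: measurable_funM.
    by apply: measurableT_comp.
  apply: measurable_funM; first exact: measurableT_comp.
  by apply: measurableT_comp => //; apply: measurable_funB.
have k0 z x : (0 <= k z x)%E by rewrite /k -!EFinM lee_fin !mulr_ge0// normal_pdf_ge0.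
rewrite (ge0_integral_normal (lt0r_neq0 r0)); [|exact/measurable_EFinP|by move=> x; rewrite lee_fin].
transitivity (\int[leb]_x \int[leb]_z k z x)%E; last first.
  rewrite (@fubini_tonelli _ _ _ _ _ leb leb (fun p => k p.2 p.1))//=.
  apply: eq_integral => z _.
  have kE x : k z x = ((F z * normal_pdf 0 r z)%:E
      * (normal_pdf (z * s ^+ 2 / r ^+ 2) (s * t / r) x)%:E)%E.
    by rewrite /k -!EFinM (normal_pdf_convolution _ _ s0 t0 r0 rE) mulrA.
  under eq_integral do rewrite kE.
  rewrite ge0_integralZl//=.
  - by rewrite integral_normal_pdf mule1 EFinM.
  - by apply/measurable_EFinP; exact: measurable_normal_pdf.
  - by rewrite lee_fin mulr_ge0// normal_pdf_ge0.
have inner x : (\int[normal_prob 0 t]_y (F (x + y))%:E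
    = \int[leb]_z ((F z)%:E * (normal_pdf 0 t (z - x))%:E))%E.
  rewrite (ge0_integral_normal (lt0r_neq0 t0)); last by move=> y; rewrite lee_fin.
    2: by apply/measurable_EFinP; apply: measurableT_comp => //; apply: measurable_funD.
  have dE : (fun z : R => z - x)^`()%classic = cst 1.
    apply/funext => z; rewrite derive1E deriveB//= derive_id derive_cst subr0//.
  rewrite (@increasing_ge0_integration_by_substitutionT _ (fun z => z - x)
     (fun y => F (x + y) * normal_pdf 0 t y))//=.
  - apply: eq_integral => z _; rewrite dE /= mulr1 -EFinM; congr (F _ * _)%:E.
    by rewrite addrC subrK.
  - by move=> a c ac; rewrite ltrD2r.
  - by rewrite dE; exact: cst_continuous.
  - by rewrite dE; exact: is_cvg_cst.
  - by rewrite dE; exact: is_cvg_cst.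
  - exact: cvg_addrr_Ny.
  - exact: cvg_addrr.
  - move=> y; apply: cvgM; last exact: continuous_normal_pdf (lt0r_neq0 t0) y.
    apply: (@continuous_comp _ _ _ (fun y : R => x + y) F); last exact: cF.
    by apply: cvgD; [exact: cvg_cst|exact: cvg_id].
  - by move=> y; rewrite mulr_ge0// normal_pdf_ge0.
under eq_integral do rewrite inner.
have minner : measurable_fun [set: R]
    (fun x : R => \int[leb]_z ((F z)%:E * (normal_pdf 0 t (z - x))%:E))%E.
  apply: (@measurable_fun_fubini_tonelli_F _ _ _ _ _ leb
     (fun p : R * R => (F p.2)%:E * (normal_pdf 0 t (p.2 - p.1))%:E)%E).
  - apply/measurable_EFinP; apply: measurable_funM; first exact: measurableT_comp.
    by apply: measurableT_comp => //; apply: measurable_funB.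
  - by move=> p; rewrite mule_ge0// lee_fin.
rewrite (ge0_integral_normal (lt0r_neq0 s0)); [|exact: minner|]; last first.
  by move=> x; apply: integral_ge0 => z _; rewrite mule_ge0// lee_fin.
apply: eq_integral => x _; rewrite muleC -ge0_integralZl//=.
- by apply: eq_integral => z _; rewrite /k muleCA.
- apply/measurable_EFinP; apply: measurable_funM => //.
  by apply: measurableT_comp => //; apply: measurable_funB.
- by move=> z _; rewrite mule_ge0// lee_fin.
Qed.

Lemma ge0_integral_reflection (f : R -> \bar R) :
  measurable_fun [set: R] f -> (forall x, 0 <= f x)%E ->
  (\int[leb]_x f x = \int[leb]_x f (- x)%R)%E.
Proof.
move=> mf f0.
have mg : measurable_fun [set: R] (f \o -%R) by apply: measurableT_comp.
have split (g : R -> \bar R) : measurable_fun [set: R] g -> (forall x, 0 <= g x)%E ->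
    (\int[leb]_x g x = \int[leb]_(x in `]-oo, 0%R]) g x
                      + \int[leb]_(x in `[0%R, +oo[) g x)%E.
  move=> mg' g0; rewrite -{1}setC0 -(set_itvoc0 0%R) setCitv/= ge0_integral_setU//=.
  - congr (_ + _)%E; rewrite integral_itv_obnd_cbnd//; exact: measurable_funTS.
  - exact: measurable_funTS.
  - rewrite disj_set2E; apply/eqP; rewrite -subset0 => x []/= /[!in_itv]/=.
    by rewrite leNgt andbT => /negP.
rewrite (split f)// (split (f \o -%R))//= [RHS]addeC.
rewrite (ge0_integration_by_substitution0 mg)//=.
rewrite (ge0_integration_by_substitution0 mf)//=.
congr (_ + _)%E; by apply: eq_integral => x _; rewrite ?opprK.
Qed.

(** The density is even and the sine odd. The argument is run on $1 \pm \sin$, which is nonnegative,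
    so that the reflection formula for nonnegative functions applies. *)
Lemma integral_normal_sin (s : R) : s != 0 ->
  \int[normal_prob 0 s]_x sin x = 0.
Proof.
move=> s0.
have ms : measurable_fun setT (@sin R).
  by apply: continuous_measurable_fun; exact: continuous_sin.
have ints : (normal_prob 0 s).-integrable setT (EFin \o @sin R).
  by apply: (@bounded_integrable _ _ _ _ _ 1) => // x; exact: sin_max.
have int1 : (normal_prob 0 s).-integrable setT (EFin \o (cst 1 : R -> R)).
  by apply: (@bounded_integrable _ _ _ _ _ 1) => // x; rewrite normr1.
have ge0 (e : R) : `|e| = 1 -> forall x, 0 <= 1 + e * sin x.
  move=> e1 x; rewrite -lerBlDl sub0r lerNl (le_trans (ler_norm _))//.
  by rewrite normrN normrM e1 mul1r sin_max.
have mes (e : R) : measurable_fun [set: R] (fun x : R => (1 + e * sin x)%:E).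
  by apply/measurable_EFinP; apply: measurable_funD => //; apply: measurable_funM.
have E (e : R) : (\int[normal_prob 0 s]_x (1 + e * sin x)%:E
    = (1 + e * \int[normal_prob 0 s]_x sin x)%:E)%E.
  have /= -> := integral_EFin (integrable_EFinD int1 (integrable_EFinZl e ints)).
  have /= -> := RintegralD measurableT int1 (integrable_EFinZl e ints).
  by rewrite Rintegral_prob_cst RintegralZl.
have pdfN x : normal_pdf 0 s (- x) = normal_pdf 0 s x.
  by rewrite !normal_pdfE// /normal_fun !subr0 sqrrN.
have : (\int[normal_prob 0 s]_x (1 + 1 * sin x)%:E
    = \int[normal_prob 0 s]_x (1 + -1 * sin x)%:E)%E.
  rewrite (ge0_integral_normal s0 (mes 1)); last by move=> x; rewrite lee_fin ge0// normr1.
  rewrite (ge0_integral_normal s0 (mes (-1))); last by move=> x; rewrite lee_fin ge0// normrN1.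
  rewrite ge0_integral_reflection; last 2 first.
  - apply: emeasurable_funM => //; apply/measurable_EFinP; exact: measurable_normal_pdf.
  - by move=> x; rewrite mule_ge0// lee_fin ?ge0 ?normr1// normal_pdf_ge0.
  by apply: eq_integral => x _; rewrite pdfN sinN mulN1r mul1r.
rewrite !E => -[] /addrI; rewrite mul1r mulN1r => /eqP.
by rewrite -addr_eq0 -mulr2n mulrn_eq0 /= => /eqP.
Qed.

(** The characteristic function at 1 of the centered normal law of variance [v], real by
    symmetry. *)
Definition normal_cos (v : R) := \int[centered_normal v]_x cos x.

Lemma normal_cos0 : normal_cos 0 = 1.
Proof.
rewrite /normal_cos /centered_normal eqxx /Rintegral integral_dirac//=.
  by rewrite indicE in_setT mul1r cos0.
by apply/measurable_EFinP; apply: continuous_measurable_fun; exact: continuous_cos.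
Qed.

Lemma integral_1_cos_sin (mu : probability (measurableTypeR R) R) (a b C S : R) :
  \int[mu]_x cos x = C -> \int[mu]_x sin x = S ->
  (\int[mu]_x (1 + (a * cos x + b * sin x))%:E = (1 + (a * C + b * S))%:E)%E.
Proof.
move=> CE SE.
have intc : mu.-integrable setT (EFin \o @cos R).
  apply: (@bounded_integrable _ _ _ _ _ 1) => [|x]; last exact: cos_max.
  by apply: continuous_measurable_fun; exact: continuous_cos.
have ints : mu.-integrable setT (EFin \o @sin R).
  apply: (@bounded_integrable _ _ _ _ _ 1) => [|x]; last exact: sin_max.
  by apply: continuous_measurable_fun; exact: continuous_sin.
have int1 : mu.-integrable setT (EFin \o (cst 1 : R -> R)).
  by apply: (@bounded_integrable _ _ _ _ _ 1) => // x; rewrite normr1.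
have I1 := integrable_EFinZl a intc.
have I2 := integrable_EFinZl b ints.
have I3 := integrable_EFinD I1 I2.
have /= -> := integral_EFin (integrable_EFinD int1 I3).
have /= -> := RintegralD measurableT int1 I3.
congr (_ + _)%:E; first exact: Rintegral_prob_cst.
have /= -> := RintegralD measurableT I1 I2.
congr (_ + _).
  by rewrite -CE; exact: RintegralZl.
by rewrite -SE; exact: RintegralZl.
Qed.

(** The addition formula expands the cosine of the sum and the sine terms have mean zero; adding 1
    to the cosine makes the convolution formula for nonnegative functions applicable. *)
Lemma integral_normal_cosD (s t r : R) : 0 < s -> 0 < t -> 0 < r ->
  r ^+ 2 = s ^+ 2 + t ^+ 2 -> \int[normal_prob 0 r]_x cos x =
    \int[normal_prob 0 s]_x cos x * \int[normal_prob 0 t]_x cos x.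
Proof.
move=> s0 t0 r0 rE.
have cF : continuous (fun x : R => 1 + cos x).
  by move=> x; apply: cvgD; [exact: cvg_cst|exact: continuous_cos].
have F0 (x : R) : 0 <= 1 + cos x by rewrite -lerBlDl sub0r cos_geN1.
have H := ge0_convolution_normal s0 t0 r0 rE cF F0.
have Ss := integral_normal_sin (lt0r_neq0 s0).
have St := integral_normal_sin (lt0r_neq0 t0).
have Sr := integral_normal_sin (lt0r_neq0 r0).
have [Is IsE] : exists I, \int[normal_prob 0 s]_x cos x = I by eexists.
have [It ItE] : exists I, \int[normal_prob 0 t]_x cos x = I by eexists.
have [Ir IrE] : exists I, \int[normal_prob 0 r]_x cos x = I by eexists.
have Rr : (\int[normal_prob 0 r]_z (1 + cos z)%:E = (1 + Ir)%:E)%E.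
  transitivity (\int[normal_prob 0 r]_z (1 + (1 * cos z + 0 * sin z))%:E)%E.
    by apply: eq_integral => x _; rewrite mul1r mul0r addr0.
  by apply: etrans (integral_1_cos_sin _ _ IrE Sr) _; rewrite mul1r mul0r addr0.
have L1 x : (\int[normal_prob 0 t]_y (1 + cos (x + y))%:E = (1 + It * cos x)%:E)%E.
  transitivity (\int[normal_prob 0 t]_y (1 + (cos x * cos y + - sin x * sin y))%:E)%E.
    by apply: eq_integral => y _; rewrite cosD mulNr.
  apply: etrans (integral_1_cos_sin _ _ ItE St) _; rewrite mulr0 addr0.
  by congr (_ + _)%:E; exact: mulrC.
have L2 : (\int[normal_prob 0 s]_x (1 + It * cos x)%:E = (1 + It * Is)%:E)%E.
  transitivity (\int[normal_prob 0 s]_x (1 + (It * cos x + 0 * sin x))%:E)%E.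
    by apply: eq_integral => x _; rewrite mul0r addr0.
  by apply: etrans (integral_1_cos_sin _ _ IsE Ss) _; rewrite mul0r addr0.
apply: (etrans IrE); apply: etrans (congr2 *%R (esym IsE) (esym ItE)).
have : (1 + It * Is)%:E = (1 + Ir)%:E.
  apply: (etrans (esym L2)); apply: etrans Rr; apply: etrans H.
  by apply: eq_integral => x _; exact/esym/L1.
by move=> -[] /addrI <-; exact: mulrC.
Qed.

Lemma normal_cosD (v w : R) : 0 <= v -> 0 <= w ->
  normal_cos (v + w) = normal_cos v * normal_cos w.
Proof.
rewrite le_eqVlt => /predU1P[<- _|v0]; first by rewrite add0r normal_cos0 mul1r.
rewrite le_eqVlt => /predU1P[<-|w0]; first by rewrite addr0 normal_cos0 mulr1.
rewrite /normal_cos /centered_normal !gt_eqF ?addr_gt0//.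
apply: integral_normal_cosD; rewrite ?sqrtr_gt0 ?addr_gt0//.
by rewrite !sqr_sqrtr// ltW// addr_gt0.
Qed.

End normal_law.

(** * Trigonometric polynomials imitating indicators *)

Section bump.
Context {R : realType}.

Lemma onem_expr_le (x : R) n : 0 <= x <= 1 -> (1 - x) ^+ n * (1 + n%:R * x) <= 1.
Proof.
move=> /andP[x0 x1]; elim: n => [|n IH]; first by rewrite expr0 mul0r addr0 mul1r.
have y0 : 0 <= (1 - x) ^+ n by rewrite exprn_ge0// subr_ge0.
apply: le_trans IH; rewrite exprS mulrAC mulrC ler_wpM2l//.
rewrite -natr1; have : 0 <= n%:R :> R by [].
nra.
Qed.

Lemma expr_ge_bernoulli (x : R) n : 0 <= x <= 1 -> 1 - n%:R * x <= (1 - x) ^+ n.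
Proof.
move=> /andP[x0 x1]; elim: n => [|n IH]; first by rewrite expr0 mul0r subr0.
rewrite exprS; apply: (@le_trans _ _ ((1 - x) * (1 - n%:R * x))); last first.
  by rewrite ler_wpM2l// subr_ge0.
rewrite -natr1; have : 0 <= n%:R :> R by [].
nra.
Qed.

Lemma expr_small (x e : R) : 0 <= x < 1 -> 0 < e ->
  exists N, forall n, (N <= n)%N -> x ^+ n < e.
Proof.
move=> /andP[x0 x1] e0.
have x1' : `|x| < 1 by rewrite ger0_norm.
have /cvgrPdist_lt /(_ _ e0) [N _ HN] := cvg_geometric 1 x1'.
exists N => n Nn; have := HN n Nn.
by rewrite /geometric /= mul1r sub0r normrN ger0_norm ?exprn_ge0.
Qed.

(** The power construction of the Stone-Weierstrass theorem applied to half of [1 + cos (l * x)]: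
    for suitable [p] and [q] it is near 0 where that quantity is below one level and near 1 where it
    is above a larger one. *)
Definition bump (p q : nat) (l x : R) : R :=
  1 - (1 - ((1 + cos (l * x)) / 2) ^+ p) ^+ q.

Lemma bump_arg p l x : 0 <= ((1 + cos (l * x)) / 2 : R) ^+ p <= 1.
Proof.
have := cos_max (l * x); rewrite ler_norml => /andP[c1 c2].
have t0 : 0 <= (1 + cos (l * x)) / 2 by lra.
by rewrite exprn_ge0//= exprn_ile1//; lra.
Qed.

Lemma bump_ge0 p q l x : 0 <= bump p q l x.
Proof.
have /andP[t0 t1] := bump_arg p l x.
by rewrite /bump subr_ge0 exprn_ile1 ?subr_ge0// gerBl.
Qed.

Lemma bump_le1 p q l x : bump p q l x <= 1.
Proof.
have /andP[t0 t1] := bump_arg p l x.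
by rewrite /bump gerBl exprn_ge0// subr_ge0.
Qed.

(** With [t1 < t2] the two levels, [p] makes $(t_1/t_2)^p$ tiny and [q] is the integer just above
    $1/(z t_2^p)$. Then $q t^p \le z$ below [t1], where Bernoulli's inequality concludes, and $q t^p
    \ge 1/z$ above [t2], where [onem_expr_le] does. *)
Lemma bump_exists (l c1 c2 z : R) : -1 <= c1 -> c1 < c2 -> c2 <= 1 -> 0 < z ->
  exists p q, (forall x, cos (l * x) <= c1 -> bump p q l x <= z) /\
              (forall x, c2 <= cos (l * x) -> 1 - z <= bump p q l x).
Proof.
move=> c1N c12 c2l z0.
pose t1 := (1 + c1) / 2; pose t2 := (1 + c2) / 2.
have t10 : 0 <= t1 by rewrite /t1; lra.
have t12 : t1 < t2 by rewrite /t1 /t2; lra.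
have t21 : t2 <= 1 by rewrite /t2; lra.
have t20 : 0 < t2 by exact: le_lt_trans t12.
have r1 : 0 <= t1 / t2 < 1 by rewrite ltr_pdivrMr// mul1r t12 andbT divr_ge0// ltW.
have z20 : 0 < z ^+ 2 / 2 by rewrite divr_gt0// exprn_gt0.
have z2 : 0 < z / 2 by rewrite divr_gt0.
have [N1 HN1] := expr_small r1 z20.
have r2 : 0 <= t1 < 1 by rewrite t10/= (lt_le_trans t12).
have [N2 HN2] := expr_small r2 z2.
pose p := maxn N1 N2.
have t2p : 0 < t2 ^+ p by exact: exprn_gt0.
have t2p1 : t2 ^+ p <= 1 by rewrite exprn_ile1// ltW.
have h1 : t1 ^+ p <= z ^+ 2 / 2 * t2 ^+ p.
  by rewrite -ler_pdivrMr// -expr_div_n ltW// HN1// leq_maxl.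
have h2 : t1 ^+ p <= z / 2 by rewrite ltW// HN2// leq_maxr.
have w0 : 0 <= (z * t2 ^+ p)^-1 by rewrite invr_ge0 mulr_ge0// ltW.
pose q := (Num.truncn (z * t2 ^+ p)^-1).+1.
have /andP[q1 q2] := truncn_itv w0.
have q2' : (z * t2 ^+ p)^-1 < q%:R by [].
have q1' : q%:R <= (z * t2 ^+ p)^-1 + 1 by rewrite -natr1 lerD2r.
have zt0 : 0 < z * t2 ^+ p by rewrite mulr_gt0.
exists p, q; split => x hx.
- rewrite /bump; have := bump_arg p l x.
  set u := _ ^+ p => u01.
  have ut : u <= t1 ^+ p.
    have := cos_max (l * x); rewrite ler_norml => /andP[h h'].
    by apply: lerXn2r; rewrite ?nnegrE /t1; lra.
  have := expr_ge_bernoulli q u01.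
  suff : q%:R * u <= z by lra.
  have u0 : 0 <= u by case/andP : u01.
  apply: (@le_trans _ _ (((z * t2 ^+ p)^-1 + 1) * t1 ^+ p)).
    by apply: ler_pM.
  rewrite mulrDl mul1r; apply: (@le_trans _ _ (z / 2 + z / 2)); last lra.
  rewrite lerD// ler_pdivrMl// (le_trans h1)// le_eqVlt.
  by apply/orP; left; apply/eqP; field.
- rewrite /bump; have := bump_arg p l x.
  set u := _ ^+ p => u01.
  have ut : t2 ^+ p <= u.
    have := cos_max (l * x); rewrite ler_norml => /andP[h h'].
    by apply: lerXn2r; rewrite ?nnegrE /t2; lra.
  have := onem_expr_le q u01.
  have k0 : 0 <= (1 - u) ^+ q by rewrite exprn_ge0// subr_ge0; case/andP : u01.
  have : 1 <= z * (q%:R * u).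
    apply: (@le_trans _ _ (z * (q%:R * t2 ^+ p))); last first.
      by rewrite ler_pM2l// ler_wpM2l.
    rewrite mulrCA mulrC -ler_pdivrMl// mulr1 ltW//.
  move: (q%:R * u) k0 => w; move: ((1 - u) ^+ q) => k k0 zw kw.
  have : k <= z.
    have : k * w * z <= z.
      have kw1 : k * w <= 1 by rewrite mulrDr mulr1 in kw; lra.
      by rewrite -[leRHS]mul1r ler_pM2r.
    by rewrite -mulrA [w * z]mulrC; nra.
  lra.
Qed.

Definition trig (s : seq (R * R)) (x : R) := \sum_(c <- s) c.1 * cos (c.2 * x).

Definition trig_mul (s u : seq (R * R)) : seq (R * R) :=
  flatten [seq [seq (c.1 * e.1 / 2, c.2 + e.2) | e <- u] ++
               [seq (c.1 * e.1 / 2, c.2 - e.2) | e <- u] | c <- s].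

Lemma cos_mul (x y : R) : cos x * cos y = (cos (x + y) + cos (x - y)) / 2.
Proof. by rewrite cosD cosB; field. Qed.

Lemma trig_cat s u x : trig (s ++ u) x = trig s x + trig u x.
Proof. by rewrite /trig big_cat. Qed.

Lemma trig_mulE s u x : trig (trig_mul s u) x = trig s x * trig u x.
Proof.
rewrite /trig /trig_mul big_flatten big_map mulr_suml; apply: eq_bigr => c _.
rewrite big_cat /= !big_map -big_split /= mulr_sumr; apply: eq_bigr => e _.
rewrite mulrDl mulrBl -[RHS]mulrA [cos _ * (_ * _)]mulrCA cos_mul; ring.
Qed.

Definition is_trig (f : R -> R) := exists s, forall x, trig s x = f x.

Lemma is_trig_cst a : is_trig (fun=> a).
Proof. by exists [:: (a, 0)] => x; rewrite /trig big_seq1 /= mul0r cos0 mulr1. Qed.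

Lemma is_trig_cos l : is_trig (fun x => cos (l * x)).
Proof. by exists [:: (1, l)] => x; rewrite /trig big_seq1 /= mul1r. Qed.

Lemma is_trigD f g : is_trig f -> is_trig g -> is_trig (fun x => f x + g x).
Proof. by move=> [s fs] [u gu]; exists (s ++ u) => x; rewrite trig_cat fs gu. Qed.

Lemma is_trigM f g : is_trig f -> is_trig g -> is_trig (fun x => f x * g x).
Proof. by move=> [s fs] [u gu]; exists (trig_mul s u) => x; rewrite trig_mulE fs gu. Qed.

Lemma is_trigX f n : is_trig f -> is_trig (fun x => f x ^+ n).
Proof.
move=> tf; elim: n => [|n IH].
  by have [s hs] := is_trig_cst 1; exists s => x; rewrite hs expr0.
by have [s hs] := is_trigM tf IH; exists s => x; rewrite hs exprS.
Qed.

Lemma is_trig_bump p q l : is_trig (bump p q l).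
Proof.
have H0 : is_trig (fun x => (1 + cos (l * x)) / 2).
  by apply: is_trigM; [apply: is_trigD; [exact: is_trig_cst|exact: is_trig_cos]|exact: is_trig_cst].
have H1 : is_trig (fun x => 1 + -1 * ((1 + cos (l * x)) / 2) ^+ p).
  by apply: is_trigD; [exact: is_trig_cst|apply: is_trigM; [exact: is_trig_cst|exact: is_trigX]].
have [s hs] : is_trig (fun x => 1 + -1 * (1 + -1 * ((1 + cos (l * x)) / 2) ^+ p) ^+ q).
  by apply: is_trigD; [exact: is_trig_cst|apply: is_trigM; [exact: is_trig_cst|exact: is_trigX]].
by exists s => x; rewrite hs /bump !mulN1r.
Qed.

End bump.

(** * Formal linear combinations, covariances and sums of cosines *)

Section linear_combinations.
Context {R : realType} {T : Type}.
Implicit Types (s u : seq (R * T)) (Z : T -> R).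

Definition lcomb Z s : R := \sum_(p <- s) p.1 * Z p.2.

Definition lscale (a : R) s := [seq (a * p.1, p.2) | p <- s].

(** Membership is given by recursion on the list, since the index type is arbitrary and may lack
    decidable equality. *)
Fixpoint indices_in (G : set T) s : Prop :=
  if s is p :: s' then G p.2 /\ indices_in G s' else True.

Lemma lcomb_cat Z s u : lcomb Z (s ++ u) = lcomb Z s + lcomb Z u.
Proof. by rewrite /lcomb big_cat. Qed.

Lemma lcomb_scale Z a s : lcomb Z (lscale a s) = a * lcomb Z s.
Proof. by rewrite /lcomb big_map mulr_sumr; apply: eq_bigr => p _; rewrite mulrA. Qed.

Lemma lcomb1 Z t : lcomb Z [:: (1, t)] = Z t.
Proof. by rewrite /lcomb big_seq1 mul1r. Qed.

Lemma indices_in_cat G s u : indices_in G s -> indices_in G u -> indices_in G (s ++ u).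
Proof. by elim: s => //= p s IH [Gp Gs] Gu; split => //; exact: IH. Qed.

Lemma indices_in_scale G a s : indices_in G s -> indices_in G (lscale a s).
Proof. by elim: s => //= p s IH [Gp Gs]; split => //; exact: IH. Qed.

Lemma indices_in_nth G s (p0 : R * T) i : indices_in G s -> (i < size s)%N ->
  G (nth p0 s i).2.
Proof. by elim: s i => //= p s IH [|i] [Gp Gs]//=; exact: IH. Qed.

Lemma indices_in_sub (G G' : set T) s : (G `<=` G') -> indices_in G s -> indices_in G' s.
Proof. by move=> GG; elim: s => //= p s IH [/GG Gp Gs]; split => //; exact: IH. Qed.

Variable K : T -> T -> R.

(** The covariance that the kernel [K] induces between two linear combinations. *)
Definition qform s u : R := \sum_(p <- s) \sum_(q <- u) p.1 * q.1 * K p.2 q.2.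

Lemma qform_catl s s' u : qform (s ++ s') u = qform s u + qform s' u.
Proof. by rewrite /qform big_cat. Qed.

Lemma qform_catr s u u' : qform s (u ++ u') = qform s u + qform s u'.
Proof. by rewrite /qform -big_split; apply: eq_bigr => p _; rewrite big_cat. Qed.

Lemma qform_scalel a s u : qform (lscale a s) u = a * qform s u.
Proof.
rewrite /qform big_map mulr_sumr; apply: eq_bigr => p _.
by rewrite mulr_sumr; apply: eq_bigr => q _ /=; rewrite !mulrA.
Qed.

Lemma qform_scaler a s u : qform s (lscale a u) = a * qform s u.
Proof.
rewrite /qform mulr_sumr; apply: eq_bigr => p _.
by rewrite big_map mulr_sumr; apply: eq_bigr => q _ /=; ring.
Qed.

Lemma qform1 t t' : qform [:: (1, t)] [:: (1, t')] = K t t'.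
Proof. by rewrite /qform !big_seq1 /= !mul1r. Qed.

(** The test functions on which processes are compared: by the product formula for cosines they form
    an algebra, and the mean of each term is determined by the covariance. *)
Definition cos_sum (Z : T -> R) (s : seq (R * seq (R * T))) : R :=
  \sum_(c <- s) c.1 * cos (lcomb Z c.2).

Definition cos_sum_mul (s u : seq (R * seq (R * T))) :=
  flatten [seq [seq (c.1 * e.1 / 2, c.2 ++ e.2) | e <- u] ++
               [seq (c.1 * e.1 / 2, c.2 ++ lscale (-1) e.2) | e <- u] | c <- s].

Lemma cos_sum_mulE Z (s u : seq (R * seq (R * T))) : cos_sum Z (cos_sum_mul s u) = cos_sum Z s * cos_sum Z u.
Proof.
rewrite /cos_sum /cos_sum_mul big_flatten big_map mulr_suml; apply: eq_bigr => c _.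
rewrite big_cat /= !big_map -big_split /= mulr_sumr; apply: eq_bigr => e _.
rewrite !lcomb_cat lcomb_scale mulN1r.
rewrite -[RHS]mulrA [cos _ * (_ * _)]mulrCA cos_mul; ring.
Qed.

Definition trig_lcomb (a : seq (R * R)) s := [seq (c.1, lscale c.2 s) | c <- a].

Lemma trig_lcombE Z a s : cos_sum Z (trig_lcomb a s) = trig a (lcomb Z s).
Proof. by rewrite /cos_sum big_map; apply: eq_bigr => c _; rewrite lcomb_scale. Qed.

Fixpoint cos_sum_in (G : set T) (s : seq (R * seq (R * T))) : Prop :=
  if s is c :: s' then indices_in G c.2 /\ cos_sum_in G s' else True.

Lemma cos_sum_in_cat G (s u : seq (R * seq (R * T))) : cos_sum_in G s -> cos_sum_in G u -> cos_sum_in G (s ++ u).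
Proof. by elim: s => //= p s IH [Gp Gs] Gu; split => //; exact: IH. Qed.

Lemma cos_sum_in_mul G (s u : seq (R * seq (R * T))) : cos_sum_in G s -> cos_sum_in G u ->
  cos_sum_in G (cos_sum_mul s u).
Proof.
move=> + Gu; elim: s => //= c s IH [Gc Gs]; rewrite /cos_sum_mul /=.
apply: cos_sum_in_cat; last exact: IH.
apply: cos_sum_in_cat.
- by elim: u Gu {IH} => //= e u IHu [Ge Gu]; split; [exact: indices_in_cat|exact: IHu].
- elim: u Gu {IH} => //= e u IHu [Ge Gu]; split; last exact: IHu.
  by apply: indices_in_cat => //; exact: indices_in_scale.
Qed.

Lemma trig_lcomb_in G a s : indices_in G s -> cos_sum_in G (trig_lcomb a s).
Proof. by move=> Gs; elim: a => //= c a IH; split => //; exact: indices_in_scale. Qed.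

End linear_combinations.

(** * Gaussian processes compared through their covariance *)

Section gaussian.
Context d (Omega : measurableType d) (R : realType) (P : probability Omega R).
Context (T : Type) (G : set T) (K : T -> T -> R).
Hypothesis Ksym : forall f g, K f g = K g f.
Implicit Types (Z : T -> Omega -> R) (s u : seq (R * T)).

Definition gaussian_on Z := (forall t, measurable_fun setT (Z t)) /\
  forall s, indices_in G s ->
    has_centered_normal_law P (fun w => lcomb (Z^~ w) s) (qform K s s).

Lemma qform_sym s u : qform K s u = qform K u s.
Proof.
rewrite /qform exchange_big /=; apply: eq_bigr => p _; apply: eq_bigr => q _.
by rewrite Ksym [_.1 * _]mulrC.
Qed.

Lemma measurable_lcomb Z s : (forall t, measurable_fun setT (Z t)) ->
  measurable_fun setT (fun w => lcomb (Z^~ w) s).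
Proof.
move=> mZ; apply: measurable_sum => p; exact: measurable_funM.
Qed.

Lemma integrable_cos Z s a : (forall t, measurable_fun setT (Z t)) ->
  P.-integrable setT (EFin \o (fun w => a * cos (lcomb (Z^~ w) s))).
Proof.
move=> mZ; apply: integrable_EFinZl; apply: (@bounded_integrable _ _ _ _ _ 1).
  apply: measurableT_comp; last exact: measurable_lcomb.
  by apply: continuous_measurable_fun; exact: continuous_cos.
by move=> w; exact: cos_max.
Qed.

Lemma integrable_cos_sum Z (s : seq (R * seq (R * T))) :
  (forall t, measurable_fun setT (Z t)) ->
  P.-integrable setT (EFin \o (fun w => cos_sum (Z^~ w) s)).
Proof.
by move=> mZ; apply: integrable_EFin_sum => c; exact: integrable_cos.
Qed.

Lemma integral_cos_lcomb Z s : gaussian_on Z -> indices_in G s ->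
  \int[P]_w cos (lcomb (Z^~ w) s) = normal_cos (qform K s s).
Proof.
move=> [mZ gZ] Gs; have [_ law] := gZ _ Gs.
apply: (Rintegral_law (C := 1) (measurable_lcomb s mZ) law) => //.
  by apply: continuous_measurable_fun; exact: continuous_cos.
by move=> x; exact: cos_max.
Qed.

Definition cos_sum_mean (s : seq (R * seq (R * T))) : R :=
  \sum_(c <- s) c.1 * normal_cos (qform K c.2 c.2).

Lemma integral_cos_sum Z (s : seq (R * seq (R * T))) : gaussian_on Z ->
  cos_sum_in G s -> \int[P]_w cos_sum (Z^~ w) s = cos_sum_mean s.
Proof.
move=> gZ Gs; rewrite /cos_sum Rintegral_sum; last first.
  by move=> c; apply: integrable_cos; exact: gZ.1.
rewrite /cos_sum_mean; elim: s Gs => [|c s IH] /=; first by rewrite !big_nil.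
move=> [Gc Gs]; rewrite !big_cons IH//; congr (_ + _).
rewrite RintegralZl//; first by rewrite integral_cos_lcomb.
have := integrable_cos c.2 1 gZ.1.
by under eq_fun do rewrite mul1r.
Qed.

Lemma qform_ge0 Z s : gaussian_on Z -> indices_in G s -> 0 <= qform K s s.
Proof. by move=> gZ Gs; have [] := gZ.2 _ Gs. Qed.

Definition exceed Z (f : nat -> T) n (e : R) : set Omega :=
  [set w | exists2 i, (i < n)%N & e < `|Z (f i) w|].

Lemma measurable_exceed1 Z t (e : R) : (forall t, measurable_fun setT (Z t)) ->
  measurable [set w | e < `|Z t w|].
Proof.
move=> mZ; have mN : measurable_fun setT (fun w => `|Z t w|) by exact: measurableT_comp.
rewrite (_ : [set w | _] = (fun w => `|Z t w|) @^-1` `]e, +oo[%classic).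
  by rewrite -[X in measurable X]setTI; exact: mN.
by apply/seteqP; split => w /=; rewrite in_itv/= andbT.
Qed.

Lemma measurable_exceed Z f n e : (forall t, measurable_fun setT (Z t)) ->
  measurable (exceed Z f n e).
Proof.
move=> mZ; rewrite (_ : exceed _ _ _ _ = \bigcup_(i in `I_n) [set w | e < `|Z (f i) w|]).
  by apply: bigcup_measurable => i _; exact: measurable_exceed1.
by apply/seteqP; split => w [i] ? ?; exists i.
Qed.

Fixpoint cos_sum_prod (a : seq (R * R)) (f : nat -> T) n : seq (R * seq (R * T)) :=
  if n is n'.+1 then cos_sum_mul (cos_sum_prod a f n') (trig_lcomb a [:: (1, f n')])
  else [:: (1, [::])].

Lemma cos_sum_prodE a f n (z : T -> R) :
  cos_sum z (cos_sum_prod a f n) = \prod_(i < n) trig a (z (f i)).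
Proof.
elim: n => [|n IH] /=.
  by rewrite big_ord0 /cos_sum big_seq1 /lcomb big_nil cos0 mulr1.
by rewrite cos_sum_mulE IH trig_lcombE lcomb1 big_ord_recr.
Qed.

Lemma cos_sum_prod_in a f n (H : set T) : (forall i, (i < n)%N -> H (f i)) ->
  cos_sum_in H (cos_sum_prod a f n).
Proof.
elim: n => [|n IH] Gf //=; apply: cos_sum_in_mul.
  by apply: IH => i ni; apply: Gf; rewrite ltnS ltnW.
by apply: trig_lcomb_in => /=; split => //; exact: Gf.
Qed.

Lemma prod_le_factor n (F : 'I_n -> R) (i : 'I_n) :
  (forall i, 0 <= F i <= 1) -> \prod_(j < n) F j <= F i.
Proof.
move=> F01; rewrite (bigD1 i)//=; have /andP[Fi0 Fi1] := F01 i.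
rewrite -[leRHS]mulr1 ler_wpM2l//.
by apply: prodr_ile1 => j _; exact: F01.
Qed.

(** The product of bumps over the [n] indices has the same mean for both processes. For [Z] it is at
    most [z] on the event on the left, for [Z'] at least [(1 - z) ^+ n] when no index exceeds
    [e / 2]; letting [z] tend to 0 compares the probabilities. The distance from [e / 2] to [e] is
    the room that the bump needs. *)
Lemma exceed_compare_bounded Z Z' f n (e M : R) : gaussian_on Z -> gaussian_on Z' ->
  (forall i, G (f i)) -> 0 < e -> e < M ->
  fine (P [set w | exists2 i, (i < n)%N & e < `|Z (f i) w| <= M])
  <= fine (P (exceed Z' f n (e / 2))).
Proof.
move=> gZ gZ' Gf e0 eM; set A := [set w | _]; set B := exceed _ _ _ _.
have mZ := gZ.1; have mZ' := gZ'.1.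
have mA : measurable A.
  rewrite (_ : A = \bigcup_(i in `I_n) ([set w | e < `|Z (f i) w|] `&` ~` [set w | M < `|Z (f i) w|])).
    apply: bigcup_measurable => i _; apply: measurableI; first exact: measurable_exceed1.
    by apply: measurableC; exact: measurable_exceed1.
  apply/seteqP; split => w [i ni].
    by move=> /andP[h1 h2]; exists i => //; split => //=; apply/negP; rewrite -leNgt.
  by move=> [h1 /negP]; rewrite -leNgt => h2; exists i => //; rewrite h1.
have mB : measurable B by exact: measurable_exceed.
have M0 : 0 < M by exact: lt_trans eM.
(* On [[0, M]] the map [cos (l * x)] is decreasing; farther out the bump repeats itself, hence the
   cap [M] in the event. *)
pose l := pi / M.
have l0 : 0 < l by rewrite divr_gt0// pi_gt0.
have lM : l * M = pi by rewrite /l divfK// gt_eqF.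
have in0pi x : 0 <= x <= M -> l * x \in `[0, pi].
  move=> /andP[x0 xM]; rewrite in_itv/= mulr_ge0//= ?(ltW l0)//.
  by rewrite -lM ler_pM2l.
have cos_anti x y : 0 <= x -> x <= y -> y <= M -> cos (l * y) <= cos (l * x).
  move=> x0 xy yM; rewrite le_eqVlt; have [->|xy'] := eqVneq x y; first by rewrite eqxx.
  rewrite ltr_cos ?in0pi ?x0 ?(le_trans xy)//= ?yM ?(le_trans x0)//.
  by rewrite ltr_pM2l// lt_neqAle xy' xy orbT.
have c12 : cos (l * e) < cos (l * (e / 2)).
  by rewrite ltr_cos ?in0pi ?ltr_pM2l//; lra.
have c1N : -1 <= cos (l * e) by exact: cos_geN1.
have c21 : cos (l * (e / 2)) <= 1 by exact: cos_le1.
suff key z : 0 < z -> z < 1 ->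
    fine (P A) - fine (P B) <= z * (1 + n%:R).
  rewrite -subr_le0 leNgt; apply/negP => d0.
  have n0 : 0 < 1 + n%:R :> R by rewrite ltr_pwDl.
  pose z := Num.min (1 / 2) ((fine (P A) - fine (P B)) / 2 / (1 + n%:R)).
  have z0 : 0 < z by rewrite lt_min !divr_gt0.
  have z1 : z < 1 by rewrite gt_min; apply/orP; left; lra.
  have := key z z0 z1.
  have : z * (1 + n%:R) <= (fine (P A) - fine (P B)) / 2.
    by rewrite -ler_pdivlMr// ge_min lexx orbT.
  lra.
move=> z0 z1.
have [p [q [hi lo]]] := bump_exists l c1N c12 c21 z0.
have [a aE] := is_trig_bump p q l.
have E1 := integral_cos_sum gZ (cos_sum_prod_in a (fun i _ => Gf i)).
have E2 := integral_cos_sum gZ' (cos_sum_prod_in a (fun i _ => Gf i)).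
have bump01 x : 0 <= trig a x <= 1 by rewrite aE bump_ge0 bump_le1.
have B1 : (1 - z) ^+ n * (1 - fine (P B)) <= cos_sum_mean (cos_sum_prod a f n).
  rewrite -fine_probability_setC// -Rintegral_indic_prob; last exact: measurableC.
  rewrite -RintegralZl//; last by apply: integrable_indic_prob; exact: measurableC.
  rewrite -E2; apply: le_Rintegral => //.
  - by apply: integrable_EFinZl; apply: integrable_indic_prob; exact: measurableC.
  - exact: integrable_cos_sum.
  - move=> w _; rewrite cos_sum_prodE indicE.
    have [|_] := boolP (w \in ~` B); last first.
      by rewrite mulr0 prodr_ge0// => i _; case/andP : (bump01 (Z' (f i) w)).
    rewrite inE mulr1 => nB; rewrite -[X in _ ^+ X]card_ord -prodr_const.
    apply: ler_prod => i _; rewrite subr_ge0 (ltW z1)/= aE lo// -[leRHS]cos_norm.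
    rewrite normrM (gtr0_norm l0).
    have nx : `|Z' (f i) w| <= e / 2.
      by rewrite leNgt; apply/negP => h; apply: nB; exists i.
    by apply: cos_anti => //; lra.
have B2 : cos_sum_mean (cos_sum_prod a f n) <= 1 - (1 - z) * fine (P A).
  rewrite -E1 -Rintegral_indic_prob// -RintegralZl//; last exact: integrable_indic_prob.
  rewrite -[X in X - _](Rintegral_prob_cst P) -RintegralB//; last 2 first.
  - by apply: (@bounded_integrable _ _ _ _ _ 1) => // ?; rewrite normr1.
  - by apply: integrable_EFinZl; exact: integrable_indic_prob.
  apply: le_Rintegral => //.
  - exact: integrable_cos_sum.
  - apply: integrable_EFinB.
    + by apply: (@bounded_integrable _ _ _ _ _ 1) => // ?; rewrite normr1.
    + by apply: integrable_EFinZl; exact: integrable_indic_prob.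
  - move=> w _; rewrite cos_sum_prodE indicE.
    have [|_] := boolP (w \in A); last by rewrite mulr0 subr0 prodr_ile1.
    rewrite inE mulr1 subKr => -[i ni /andP[h1 h2]].
    apply: (le_trans (@prod_le_factor _ _ (Ordinal ni) _)) => [j|/=]; first exact: bump01.
    rewrite aE hi// -[leLHS]cos_norm normrM (gtr0_norm l0).
    by apply: cos_anti => //; rewrite ltW.
have z01 : 0 <= z <= 1 by rewrite !ltW.
have := expr_ge_bernoulli n z01.
have pB0 := fine_probability_ge0 P B.
have pB1 := fine_probability_le1 P mB.
have pA1 := fine_probability_le1 P mA.
move=> bn.
have : (1 - n%:R * z) * (1 - fine (P B)) <= 1 - (1 - z) * fine (P A).
  apply: le_trans (le_trans B1 B2); rewrite ler_wpM2r//; lra.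
have n0 : 0 <= n%:R :> R by [].
have zA : z * fine (P A) <= z by rewrite ler_piMr// ltW.
have nzB : 0 <= n%:R * z * fine (P B) by rewrite !mulr_ge0// ltW.
move: (fine (P A)) (fine (P B)) (n%:R) zA nzB => pA pB N zA nzB h.
have : (1 - N * z) * (1 - pB) = 1 - N * z - pB + N * z * pB by ring.
have : (1 - z) * pA = pA - z * pA by ring.
have : z * (1 + N) = z + N * z by ring.
lra.
Qed.

(** The cap is removed by continuity of the probability along increasing caps. *)
Lemma exceed_compare Z Z' f n (e : R) : gaussian_on Z -> gaussian_on Z' ->
  (forall i, G (f i)) -> 0 < e ->
  fine (P (exceed Z f n e)) <= fine (P (exceed Z' f n (e / 2))).
Proof.
move=> gZ gZ' Gf e0; have mZ := gZ.1.
pose A N := [set w | exists2 i, (i < n)%N & e < `|Z (f i) w| <= e + N.+1%:R].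
have mA N : measurable (A N).
  rewrite (_ : A N = \bigcup_(i in `I_n) ([set w | e < `|Z (f i) w|] `&` ~` [set w | e + N.+1%:R < `|Z (f i) w|])).
    apply: bigcup_measurable => i _; apply: measurableI; first exact: measurable_exceed1.
    by apply: measurableC; exact: measurable_exceed1.
  apply/seteqP; split => w [i ni].
    by move=> /andP[h1 h2]; exists i => //; split => //=; apply/negP; rewrite -leNgt.
  by move=> [h1 /negP]; rewrite -leNgt => h2; exists i => //; rewrite h1.
have AE : \bigcup_N A N = exceed Z f n e.
  apply/seteqP; split => [w [N _ [i ni /andP[h _]]]|w [i ni h]]; first by exists i.
  exists (Num.truncn `|Z (f i) w|) => //; exists i => //; rewrite h/=.
  have /andP[_ /ltW h'] := truncn_itv (normr_ge0 (Z (f i) w)).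
  by rewrite (le_trans h')// lerDr ltW.
have cvA : P (A N) @[N --> \oo] --> P (exceed Z f n e).
  rewrite -AE; apply: nondecreasing_cvg_mu => //.
    by rewrite AE; exact: measurable_exceed.
  move=> N N' NN; apply/subsetPset => w [i ni /andP[h1 h2]]; exists i => //.
  by rewrite h1/= (le_trans h2)// lerD2l ler_nat ltnS.
rewrite -lee_fin !fine_probability//; try exact: measurable_exceed (gZ'.1).
  rewrite -(cvg_lim _ cvA)//; apply: lime_le; first by apply/cvg_ex; eexists; exact: cvA.
  apply: nearW => N.
  rewrite -fine_probability// -[leRHS]fine_probability ?lee_fin; last exact: measurable_exceed (gZ'.1).
  by apply: exceed_compare_bounded => //; rewrite ltrDl.
exact: measurable_exceed.
Qed.

End gaussian.

(** * Normal mass of a window of the cosine *)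

Section normal_lower_bound.
Context {R : realType}.

(** The interval lies in [[-5, 5]] and the variance between [e] and [D], so the density is at least
    its peak for variance [D] times $\exp(-25/(2e))$. *)
Lemma centered_normal_interval (v e D y : R) : 0 < e -> e <= v -> v <= D ->
  -4 <= y <= 4 ->
  normal_peak (Num.sqrt D) * expR (- (25 / (e + e)))
  <= fine (centered_normal v `[y, (y + 1)%R]%classic).
Proof.
move=> e0 ev vD /andP[y1 y2].
have v0 : 0 < v by exact: lt_le_trans ev.
have D0 : 0 < D by exact: lt_le_trans vD.
have v0' := ltW v0; have D0' := ltW D0.
set c := _ * _.
have c0 : 0 <= c by rewrite mulr_ge0 ?normal_peak_ge0 ?expR_ge0.
have s0 : Num.sqrt v != 0 by rewrite gt_eqF// sqrtr_gt0.
rewrite -lee_fin fineK ?fin_num_measure//.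
rewrite /centered_normal gt_eqF//= /normal_prob.
rewrite -[leLHS]mule1 (_ : 1%E = @lebesgue_measure R `[y, (y + 1)%R]%classic); last first.
  by rewrite lebesgue_measure_itv/= lte_fin ltrDl ltr01 -EFinB addrAC subrr add0r.
rewrite -integral_cst//=; apply: ge0_le_integral => //=.
- by apply/measurable_EFinP/measurable_funTS; exact: measurable_normal_pdf.
move=> x; rewrite in_itv/= => /andP[x1 x2]; rewrite lee_fin normal_pdfE//.
rewrite /c ler_pM ?normal_peak_ge0 ?expR_ge0//.
  rewrite /normal_peak lef_pV2 ?posrE ?sqrtr_gt0 ?mulrn_wgt0 ?mulr_gt0 ?pi_gt0 ?exprn_gt0 ?sqrtr_gt0//.
  by rewrite ler_wsqrtr// lerMn2r//= ler_wpM2r ?pi_ge0// !sqr_sqrtr.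
rewrite /normal_fun ler_expR subr0 mulNr lerN2 mulr2n sqr_sqrtr//.
have x25 : x ^+ 2 <= 25.
  have -> : 25 = 5 ^+ 2 :> R by rewrite -natrX.
  by rewrite -real_normK ?num_real// lerXn2r ?nnegrE// ler_norml; lra.
rewrite ler_pM ?sqr_ge0 ?invr_ge0 ?addr_ge0//.
by rewrite lef_pV2 ?posrE ?addr_gt0// lerD.
Qed.

Lemma cos_period_int (k : int) (x : R) : cos (x + (pi *+ 2) *~ k) = cos x.
Proof.
case: k => n; first by rewrite -pmulrn (periodicn (@cosD2pi R)).
by rewrite NegzE mulrNz -[LHS](periodicn (@cosD2pi R) n.+1) -pmulrn subrK.
Qed.

(** The period is 6. Reducing [x] to [[0, 6)], the window for [z] is placed so that [x + z] falls in
    [[2, 3]] modulo 6, where the cosine is at most its value at 2. *)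
Lemma cos_window (x : R) : exists2 y, -4 <= y <= 4 &
  forall z, y <= z <= y + 1 -> cos (pi / 3 * (x + z)) <= cos (pi / 3 * 2).
Proof.
pose k := Num.floor (x / 6).
have /andP[k1 k2] := floor_itv (x / 6).
rewrite -/k in k1 k2; rewrite intrD in k2.
have k1' : 6 * k%:~R <= x by rewrite mulrC -ler_pdivlMr.
have k2' : x < 6 * k%:~R + 6 by rewrite -[X in _ + X]mulr1 -mulrDr mulrC -ltr_pdivrMr.
exists (2 - (x - 6 * k%:~R)); first by lra.
move=> z /andP[z1 z2].
have -> : pi / 3 * (x + z) = pi / 3 * (x + z - 6 * k%:~R) + (pi *+ 2) *~ k.
  by rewrite -mulrzr mulr2n; field.
rewrite cos_period_int.
have [->//|ne] := eqVneq (x + z - 6 * k%:~R) 2.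
have p0 : 0 < pi / 3 :> R by rewrite divr_gt0// pi_gt0.
have p3 : pi / 3 * 3 = pi :> R by field.
apply: ltW; rewrite ltr_cos ?in_itv/=.
- by rewrite ltr_pM2l// lt_neqAle eq_sym ne/=; lra.
- by apply/andP; split; [rewrite mulr_ge0// ltW|rewrite -[X in _ <= X]p3 ler_pM2l//; lra].
- apply/andP; split; last by rewrite -[X in _ <= X]p3 ler_pM2l//; lra.
  by rewrite mulr_ge0 ?(ltW p0)//; lra.
Qed.

End normal_lower_bound.

(** * Integrating out an orthogonal component *)

Section gaussian_smoothing.
Context d (Omega : measurableType d) (R : realType) (P : probability Omega R).
Context (T : Type) (G : set T) (K : T -> T -> R).
Hypothesis Ksym : forall f g, K f g = K g f.
Variable Z : T -> Omega -> R.
Hypothesis gZ : gaussian_on P G K Z.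

Lemma cos_sum_mean_mul (s u : seq (R * seq (R * T))) :
  cos_sum_mean K (cos_sum_mul s u) = \sum_(c <- s) \sum_(e <- u)
    c.1 * e.1 / 2 * (normal_cos (qform K (c.2 ++ e.2) (c.2 ++ e.2)) +
       normal_cos (qform K (c.2 ++ lscale (-1) e.2) (c.2 ++ lscale (-1) e.2))).
Proof.
rewrite /cos_sum_mean /cos_sum_mul big_flatten big_map; apply: eq_bigr => c _.
rewrite big_cat /= !big_map -big_split /=; apply: eq_bigr => e _.
by rewrite mulrDr.
Qed.

(** The convolution of a cosine sum with the centered normal law of variance [v]: each frequency is
    damped by the characteristic function. *)
Definition trig_smooth (v : R) (a : seq (R * R)) :=
  [seq (c.1 * normal_cos (c.2 ^+ 2 * v), c.2) | c <- a].

Fixpoint cos_sum_orth (r : seq (R * T)) (s : seq (R * seq (R * T))) : Prop :=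
  if s is c :: s' then qform K r c.2 = 0 /\ cos_sum_orth r s' else True.

Lemma cos_sum_orth_sub (r : seq (R * T)) (s : seq (R * seq (R * T))) (H : set T) :
  (forall t, H t -> qform K r [:: (1, t)] = 0) -> cos_sum_in H s -> cos_sum_orth r s.
Proof.
move=> rH; elim: s => //= -[c u] s IH [/= Hu Hs]; split; last exact: IH.
elim: u Hu => [|[a t] u IHu] /= Hu.
  by rewrite /qform; apply: big1 => p _; rewrite big_nil.
case: Hu => /= Ht Hu.
rewrite -cat1s qform_catr IHu// addr0.
have -> : [:: (a, t)] = lscale a [:: (1, t)] by rewrite /lscale /= mulr1.
by rewrite qform_scaler rH// mulr0.
Qed.

Lemma qform_orth_sub (r u : seq (R * T)) (H : set T) :
  (forall t, H t -> qform K r [:: (1, t)] = 0) -> indices_in H u -> qform K r u = 0.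
Proof.
by move=> rH Hu; have [] := @cos_sum_orth_sub r [:: (1, u)] H rH (conj Hu I).
Qed.

(** This acts as conditioning on variables orthogonal to [r], without conditional laws: variances of
    orthogonal combinations add, and [normal_cosD] factors the contribution of [r] out of each
    mean. *)
Lemma integral_trig_smooth (s : seq (R * seq (R * T))) (r u : seq (R * T)) a :
  cos_sum_in G s -> indices_in G r -> indices_in G u ->
  cos_sum_orth r s -> qform K r u = 0 ->
  \int[P]_w (cos_sum (Z^~ w) s * trig a (lcomb (Z^~ w) r + lcomb (Z^~ w) u))
  = \int[P]_w (cos_sum (Z^~ w) s * trig (trig_smooth (qform K r r) a) (lcomb (Z^~ w) u)).
Proof.
move=> Gs Gr Gu os ou.
under eq_Rintegral do rewrite -lcomb_cat -trig_lcombE -cos_sum_mulE.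
under [RHS]eq_Rintegral do rewrite -trig_lcombE -cos_sum_mulE.
rewrite !(integral_cos_sum gZ); last 2 first.
- by apply: cos_sum_in_mul => //; exact: trig_lcomb_in.
- by apply: cos_sum_in_mul => //; apply: trig_lcomb_in; exact: indices_in_cat.
rewrite !cos_sum_mean_mul; elim: s Gs os => [|c s IH] /=; first by rewrite !big_nil.
move=> [Gc Gs] [oc os]; rewrite !big_cons IH//; congr (_ + _).
rewrite !big_map; apply: eq_bigr => -[e t] _ /=.
have ur : qform K u r = 0 by rewrite qform_sym.
have cr : qform K c.2 r = 0 by rewrite qform_sym.
have E (b : R) : qform K (c.2 ++ lscale b (r ++ u)) (c.2 ++ lscale b (r ++ u)) =
    qform K (c.2 ++ lscale b u) (c.2 ++ lscale b u) + b ^+ 2 * qform K r r.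
  rewrite !(qform_catl, qform_catr, qform_scalel, qform_scaler).
  by rewrite ur cr oc ou; ring.
have q0 b : 0 <= qform K (c.2 ++ lscale b u) (c.2 ++ lscale b u).
  by apply: (qform_ge0 gZ); apply: indices_in_cat => //; exact: indices_in_scale.
have r0 b : 0 <= b ^+ 2 * qform K r r.
  by rewrite mulr_ge0 ?sqr_ge0//; exact: (qform_ge0 gZ).
have SS (x : seq (R * T)) : lscale (-1) (lscale t x) = lscale (- t) x.
  by rewrite /lscale -map_comp; apply: eq_map => p /=; rewrite mulrA mulN1r.
rewrite !SS !E sqrrN (normal_cosD (q0 t) (r0 t)).
rewrite (normal_cosD (q0 (- t)) (r0 t)).
move: (normal_cos _) (normal_cos (t ^+ 2 * _)) (normal_cos _) => x1 x2 x3; ring.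
Qed.

(** Averaging over both signs of the residual cancels the sine terms, and exhibits the smoothed
    function as a mean of values of the original one, so that bounds on the latter carry over. *)
Lemma trig_smoothE (r : seq (R * T)) a x : indices_in G r ->
  trig (trig_smooth (qform K r r) a) x =
  \int[P]_w ((trig a (x + lcomb (Z^~ w) r) + trig a (x - lcomb (Z^~ w) r)) / 2).
Proof.
move=> Gr.
have E w : (trig a (x + lcomb (Z^~ w) r) + trig a (x - lcomb (Z^~ w) r)) / 2 =
    \sum_(c <- a) (c.1 * cos (c.2 * x)) * cos (lcomb (Z^~ w) (lscale c.2 r)).
  rewrite /trig -big_split /= mulr_suml; apply: eq_bigr => c _.
  by rewrite lcomb_scale mulrDr mulrBr -[RHS]mulrA cos_mul; ring.
under eq_Rintegral do rewrite E.
rewrite Rintegral_sum; last by move=> c; apply: integrable_cos; exact: gZ.1.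
rewrite /trig /trig_smooth big_map; apply: eq_bigr => c _ /=.
rewrite RintegralZl//; last first.
  have := integrable_cos P (lscale c.2 r) 1 gZ.1.
  by under eq_fun do rewrite mul1r.
rewrite (integral_cos_lcomb gZ); last exact: indices_in_scale.
by rewrite qform_scalel qform_scaler mulrA -expr2 mulrAC.
Qed.

Lemma prob_window (r : seq (R * T)) (e D x : R) : indices_in G r ->
  0 < e -> e <= qform K r r -> qform K r r <= D ->
  normal_peak (Num.sqrt D) * expR (- (25 / (e + e)))
  <= fine (P [set w | cos (pi / 3 * (x + lcomb (Z^~ w) r)) <= cos (pi / 3 * 2)]).
Proof.
move=> Gr e0 er rD; have [y y4 Hy] := cos_window x.
apply: (le_trans (centered_normal_interval e0 er rD y4)).
have [_ <-//] := gZ.2 _ Gr.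
have mr := measurable_lcomb r gZ.1.
apply: le_fine_probability.
- by rewrite -[X in measurable X]setTI; exact: mr.
- have mc : measurable_fun setT (fun w => cos (pi / 3 * (x + lcomb (Z^~ w) r))).
    apply: measurableT_comp.
      by apply: continuous_measurable_fun; exact: continuous_cos.
    by apply: measurable_funM => //; exact: measurable_funD.
  rewrite (_ : [set w | _] = (fun w => cos (pi / 3 * (x + lcomb (Z^~ w) r)))
     @^-1` `]-oo, cos (pi / 3 * 2)]%classic).
    by rewrite -[X in measurable X]setTI; exact: mc.
  by apply/seteqP; split => w /=; rewrite in_itv.
- by move=> w /=; rewrite in_itv/=; exact: Hy.
Qed.

End gaussian_smoothing.

(** * Orthogonal residuals make the supremum large *)

Section separability.
Context d (Omega : measurableType d) (R : realType) (P : probability Omega R).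
Context (T : Type) (G : set T) (K : T -> T -> R).
Hypothesis Ksym : forall f g, K f g = K g f.
Variable Z : T -> Omega -> R.
Hypothesis gZ : gaussian_on P G K Z.

(* If each [f n] has a component [r n] of variance at least [e] orthogonal to
   all the previous ones, then conditionally on [Z (f j)], [j < n], the variable
   [Z (f n)] leaves [[-1, 1]] with a probability bounded from below. *)
Lemma not_exceed_decay (e D : R) : 0 < e -> exists2 q : R, 0 <= q < 1 &
  forall (f : nat -> T) (r u : nat -> seq (R * T)),
  (forall n, G (f n)) -> (forall n, indices_in G (r n)) ->
  (forall n, indices_in G (u n)) ->
  (forall n (z : T -> R), z (f n) = lcomb z (r n) + lcomb z (u n)) ->
  (forall n j, (j < n)%N -> qform K (r n) [:: (1, f j)] = 0) ->
  (forall n, qform K (r n) (u n) = 0) ->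
  (forall n, e <= qform K (r n) (r n)) -> (forall n, qform K (r n) (r n) <= D) ->
  forall n, 1 - fine (P (exceed Z f n 1)) <= q ^+ n.
Proof.
move=> e0; have [D0|D0] := leP D 0.
  exists 0; first by rewrite lexx ltr01.
  move=> f r u _ _ _ _ _ _ re rD n.
  by have := lt_le_trans e0 (le_trans (re 0%N) (le_trans (rD 0%N) D0)); rewrite ltxx.
(* A lower bound for the probability that a residual of variance between [e] and [D] moves a given
   point into the window where the bump is small. *)
pose p1 := Num.min 1 (normal_peak (Num.sqrt D) * expR (- (25 / (e + e)))).
have p10 : 0 < p1.
  by rewrite lt_min ltr01 mulr_gt0 ?expR_gt0// normal_peak_gt0 ?gt_eqF ?sqrtr_gt0.
have p11 : p1 <= 1 by rewrite ge_min lexx.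
have pi3 : 0 < pi / 3 :> R by rewrite divr_gt0// pi_gt0.
have p3 : pi / 3 * 3 = pi :> R by field.
have in0pi x : 0 <= x <= 3 -> pi / 3 * x \in `[0, pi : R].
  move=> /andP[x0 x3]; rewrite in_itv/= mulr_ge0 ?(ltW pi3)//=.
  by rewrite -[X in _ <= X]p3 ler_pM2l.
(* The bump has period 6: it is near 1 for arguments of modulus at most 1, and near 0 at distance at
   least 2 from the multiples of 6. *)
pose c1 : R := cos (pi / 3 * 2); pose c2 : R := cos (pi / 3 * 1).
have c12 : c1 < c2.
  by rewrite /c1 /c2 ltr_cos ?in0pi ?ltr_pM2l ?ltr1n//; lra.
have z0 : 0 < p1 / 3 by rewrite divr_gt0.
have [p [q [hi lo]]] := bump_exists (pi / 3) (cos_geN1 _) c12 (cos_le1 _) z0.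
have [a aE] := is_trig_bump p q (pi / 3 : R).
set z := p1 / 3 in z0 hi lo.
have z1 : z < 1 by rewrite /z; lra.
(* [Q] bounds the bump averaged over one residual, and each factor of the product loses [1 - z] on
   the event of no exceedance; the choice of [p1 / 3] for [z] makes the ratio [Q / (1 - z)] less
   than 1. *)
pose Q := 1 - (1 - z) * p1.
have Q0 : 0 <= Q by rewrite /Q /z; nra.
exists (Q / (1 - z)).
  rewrite divr_ge0//= ?subr_ge0 ?ltW// ltr_pdivrMr ?subr_gt0// mul1r /Q /z.
  nra.
move=> f r u Gf Gr Gu zE orf oru er rD n.
have mZ := gZ.1.
have trig01 x : 0 <= trig a x <= 1 by rewrite aE bump_ge0 bump_le1.
have smooth_le i x : trig (trig_smooth (qform K (r i) (r i)) a) x <= Q.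
  rewrite (trig_smoothE gZ)//.
  pose B y := [set w | cos (pi / 3 * (y + lcomb (Z^~ w) (r i))) <= c1].
  have mB y : measurable (B y).
    have mc : measurable_fun setT (fun w => cos (pi / 3 * (y + lcomb (Z^~ w) (r i)))).
      apply: measurableT_comp.
        by apply: continuous_measurable_fun; exact: continuous_cos.
      apply: measurable_funM => //; apply: measurable_funD => //.
      exact: measurable_lcomb.
    rewrite (_ : B y = (fun w => cos (pi / 3 * (y + lcomb (Z^~ w) (r i))))
       @^-1` `]-oo, c1]%classic).
      by rewrite -[X in measurable X]setTI; exact: mc.
    by apply/seteqP; split => w /=; rewrite in_itv.
  have pB y : p1 <= fine (P (B y)).
    rewrite ge_min; apply/orP; right.
    exact: (prob_window gZ y (Gr i) e0 (er i) (rD i)).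
  have mtrig g : measurable_fun setT g -> measurable_fun setT (fun w : Omega => trig a (g w)).
    move=> mg; apply: measurable_sum => c; apply: measurable_funM => //.
    apply: measurableT_comp; last exact: measurable_funM.
    by apply: continuous_measurable_fun; exact: continuous_cos.
  have mr := measurable_lcomb (r i) mZ.
  (* The bump is even, so its value at [x] minus the residual is the one at [- x] plus the residual,
     and the window for [- x] serves. *)
  apply: (@le_trans _ _ (\int[P]_w (1 - (1 - z) * ((\1_(B x) w + \1_(B (- x)) w) / 2)))).
    apply: le_Rintegral => //.
    - apply: (@bounded_integrable _ _ _ _ _ 1).
        apply: measurable_funM => //; apply: measurable_funD.
          by apply: mtrig; exact: measurable_funD.
        by apply: mtrig; exact: measurable_funB.
      move=> w; have /andP[? ?] := trig01 (x + lcomb (Z^~ w) (r i)).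
      have /andP[? ?] := trig01 (x - lcomb (Z^~ w) (r i)).
      rewrite ger0_norm; lra.
    - apply: (@bounded_integrable _ _ _ _ _ 2).
        apply: measurable_funB => //; apply: measurable_funM => //.
        by apply: measurable_funM => //; apply: measurable_funD; exact: measurable_indic.
      move=> w; rewrite !indicE ler_norml.
      by case: (_ \in B x); case: (_ \in B (- x)) => /=; lra.
    - have bad y w : trig a (y + lcomb (Z^~ w) (r i)) <= 1 - (1 - z) * \1_(B y) w.
        rewrite indicE; have [|_] := boolP (w \in B y).
          by rewrite inE mulr1 subKr aE => /hi.
        by rewrite mulr0 subr0; case/andP : (trig01 (y + lcomb (Z^~ w) (r i))).
      move=> w _; have b1 := bad x w.
      have : trig a (x - lcomb (Z^~ w) (r i)) <= 1 - (1 - z) * \1_(B (- x)) w.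
        have <- : trig a (- x + lcomb (Z^~ w) (r i)) = trig a (x - lcomb (Z^~ w) (r i)).
          by rewrite !aE /bump -[in LHS]cos_norm -[in RHS]cos_norm -normrN -mulrN opprD opprK.
        exact: bad.
      lra.
  have ii y : P.-integrable setT (EFin \o (\1_(B y) : Omega -> R)).
    exact: integrable_indic_prob.
  have -> : \int[P]_w (1 - (1 - z) * ((\1_(B x) w + \1_(B (- x)) w) / 2)) =
     1 - (1 - z) / 2 * (fine (P (B x)) + fine (P (B (- x)))).
    rewrite -!Rintegral_indic_prob// -RintegralD// -RintegralZl//; last exact: integrable_EFinD.
    rewrite -[X in _ = X - _](Rintegral_prob_cst P) -RintegralB//; last 2 first.
    - by apply: (@bounded_integrable _ _ _ _ _ 1) => // ?; rewrite normr1.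
    - by apply: integrable_EFinZl; exact: integrable_EFinD.
    by apply: eq_Rintegral => w _; field.
  have := pB x; have := pB (- x); rewrite /Q.
  have z1' : 0 <= 1 - z by lra.
  move: (fine _) (fine _) => y1 y2 h1 h2.
  nra.
(* The last factor is integrated out: its residual is orthogonal to the earlier variables, so
   smoothing replaces it by a function bounded by [Q]. *)
have step i : cos_sum_mean K (cos_sum_prod a f i) <= Q ^+ i.
  elim: i => [|i IH] /=.
    rewrite /cos_sum_mean big_seq1 /= /qform big_nil normal_cos0 mulr1 expr0//.
  rewrite -(integral_cos_sum gZ); last first.
    apply: cos_sum_in_mul; first by apply: cos_sum_prod_in => j _; exact: Gf.
    by apply: trig_lcomb_in => /=.
  have ZE w : Z (f i) w = lcomb (Z^~ w) (r i) + lcomb (Z^~ w) (u i) := zE i (Z^~ w).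
  under eq_Rintegral do rewrite cos_sum_mulE trig_lcombE lcomb1 ZE.
  have Gs : cos_sum_in G (cos_sum_prod a f i) by apply: cos_sum_prod_in => j _; exact: Gf.
  rewrite (integral_trig_smooth Ksym gZ)//; last first.
    apply: (cos_sum_orth_sub (H := [set t | exists2 j, (j < i)%N & t = f j])).
      by move=> t [j ji ->]; exact: orf.
    by apply: cos_sum_prod_in => j ji; exists j.
  rewrite exprS; apply: (@le_trans _ _ (Q * cos_sum_mean K (cos_sum_prod a f i))); last first.
    by rewrite ler_wpM2l.
  rewrite -(integral_cos_sum gZ)// -RintegralZl//; last exact: integrable_cos_sum.
  apply: le_Rintegral => //.
  - under eq_fun do rewrite /= -trig_lcombE -cos_sum_mulE.
    exact: integrable_cos_sum.
  - by apply: integrable_EFinZl; exact: integrable_cos_sum.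
  - move=> w _; rewrite mulrC ler_wpM2r// cos_sum_prodE prodr_ge0// => j _.
    by case/andP : (trig01 (Z (f j) w)).
rewrite expr_div_n ler_pdivlMr ?exprn_gt0 ?subr_gt0// mulrC.
apply: le_trans (step n).
have mE : measurable (exceed Z f n 1) by exact: measurable_exceed.
rewrite -fine_probability_setC// -Rintegral_indic_prob; last exact: measurableC.
rewrite -RintegralZl//; last by apply: integrable_indic_prob; exact: measurableC.
rewrite -(integral_cos_sum gZ); last by apply: cos_sum_prod_in => j _; exact: Gf.
apply: le_Rintegral => //.
- by apply: integrable_EFinZl; apply: integrable_indic_prob; exact: measurableC.
- exact: integrable_cos_sum.
- move=> w _; rewrite cos_sum_prodE indicE.
  have [|_] := boolP (w \in ~` _); last first.
    by rewrite mulr0 prodr_ge0// => i _; case/andP : (trig01 (Z (f i) w)).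
  rewrite inE mulr1 => nE; rewrite -[X in _ ^+ X]card_ord -prodr_const.
  apply: ler_prod => i _; rewrite subr_ge0 (ltW z1)/= aE lo// /c2 -[leRHS]cos_norm.
  rewrite normrM (gtr0_norm pi3).
  have nx : `|Z (f i) w| <= 1.
    by rewrite leNgt; apply/negP => h; apply: nE; exists i.
  have [->//|ne] := eqVneq (`|Z (f i) w|) 1.
  apply: ltW; rewrite ltr_cos ?in0pi//; rewrite ?normr_ge0/= ?(le_trans nx) ?ler1n//.
    by rewrite ltr_pM2l// lt_neqAle ne nx.
  by rewrite ler01.
Qed.

End separability.

(** * Gram-Schmidt for a semidefinite form *)

Section quadratic_form.
Context (R : realType) (T : Type) (G : set T) (K : T -> T -> R).
Hypothesis Ksym : forall f g, K f g = K g f.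
Hypothesis Kge0 : forall s, indices_in G s -> 0 <= qform K s s.
Implicit Types (s u : seq (R * T)).

Lemma qform_cat2 s u : qform K (s ++ u) (s ++ u) =
  qform K s s + 2 * qform K s u + qform K u u.
Proof. rewrite qform_catl !qform_catr (qform_sym Ksym u s); ring. Qed.

Lemma qform_scale2 a s : qform K (lscale a s) (lscale a s) = a ^+ 2 * qform K s s.
Proof. by rewrite qform_scalel qform_scaler mulrA -expr2. Qed.

Lemma qform_cat_le2 s u : indices_in G s -> indices_in G u ->
  qform K (s ++ u) (s ++ u) <= 2 * qform K s s + 2 * qform K u u.
Proof.
move=> Gs Gu; have : 0 <= qform K (s ++ lscale (-1) u) (s ++ lscale (-1) u).
  by apply: Kge0; apply: indices_in_cat => //; exact: indices_in_scale.
by rewrite !qform_cat2 qform_scale2 qform_scaler; lra.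
Qed.

(** The degenerate case of the Cauchy-Schwarz inequality: along a null direction the form is affine,
    and the chosen [a] would give it the value -1. *)
Lemma qform_cauchy0 s u : indices_in G s -> indices_in G u ->
  qform K u u = 0 -> qform K s u = 0.
Proof.
move=> Gs Gu u0; apply/eqP/contraT => su.
pose a := - (qform K s s + 1) / (2 * qform K s u).
have : 0 <= qform K (s ++ lscale a u) (s ++ lscale a u).
  by apply: Kge0; apply: indices_in_cat => //; exact: indices_in_scale.
rewrite qform_cat2 qform_scale2 qform_scaler u0 mulr0 addr0.
have -> : 2 * (a * qform K s u) = - (qform K s s + 1) by rewrite /a; field.
lra.
Qed.

Lemma kernel_diag_ge0 t : G t -> 0 <= K t t.
Proof. by move=> Gt; rewrite -qform1; exact: Kge0. Qed.

Lemma kernel_bound D t t' : G t -> G t' -> K t t <= D -> K t' t' <= D -> `|K t t'| <= D.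
Proof.
move=> Gt Gt' tD t'D.
have H (a : R) : a ^+ 2 = 1 -> 0 <= K t t + 2 * (a * K t t') + K t' t'.
  move=> a1; have : 0 <= qform K ([:: (1, t)] ++ lscale a [:: (1, t')]) ([:: (1, t)] ++ lscale a [:: (1, t')]).
    by apply: Kge0; apply: indices_in_cat => //; exact: indices_in_scale.
  by rewrite qform_cat2 qform_scale2 qform_scaler !qform1 a1 mul1r.
have := H 1 (expr1n _ _); have := H (-1) (etrans (sqrrN 1) (expr1n _ _)).
by rewrite mul1r mulN1r ler_norml; lra.
Qed.

Lemma qform_abs_bound D s u : indices_in G s -> indices_in G u ->
  (forall t t', G t -> G t' -> `|K t t'| <= D) ->
  `|qform K s u| <= (\sum_(p <- s) `|p.1|) * (\sum_(p <- u) `|p.1|) * D.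
Proof.
move=> + Gu KD; elim: s => [|p s IH] /=.
  by move=> _; rewrite /qform !big_nil normr0 !mul0r.
move=> [Gp Gs]; rewrite -cat1s qform_catl big_cons mulrDl mulrDl.
apply: (le_trans (ler_normD _ _)); apply: lerD; last exact: IH.
rewrite /qform big_seq1; elim: u Gu {IH} => [|q u IHu] /=.
  by move=> _; rewrite !big_nil normr0 mulr0 mul0r.
move=> [Gq Gu]; rewrite !big_cons mulrDr mulrDl.
apply: (le_trans (ler_normD _ _)); apply: lerD; last exact: IHu.
by rewrite !normrM ler_wpM2l// ?mulr_ge0// KD.
Qed.

Definition span_set (hs : seq T) : set T := [set t | List.In t hs].

(** Gram-Schmidt, one element at a time: the new element is first made orthogonal to the others. If
    no variance is left it is skipped, orthogonality to it being granted by [qform_cauchy0]. *)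
Lemma projection_exists (hs : seq T) u : (forall t, span_set hs t -> G t) ->
  indices_in G u -> exists2 s, indices_in (span_set hs) s &
    forall t, span_set hs t -> qform K (u ++ s) [:: (1, t)] = 0.
Proof.
elim: hs u => [|h hs IH] u Ghs Gu; first by exists [::].
have Ghs' t : span_set hs t -> G t by move=> ht; apply: Ghs; right.
have Gh : G h by apply: Ghs; left.
have [su Hsu Osu] := IH u Ghs' Gu.
have [sh Hsh Osh] := IH [:: (1, h)] Ghs' (conj Gh I).
have sub s : indices_in (span_set hs) s -> indices_in (span_set (h :: hs)) s.
  by apply: indices_in_sub => t ht; right.
have GG s : indices_in (span_set hs) s -> indices_in G s.
  by apply: indices_in_sub => t; exact: Ghs'.
have Gsh : indices_in G ([:: (1, h)] ++ sh) by split => //; exact: GG.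
have Gsu : indices_in G (u ++ su) by apply: indices_in_cat => //; exact: GG.
have orthu s : indices_in (span_set hs) s -> qform K (u ++ su) s = 0.
  by apply: qform_orth_sub.
have orthh s : indices_in (span_set hs) s -> qform K ([:: (1, h)] ++ sh) s = 0.
  by apply: qform_orth_sub.
have [r0|r0] := eqVneq (qform K ([:: (1, h)] ++ sh) ([:: (1, h)] ++ sh)) 0.
  exists su; first exact: sub.
  move=> t [<-|]; last exact: Osu.
  have := qform_cauchy0 Gsu Gsh r0.
  by rewrite qform_catr (orthu sh)// addr0.
pose c := - qform K (u ++ su) ([:: (1, h)] ++ sh) / qform K ([:: (1, h)] ++ sh) ([:: (1, h)] ++ sh).
exists (su ++ lscale c ([:: (1, h)] ++ sh)).
  apply: indices_in_cat; first exact: sub.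
  by apply: indices_in_scale; split; [left|exact: sub].
move=> t ht; rewrite catA qform_catl qform_scalel.
case: ht => [<-|ht]; last by rewrite Osu// Osh// mulr0 addr0.
have e1 : qform K ([:: (1, h)] ++ sh) ([:: (1, h)] ++ sh) = qform K ([:: (1, h)] ++ sh) [:: (1, h)].
  by rewrite [LHS]qform_catr (orthh sh)// addr0.
have e2 : qform K (u ++ su) ([:: (1, h)] ++ sh) = qform K (u ++ su) [:: (1, h)].
  by rewrite [LHS]qform_catr (orthu sh)// addr0.
rewrite -e1 -e2 /c divfK// subrr//.
Qed.

(** The aim is countability: coefficients are rational and elements are given by their position in
    [hs]. The error is itself a combination [w], of small total weight. *)
Lemma rational_approx (hs : seq T) (b0 : T) s e : 0 < e ->
  indices_in (span_set hs) s -> exists (q : seq (rat * nat)) (w : seq (R * T)),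
  [/\ indices_in (span_set hs) w, \sum_(p <- w) `|p.1| <= e,
      indices_in (span_set hs) [seq (ratr p.1 : R, nth b0 hs p.2) | p <- q] &
      forall u, qform K [seq (ratr p.1 : R, nth b0 hs p.2) | p <- q] u =
                qform K s u + qform K w u].
Proof.
elim: s e => [|[a t] s IH] e e0 /=.
  by move=> _; exists [::], [::]; split => //; rewrite ?big_nil ?ltW// => u; rewrite /qform big_nil addr0.
move=> [/= ht Hs].
have e2 : 0 < e / 2 by rewrite divr_gt0.
have [q [w [Hw We Hq Eq]]] := IH _ e2 Hs.
have ae : a - e / 2 < a by rewrite gtrBl.
have [r] := rat_in_itvoo ae.
rewrite in_itv/= => /andP[r1 r2].
have [i ni] : exists2 i, (i < size hs)%N & nth b0 hs i = t.
  elim: hs ht {Hs Hw Hq Eq IH} => //= h hs IH [->|/IH[i ? ?]]; first by exists 0%N.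
  by exists i.+1.
move=> it.
exists ((r, i) :: q), ((ratr r - a, t) :: w); split.
- by split.
- rewrite big_cons /= (_ : e = e / 2 + e / 2); last by field.
  by rewrite lerD// ler_norml; lra.
- by rewrite /= it; split.
- move=> u; rewrite /= it -cat1s qform_catl Eq -[(a, t) :: s]cat1s -[(_, t) :: w]cat1s.
  rewrite !qform_catl addrACA; congr (_ + _).
  have E (x : R) : [:: (x, t)] = lscale x [:: (1, t)] by rewrite /lscale /= mulr1.
  by rewrite !(E (ratr r)) !(E a) (E (ratr r - a)) !qform_scalel; ring.
Qed.

End quadratic_form.

(** * A ball on which the process stays bounded is separable *)

Section separability.
Context d (Omega : measurableType d) (R : realType) (P : probability Omega R).
Context (T : Type) (G : set T) (K : T -> T -> R).
Hypothesis Ksym : forall f g, K f g = K g f.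
Variable Z : T -> Omega -> R.
Hypothesis gZ : gaussian_on P G K Z.
Variables (B : set T) (D : R) (b0 : T).
Hypotheses (BG : B `<=` G) (BD : forall t, B t -> K t t <= D) (Bb0 : B b0).
Hypothesis Bhalf : forall f : nat -> T, (forall n, B (f n)) ->
  forall n, fine (P (exceed Z f n 1)) <= 1 / 2.

Let Kge0 s : indices_in G s -> 0 <= qform K s s.
Proof. exact: (qform_ge0 gZ). Qed.

(** Otherwise elements of [B] could be picked one after the other with residual variance at least
    [e], and [not_exceed_decay] would make some of them exceed 1 with probability near one, against
    [Bhalf]. *)
Lemma finite_span_approx e : 0 < e -> exists2 hs : seq T,
  (forall t, span_set hs t -> B t) & forall f, B f ->
  exists2 s, indices_in (span_set hs) s & qform K ((1, f) :: s) ((1, f) :: s) < e.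
Proof.
move=> e0; apply: contrapT => no.
have pick hs : exists f, (forall t, span_set hs t -> B t) ->
    B f /\ forall s, indices_in (span_set hs) s -> e <= qform K ((1, f) :: s) ((1, f) :: s).
  have [hB|hB] := pselect (forall t, span_set hs t -> B t); last by exists b0 => /hB.
  apply: contrapT => /forallNP nf; apply: no; exists hs => // f Bf.
  apply: contrapT => ns; apply: (nf f) => _; split => // s Hs.
  by rewrite leNgt; apply/negP => lt; apply: ns; exists s.
have [pk pkP] := choice pick.
pose fix hist n := if n is n'.+1 then pk (hist n') :: hist n' else [::].
pose f n := pk (hist n).
have histB n t : span_set (hist n) t -> B t.
  elim: n t => //= n IH t [<-|]; last exact: IH.
  by have [] := pkP _ IH.
have Bf n : B (f n) by have [] := pkP _ (histB n).
have fhist n j : (j < n)%N -> span_set (hist n) (f j).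
  elim: n => // n IH; rewrite ltnS leq_eqVlt => /orP[/eqP->|jn]; first by left.
  by right; exact: IH.
have proj n : exists s, indices_in (span_set (hist n)) s /\
    forall t, span_set (hist n) t -> qform K ([:: (1, f n)] ++ s) [:: (1, t)] = 0.
  have [||s Hs Os] := @projection_exists _ _ G K Ksym Kge0 (hist n) [:: (1, f n)].
  - by move=> t /histB; exact: BG.
  - by split => //; apply: BG; exact: Bf.
  - by exists s.
have [s sP] := choice proj.
have [q /andP[q0 q1] Hq] := @not_exceed_decay _ _ _ P T G K Ksym Z gZ e D e0.
pose r n := [:: (1, f n)] ++ s n; pose u n := lscale (-1) (s n).
have GH n (x : seq (R * T)) : indices_in (span_set (hist n)) x -> indices_in G x.
  by apply: indices_in_sub => t /histB; exact: BG.
have Gr n : indices_in G (r n).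
  by split; [apply: BG; exact: Bf|apply: GH; exact: (sP n).1].
have oru n : qform K (r n) (u n) = 0.
  apply: (qform_orth_sub (H := span_set (hist n))); first exact: (sP n).2.
  by apply: indices_in_scale; exact: (sP n).1.
have rf n : qform K (r n) (r n) <= D.
  have /BD := Bf n; apply: le_trans.
  have -> : K (f n) (f n) = qform K (r n ++ u n) (r n ++ u n).
    rewrite -qform1 !qform_catl !qform_catr /u !qform_scalel !qform_scaler; ring.
  rewrite (qform_cat2 Ksym (r n) (u n)) oru mulr0 addr0 lerDl; apply: Kge0.
  by apply: indices_in_scale; apply: GH; exact: (sP n).1.
have dec := Hq f r u.
have q01 : 0 <= q < 1 by rewrite q0 q1.
have half0 : 0 < 1 / 2 :> R by [].
have [N HN] := expr_small q01 half0.
have : 1 - fine (P (exceed Z f N 1)) <= q ^+ N.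
  apply: dec => //.
  - by move=> n; apply: BG; exact: Bf.
  - by move=> n; apply: indices_in_scale; apply: GH; exact: (sP n).1.
  - by move=> n z; rewrite /r /u lcomb_cat lcomb1 lcomb_scale mulN1r addrK.
  - by move=> n j jn; apply: (sP n).2; exact: fhist.
  - by move=> n; apply: (pkP _ (histB n)).2; exact: (sP n).1.
have := HN N (leqnn _); have := Bhalf Bf N; lra.
Qed.

(** A rational combination close to [f] need not lie in [B]. For each combination an element of [B]
    close to it is fixed when there is one, and these countably many elements are dense. *)
Lemma separable_ball : exists2 g : nat -> T, (forall n, B (g n)) &
  forall f e, B f -> 0 < e -> exists n,
    K f f - 2 * K f (g n) + K (g n) (g n) < e.
Proof.
have dist f g : qform K [:: (1, f); (-1, g)] [:: (1, f); (-1, g)] = K f f - 2 * K f g + K g g.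
  have -> : [:: (1, f); (-1, g)] = [:: (1, f)] ++ lscale (-1) [:: (1 : R, g)].
    by rewrite /lscale /= mulr1.
  rewrite qform_cat2// qform_scale2 qform_scaler !qform1; ring.
have /choice[hs hsP] : forall j, exists hs : seq T, (forall t, span_set hs t -> B t) /\
    forall f, B f -> exists2 s, indices_in (span_set hs) s &
      qform K ((1, f) :: s) ((1, f) :: s) < j.+1%:R^-1.
  move=> j; have [|hs h1 h2] := @finite_span_approx j.+1%:R^-1; first by rewrite invr_gt0.
  by exists hs.
pose ls j (q : seq (rat * nat)) : seq (R * T) := [seq (ratr p.1, nth b0 (hs j) p.2) | p <- q].
have /choice[g gP] : forall x : nat * seq (rat * nat), exists g, B g /\
    forall f, B f -> indices_in G (ls x.1 x.2) ->
    qform K ((1, f) :: ls x.1 x.2) ((1, f) :: ls x.1 x.2) < 4 * x.1.+1%:R^-1 ->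
    qform K ((1, g) :: ls x.1 x.2) ((1, g) :: ls x.1 x.2) < 4 * x.1.+1%:R^-1.
  move=> [j q] /=.
  have [[f [Bf fq]]|no] := pselect (exists f, B f /\
      qform K ((1, f) :: ls j q) ((1, f) :: ls j q) < 4 * j.+1%:R^-1).
    by exists f.
  by exists b0; split => // f Bf _ fq; exfalso; apply: no; exists f.
exists (fun n => if unpickle n is Some x then g x else b0).
  by move=> n; case: unpickle => // x; exact: (gP x).1.
move=> f e Bf e0.
(* Up to sign, [f] and the chosen element are both within squared distance [4 * dl] of the same
   combination; [qform_cat_le2] doubles each, which makes [16 * dl]. *)
pose j := Num.truncn (16 / e).
have je : 16 * j.+1%:R^-1 < e.
  have /andP[_ h] := truncn_itv (ltW (divr_gt0 (ltr0n _ 16) e0)).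
  by rewrite ltr_pdivrMr// -ltr_pdivrMl// mulrC.
set dl := j.+1%:R^-1 in je.
have dl0 : 0 < dl by rewrite invr_gt0.
have [s Hs fs] := (hsP j).2 f Bf.
have D0 : 0 <= D by apply: (le_trans _ (BD Bb0)); apply: (kernel_diag_ge0 Kge0); exact: BG.
pose e1 := Num.min 1 (dl / (D + 1)).
have D1 : 0 < D + 1 by rewrite ltr_wpDl.
have e10 : 0 < e1 by rewrite lt_min ltr01 divr_gt0.
have [q [w [Hw We Hq Eq]]] := rational_approx K b0 e10 Hs.
have BH (x : seq (R * T)) : indices_in (span_set (hs j)) x -> indices_in B x.
  by apply: indices_in_sub => t; exact: (hsP j).1.
have GH (x : seq (R * T)) : indices_in (span_set (hs j)) x -> indices_in G x.
  by move=> /BH; apply: indices_in_sub.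
have fls : qform K ((1, f) :: ls j q) ((1, f) :: ls j q) < 4 * dl.
  have E v : qform K ((1, f) :: ls j q) v = qform K (((1, f) :: s) ++ w) v.
    by rewrite -[(1, f) :: ls j q]cat1s -[(1, f) :: s]cat1s !qform_catl Eq addrA.
  rewrite E qform_sym// E.
  have Gfs : indices_in G ((1, f) :: s) by split; [exact: BG|exact: GH].
  have := qform_cat_le2 Ksym Kge0 Gfs (GH _ Hw).
  have : qform K w w <= dl.
    apply: (le_trans (ler_norm _)).
    have KD t t' : B t -> B t' -> `|K t t'| <= D.
      by move=> Bt Bt'; apply: (kernel_bound Ksym Kge0); rewrite ?BD//; exact: BG.
    apply: (le_trans (qform_abs_bound (BH _ Hw) (BH _ Hw) KD)).
    have w0 : 0 <= \sum_(p <- w) `|p.1| by apply: sumr_ge0.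
    have W1 : \sum_(p <- w) `|p.1| <= 1 by rewrite (le_trans We)// ge_min lexx.
    have W2 : (\sum_(p <- w) `|p.1|) * (D + 1) <= dl.
      by rewrite -ler_pdivlMr// (le_trans We)// ge_min lexx orbT.
    move: (\sum_(p <- w) `|p.1|) w0 W1 W2 => W w0 W1 W2.
    have : W * W * D <= W * D by rewrite ler_wpM2r// ler_piMr.
    rewrite mulrDr mulr1 in W2; lra.
  move: fs; rewrite -/dl; lra.
have Gls : indices_in G (ls j q) by exact: GH.
have gls := (gP (j, q)).2 f Bf Gls fls.
have Bg := (gP (j, q)).1.
exists (pickle (j, q)); rewrite pickleK -dist /=.
set h := g (j, q) in gls Bg *.
have -> : qform K [:: (1, f); (-1, h)] [:: (1, f); (-1, h)] =
    qform K (((1, f) :: ls j q) ++ lscale (-1) ((1, h) :: ls j q))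
            (((1, f) :: ls j q) ++ lscale (-1) ((1, h) :: ls j q)).
  have E x v : qform K (x :: v) = fun y => qform K [:: x] y + qform K v y.
    by apply/funext => y; rewrite -cat1s qform_catl.
  have E' v : qform K (((1, f) :: ls j q) ++ lscale (-1) ((1, h) :: ls j q)) v
      = qform K [:: (1, f); (-1, h)] v.
    rewrite qform_catl qform_scalel !(E _ (ls j q)) (E _ [:: (-1, h)]).
    have -> : qform K [:: (-1, h)] v = - qform K [:: (1, h)] v.
      by rewrite (_ : [:: (-1, h)] = lscale (-1) [:: (1 : R, h)]) ?qform_scalel ?mulN1r// /lscale /= mulr1.
    ring.
  by rewrite E' qform_sym// [RHS]qform_sym// E' qform_sym//.
have Gf1 : indices_in G ((1, f) :: ls j q) by split => //; exact: BG.
have Gh1 : indices_in G ((1, h) :: ls j q) by split => //; exact: BG.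
have := qform_cat_le2 Ksym Kge0 Gf1 (indices_in_scale (-1) Gh1).
rewrite qform_scale2 sqrrN expr1n mul1r.
move: fls gls je; rewrite /= -/dl; lra.
Qed.

End separability.

(** * Equicontinuity at zero, uniformly in the process *)

Section equicontinuity.
Context d (Omega : measurableType d) (R : realType) (P : probability Omega R).
Context (T : Type) (G : set T) (K : T -> T -> R).
Hypothesis Ksym : forall f g, K f g = K g f.
Variable Z : nat -> T -> Omega -> R.
Hypothesis gZ : forall n, gaussian_on P G K (Z n).
Hypothesis Zcont : forall n, {ae P, forall w, forall eps, 0 < eps ->
  exists2 delta, 0 < delta & forall f g, G f -> G g ->
    K f f - 2 * K f g + K g g < delta ^+ 2 -> `|Z n f w - Z n g w| < eps}.
Variable t0 : T.
Hypotheses (Gt0 : G t0) (K0 : forall t, K t0 t = 0).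

Lemma gaussian_zero n : {ae P, forall w, Z n t0 w = 0}.
Proof.
have [_ law] := (gZ n).2 [:: (1, t0)] (conj Gt0 I).
exists (Z n t0 @^-1` (~` [set 0])); split => //.
  by rewrite -[X in measurable X]setTI; apply: (gZ n).1 => //; apply: measurableC.
have := law (~` [set 0]) (measurableC (measurable_set1 0)).
have h0 : (0 : R) \in ~` [set 0] = false by apply/negP; rewrite inE => /(_ erefl).
rewrite qform1 K0 /centered_normal eqxx /= diracE h0.
by rewrite (_ : (fun w => lcomb (Z n ^~ w) [:: (1, t0)]) = Z n t0)//; apply/funext => w; rewrite lcomb1.
Qed.

Lemma mu_ext_le_measurable (S A : set Omega) : measurable A -> S `<=` A ->
  (mu_ext P S <= P A)%E.
Proof.
by move=> mA SA; apply: le_trans (le_mu_ext P SA) _; rewrite measurable_mu_extE.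
Qed.

(** Otherwise, for every [j], a finite family of variances below $1/(j+1)^2$ exceeds [e] with
    probability above [eta], so infinitely many do with probability at least [eta]. Uniform
    continuity of the path, which vanishes at [t0], excludes this almost surely. *)
Lemma countable_equicontinuity e eta : 0 < e -> 0 < eta -> exists2 delta, 0 < delta &
  forall f : nat -> T, (forall i, G (f i) /\ K (f i) (f i) < delta ^+ 2) ->
  forall m, fine (P (exceed (Z 0) f m e)) <= eta.
Proof.
move=> e0 eta0; apply: contrapT => no.
have ex j : exists fm : (nat -> T) * nat,
    (forall i, G (fm.1 i) /\ K (fm.1 i) (fm.1 i) < j.+1%:R^-1 ^+ 2) /\
    eta < fine (P (exceed (Z 0) fm.1 fm.2 e)).
  apply: contrapT => nj; apply: no; exists j.+1%:R^-1; first by rewrite invr_gt0.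
  move=> f fG m; rewrite leNgt; apply/negP => h; apply: nj; by exists (f, m).
have [F FP] := choice ex.
pose E j := exceed (Z 0) (F j).1 (F j).2 e.
have mE j : measurable (E j) by apply: measurable_exceed; exact: (gZ 0).1.
pose U N := \bigcup_(j in [set j | (N <= j)%N]) E j.
have mU N : measurable (U N) by apply: bigcup_measurable.
have niU : nonincreasing_seq U.
  by move=> N N' NN; apply/subsetPset => w [j /= Nj Ej]; exists j => //=; exact: leq_trans NN _.
have cv : P (U N) @[N --> \oo] --> P (\bigcap_N U N).
  apply: nonincreasing_cvg_mu => //; last by apply: bigcap_measurable.
  exact: le_lt_trans (probability_le1 P (mU 0%N)) (ltry _).
have neg := negligibleU (Zcont 0) (gaussian_zero 0).
have P0 : P (\bigcap_N U N) = 0%E.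
  apply: measure_negligible; first exact: bigcap_measurable.
  apply: (negligibleS _ neg) => w wU; apply: contrapT => nA.
  have /contrapT c1 : ~ ~ (forall eps, 0 < eps ->
    exists2 delta, 0 < delta & forall f g, G f -> G g ->
    K f f - 2 * K f g + K g g < delta ^+ 2 -> `|Z 0 f w - Z 0 g w| < eps).
    by move=> nc; apply: nA; left.
  have /contrapT c2 : ~ ~ (Z 0 t0 w = 0).
    by move=> nc; apply: nA; right.
  have [delta d0 Hd] := c1 e e0.
  have := wU (Num.truncn delta^-1) I.
  move=> [j /= Nj [i im]]; apply/negP; rewrite -leNgt.
  have [Gf Kf] := (FP j).1 i.
  apply: ltW; rewrite -[X in `|X|]subr0 -c2; apply: Hd => //.
  rewrite [K _ t0]Ksym !K0 mulr0 subr0 addr0 (lt_le_trans Kf)//.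
  rewrite lerXn2r ?nnegrE ?invr_ge0 ?(ltW d0)//.
  rewrite -[leRHS]invrK lef_pV2 ?posrE ?invr_gt0//.
  have {}h : delta^-1 <= (Num.truncn delta^-1).+1%:R.
    have di : 0 <= delta^-1 by rewrite invr_ge0 ltW.
    by have /andP[_ /ltW] := truncn_itv di.
  by rewrite (le_trans h)// ler_nat ltnS.
have : (eta%:E <= P (\bigcap_N U N))%E.
  rewrite -(cvg_lim _ cv)//; apply: lime_ge; first by apply/cvg_ex; eexists; exact: cv.
  apply: nearW => N; apply: (@le_trans _ _ (P (E N))).
    rewrite -fine_probability// lee_fin ltW//; exact: (FP N).2.
  by apply: le_measure; rewrite ?inE// => w Ew; exists N => /=.
by rewrite P0 lee_fin leNgt eta0.
Qed.

(** The bound for the process of index 0 is moved to every [Z n] by [exceed_compare] along one dense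
    sequence of the ball, and extended to the whole ball by the continuity of the paths of [Z n].
    Each of these two steps halves the level, hence [e / 4]. *)
Lemma gaussian_equicontinuity e eta : 0 < e -> 0 < eta -> exists2 delta, 0 < delta &
  forall n, (mu_ext P [set w | exists f, [/\ G f, (K f f < delta ^+ 2)%R & (e < `|Z n f w|)%R]]
    <= eta%:E)%E.
Proof.
move=> e0 eta0.
(* Level 1 with probability one half is what [separable_ball] asks of the ball. *)
have [d0 d00 Hd0] := @countable_equicontinuity 1 (1 / 2) ltr01 ltac:(by []).
have e40 : 0 < e / 4 by rewrite divr_gt0.
have [d1 d10 Hd1] := countable_equicontinuity e40 eta0.
pose dm := Num.min d0 d1.
have dm0 : 0 < dm by rewrite lt_min d00.
have dmd0 : dm ^+ 2 <= d0 ^+ 2 by rewrite lerXn2r ?nnegrE ?(ltW dm0) ?(ltW d00)// ge_min lexx.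
have dmd1 : dm ^+ 2 <= d1 ^+ 2 by rewrite lerXn2r ?nnegrE ?(ltW dm0) ?(ltW d10)// ge_min lexx orbT.
have dm2 : 0 < dm ^+ 2 by rewrite exprn_gt0.
pose B := [set t | G t /\ K t t < dm ^+ 2].
have Bt0 : B t0 by split; rewrite ?K0.
have Bhalf (f : nat -> T) : (forall n, B (f n)) -> forall n, fine (P (exceed (Z 0) f n 1)) <= 1 / 2.
  by move=> Bf n; apply: Hd0 => i; have [? h] := Bf i; split => //; exact: lt_le_trans dmd0.
have BG : B `<=` G by move=> t [].
have BD t : B t -> K t t <= dm ^+ 2 by move=> [_ /ltW].
have [g Bg gd] := separable_ball Ksym (gZ 0) BG BD Bt0 Bhalf.
have Kge0 s : indices_in G s -> 0 <= qform K s s by exact: (qform_ge0 (gZ 0)).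
exists (dm / 2); first by rewrite divr_gt0.
move=> n.
pose W := \bigcup_m exceed (Z n) g m (e / 2).
have mX m : measurable (exceed (Z n) g m (e / 2)) by apply: measurable_exceed; exact: (gZ n).1.
have mW : measurable W by exact: bigcup_measurable.
have e20 : 0 < e / 2 by rewrite divr_gt0.
have PW : (P W <= eta%:E)%E.
  have cv : P (exceed (Z n) g m (e / 2)) @[m --> \oo] --> P W.
    apply: nondecreasing_cvg_mu => // m m' mm; apply/subsetPset => w [i im h].
    by exists i => //; exact: leq_trans mm.
  rewrite -(cvg_lim _ cv)//; apply: lime_le; first by apply/cvg_ex; eexists; exact: cv.
  apply: nearW => m; rewrite -fine_probability// lee_fin.
  have := @exceed_compare _ _ _ P T G K (Z n) (Z 0) g m (e / 2) (gZ n) (gZ 0) _ e20.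
  rewrite (_ : e / 2 / 2 = e / 4); last by field.
  move=> /(_ _)/le_trans; apply; first by move=> i; exact: (Bg i).1.
  by apply: Hd1 => i; have [? h] := Bg i; split => //; exact: lt_le_trans dmd1.
have [A [mA PA sA]] := Zcont n.
have -> : eta%:E = (eta%:E + 0)%E by rewrite adde0.
apply: (@le_trans _ _ (P (W `|` A))).
  apply: mu_ext_le_measurable; first exact: measurableU.
  move=> w [f [Gf Kf ef]]; apply: contrapT => nWA.
  have /contrapT c1 : ~ ~ (forall eps, 0 < eps ->
    exists2 delta, 0 < delta & forall f g, G f -> G g ->
    K f f - 2 * K f g + K g g < delta ^+ 2 -> `|Z n f w - Z n g w| < eps).
    by move=> nc; apply: nWA; right; exact: sA.
  have [dl dl0 Hdl] := c1 _ e20.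
  have Kf4 : K f f < dm ^+ 2 / 4.
    by rewrite (lt_le_trans Kf)// le_eqVlt; apply/orP; left; apply/eqP; field.
  have Bf : B f by split => //; lra.
  have dl2 : 0 < dl ^+ 2 by rewrite exprn_gt0.
  have [i Ki] := gd f (dl ^+ 2) Bf dl2.
  have := Hdl f (g i) Gf (Bg i).1 Ki.
  have : `|Z n (g i) w| <= e / 2.
    rewrite leNgt; apply/negP => h; apply: nWA; left.
    by exists i.+1 => //; exists i.
  have := ler_distD (Z n (g i) w) (Z n f w) 0; rewrite !subr0.
  lra.
apply: (@le_trans _ _ (P W + P A)%E); first exact: measureU2.
apply: leeD => //.
by rewrite le_eqVlt; apply/orP; left; apply/eqP.
Qed.

End equicontinuity.

Section whp_le.
Context {R : realType} {dO : measure_display} {Omega : measurableType dO}.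
Variable P : probability Omega R.

Lemma whp_le (S : nat -> set Omega) :
  (forall eta : R, 0 < eta -> \forall n \near \oo, (mu_ext P (~` S n) <= eta%:E)%E) -> whp P S.
Proof.
move=> H; have H1 n : (0 <= mu_ext P (~` S n))%E by exact: mu_ext_prob_ge0.
apply: cvg_EFin.
  apply: filterS (H 1 ltr01) => n le1; rewrite ge0_fin_numE//.
  exact: le_lt_trans le1 (ltry _).
apply/cvgrPdist_le => eta eta0; apply: filterS (H eta eta0) => n le_eta /=.
rewrite sub0r normrN ger0_norm ?fine_ge0// -lee_fin fineK// ge0_fin_numE//.
exact: le_lt_trans le_eta (ltry _).
Qed.

End whp_le.

(** * The empirical process at the estimated function *)

Section donsker_application.
Context {R : realType} {dO dE : measure_display}.
Context {Omega : measurableType dO} {E : measurableType dE}.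
Variables (P : probability Omega R) (X : nat -> {RV P >-> E}).
Local Notation K := (longrun_cov X).

Lemma longrun_covC f g : K f g = K g f.
Proof.
rewrite /longrun_cov; suff -> : longrun_partial X f g = longrun_partial X g f by [].
apply/funext => N.
rewrite /longrun_partial; congr (_ + _); first by rewrite /autocov covarianceC.
by apply: eq_bigr => t _; rewrite addrC.
Qed.

Lemma longrun_cov0 f : K (fun _ _ => 0) f = 0.
Proof.
have a0 t : autocov X (fun _ _ => 0) f t = 0.
  by rewrite /autocov (_ : pair_at X (fun _ _ => 0) 0 = cst 0)// covariance_cst_l.
have a1 t : autocov X f (fun _ _ => 0) t = 0.
  by rewrite /autocov (_ : pair_at X (fun _ _ => 0) t = cst 0)// covariance_cst_r.
rewrite /longrun_cov (_ : longrun_partial X (fun _ _ => 0) f = cst 0) ?lim_cst//.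
apply/funext => N; rewrite /longrun_partial a0 add0r big1// => t _; by rewrite a0 a1 addr0.
Qed.

Variables (G : set (E -> E -> R)) (ghat : nat -> Omega -> E -> E -> R).
Hypothesis G0 : G (fun _ _ => 0).
Hypothesis Gdonsker : donsker X G.
Hypothesis ghat_in : forall n w, G (ghat n w).
Hypothesis Kghat : is_op P (fun=> 1) (fun n w => (K (ghat n w) (ghat n w))%:E).

Lemma gaussian_process_on (Z : (E -> E -> R) -> {RV P >-> R}) :
  gaussian_process P G K (fun g => Z g) -> gaussian_on P G K (fun g => Z g).
Proof.
move=> GZ; split=> [t|s sG]; first by [].
pose s0 := (0, fun _ _ => 0) : R * (E -> E -> R).
have := GZ (size s) (fun i => (nth s0 s i).2) (fun i => (nth s0 s i).1)
  (fun i => indices_in_nth s0 sG (ltn_ord i)).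
congr (has_centered_normal_law P _ _).
  by apply/funext => w; rewrite /lcomb (big_nth s0) big_mkord.
rewrite /qform (big_nth s0) big_mkord; apply: eq_bigr => i _.
by rewrite (big_nth s0) big_mkord.
Qed.

(** With high probability the estimated function is in a small ball around the zero function, which
    belongs to the class. There the approximating Gaussian process is small for every [n], and its
    distance to the empirical process is small uniformly over the class. *)
Lemma empirical_equicontinuity eps : 0 < eps ->
  whp P (fun n => [set w | `|empirical X n (ghat n w) w| <= eps]).
Proof.
move=> e0; have e20 : 0 < eps / 2 by rewrite divr_gt0.
have [Z [gZ cZ aZ]] := donsker_approx Gdonsker.
apply: whp_le => eta eta0; have eta20 : 0 < eta / 2 by rewrite divr_gt0.
have [delta d0 dP] := gaussian_equicontinuity longrun_covC (fun n => gaussian_process_on (gZ n)) cZ G0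
  longrun_cov0 e20 eta20.
have w1 : whp P (fun n => [set w | ereal_sup [set (`|empirical X n g w - Z n g w|)%:E | g in G]
    <= (eps / 2)%:E]%E).
  have := aZ _ e20; apply: cvg_trans; apply: near_eq_cvg; apply: nearW => n.
  have sup0 w : (0 <= ereal_sup [set (`|empirical X n g w - Z n g w|)%:E | g in G])%E.
    apply: le_trans (ereal_sup_ubound _); last by exists (fun _ _ => 0).
    by rewrite lee_fin.
  congr mu_ext; apply/seteqP; split => w /=; rewrite mulr1 gee0_abs// ltNge.
    by move=> /negP.
  by move=> H; apply/negP.
have d20 : 0 < delta ^+ 2 / 2 by rewrite divr_gt0// exprn_gt0.
have /is_opP/(_ _ d20) w2 := Kghat.
have eta40 : 0 < eta / 4 by rewrite divr_gt0.
near=> n.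
have h1 : (mu_ext P (~` [set w | ereal_sup [set (`|empirical X n g w - Z n g w|)%:E | g in G]
    <= (eps / 2)%:E]%E) <= (eta / 4)%:E)%E.
  by apply: ltW; near: n; exact: cvge0_near_lt w1 eta40.
have h2 : (mu_ext P (~` [set w | (`|K (ghat n w) (ghat n w)| <= delta ^+ 2 / 2 * 1)%R]) <= (eta / 4)%:E)%E.
  by apply: ltW; near: n; exact: cvge0_near_lt w2 eta40.
have -> : eta%:E = ((eta / 4)%:E + (eta / 4)%:E + (eta / 2)%:E)%E.
  by rewrite -!EFinD; congr EFin; field.
apply: le_trans (leeD (leeD h1 h2) (dP n)).
apply: le_trans (leeD (outer_measureU2 _ _ _) (lexx _)).
apply: le_trans (outer_measureU2 _ _ _).
apply: le_mu_ext => w /= nS.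
have [a1|] := pselect (ereal_sup [set (`|empirical X n g w - Z n g w|)%:E | g in G]
    <= (eps / 2)%:E)%E; last by left; left.
have [a2|] := pselect (`|K (ghat n w) (ghat n w)| <= delta ^+ 2 / 2 * 1); last by left; right.
right; exists (ghat n w); split => //.
  apply: le_lt_trans (ler_norm _) (le_lt_trans a2 _); rewrite mulr1 ltr_pdivrMr// mulrC.
  by rewrite ltr_pMl ?exprn_gt0// ltr1n.
have a3 : `|empirical X n (ghat n w) w - Z n (ghat n w) w| <= eps / 2.
  rewrite -lee_fin; apply: le_trans a1; apply: ereal_sup_ubound.
  by exists (ghat n w).
have : eps < `|empirical X n (ghat n w) w| by rewrite ltNge; apply/negP.
have := ler_normD (empirical X n (ghat n w) w - Z n (ghat n w) w) (Z n (ghat n w) w).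
by rewrite subrK; move: a3; lra.
Unshelve. all: by end_near. Qed.

End donsker_application.

(** * Moment bounds for products and normalized sums *)

Section product_moments.
Context {R : realType} {dO dE : measure_display}.
Context {Omega : measurableType dO} {E : measurableType dE}.
Variables (P : probability Omega R) (X : nat -> {RV P >-> E}).
Hypothesis Xs : strictly_stationary X.
Local Notation Q := (stat_dist X).

(** An elementary form of Young's inequality: the exponents are such that the larger of [c] and
    $a^{(s-2)/2}$ bounds the square of the product by its own term on the right. *)
Lemma sqr_mul_powR_le (a c s : R) : 2 < s -> 0 <= a -> 0 <= c ->
  (a * c) ^+ 2 <= a `^ s + c `^ (2 * s / (s - 2)).
Proof.
move=> s2 a0 c0; have s20 : 0 < s - 2 by rewrite subr_gt0.
have [ca|ac] := leP c (a `^ ((s - 2) / 2)).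
  apply: (@le_trans _ _ (a `^ s)); last by rewrite lerDl powR_ge0.
  apply: (@le_trans _ _ (a ^+ 2 * (a `^ ((s - 2) / 2)) ^+ 2)).
    by rewrite exprMn ler_wpM2l ?sqr_ge0// ler_sqr ?nnegrE ?powR_ge0.
  rewrite -!powR_mulrn ?powR_ge0// -powRrM -powRD; last first.
    by apply/implyP => /eqP; lra.
  by rewrite (_ : 2%:R + _ = s)//; field.
have {}c0 : 0 < c by apply: le_lt_trans ac; exact: powR_ge0.
apply: (@le_trans _ _ (c `^ (2 * s / (s - 2)))); last by rewrite lerDr powR_ge0.
have ac' : a <= c `^ (2 / (s - 2)).
  have -> : a = (a `^ ((s - 2) / 2)) `^ (2 / (s - 2)).
    rewrite -powRrM (_ : _ * _ = 1) ?powRr1//; field.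
    by rewrite gt_eqF.
  by apply: ge0_ler_powR; rewrite ?nnegrE ?powR_ge0// ?(ltW ac) ?(ltW c0)// divr_ge0// ltW.
apply: (@le_trans _ _ ((c `^ (2 / (s - 2))) ^+ 2 * c ^+ 2)).
  by rewrite exprMn ler_wpM2r ?sqr_ge0// ler_sqr ?nnegrE ?powR_ge0.
rewrite -!powR_mulrn ?powR_ge0// ?(ltW c0)// -powRrM -powRD; last first.
  by apply/implyP => _; rewrite gt_eqF.
rewrite (_ : _ + _ = 2 * s / (s - 2))//; field.
by rewrite gt_eqF.
Qed.

Lemma L2_comp t (f : E -> R) : L2 Q f ->
  L2 P (fun w => f (X t w)) /\ L2norm P (fun w => f (X t w)) = L2norm Q f.
Proof.
move=> f2; have mf := L2_measurable f2.
have fP : L2 P (fun w => f (X t w)).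
  apply: L2_intro; first exact: measurableT_comp.
  exact: (integrable_stat Xs t (L2_integrable_sqr f2)).
split=> //; rewrite !L2normE//; congr Num.sqrt.
exact: (Rintegral_stat Xs t (measurable_funM mf mf)).
Qed.

(* A three-factor Hölder inequality with exponents [2], [s] and [2s/(s-2)]. *)
Lemma weighted_product_le (D : E * E -> R) (s A B : R) (f g : E -> R) (i j : nat) :
  2 < s -> measurable_fun [set: E * E] D -> (forall z, 0 <= D z) ->
  (\int[P]_w (D (pair_rv X 0 w) `^ s)%:E <= A%:E)%E ->
  (\int[Q]_x (`|g x| `^ (2 * s / (s - 2)))%:E <= B%:E)%E ->
  L2 Q f -> measurable_fun [set: E] g ->
  (\int[P]_w (D (pair_rv X 0 w) * `|f (X i w)| * `|g (X j w)|)%:E <=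
    (Num.sqrt (A + B) * L2norm Q f)%:E)%E.
Proof.
move=> s2 mD D0 DA gB f2 mg; have f2' := L2_abs f2.
have [fP fN] := L2_comp i f2'.
have mDX : measurable_fun setT (fun w => D (pair_rv X 0 w)).
  by apply: (measurableT_comp mD); exact: measurable_pair_rv.
have mag : measurable_fun setT (fun x => `|g x|) by exact: measurableT_comp.
have magX : measurable_fun setT (fun w => `|g (X j w)|) by apply: (measurableT_comp mag).
pose G w := D (pair_rv X 0 w) * `|g (X j w)|.
have mG : measurable_fun setT G by exact: measurable_funM.
have GAB : (\int[P]_w (G w ^+ 2)%:E <= (A + B)%:E)%E.
  have mgp : measurable_fun setT (fun x => (`|g x| `^ (2 * s / (s - 2)))%:E).
    by apply/measurable_EFinP; apply: (measurableT_comp (measurable_powR _)).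
  rewrite EFinD; apply: le_trans (leeD DA gB).
  have mgpX : measurable_fun setT (fun w => (`|g (X j w)| `^ (2 * s / (s - 2)))%:E).
    by apply: (measurableT_comp mgp).
  have mDs : measurable_fun setT (fun w => (D (pair_rv X 0 w) `^ s)%:E).
    by apply/measurable_EFinP; apply: (measurableT_comp (measurable_powR _)).
  rewrite -(integral_stat Xs j mgp) -ge0_integralD//=; try by move=> w _; rewrite lee_fin powR_ge0.
  apply: ge0_le_integral => //.
  - by move=> w _; rewrite lee_fin sqr_ge0.
  - by apply/measurable_EFinP; exact: measurable_funX.
  - exact: emeasurable_funD.
  - by move=> w _; rewrite -EFinD lee_fin; exact: sqr_mul_powR_le.
have G2 : L2 P G.
  apply: L2_intro => //; apply/integrableP; split.
    by apply/measurable_EFinP; exact: measurable_funX.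
  apply: le_lt_trans (ltry (A + B)); apply: le_trans GAB.
  by under eq_integral do rewrite gee0_abs ?lee_fin ?sqr_ge0//.
have GN : L2norm P G <= Num.sqrt (A + B).
  rewrite L2normE// ler_wsqrtr// -lee_fin /L2inner -integral_EFin.
    by apply: le_trans GAB; under eq_integral do rewrite -expr2.
  exact: L2_mul_integrable.
have fG := inner_le fP G2; rewrite fN in fG.
have -> : L2norm Q f = L2norm Q (fun x => `|f x|).
  rewrite !L2normE//; congr Num.sqrt; apply: eq_Rintegral => x _.
  by rewrite -normrM ger0_norm// -expr2 sqr_ge0.
have -> : (\int[P]_w (D (pair_rv X 0 w) * `|f (X i w)| * `|g (X j w)|)%:E =
    (L2inner P (fun w => `|f (X i w)|) G)%:E)%E.
  rewrite /L2inner -integral_EFin; last exact: L2_mul_integrable.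
  by apply: eq_integral => w _; rewrite /G mulrA (mulrC (D _)).
rewrite lee_fin; apply: le_trans (ler_norm _) (le_trans fG _).
by rewrite mulrC ler_wpM2r ?L2norm_ge0.
Qed.

Lemma mul_le_L2norm (f g : E -> R) t : L2 Q f -> L2 Q g ->
  (\int[P]_w (`|f (X t w)| * `|g (X t w)|)%:E <= (L2norm Q f * L2norm Q g)%:E)%E.
Proof.
move=> f2 g2; have f2' := L2_abs f2; have g2' := L2_abs g2.
have [fP <-] := L2_comp t f2; have [gP <-] := L2_comp t g2.
have N (h : Omega -> R) : L2 P h -> L2norm P h = L2norm P (fun x => `|h x|).
  move=> h2; rewrite !L2normE//; last exact: L2_abs.
  congr Num.sqrt; apply: eq_Rintegral => x _.
  by rewrite -normrM ger0_norm// -expr2 sqr_ge0.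
rewrite (N _ fP) (N _ gP) (integral_EFin (L2_mul_integrable (L2_abs fP) (L2_abs gP))) lee_fin.
by apply: le_trans (ler_norm _) (inner_le _ _); exact: L2_abs.
Qed.

(** By stationarity all [n] terms have the same mean, whatever their dependence; the normalization
    leaves a factor $\sqrt n$. *)
Lemma normalized_sum_integral (h : E * E -> R) (r : R) n :
  measurable_fun [set: E * E] h -> (forall z, 0 <= h z) ->
  (\int[P]_w (h (pair_rv X 0 w))%:E <= r%:E)%E ->
  (\int[P]_w (normalized_sum (fun t w => h (pair_rv X t w)) n w)%:E <= (Num.sqrt n%:R * r)%:E)%E.
Proof.
move=> mh h0 hr.
have mhX t : measurable_fun setT (fun w => h (pair_rv X t w)).
  by apply: (measurableT_comp mh); exact: measurable_pair_rv.
have mS : measurable_fun setT (fun w => \sum_(t < n) (h (pair_rv X t w))%:E)%E.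
  by apply: emeasurable_sum => t; exact/measurable_EFinP.
have -> : (\int[P]_w (normalized_sum (fun t w => h (pair_rv X t w)) n w)%:E =
    ((Num.sqrt n%:R)^-1)%:E * \sum_(t < n) \int[P]_w (h (pair_rv X t w))%:E)%E.
  rewrite -ge0_integral_sum//=; last 2 first.
  - by move=> t; exact/measurable_EFinP.
  - by move=> t w _; rewrite lee_fin.
  rewrite -ge0_integralZl//.
  - by apply: eq_integral => w _; rewrite /normalized_sum EFinM -sumEFin.
  - by move=> w _; apply: sume_ge0 => t _; rewrite lee_fin.
apply: (@le_trans _ _ (((Num.sqrt n%:R)^-1)%:E * \sum_(t < n) r%:E)%E).
  rewrite lee_wpmul2l ?lee_fin ?invr_ge0 ?sqrtr_ge0//.
  apply: lee_sum => t _; apply: le_trans hr.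
  have me : measurable_fun [set: E * E] (fun z => (h z)%:E) by exact/measurable_EFinP.
  by rewrite (integral_pair Xs t me).
rewrite sumEFin -EFinM lee_fin sumr_const card_ord -[r *+ n]mulr_natr.
rewrite (_ : r * n%:R = (Num.sqrt n%:R * r) * Num.sqrt n%:R); last first.
  by rewrite mulrAC -expr2 sqr_sqrtr// mulrC.
have [->|n0] := eqVneq (Num.sqrt (n%:R : R)) 0; first by rewrite !(mulr0, mul0r).
by rewrite mulrC mulfK.
Qed.

Lemma normalized_sum_markov (h : nat -> E * E -> R) (r : nat -> R) :
  (forall n, measurable_fun [set: E * E] (h n)) -> (forall n z, 0 <= h n z) ->
  (\forall n \near \oo, (\int[P]_w (h n (pair_rv X 0 w))%:E <= (r n)%:E)%E) ->
  Num.sqrt n%:R * r n @[n --> \oo] --> (0 : R) ->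
  forall eps, 0 < eps ->
    whp P (fun n => [set w | normalized_sum (fun t w => h n (pair_rv X t w)) n w <= eps]).
Proof.
move=> mh h0 hr r0; apply: whp_markov r0.
- move=> n; apply: measurable_funM => //; apply: measurable_sum => t.
  by apply: (measurableT_comp (mh n)); exact: measurable_pair_rv.
- by move=> n w; rewrite mulr_ge0 ?invr_ge0 ?sqrtr_ge0// sumr_ge0.
- by apply: filterS hr => n; exact: normalized_sum_integral.
Qed.

End product_moments.

(** * Sample matrices as bilinear forms *)

Section bilinear_form.
Context {R : realType} {dO dE : measure_display}.
Context {Omega : measurableType dO} {E : measurableType dE}.
Variables (P : probability Omega R) (X : nat -> {RV P >-> E}).
Variables (k : nat) (b : 'I_k -> E -> R) (c cs : 'cV[R]_k) (n : nat) (w : Omega).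

Lemma dot_sum_outer (u v : nat -> 'I_k -> R) :
  dot cs ((\matrix_(i, j) (n%:R^-1 * \sum_(t < n) u t i * v t j)) *m c) =
  n%:R^-1 * \sum_(t < n) (\sum_i cs i 0 * u t i) * (\sum_j c j 0 * v t j).
Proof.
rewrite dotE; under eq_bigr do rewrite mxE.
under eq_bigr => i _.
  under eq_bigr => j _ do rewrite mxE -mulrA.
  rewrite -mulr_sumr mulrCA.
  over.
rewrite -mulr_sumr; congr (_ * _).
under [RHS]eq_bigr do rewrite mulr_suml.
rewrite exchange_big; apply: eq_bigr => i _.
under [RHS]eq_bigr do rewrite mulr_sumr.
rewrite exchange_big mulr_sumr; apply: eq_bigr => j _.
rewrite mulr_suml mulr_sumr; apply: eq_bigr => t _; ring.
Qed.

Lemma dot_Ghat : dot cs (Ghat X b n w *m c) =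
  n%:R^-1 * \sum_(t < n) lincomb b cs (X t w) * lincomb b c (X t w).
Proof. exact: (dot_sum_outer (fun t i => b i (X t w)) (fun t i => b i (X t w))). Qed.

Lemma dot_Mhat (mhat : Omega -> E -> E -> R) : dot cs (Mhat X b mhat n w *m c) =
  n%:R^-1 * \sum_(t < n) lincomb b cs (X t w) * mhat w (X t w) (X t.+1 w) * lincomb b c (X t.+1 w).
Proof.
rewrite (dot_sum_outer (fun t i => b i (X t w) * mhat w (X t w) (X t.+1 w)) (fun t i => b i (X t.+1 w))).
congr (_ * _); apply: eq_bigr => t _; congr (_ * _).
by rewrite /lincomb mulr_suml; apply: eq_bigr => i _; rewrite mulrA.
Qed.

End bilinear_form.

Section integral_bounds.
Context {R : realType} {dO : measure_display} {Omega : measurableType dO}.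
Variable P : probability Omega R.

Lemma integral_le_add (f g h : Omega -> R) (a c : R) :
  measurable_fun setT f -> measurable_fun setT g -> measurable_fun setT h ->
  (forall w, 0 <= f w) -> (forall w, 0 <= g w) -> (forall w, 0 <= h w) ->
  (forall w, h w <= f w + g w) ->
  (\int[P]_w (f w)%:E <= a%:E)%E -> (\int[P]_w (g w)%:E <= c%:E)%E ->
  (\int[P]_w (h w)%:E <= (a + c)%:E)%E.
Proof.
move=> mf mg mh f0 g0 h0 hfg fa gc; rewrite EFinD; apply: le_trans (leeD fa gc).
rewrite -ge0_integralD//=; try by move=> w _; rewrite lee_fin.
- apply: ge0_le_integral => //.
  + by move=> w _; rewrite lee_fin.
  + exact/measurable_EFinP.
  + by apply: emeasurable_funD; exact/measurable_EFinP.
  + by move=> w _; rewrite -EFinD lee_fin.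
- exact/measurable_EFinP.
- exact/measurable_EFinP.
Qed.

Lemma integral_le_scale (f : Omega -> R) (a c : R) : measurable_fun setT f ->
  (forall w, 0 <= f w) -> 0 <= c -> (\int[P]_w (f w)%:E <= a%:E)%E ->
  (\int[P]_w (c * f w)%:E <= (c * a)%:E)%E.
Proof.
move=> mf f0 c0 fa; under eq_integral do rewrite EFinM.
rewrite ge0_integralZl//; last 2 first.
- exact/measurable_EFinP.
- by move=> w _; rewrite lee_fin.
by rewrite EFinM lee_wpmul2l// lee_fin.
Qed.

Lemma whp_ae (S : set Omega) : {ae P, forall w, S w} -> whp P (fun=> S).
Proof.
move=> [N [mN N0 SN]]; rewrite /whp (_ : mu_ext P (~` S) = 0%E); first exact: cvg_cst.
apply/eqP; rewrite eq_le mu_ext_prob_ge0 andbT.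
apply: (@le_trans _ _ (P N)); last by rewrite N0.
by rewrite -(measurable_mu_extE _ mN); exact: le_mu_ext.
Qed.

End integral_bounds.

(** * Envelope of the parametric family *)

Section envelope.
Context {R : realType} {dO dE : measure_display}.
Context {Omega : measurableType dO} {E : measurableType dE}.
Variables (P : probability Omega R) (X : nat -> {RV P >-> E}).
Hypothesis Xs : strictly_stationary X.
Variables (V : Type) (m : V -> E -> E -> R) (A : set V) (alpha0 : V) (s : R).
Hypotheses (alpha0_in : A alpha0) (s0 : 0 < s).
Hypothesis moment : finite_sup_moment X m A s.

(** [fine] sends an infinite supremum to 0, so domination can fail there; [le_envelope] shows that
    this happens on a null event, the same for all times and parameters. *)
Definition envelope (z : E * E) : R := fine (sup_powR m A s z) `^ s^-1.

Lemma sup_powR_ge0 z : (0 <= sup_powR m A s z)%E.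
Proof.
apply: (@le_trans _ _ ((m alpha0 z.1 z.2) `^ s)%:E); first by rewrite lee_fin powR_ge0.
by apply: ereal_sup_ubound; exists alpha0.
Qed.

Lemma envelope_ge0 z : 0 <= envelope z.
Proof. exact: powR_ge0. Qed.

Lemma measurable_envelope : measurable_fun [set: E * E] envelope.
Proof.
apply: (measurableT_comp (measurable_powR _)); apply: measurableT_comp => //.
exact: moment.1.
Qed.

Lemma envelope_moment : exists a : R, (\int[P]_w (envelope (pair_rv X 0 w) `^ s)%:E <= a%:E)%E.
Proof.
have [mS Sfin] := moment.
have I0 : (0 <= \int[P]_w sup_powR m A s (X 0 w, X 1 w))%E.
  by apply: integral_ge0 => w _; exact: sup_powR_ge0.
exists (fine (\int[P]_w sup_powR m A s (X 0 w, X 1 w))).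
rewrite fineK ?ge0_fin_numE//; apply: ge0_le_integral => //.
- by move=> w _; rewrite lee_fin powR_ge0.
- apply/measurable_EFinP; apply: (measurableT_comp (measurable_powR _)).
  by apply: (measurableT_comp measurable_envelope); exact: measurable_pair_rv.
- by apply: (measurableT_comp mS); exact: (measurable_pair_rv X 0).
- move=> w _; rewrite /envelope -powRrM mulVf ?gt_eqF// powRr1 ?fine_ge0 ?sup_powR_ge0//.
  have := sup_powR_ge0 (pair_rv X 0 w); rewrite /pair_rv.
  by case: (sup_powR _ _ _ _) => //= *; rewrite leey.
Qed.

Lemma le_envelope : whp P (fun=> [set w | forall t alpha, A alpha ->
  0 <= m alpha (X t w) (X t.+1 w) -> m alpha (X t w) (X t.+1 w) <= envelope (pair_rv X t w)]).
Proof.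
have [mS Sfin] := moment.
have mSX t : measurable_fun setT (fun w => sup_powR m A s (pair_rv X t w)).
  by apply: (measurableT_comp mS); exact: measurable_pair_rv.
have fin t : {ae P, forall w, (sup_powR m A s (pair_rv X t w) < +oo)%E}.
  have I : P.-integrable setT (fun w => sup_powR m A s (pair_rv X t w)).
    apply/integrableP; split => //.
    under eq_integral do rewrite gee0_abs ?sup_powR_ge0//.
    by rewrite (integral_pair Xs t mS).
  have := integrable_ae measurableT I; apply: filterS => w /(_ Logic.I).
  by rewrite ge0_fin_numE ?sup_powR_ge0.
apply: whp_ae; have := ae_foralln fin; apply: filterS => w Sw t alpha Aalpha m0.
have le : ((m alpha (X t w) (X t.+1 w)) `^ s)%R <= fine (sup_powR m A s (pair_rv X t w)).
  rewrite -lee_fin fineK; last by rewrite ge0_fin_numE ?sup_powR_ge0.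
  by apply: ereal_sup_ubound; exists alpha.
have -> : m alpha (X t w) (X t.+1 w) = ((m alpha (X t w) (X t.+1 w)) `^ s) `^ s^-1.
  by rewrite -powRrM mulfV ?gt_eqF// powRr1.
by apply: ge0_ler_powR; rewrite ?nnegrE ?powR_ge0 ?invr_ge0 ?(ltW s0)// fine_ge0 ?sup_powR_ge0.
Qed.

End envelope.

(** * Replacing the sieve eigenfunctions by their limits *)

Section product_perturbation.
Context {R : realType} {dO dE : measure_display}.
Context {Omega : measurableType dO} {E : measurableType dE}.
Variables (P : probability Omega R) (X : nat -> {RV P >-> E}).
Hypothesis Xs : strictly_stationary X.
Local Notation Q := (stat_dist X).
Variables (D : E * E -> R) (s a : R).
Hypotheses (s2 : 2 < s) (mD : measurable_fun [set: E * E] D) (D0 : forall z, 0 <= D z).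
Hypothesis Da : (\int[P]_w (D (pair_rv X 0 w) `^ s)%:E <= a%:E)%E.
Variables (u v : nat -> E -> R) (phi phis : E -> R) (rk delta : nat -> R) (rho : R).
Hypotheses (u2 : forall n, L2 Q (u n)) (v2 : forall n, L2 Q (v n)).
Hypotheses (phi2 : L2 Q phi) (phis2 : L2 Q phis).
Hypothesis delta0 : Num.sqrt n%:R * delta n @[n --> \oo] --> (0 : R).
Hypothesis u_close : \forall n \near \oo, L2norm Q (fun x => u n x - phis x) <= delta n.
Hypothesis v_close : \forall n \near \oo, L2norm Q (fun x => v n x - phi x) <= delta n.
Hypothesis rk_close : \forall n \near \oo, `|rk n - rho| <= delta n.
Local Notation moment f B := (\int[Q]_x (`|f x| `^ (2 * s / (s - 2)))%:E <= B%:E)%E.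
Hypothesis uv_moment : exists B : R,
  ((\forall n \near \oo, moment (v n) B) /\ moment phis B) \/
  ((\forall n \near \oo, moment (u n) B) /\ moment phi B).

Definition cross_error n (z : E * E) : R := `|u n z.1 * v n z.2 - phis z.1 * phi z.2|.
Definition diag_error n (z : E * E) : R := `|u n z.1 * v n z.1 - phis z.1 * phi z.1|.

Let mu n : measurable_fun setT (u n). Proof. exact: L2_measurable. Qed.
Let mv n : measurable_fun setT (v n). Proof. exact: L2_measurable. Qed.
Let mphi : measurable_fun setT phi. Proof. exact: L2_measurable phi2. Qed.
Let mphis : measurable_fun setT phis. Proof. exact: L2_measurable phis2. Qed.

Let mfst (f : E -> R) : measurable_fun setT f -> measurable_fun setT (fun z : E * E => f z.1).
Proof. by move=> mf; apply: (measurableT_comp mf). Qed.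
Let msnd (f : E -> R) : measurable_fun setT f -> measurable_fun setT (fun z : E * E => f z.2).
Proof. by move=> mf; apply: (measurableT_comp mf). Qed.
Let mX t (f : E -> R) : measurable_fun setT f -> measurable_fun setT (fun w => f (X t w)).
Proof. by move=> mf; apply: (measurableT_comp mf). Qed.
Let mabs dT (T : measurableType dT) (f : T -> R) : measurable_fun setT f ->
  measurable_fun setT (fun z => `|f z|).
Proof. by move=> mf; exact: measurableT_comp. Qed.
Let mP (h : E * E -> R) : measurable_fun setT h -> measurable_fun setT (fun w => h (pair_rv X 0 w)).
Proof. by move=> mh; apply: (measurableT_comp mh); exact: measurable_pair_rv. Qed.

Lemma measurable_cross_error n : measurable_fun setT (cross_error n).
Proof.
exact: (mabs (measurable_funB (measurable_funM (mfst (mu n)) (msnd (mv n)))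
  (measurable_funM (mfst mphis) (msnd mphi)))).
Qed.

Lemma measurable_diag_error n : measurable_fun setT (diag_error n).
Proof.
exact: (mabs (measurable_funB (measurable_funM (mfst (mu n)) (mfst (mv n)))
  (measurable_funM (mfst mphis) (mfst mphi)))).
Qed.

(** The difference of products telescopes into a term with [u n - phis] and one with [v n - phi]. Of
    the two ways to telescope, the one is taken whose remaining factors have a moment of order
    $2s/(s-2)$. *)
Lemma cross_error_moment : exists2 K : R, 0 <= K &
  \forall n \near \oo, (\int[P]_w (D (pair_rv X 0 w) * cross_error n (pair_rv X 0 w))%:E
    <= (K * delta n)%:E)%E.
Proof.
have key (f g f' g' : E -> R) (i j : nat) (B : R) n : L2 Q f -> L2 Q f' -> measurable_fun setT g ->
    measurable_fun setT g' -> moment g B -> moment g' B ->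
    L2norm Q f <= delta n -> L2norm Q f' <= delta n ->
    (forall w, cross_error n (pair_rv X 0 w) <=
      `|f (X i w)| * `|g (X j w)| + `|f' (X j w)| * `|g' (X i w)|) ->
    (\int[P]_w (D (pair_rv X 0 w) * cross_error n (pair_rv X 0 w))%:E
      <= (2 * Num.sqrt (a + B) * delta n)%:E)%E.
  move=> f2 f'2 mg mg' gB g'B fd f'd le.
  have mf := L2_measurable f2; have mf' := L2_measurable f'2.
  have -> : 2 * Num.sqrt (a + B) * delta n =
    Num.sqrt (a + B) * delta n + Num.sqrt (a + B) * delta n by ring.
  have H1 : forall F, L2norm Q F <= delta n ->
      ((Num.sqrt (a + B) * L2norm Q F)%:E <= (Num.sqrt (a + B) * delta n)%:E)%E.
    by move=> F Fd; rewrite lee_fin ler_wpM2l ?sqrtr_ge0.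
  have := weighted_product_le Xs i j s2 mD D0 Da gB f2 mg => /le_trans/(_ (H1 _ fd)) b1.
  have := weighted_product_le Xs j i s2 mD D0 Da g'B f'2 mg' => /le_trans/(_ (H1 _ f'd)) b2.
  apply: integral_le_add b1 b2.
  - exact: (measurable_funM (measurable_funM (mP mD) (mX i (mabs mf))) (mX j (mabs mg))).
  - exact: (measurable_funM (measurable_funM (mP mD) (mX j (mabs mf'))) (mX i (mabs mg'))).
  - exact: (measurable_funM (mP mD) (mP (measurable_cross_error n))).
  - by move=> w; rewrite !mulr_ge0.
  - by move=> w; rewrite !mulr_ge0.
  - by move=> w; rewrite mulr_ge0 ?normr_ge0.
  - by move=> w; rewrite -!mulrA -mulrDr ler_wpM2l.
have [B HB] := uv_moment; exists (2 * Num.sqrt (a + B)); first by rewrite mulr_ge0 ?sqrtr_ge0.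
case: HB => -[nB oB]; near=> n.
- apply: (key (fun x => u n x - phis x) (v n) (fun x => v n x - phi x) phis 0 1 B n).
  + exact: L2B.
  + exact: L2B.
  + exact: mv.
  + exact: mphis.
  + by near: n.
  + exact: oB.
  + by near: n.
  + by near: n.
  + move=> w; rewrite /cross_error /pair_rv /= -!normrM; apply: le_trans _ (ler_normD _ _).
    by rewrite le_eqVlt; apply/orP; left; apply/eqP; congr `|_|; ring.
- apply: (key (fun x => v n x - phi x) (u n) (fun x => u n x - phis x) phi 1 0 B n).
  + exact: L2B.
  + exact: L2B.
  + exact: mu.
  + exact: mphi.
  + by near: n.
  + exact: oB.
  + by near: n.
  + by near: n.
  + move=> w; rewrite /cross_error /pair_rv /= -!normrM; apply: le_trans _ (ler_normD _ _).
    by rewrite le_eqVlt; apply/orP; left; apply/eqP; congr `|_|; ring.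
Unshelve. all: by end_near. Qed.

Lemma diag_error_moment n d : 0 <= d <= 1 ->
  L2norm Q (fun x => u n x - phis x) <= d -> L2norm Q (fun x => v n x - phi x) <= d ->
  (\int[P]_w (diag_error n (pair_rv X 0 w))%:E <= ((L2norm Q phi + 1 + L2norm Q phis) * d)%:E)%E.
Proof.
move=> /andP[d0 d1] ud vd; have u2' := L2B (u2 n) phis2; have v2' := L2B (v2 n) phi2.
have vn : L2norm Q (v n) <= L2norm Q phi + 1.
  have := L2normD_le v2' phi2.
  rewrite (_ : (fun x => v n x - phi x + phi x) = v n); last by apply/funext => x; rewrite subrK.
  by move=> /le_trans; apply; rewrite addrC lerD2l (le_trans vd).
have b1 := mul_le_L2norm Xs 0 u2' (v2 n); have b2 := mul_le_L2norm Xs 0 phis2 v2'.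
have mu' := L2_measurable u2'; have mv' := L2_measurable v2'.
apply: le_trans (integral_le_add (h := fun w => diag_error n (pair_rv X 0 w)) _ _ _ _ _ _ _ b1 b2) _.
- exact: (measurable_funM (mX 0 (mabs mu')) (mX 0 (mabs (mv n)))).
- exact: (measurable_funM (mX 0 (mabs mphis)) (mX 0 (mabs mv'))).
- by apply: mP; exact: measurable_diag_error.
- by move=> w; rewrite mulr_ge0.
- by move=> w; rewrite mulr_ge0.
- by move=> w; exact: normr_ge0.
- move=> w; rewrite /diag_error /pair_rv /= -!normrM; apply: le_trans _ (ler_normD _ _).
  by rewrite le_eqVlt; apply/orP; left; apply/eqP; congr `|_|; ring.
rewrite lee_fin mulrDl; apply: lerD; last by rewrite ler_wpM2l ?L2norm_ge0.
by rewrite mulrC; apply: ler_pM; rewrite ?L2norm_ge0.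
Qed.

(** A bound for the change in one summand of the linear term when [u n], [v n] and [rk n] are
    replaced by [phis], [phi] and [rho], uniform over the parameter because [D] stands for the
    envelope. *)
Definition total_error n (z : E * E) : R := D z * cross_error n z + `|rk n| * diag_error n z
  + `|rk n - rho| * (`|phis z.1| * `|phi z.1|).

(** The mean of the error is of the order of [delta n], which vanishes after multiplication by
    $\sqrt n$; Markov's inequality concludes. *)
Lemma total_error_whp eps : 0 < eps ->
  whp P (fun n => [set w | normalized_sum (fun t w => total_error n (pair_rv X t w)) n w <= eps]).
Proof.
have [K K0 crossK] := cross_error_moment.
pose K' := K + (`|rho| + 1) * (L2norm Q phi + 1 + L2norm Q phis) + L2norm Q phis * L2norm Q phi.
have m1 n : measurable_fun setT (fun z => D z * cross_error n z).
  by apply: measurable_funM => //; exact: measurable_cross_error.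
have m2 n : measurable_fun setT (fun z => `|rk n| * diag_error n z).
  by apply: measurable_funM => //; exact: measurable_diag_error.
have m3' : measurable_fun setT (fun z : E * E => `|phis z.1| * `|phi z.1|).
  exact: (measurable_funM (mabs (mfst mphis)) (mabs (mfst mphi))).
have m3 n : measurable_fun setT (fun z : E * E => `|rk n - rho| * (`|phis z.1| * `|phi z.1|)).
  exact: measurable_funM.
have e0 n z : 0 <= D z * cross_error n z by rewrite mulr_ge0 ?normr_ge0.
have e1 n z : 0 <= `|rk n| * diag_error n z by rewrite mulr_ge0 ?normr_ge0.
have e2 n (z : E * E) : 0 <= `|rk n - rho| * (`|phis z.1| * `|phi z.1|) by rewrite !mulr_ge0.
apply: (@normalized_sum_markov _ _ _ _ _ _ X Xs total_error (fun n => K' * delta n)).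
- by move=> n; apply: measurable_funD => //; exact: measurable_funD.
- by move=> n z; rewrite !addr_ge0.
- near=> n.
  have ud : L2norm Q (fun x => u n x - phis x) <= delta n by near: n.
  have vd : L2norm Q (fun x => v n x - phi x) <= delta n by near: n.
  have d0 : 0 <= delta n by apply: le_trans ud; exact: L2norm_ge0.
  have d1 : delta n <= 1.
    have n1 : (0 < n)%N by near: n; exact: nbhs_infty_gt.
    have : `|0 - Num.sqrt n%:R * delta n| <= 1 by near: n; move/cvgrPdist_le: delta0; apply.
    rewrite sub0r normrN ger0_norm ?mulr_ge0 ?sqrtr_ge0//; apply: le_trans.
    by rewrite ler_peMl// -{1}sqrtr1 ler_wsqrtr// ler1n.
  have rd : `|rk n - rho| <= delta n by near: n.
  have rn : `|rk n| <= `|rho| + 1.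
    rewrite -[rk n](subrK rho) addrC; apply: le_trans (ler_normD _ _) _.
    by rewrite lerD2l (le_trans rd).
  have b1 : (\int[P]_w (D (pair_rv X 0 w) * cross_error n (pair_rv X 0 w))%:E
    <= (K * delta n)%:E)%E by near: n.
  have b2 : (\int[P]_w (`|rk n| * diag_error n (pair_rv X 0 w))%:E <=
      (`|rk n| * ((L2norm Q phi + 1 + L2norm Q phis) * delta n))%:E)%E.
    apply: integral_le_scale => //; first by apply: mP; exact: measurable_diag_error.
      by move=> w; exact: normr_ge0.
    by apply: diag_error_moment => //; rewrite d0.
  have b3 : (\int[P]_w (`|rk n - rho| * (`|phis (X 0 w)| * `|phi (X 0 w)|))%:E <=
      (`|rk n - rho| * (L2norm Q phis * L2norm Q phi))%:E)%E.
    apply: integral_le_scale => //; first exact: (mP m3').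
    exact: mul_le_L2norm.
  have b12 : (\int[P]_w (D (pair_rv X 0 w) * cross_error n (pair_rv X 0 w) +
      `|rk n| * diag_error n (pair_rv X 0 w))%:E <= (K * delta n +
      `|rk n| * ((L2norm Q phi + 1 + L2norm Q phis) * delta n))%:E)%E.
    apply: integral_le_add b1 b2 => //; [exact: (mP (m1 n))|exact: (mP (m2 n))| |].
      by apply: measurable_funD; [exact: (mP (m1 n))|exact: (mP (m2 n))].
    by move=> w; rewrite addr_ge0.
  have mm : measurable_fun setT (fun w => D (pair_rv X 0 w) * cross_error n (pair_rv X 0 w) +
      `|rk n| * diag_error n (pair_rv X 0 w)).
    by apply: measurable_funD; [exact: (mP (m1 n))|exact: (mP (m2 n))].
  apply: le_trans (integral_le_add (h := fun w => total_error n (pair_rv X 0 w)) _ _ _ _ _ _ _ b12 b3) _ => //.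
  + exact: (mP (m3 n)).
  + by apply: measurable_funD => //; exact: (mP (m3 n)).
  + by move=> w; rewrite addr_ge0.
  + by move=> w; rewrite !addr_ge0.
  rewrite lee_fin (_ : K' * delta n = K * delta n
    + (`|rho| + 1) * ((L2norm Q phi + 1 + L2norm Q phis) * delta n)
    + delta n * (L2norm Q phis * L2norm Q phi)); last by rewrite /K'; ring.
  apply: lerD; [apply: lerD => //|].
  * by rewrite ler_wpM2r// mulr_ge0// ?addr_ge0 ?L2norm_ge0.
  * by rewrite ler_wpM2r// mulr_ge0 ?L2norm_ge0.
- rewrite (_ : (fun n => _) = fun n => K' * (Num.sqrt n%:R * delta n)); last first.
    by apply/funext => n; rewrite mulrCA.
  by rewrite -(mulr0 K'); apply: cvgM => //; exact: cvg_cst.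
Unshelve. all: by end_near. Qed.

End product_perturbation.

(** * Powers of the sample size *)

Section rates.
Context {R : realType}.

Lemma sqrt_quarter_rate n : (0 < n)%N -> Num.sqrt n%:R * (n%:R `^ (- (1 / 4))) ^+ 2 = 1 :> R.
Proof.
move=> n0; have n0' : (0 : R) < n%:R by rewrite ltr0n.
rewrite -powR_mulrn ?powR_ge0// -powRrM.
have <- : (n%:R : R) `^ 2^-1 = Num.sqrt n%:R by rewrite powR12_sqrt// ltW.
have q : 2^-1 + - (1 / 4) * 2%:R = 0 :> R by field.
by rewrite -powRD q ?eqxx ?gt_eqF// powRr0.
Qed.

Lemma quarter_rate_le1 n : (0 < n)%N -> n%:R `^ (- (1 / 4)) <= 1 :> R.
Proof.
move=> n0; rewrite powRN invf_le1 ?powR_gt0 ?ltr0n//.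
by rewrite -[leLHS](powRr0 (n%:R : R)) ler_powR ?ler1n// divr_ge0.
Qed.

Lemma sqrt_divn n : Num.sqrt n%:R * n%:R^-1 = (Num.sqrt n%:R)^-1 :> R.
Proof.
have [->|n0] := posnP n; first by rewrite sqrtr0 mul0r invr0.
have s0 : Num.sqrt (n%:R : R) != 0 by rewrite gt_eqF// sqrtr_gt0 ltr0n.
have {2}-> : n%:R = Num.sqrt n%:R * Num.sqrt n%:R :> R by rewrite -expr2 sqr_sqrtr.
by rewrite invfM mulVKf.
Qed.

Lemma sqrt_inv_mul n (c : R) : (Num.sqrt n%:R)^-1 * (c * n%:R) = Num.sqrt n%:R * c.
Proof.
have [->|n0] := posnP n; first by rewrite sqrtr0 invr0 !mul0r.
have s0 : Num.sqrt (n%:R : R) != 0 by rewrite gt_eqF// sqrtr_gt0 ltr0n.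
have {2}-> : n%:R = Num.sqrt n%:R * Num.sqrt n%:R :> R by rewrite -expr2 sqr_sqrtr.
by rewrite mulrCA mulKf// mulrC.
Qed.

End rates.

Lemma Lnorm_moment {R : realType} {dE : measure_display} {E : measurableType dE}
    (Q : probability E R) (p C : R) (f : E -> R) : 0 < p -> 0 <= C ->
  ('N[Q]_p%:E[EFin \o f] <= C%:E)%E -> (\int[Q]_x (`|f x| `^ p)%:E <= (C `^ p)%:E)%E.
Proof.
move=> p0 C0 NC; have -> : (\int[Q]_x (`|f x| `^ p)%:E = 'N[Q]_p%:E[EFin \o f] `^ p)%E.
  by rewrite poweR_Lnorm ?gt_eqF.
rewrite -poweR_EFin; apply: gt0_ler_poweR => //; first exact: ltW.
  by rewrite in_itv/= leey andbT Lnorm_ge0.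
by rewrite in_itv/= leey andbT lee_fin.
Qed.

Section normalized_sums.
Context {R : realType} {dO : measure_display} {Omega : measurableType dO}.
Implicit Types Y Z H : nat -> Omega -> R.

Lemma normalized_sumB Y Z n w : normalized_sum (fun t w => Y t w - Z t w) n w =
  normalized_sum Y n w - normalized_sum Z n w.
Proof. by rewrite /normalized_sum -mulrBr -sumrB. Qed.

Lemma normalized_sum_le Y H n w : (forall t, `|Y t w| <= H t w) ->
  `|normalized_sum Y n w| <= normalized_sum H n w.
Proof.
move=> YH; rewrite /normalized_sum normrM ger0_norm ?invr_ge0 ?sqrtr_ge0//.
rewrite ler_wpM2l ?invr_ge0 ?sqrtr_ge0//.
by apply: le_trans (ler_norm_sum _ _ _) _; apply: ler_sum.
Qed.

Lemma measurable_normalized_sum Y n : (forall t, measurable_fun setT (Y t)) ->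
  measurable_fun setT (normalized_sum Y n).
Proof. by move=> mY; apply: measurable_funM => //; apply: measurable_sum. Qed.

End normalized_sums.

(** * The linear term at the estimated parameter *)

Section estimated_class.
Context {R : realType} {dO dE : measure_display}.
Context {Omega : measurableType dO} {E : measurableType dE}.
Variables (P : probability Omega R) (X : nat -> {RV P >-> E}).
Hypothesis Xs : strictly_stationary X.
Local Notation Q := (stat_dist X).
Variables (V : Type) (m : V -> E -> E -> R) (A : set V) (alpha0 : V) (phi phis : E -> R).
Hypothesis alpha0_in : A alpha0.
Hypothesis m_meas : forall alpha, A alpha ->
  measurable_fun [set: E * E] (fun z => m alpha z.1 z.2).
Hypotheses (mphi : measurable_fun setT phi) (mphis : measurable_fun setT phis).
Hypothesis moment2 : P.-integrable [set: Omega] (fun w =>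
     ((pair_at X (fun x y => phis x * m alpha0 x y * phi y) 0 w) ^+ 2)%:E).
Hypothesis class_L2 : forall alpha, A alpha -> L2 P (pair_at X (g_class m alpha0 phi phis alpha) 0).

Lemma g_class_alpha0 : g_class m alpha0 phi phis alpha0 = fun _ _ => 0.
Proof. by apply/funext => x; apply/funext => y; rewrite /g_class subrr mulr0. Qed.

Let mpair f : measurable_fun [set: E * E] f -> forall t,
  measurable_fun setT (fun w : Omega => f (pair_rv X t w) : R).
Proof. by move=> mf t; apply: (measurableT_comp mf); exact: measurable_pair_rv. Qed.

Let mfst (f : E -> R) : measurable_fun setT f -> measurable_fun setT (fun z : E * E => f z.1).
Proof. by move=> mf; apply: (measurableT_comp mf). Qed.
Let msnd (f : E -> R) : measurable_fun setT f -> measurable_fun setT (fun z : E * E => f z.2).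
Proof. by move=> mf; apply: (measurableT_comp mf). Qed.

Lemma measurable_psi_rho rho t : measurable_fun setT (psi_rho X m alpha0 phi phis rho t).
Proof.
have m1 := measurable_funM (measurable_funM (mfst mphis) (m_meas alpha0_in)) (msnd mphi).
have m2 := measurable_funM (mfst mphis) (mfst mphi).
have m3 : measurable_fun setT (fun z : E * E => rho * (phis z.1 * phi z.1)) by exact: measurable_funM.
exact: (mpair (measurable_funB m1 m3) t).
Qed.

(** Square integrability is known for [g_class] and for the term at [alpha0]; the term at [alpha] is
    recovered as their sum, so that the mean can be split. *)
Lemma mean_g_class alpha t : A alpha ->
  \int[P]_w pair_at X (g_class m alpha0 phi phis alpha) t w =
  ell X m phi phis alpha - ell X m phi phis alpha0.
Proof.
move=> Aa; have mg : measurable_fun setT (fun z : E * E => (g_class m alpha0 phi phis alpha z.1 z.2)%:E).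
  apply/measurable_EFinP; apply: measurable_funM; last first.
    exact: (measurable_funB (m_meas Aa) (m_meas alpha0_in)).
  exact: (measurable_funM (mfst mphis) (msnd mphi)).
have -> : \int[P]_w pair_at X (g_class m alpha0 phi phis alpha) t w =
    \int[P]_w pair_at X (g_class m alpha0 phi phis alpha) 0 w.
  by rewrite /Rintegral; congr fine; exact: (integral_pair Xs t mg).
have gi := L2_integrable (class_L2 Aa).
have fi : P.-integrable setT (EFin \o pair_at X (fun x y => phis x * phi y * m alpha0 x y) 0).
  apply: L2_integrable; apply: L2_intro.
    have := mpair (measurable_funM (measurable_funM (mfst mphis) (msnd mphi)) (m_meas alpha0_in)) 0.
    exact.
  move: moment2; congr (_.-integrable _ _); apply/funext => w.
  by rewrite /= /pair_at; congr (_ ^+ 2)%:E; ring.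
rewrite /ell /pair_mean.
have -> : \int[P]_w pair_at X (fun x y => phis x * phi y * m alpha x y) 0 w =
    \int[P]_w (pair_at X (g_class m alpha0 phi phis alpha) 0 w +
      pair_at X (fun x y => phis x * phi y * m alpha0 x y) 0 w).
  by apply: eq_Rintegral => w _; rewrite /pair_at /g_class; ring.
by rewrite RintegralD// addrK.
Qed.

Lemma normalized_sum_class rho alpha n w : A alpha ->
  normalized_sum (fun t w => phis (X t w) * m alpha (X t w) (X t.+1 w) * phi (X t.+1 w)
      - rho * (phis (X t w) * phi (X t w))) n w =
  normalized_sum (psi_rho X m alpha0 phi phis rho) n w +
  (empirical X n (g_class m alpha0 phi phis alpha) w +
    Num.sqrt n%:R * (ell X m phi phis alpha - ell X m phi phis alpha0)).
Proof.
move=> Aa; rewrite /empirical (normalized_sumB (pair_at X (g_class m alpha0 phi phis alpha))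
  (fun t _ => \int[P]_w' pair_at X (g_class m alpha0 phi phis alpha) t w')).
have -> : normalized_sum (fun t _ => \int[P]_w' pair_at X (g_class m alpha0 phi phis alpha) t w') n w
    = Num.sqrt n%:R * (ell X m phi phis alpha - ell X m phi phis alpha0).
  rewrite /normalized_sum (eq_bigr (fun=> ell X m phi phis alpha - ell X m phi phis alpha0)).
    by rewrite sumr_const card_ord -[(_ - _) *+ n]mulr_natr sqrt_inv_mul.
  by move=> t _; exact: mean_g_class.
rewrite subrK /normalized_sum -mulrDr -big_split/=; congr (_ * _); apply: eq_bigr => t _.
by rewrite /psi_rho /pair_at /g_class; ring.
Qed.

End estimated_class.

(** A quantity below the order $n^{-1/4}$ has a square below $n^{-1/2}$. The quadratic bound is
    asked for only where [Y] is below [delta], an event of probability tending to one. *)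
Lemma op_mul_rate {R : realType} {dO : measure_display} {Omega : measurableType dO}
    (P : probability Omega R) (Y Z : nat -> Omega -> R) (K delta : R) :
  0 <= K -> 0 < delta -> (forall n w, 0 <= Y n w) ->
  is_op P (fun n => n%:R `^ (- (1 / 4))) (fun n w => (Y n w)%:E) ->
  (forall n w, Y n w < delta -> `|Z n w| <= K * Y n w ^+ 2) ->
  forall eps, 0 < eps -> whp P (fun n => [set w | `|Num.sqrt n%:R * Z n w| <= eps]).
Proof.
move=> K0 d0 Y0 /is_opP Yop ZY eps e0.
have K1 : 0 < K + 1 by rewrite ltr_wpDl.
(* The three bounds give in turn [e ^+ 2 <= e], the range of the quadratic bound, and the final
   [eps]. *)
pose e := Num.min 1 (Num.min (delta / 2) (eps / (K + 1))).
have egt0 : 0 < e by rewrite !lt_min ltr01 !divr_gt0.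
apply: whpS (Yop _ egt0); near=> n => w /=.
have n0 : (0 < n)%N by near: n; exact: nbhs_infty_gt.
rewrite (ger0_norm (Y0 n w)) => Yn.
have a1 := @quarter_rate_le1 R _ n0; have aE := @sqrt_quarter_rate R _ n0.
have ed : e < delta.
  apply: (@le_lt_trans _ _ (delta / 2)); first by rewrite /e !ge_min lexx !orbT.
  by rewrite ltr_pdivrMr// ltr_pMr// ltr1n.
have Yd : Y n w < delta.
  by apply: le_lt_trans Yn (le_lt_trans _ ed); rewrite ler_piMr// ltW.
rewrite normrM ger0_norm ?sqrtr_ge0//.
apply: (@le_trans _ _ (Num.sqrt n%:R * (K * (e * n%:R `^ (- (1 / 4))) ^+ 2))).
  rewrite ler_wpM2l ?sqrtr_ge0//; apply: le_trans (ZY _ _ Yd) _; rewrite ler_wpM2l//.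
  by rewrite ler_sqr ?nnegrE// ?Y0// mulr_ge0 ?powR_ge0// ltW.
rewrite exprMn mulrCA (mulrCA (Num.sqrt _)) aE mulr1.
apply: (@le_trans _ _ ((K + 1) * e)).
  apply: ler_pM => //; first exact: sqr_ge0.
    by rewrite lerDl.
  by rewrite expr2 ler_piMr ?(ltW egt0)// /e ge_min lexx.
by rewrite mulrC -ler_pdivlMr// /e !ge_min lexx !orbT.
Unshelve. all: by end_near. Qed.

(** * Asymptotic normality of the eigenvalue estimator *)

Theorem theorem3p5
  (R : realType)
  (* the process, with values in a subset SX of R^d *)
  (dO : measure_display) (Omega : measurableType dO) (P : probability Omega R)
  (d : nat) (SX : set (d.-tuple R))
  (X : nat -> {RV P >-> d.-tuple R})
  (X_in : forall t w, SX (X t w))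
  (X_stationary : strictly_stationary X)
  (X_ergodic : ergodic X)
  (X_markov : homogeneous_markov X)
  (* the parameter space and the functions m(., .; alpha) *)
  (AA : completeNormedModType R) (A : set AA)
  (normA : AA -> R) (normA_norm : is_norm normA)
  (alpha0 : AA) (alpha0_in : A alpha0)
  (m : AA -> d.-tuple R -> d.-tuple R -> R)
  (m_meas : forall alpha, A alpha ->
     measurable_fun [set: d.-tuple R * d.-tuple R]
       (fun z => m alpha z.1 z.2))
  (m_pos : forall alpha, A alpha ->
     forall x y, SX x -> SX y -> 0 < m alpha x y)
  (* the sieve *)
  (b : forall j : nat, 'I_j -> d.-tuple R -> R)
  (b_L2 : forall j (i : 'I_j), L2 (stat_dist X) (b j i))
  (b_indep : forall j, lin_indep (stat_dist X) (b j))
  (k : nat -> nat) (k_infty : k n @[n --> \oo] --> \oo)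
  (* the estimators *)
  (alphahat : nat -> Omega -> AA)
  (alphahat_in : forall n w, A (alphahat n w))
  (rhohat : nat -> {RV P >-> R})
  (rhohat_def : forall n w r,
     largest_geigenvalue
       (Mhat X (b (k n)) (fun w => m (alphahat n w)) n w)
       (Ghat X (b (k n)) n w) r ->
     rhohat n w = r)
  (* (A1) *)
  (rho : R) (phi phis : d.-tuple R -> R)
  (A1 : perron_frobenius X (m alpha0) rho phi phis)
  (* (A2) *)
  (A2 : L2opnorm (stat_dist X)
          (fun psi => sieve_proj (stat_dist X) (b (k n))
                        (opM X (m alpha0) psi) \- opM X (m alpha0) psi)
        @[n --> \oo] --> 0%E)
  (* (A3) *)
  (A3_G : is_op P (fun=> 1) (fun n w => (Gerr X (b (k n)) n w)%:E))
  (A3_M : is_op P (fun=> 1) (fun n w =>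
     (Merr X (m alpha0) (b (k n)) (fun w => m (alphahat n w)) n w)%:E))
  (* (A4) *)
  (A4a_phi : Num.sqrt n%:R
       * L2norm (stat_dist X) (sieve_proj (stat_dist X) (b (k n)) phi \- phi)
     @[n --> \oo] --> (0 : R))
  (A4a_phis : Num.sqrt n%:R
       * L2norm (stat_dist X) (sieve_proj (stat_dist X) (b (k n)) phis \- phis)
     @[n --> \oo] --> (0 : R))
  (A4b_G : is_op P (fun n => n%:R `^ (- (1 / 4)))
     (fun n w => (Gerr X (b (k n)) n w)%:E))
  (A4b_M : is_op P (fun n => n%:R `^ (- (1 / 4))) (fun n w =>
     (Merr X (m alpha0) (b (k n)) (fun w => m (alphahat n w)) n w)%:E))
  (A4c : P.-integrable [set: Omega] (fun w =>
     ((pair_at X (fun x y => phis x * m alpha0 x y * phi y) 0 w) ^+ 2)%:E))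
  (* normalization of phi and phis *)
  (phi_norm : L2norm (stat_dist X) phi = 1)
  (phi_phis : L2inner (stat_dist X) phi phis = 1)
  (* (A5) *)
  (A5a : donsker X (g_class m alpha0 phi phis @` A))
  (A5b_diff : pathwise_differentiable A (ell X m phi phis) alpha0)
  (A5b_rem : exists C delta : R, 0 < delta /\
     forall alpha, A alpha -> normA (alpha - alpha0) < delta ->
       `|ell X m phi phis alpha - ell X m phi phis alpha0
         - pathwise_derivative (ell X m phi phis) alpha0 (alpha - alpha0)|
         <= C * normA (alpha - alpha0) ^+ 2)
  (psi_l : nat -> {RV P >-> R})
  (A5c_lin : is_op P (fun=> 1) (fun n w =>
     (Num.sqrt n%:R * pathwise_derivative (ell X m phi phis) alpha0 (alphahat n w - alpha0)
       - normalized_sum (fun t => psi_l t) n w)%:E))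
  (A5c_rate : is_op P (fun n => n%:R `^ (- (1 / 4)))
     (fun n w => (normA (alphahat n w - alpha0))%:E))
  (A5c_K : is_op P (fun=> 1) (fun n w =>
     (longrun_cov X (g_class m alpha0 phi phis (alphahat n w))
                    (g_class m alpha0 phi phis (alphahat n w)))%:E))
  (V : 'M[R]_2)
  (A5d : cvg_dist_normal2 P
     (normalized_sum (psi_rho X m alpha0 phi phis rho)) (normalized_sum (fun t => psi_l t)) V)
  (s : R) (s_gt2 : 2 < s)
  (A5e_sup : finite_sup_moment X m A s)
  (A5e_norm : let p := (2 * s / (s - 2))%:E in
     ((exists C : R, \forall n \near \oo,
         ('N[stat_dist X]_p[EFin \o phi_k X (m alpha0) (b (k n))] <= C%:E)%E)
      /\ ('N[stat_dist X]_p[EFin \o phis] < +oo)%E)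
     \/
     ((exists C : R, \forall n \near \oo,
         ('N[stat_dist X]_p[EFin \o phis_k X (m alpha0) (b (k n))] <= C%:E)%E)
      /\ ('N[stat_dist X]_p[EFin \o phi] < +oo)%E)) :
  let h : 'cV[R]_2 := const_mx 1 in
  let V_rho := (h^T *m V *m h) 0 0 in
  cvg_dist_normal P (fun n w => Num.sqrt n%:R * (rhohat n w - rho)) V_rho.
Proof.
set Q := stat_dist X; have a0A := alpha0_in.
have m0_meas := m_meas _ a0A.
have m_ge0 alpha x y : A alpha -> SX x -> SX y -> 0 <= m alpha x y.
  by move=> Aa Sx Sy; apply/ltW/m_pos.
have m0_ge0 w : 0 <= m alpha0 (X 0 w) (X 1 w) by exact: m_ge0.
have [phi2 _ _] := pf_right A1; have [phis2 _ _] := pf_left A1.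
have mphi := L2_measurable phi2; have mphis := L2_measurable phis2.
have sbias : Num.sqrt n%:R * sieve_bias X phi phis b k n @[n --> \oo] --> (0 : R).
  rewrite (_ : (fun n => _) = fun n : nat =>
      Num.sqrt n%:R * L2norm Q (sieve_proj Q (b (k n)) phi \- phi) +
      Num.sqrt n%:R * L2norm Q (sieve_proj Q (b (k n)) phis \- phis)); last first.
    by apply/funext => n; rewrite /sieve_bias mulrDr.
  by rewrite -[0]addr0; exact: cvgD.
have bias_ge0 n : 0 <= sieve_bias X phi phis b k n by rewrite addr_ge0 ?L2norm_ge0.
have bias0 : sieve_bias X phi phis b k n @[n --> \oo] --> (0 : R).
  apply: (squeeze_cvgr _ (cvg_cst 0) sbias); near=> n; rewrite bias_ge0/=.
  have n1 : (0 < n)%N by near: n; exact: nbhs_infty_gt.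
  by rewrite ler_peMl// -{1}sqrtr1 ler_wsqrtr// ler1n.
have [K0 [tau [N [K0ge0 tau0 expansion]]]] :=
  sieve_eigenvalue X_stationary m0_ge0 m0_meas A1 phi_norm phi_phis b_L2 b_indep A2 bias0.
pose c n := (sieve_eigvecs X (m alpha0) (b (k n))).1.
pose cs n := (sieve_eigvecs X (m alpha0) (b (k n))).2.
pose mhat n w := m (alphahat n w).
pose gh n w := Gerr X (b (k n)) n w + Merr X (m alpha0) (b (k n)) (mhat n) n w.
pose bias n := K0 * sieve_bias X phi phis b k n.
pose Lin n r w := dot (cs n) ((Mhat X (b (k n)) (mhat n) n w - r *: Ghat X (b (k n)) n w) *m c n).
(* [rs n] holds the sieve eigenvalue and the sign of its eigenvectors, with a default before [N].
   The estimator enters through its defining property, once a largest eigenvalue is known to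
   exist. *)
have /choice[rs rsP] n : exists r : R * R, (N <= n)%N ->
    [/\ `|r.2| = 1, `|r.1 - rho| <= bias n,
      L2norm Q (fun x => r.2 * phi_k X (m alpha0) (b (k n)) x - phi x) <= bias n,
      L2norm Q (fun x => r.2 * phis_k X (m alpha0) (b (k n)) x - phis x) <= bias n &
      forall w, gh n w <= tau ->
        `|rhohat n w - r.1 - Lin n r.1 w| <= K0 * gh n w ^+ 2].
  have [Nn|_] := leqP N n; last by exists (0, 0).
  have [rk [sg [s1 rk1 phik phisk ex]]] := expansion n Nn.
  exists (rk, sg) => _; split => // w ghw.
  have [rh [rhl rhE]] := ex _ _ ghw.
  by rewrite (rhohat_def _ _ _ rhl).
pose rk n := (rs n).1.
(* The same sign multiplies both eigenfunctions: each is then close to its limit, and products of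
   the two are unchanged. *)
pose u n x := (rs n).2 * phis_k X (m alpha0) (b (k n)) x.
pose v n x := (rs n).2 * phi_k X (m alpha0) (b (k n)) x.
have N_near : \forall n \near \oo, (N <= n)%N by exact: nbhs_infty_ge.
have u2 n : L2 Q (u n) by apply: L2Z; exact: L2_lincomb.
have v2 n : L2 Q (v n) by apply: L2Z; exact: L2_lincomb.
have s0 : 0 < s by apply: lt_trans s_gt2.
have [a Da] := envelope_moment a0A s0 A5e_sup.
have p0 : 0 < 2 * s / (s - 2) by rewrite divr_gt0 ?mulr_gt0 ?subr_gt0.
have moments : exists B : R,
  ((\forall n \near \oo, (\int[Q]_x (`|v n x| `^ (2 * s / (s - 2)))%:E <= B%:E)%E) /\
    (\int[Q]_x (`|phis x| `^ (2 * s / (s - 2)))%:E <= B%:E)%E) \/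
  ((\forall n \near \oo, (\int[Q]_x (`|u n x| `^ (2 * s / (s - 2)))%:E <= B%:E)%E) /\
    (\int[Q]_x (`|phi x| `^ (2 * s / (s - 2)))%:E <= B%:E)%E).
  have key (f : nat -> d.-tuple R -> R) (g : d.-tuple R -> R) :
      (exists C : R, \forall n \near \oo,
         ('N[Q]_(2 * s / (s - 2))%:E[EFin \o f n] <= C%:E)%E) ->
      ('N[Q]_(2 * s / (s - 2))%:E[EFin \o g] < +oo)%E ->
      exists B : R, (\forall n \near \oo,
        (\int[Q]_x (`|(rs n).2 * f n x| `^ (2 * s / (s - 2)))%:E <= B%:E)%E) /\
        (\int[Q]_x (`|g x| `^ (2 * s / (s - 2)))%:E <= B%:E)%E.
    move=> [C fC] gfin; pose D := Num.max C (fine 'N[Q]_(2 * s / (s - 2))%:E[EFin \o g])%E.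
    have gD : ('N[Q]_(2 * s / (s - 2))%:E[EFin \o g] <= D%:E)%E.
      rewrite -[leLHS]fineK; last by rewrite ge0_fin_numE ?Lnorm_ge0.
      by rewrite lee_fin le_max lexx orbT.
    have D0 : 0 <= D by rewrite -lee_fin (le_trans _ gD)// Lnorm_ge0.
    exists (D `^ (2 * s / (s - 2))); split; last exact: Lnorm_moment.
    near=> n; have Nn : (N <= n)%N by near: n.
    have [s1 _ _ _ _] := rsP n Nn.
    under eq_integral do rewrite normrM s1 mul1r.
    apply: Lnorm_moment => //.
    apply: (@le_trans _ _ C%:E); first by near: n.
    by rewrite lee_fin le_max lexx.
  by case: A5e_norm => -[h1 h2]; have [B [B1 B2]] := key _ _ h1 h2; exists B; [left|right].
have d0 : Num.sqrt n%:R * bias n @[n --> \oo] --> (0 : R).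
  rewrite (_ : (fun n => _) = fun n : nat => K0 * (Num.sqrt n%:R * sieve_bias X phi phis b k n)).
    by rewrite -(mulr0 K0); apply: cvgM => //; exact: cvg_cst.
  by apply/funext => n; rewrite /bias mulrCA.
have u_close : \forall n \near \oo, L2norm Q (fun x => u n x - phis x) <= bias n.
  by apply: filterS N_near => n /rsP[].
have v_close : \forall n \near \oo, L2norm Q (fun x => v n x - phi x) <= bias n.
  by apply: filterS N_near => n /rsP[].
have rk_close : \forall n \near \oo, `|rk n - rho| <= bias n.
  by apply: filterS N_near => n /rsP[].
have mD := measurable_envelope A5e_sup.
have W1 := total_error_whp X_stationary s_gt2 mD (envelope_ge0 m A s) Da
  u2 v2 phi2 phis2 d0 u_close v_close rk_close moments.
have W2 := le_envelope X_stationary a0A s0 A5e_sup.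
have gh_ge0 n w : 0 <= gh n w by rewrite addr_ge0// mxopnorm_ge0.
have gh_op : is_op P (fun n => n%:R `^ (- (1 / 4))) (fun n w => (gh n w)%:E).
  apply/is_opP => eps e0; have e20 : 0 < eps / 2 by rewrite divr_gt0.
  move/is_opP: A4b_G => /(_ _ e20) g1; move/is_opP: A4b_M => /(_ _ e20) h1.
  apply: whpS (whpI g1 h1); apply: nearW => n w /= [g2 h2].
  apply: le_trans (ler_normD _ _) _; apply: le_trans (lerD g2 h2) _.
  by rewrite -mulrDl -splitr.
pose Z1 n w := if (N <= n)%N then rhohat n w - rk n - Lin n (rk n) w else 0.
have W3 : forall eps, 0 < eps -> whp P (fun n => [set w | `|Num.sqrt n%:R * Z1 n w| <= eps]).
  apply: (op_mul_rate (Y := gh) (K := K0) (delta := tau)) => // n w ghw.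
  rewrite /Z1; case: ifPn => [Nn|_]; last by rewrite normr0 mulr_ge0 ?sqr_ge0.
  by have [_ _ _ _] := rsP n Nn; apply; exact: ltW.
have normA_ge0 x : 0 <= normA x.
  have [nD nZ _] := normA_norm.
  have n0 : normA 0 = 0 by rewrite -(scale0r (0 : AA)) nZ normr0 mul0r.
  have := nD x (- x); rewrite subrr n0 -scaleN1r nZ normrN1 mul1r.
  by rewrite -mulr2n pmulrn_lge0.
pose Z2 n w := ell X m phi phis (alphahat n w) - ell X m phi phis alpha0
         - pathwise_derivative (ell X m phi phis) alpha0 (alphahat n w - alpha0).
have W4 : forall eps, 0 < eps -> whp P (fun n => [set w | `|Num.sqrt n%:R * Z2 n w| <= eps]).
  have [C [delta [delta0 rem]]] := A5b_rem.
  apply: (op_mul_rate (Y := fun n w => normA (alphahat n w - alpha0)) (K := `|C|)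
    (delta := delta)) => // n w aw.
  by apply: le_trans (rem _ (alphahat_in n w) aw) _; rewrite ler_wpM2r ?sqr_ge0// ler_norm.
have W5 : forall eps, 0 < eps -> whp P (fun n => [set w |
    `|empirical X n (g_class m alpha0 phi phis (alphahat n w)) w| <= eps]).
  move=> eps; apply: (empirical_equicontinuity (G := g_class m alpha0 phi phis @` A)
      (ghat := fun n w => g_class m alpha0 phi phis (alphahat n w))) => //.
  - by exists alpha0 => //; exact: g_class_alpha0.
  - by move=> n w; exists (alphahat n w).
have W6 : forall eps, 0 < eps -> whp P (fun n => [set w |
    `|Num.sqrt n%:R * pathwise_derivative (ell X m phi phis) alpha0 (alphahat n w - alpha0)
       - normalized_sum (fun t => psi_l t) n w| <= eps]).
  move/is_opP: A5c_lin => H eps /H; apply: whpS; apply: nearW => n w /=.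
  by rewrite mulr1.
have class_L2 alpha : A alpha -> L2 P (pair_at X (g_class m alpha0 phi phis alpha) 0).
  by move=> Aa; apply: (donsker_L2 A5a); exists alpha.
apply: (slutsky (W := fun n w => normalized_sum (psi_rho X m alpha0 phi phis rho) n w
    + normalized_sum (fun t => psi_l t) n w)).
- by move=> n; apply: measurable_funM => //; exact: measurable_funB.
- move=> n; apply: measurable_funD; apply: measurable_normalized_sum => // t.
  exact: (measurable_psi_rho X a0A m_meas mphi mphis).
- exact: cvg_dist_normal_sum A5d.
(* Six errors: the quadratic remainder, the bias of the sieve eigenvalue, the replacement of the
   eigenfunctions, the empirical process, the remainder of [ell], and the linearization of the first
   stage. *)
move=> eps e0; pose e := eps / 6.
have e60 : 0 < e by rewrite divr_gt0.
apply: whpS (whpI (whpI (whpI (W1 e e60) W2) (whpI (W3 e e60) (W4 e e60)))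
  (whpI (W5 e e60) (W6 e e60))).
near=> n => w /= [[[w1 w2] [w3 w4]] [w5 w6]].
have Nn : (N <= n)%N by near: n.
rewrite /Z1 Nn in w3.
have [sg1 _ _ _ _] := rsP n Nn.
have rkb : Num.sqrt n%:R * `|rk n - rho| <= e.
  apply: (@le_trans _ _ (Num.sqrt n%:R * bias n)).
    by rewrite ler_wpM2l ?sqrtr_ge0//; near: n.
  apply: le_trans (ler_norm _) _; rewrite -normrN -sub0r.
  by near: n; move/cvgrPdist_le: d0; apply.
have LinE : Num.sqrt n%:R * Lin n (rk n) w = normalized_sum (fun t z =>
    u n (X t z) * m (alphahat n w) (X t z) (X t.+1 z) * v n (X t.+1 z)
    - rk n * (u n (X t z) * v n (X t z))) n w.
  (* [Lin] is bilinear in the two eigenvectors, so their common sign cancels. *)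
  have sg2 : (rs n).2 * (rs n).2 = 1 by rewrite -expr2 -real_normK ?num_real// sg1 expr1n.
  rewrite /Lin mulmxBl -scalemxAl dotDr -scaleN1r !dotZr dot_Ghat dot_Mhat mulN1r.
  rewrite mulrCA -mulrBr mulrA sqrt_divn /normalized_sum mulr_sumr -sumrB.
  congr (_ * _); apply: eq_bigr => t _; rewrite /u /v /phi_k /phis_k /mhat -/(c n) -/(cs n).
  by rewrite -[LHS]mul1r -sg2; ring.
have close : `|normalized_sum (fun t z =>
    (u n (X t z) * m (alphahat n w) (X t z) (X t.+1 z) * v n (X t.+1 z)
    - rk n * (u n (X t z) * v n (X t z))) -
    (phis (X t z) * m (alphahat n w) (X t z) (X t.+1 z) * phi (X t.+1 z)
      - rho * (phis (X t z) * phi (X t z)))) n w| <= e.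
  apply: le_trans w1; apply: normalized_sum_le => t.
  rewrite /total_error /cross_error /diag_error /pair_rv /=.
  have mt0 := m_ge0 _ _ _ (alphahat_in n w) (X_in t w) (X_in t.+1 w).
  have mtD := w2 t _ (alphahat_in n w) mt0; rewrite /pair_rv in mtD.
  move: mt0 mtD; set mt := m _ _ _ => mt0 mtD.
  rewrite (_ : _ - _ = mt * (u n (X t w) * v n (X t.+1 w) - phis (X t w) * phi (X t.+1 w))
    - rk n * (u n (X t w) * v n (X t w) - phis (X t w) * phi (X t w))
    - (rk n - rho) * (phis (X t w) * phi (X t w))); last by ring.
  apply: le_trans (ler_normB _ _) _; rewrite normrM normrM lerD2r.
  apply: le_trans (ler_normB _ _) _; rewrite normrM normrM lerD2r.
  by rewrite (ger0_norm mt0) ler_wpM2r.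
have := normalized_sum_class X_stationary a0A m_meas mphi mphis A4c class_L2 rho n w (alphahat_in n w).
rewrite normalized_sumB -LinE in close.
move=> classE; rewrite classE in close.
rewrite (_ : _ - _ = Num.sqrt n%:R * (rhohat n w - rk n - Lin n (rk n) w)
  + Num.sqrt n%:R * (rk n - rho)
  + (Num.sqrt n%:R * Lin n (rk n) w - (normalized_sum (psi_rho X m alpha0 phi phis rho) n w
    + (empirical X n (g_class m alpha0 phi phis (alphahat n w)) w
      + Num.sqrt n%:R * (ell X m phi phis (alphahat n w) - ell X m phi phis alpha0))))
  + empirical X n (g_class m alpha0 phi phis (alphahat n w)) w
  + Num.sqrt n%:R * Z2 n w
  + (Num.sqrt n%:R * pathwise_derivative (ell X m phi phis) alpha0 (alphahat n w - alpha0)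
    - normalized_sum (fun t => psi_l t) n w)); last by rewrite /Z2; ring.
have -> : eps = e + e + e + e + e + e by rewrite /e; field.
do 5 (apply: le_trans (ler_normD _ _) _; apply: lerD => //).
by rewrite normrM ger0_norm ?sqrtr_ge0.
Unshelve. all: by end_near. Qed.
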